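(* Let $\alpha>1$, $m_0\in\mathcal P_\alpha(\mathbb R^d)$, and let $R\ge R(\alpha,[m_0]_\alpha)$. Then the set-valued map $E:\mathcal P_{m_0}(\Gamma_T,R)\rightrightarrows\mathcal P_{m_0}(\Gamma_T,R)$ has a fixed point, i.e. there exists $\eta\in\mathcal P_{m_0}(\Gamma_T,R)$ with $\eta\in E(\eta)$.
   Context: Data: $T>0$; real matrices $A$ ($d\times d$) and $B$ ($d\times k$). $\mathcal P_p(\mathbb R^d)$ is the set of Borel probability measures on $\mathbb R^d$ with finite $p$-th moment and $d_1$ is the Kantorovich–Rubinstein (1-Wasserstein) distance. $L:\mathbb R^d\times\mathbb R^k\times\mathcal P_1(\mathbb R^d)\to\mathbb R$ and $G:\mathbb R^d\times\mathcal P_1(\mathbb R^d)\to\mathbb R$ satisfy the standing assumptions: (1) for each $m$, $(x,u)\mapsto L(x,u,m)$ is $C^2$, and $m\mapsto L(x,u,m)$ is $d_1$-Lipschitz with a constant independent of $(x,u)$; (2) $G$ is bounded and uniformly continuous on $\mathbb R^d\times\mathcal P_1(\mathbb R^d)$, and for each $m$, $x\mapsto G(x,m)$ is in $C^1_b(\mathbb R^d)$ (bounded with bounded uniformly continuous first derivatives); (3) there are constants $C_0>0$, $C_1,C_2\ge0$ such that for all $(x,u,m)$: $\frac{1}{C_0}\mathrm{Id}\le D^2_{uu}L(x,u,m)\le C_0\mathrm{Id}$, $\|D^2_{xu}L(x,u,m)\|\le C_1(1+|u|)$, and $|L(x,0,m)|+|D_xL(x,0,m)|+|D_uL(x,0,m)|\le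 C_2$. For $x\in\mathbb R^d$ and $u\in L^1(0,T;\mathbb R^k)$, $\gamma(\cdot;x,u)$ is the solution of $\dot\gamma=A\gamma+Bu$ on $[0,T]$, $\gamma(0)=x$. $\Gamma_T$ is the set of all such curves, with the uniform norm, $\Gamma_T(x)=\{\gamma\in\Gamma_T:\gamma(0)=x\}$, and $e_t(\gamma)=\gamma(t)$. Let $[m_0]_\alpha=\int|x|^\alpha\,m_0(dx)$. For $R\ge[m_0]_\alpha$, $$\mathcal P_{m_0}(\Gamma_T,R)=\Big\{\eta\in\mathcal P(\Gamma_T):\int_{\Gamma_T}\|\dot\gamma\|_{2}^\alpha\,\eta(d\gamma)\le R,\ e_0\sharp\eta=m_0\Big\},$$ where $\|\cdot\|_2$ is the $L^2(0,T)$ norm (equal to $+\infty$ if $\dot\gamma\notin L^2$). For $\eta$ in this set, let $J_\eta(x,u)=\int_0^TL(\gamma(t;x,u),u(t),e_t\sharp\eta)\,dt+G(\gamma(T;x,u),e_T\sharp\eta)$, and let $\Gamma^*_\eta(x)$ be the set of curves $\gamma(\cdot;x,u^* )$ where $u^*$ minimizes $J_\eta(x,\cdot)$ over $L^2(0,T;\mathbb R^k)$. By disintegration with respect to $e_0$, each $\nu\in\mathcal P_{m_0}(\Gamma_T,R)$ is written $\nu(d\gamma)=\int_{\mathbb R^d}\nu_x(d\gamma)\,m_0(dx)$ with $\operatorname{supp}(\nu_x)\subset\Gamma_T(x)$ for $m_0$-a.e. $x$. Set $$E(\eta)=\{\nu\in\mathcal P_{m_0}(\Gamma_T,R):\operatorname{supp}(\nu_x)\subset\Gamma^*_\eta(x)\text{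 for }m_0\text{-a.e. }x\}.$$ $R(\alpha,[m_0]_\alpha)\ge[m_0]_\alpha$ denotes a positive constant with the property that, for every $R\ge R(\alpha,[m_0]_\alpha)$, the set $\mathcal P_{m_0}(\Gamma_T,R)$ is non-empty and $E(\eta)\neq\emptyset$ for every $\eta\in\mathcal P_{m_0}(\Gamma_T,R)$ (such a constant exists). A Mean Field Games equilibrium for $m_0$ is an $\eta\in\mathcal P_{m_0}(\Gamma_T,R)$ with $\operatorname{supp}(\eta)\subset\bigcup_{x}\Gamma^*_\eta(x)$; the fixed points of $E$ are exactly the Mean Field Games equilibria. *)

(* Defs.v *)
From HB Require Import structures.
From mathcomp Require Import all_boot all_order all_algebra.
From mathcomp Require Import all_classical all_reals all_analysis.

Set Implicit Arguments.
Unset Strict Implicit.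
Unset Printing Implicit Defensive.

Import Order.TTheory GRing.Theory Num.Theory.
Import numFieldNormedType.Exports.

Local Open Scope classical_set_scope.
Local Open Scope ring_scope.

(* R^n is 'cV[R]_n. Its library norm is the max norm: it only serves to provide
   the (norm-independent) topology and differential calculus; wherever |x| enters
   quantitatively, the Euclidean norm below is used. *)
Definition enorm (R : realType) (n : nat) (x : 'cV[R]_n) : R :=
  Num.sqrt (\sum_i x i 0 ^+ 2).

Section matrix_borel.
Context {R : realType} {m n : nat}.

HB.instance Definition _ := @isMeasurable.Build
  (sigma_display (@open 'M[R]_(m, n))) 'M[R]_(m, n)
  <<s (@open 'M[R]_(m, n)) >> (@sigma_algebra0 _ setT _)
  (@sigma_algebraC _ _)
  (@sigma_algebra_bigcup _ setT _).

End matrix_borel.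

Section wasserstein.
Context {R : realType} {n : nat}.
Local Open Scope ereal_scope.
Implicit Types (m : probability 'cV[R]_n R).

Definition moment (p : R) m : \bar R := \int[m]_x (enorm x `^ p)%:E.

Definition Pspace (p : R) : set (probability 'cV[R]_n R) :=
  [set m | moment p m < +oo].

Definition coupling m m' :
    set (probability ('cV[R]_n * 'cV[R]_n)%type R) :=
  [set pi : probability _ R | forall A : set 'cV[R]_n, measurable A ->
     pi (A `*` setT) = m A /\ pi (setT `*` A) = m' A].

Definition d1 m m' : \bar R :=
  ereal_inf [set \int[pi]_z (enorm (z.1 - z.2))%:E | pi in coupling m m'].

End wasserstein.

Section smoothness.
Context {R : realType}.

(* Only used for finite-dimensional V, where the continuity of all x |-> 'D_v f x
   is that of the differential. *)
Definition C1 (V : normedModType R) (f : V -> R) : Prop :=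
  (forall x, differentiable f x) /\ (forall v, continuous ('D_v f)).

Definition C2 (V : normedModType R) (f : V -> R) : Prop :=
  C1 f /\ (forall v, C1 ('D_v f)).

Definition bounded_real (X : Type) (f : X -> R) : Prop :=
  exists M, forall x, `|f x| <= M.

Definition C1b (V : normedModType R) (f : V -> R) : Prop :=
  [/\ bounded_real f, forall x, differentiable f x &
      forall v, bounded_real ('D_v f) /\ unif_continuous ('D_v f)].

Definition basis_vec (n : nat) (i : 'I_n) : 'cV[R]_n := delta_mx i 0.

Definition gradient (n : nat) (f : 'cV[R]_n -> R) (x : 'cV[R]_n) : 'cV[R]_n :=
  \col_i 'D_(basis_vec i) f x.

Definition hessian (n : nat) (f : 'cV[R]_n -> R) (x : 'cV[R]_n) : 'M[R]_n :=
  \matrix_(i, j) 'D_(basis_vec i) ('D_(basis_vec j) f) x.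

Definition mixed_hessian (d k : nat) (f : 'cV[R]_d -> 'cV[R]_k -> R)
    (x : 'cV[R]_d) (u : 'cV[R]_k) : 'M[R]_(d, k) :=
  \matrix_(i, j) 'D_(basis_vec i) (fun y => 'D_(basis_vec j) (f y) u) x.

Definition loewner_le (n : nat) (M N : 'M[R]_n) : Prop :=
  forall v : 'cV[R]_n, 0 <= (v^T *m (N - M) *m v) 0 0.

Definition opnorm (d k : nat) (M : 'M[R]_(d, k)) : R :=
  sup [set enorm (M *m v) | v in [set v : 'cV[R]_k | enorm v <= 1]].

End smoothness.

(* The costs are defined on all Borel probability measures, but are only
   constrained (and only ever evaluated, since the time marginals of the measures
   in [PGamma] below lie in P_1) on P_1. *)
Section costs.
Context {R : realType} {d k : nat}.
Variables (L : 'cV[R]_d -> 'cV[R]_k -> probability 'cV[R]_d R -> R)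
  (G : 'cV[R]_d -> probability 'cV[R]_d R -> R).

Definition running_cost_regular : Prop :=
  (forall m, Pspace 1 m ->
    C2 (fun z : 'cV[R]_d * 'cV[R]_k => L z.1 z.2 m)) /\
  (exists2 lambda : R, 0 <= lambda & forall x u m m',
    Pspace 1 m -> Pspace 1 m' ->
    (`|L x u m - L x u m'|%:E <= lambda%:E * d1 m m')%E).

Definition terminal_cost_regular : Prop :=
  [/\ exists M : R, forall x m, Pspace 1 m -> `|G x m| <= M,
      forall eps : R, 0 < eps -> exists2 delta : R, 0 < delta &
        forall x y m m', Pspace 1 m -> Pspace 1 m' ->
          enorm (x - y) < delta -> (d1 m m' < delta%:E)%E ->
          `|G x m - G y m'| < eps &
      forall m, Pspace 1 m -> C1b (G ^~ m)].

Definition running_cost_growth : Prop :=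
  exists c0 c1 c2 : R, [/\ 0 < c0, 0 <= c1, 0 <= c2 &
    forall x u m, Pspace 1 m ->
    [/\ loewner_le (c0^-1)%:M (hessian (fun w => L x w m) u),
        loewner_le (hessian (fun w => L x w m) u) c0%:M,
        opnorm (mixed_hessian (fun y w => L y w m) x u)
          <= c1 * (1 + enorm u) &
        `|L x 0 m| + enorm (gradient (fun y => L y 0 m) x)
          + enorm (gradient (fun w => L x w m) 0) <= c2]].

End costs.

Section curves.
Context {R : realType} {d k : nat}.
Variables (T : R) (A : 'M[R]_d) (B : 'M[R]_(d, k)).

Definition Lp_control (p : nat) (u : R -> 'cV[R]_k) : Prop :=
  measurable_fun `[0, T] u /\
  (\int[lebesgue_measure]_(t in `[0%R, T]) (enorm (u t) ^+ p)%:E < +oo)%E.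

(* Caratheodory solution of g' = A g + B u, g(0) = x, on [0, T] (integrals are
   taken componentwise). *)
Definition solution (x : 'cV[R]_d) (u : R -> 'cV[R]_k) (g : R -> 'cV[R]_d)
    : Prop :=
  {within `[0, T], continuous g} /\
  forall t, t \in `[0, T] -> forall i,
    g t i 0 = x i 0 +
      \int[lebesgue_measure]_(s in `[0, t]) (A *m g s + B *m u s) i 0.

(* A curve on [0, T] is represented by its extension by 0 to the real line, so
   that it is determined by its values on [0, T]. *)
Definition Gamma_set : set {uniform` `[0, T] -> 'cV[R]_d} :=
  [set g | (exists x u, Lp_control 1 u /\ solution x u g) /\
           forall t, t \notin `[0, T] -> g t = 0].

(* Gamma_T: the topology inherited from [set_type] is that of uniform convergence
   on [0, T]. *)
Definition Gamma : Type := set_type Gamma_set.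

Definition curve_fun (g : Gamma) : R -> 'cV[R]_d := set_val g.
Coercion curve_fun : Gamma >-> Funclass.

Lemma Gamma_set0 : Gamma_set (fun=> 0).
Proof.
split=> //; exists 0, (fun=> 0); split; first split.
- exact: measurable_cst.
- rewrite (eq_integral (cst 0%E)) ?integral0 ?ltry// => t _.
  by rewrite /enorm big1 ?sqrtr0// => i _; rewrite mxE expr0n.
- split; first by apply: continuous_subspaceT => x; exact: cvg_cst.
  move=> t _ i; rewrite mxE add0r /Rintegral.
  rewrite (eq_integral (cst 0%E)) ?integral0// => s _.
  by rewrite !mulmx0 addr0 mxE.
Qed.

HB.instance Definition _ := Topological.on Gamma.
HB.instance Definition _ := isPointed.Build Gamma
  (exist _ (fun=> 0) (mem_set Gamma_set0)).

HB.instance Definition _ := @isMeasurable.Build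
  (sigma_display (@open Gamma)) Gamma
  <<s (@open Gamma) >> (@sigma_algebra0 _ setT _)
  (@sigma_algebraC _ _)
  (@sigma_algebra_bigcup _ setT _).

Definition evaluation (t : R) (g : Gamma) : 'cV[R]_d := g t.

Lemma evaluation_continuous (t : R) : continuous (evaluation t).
Proof.
have [tT|tT] := boolP (t \in `[0, T]); last first.
  have -> : evaluation t = cst 0; last exact: cst_continuous.
  apply/funext => g; rewrite /evaluation /curve_fun.
  by have [_] := set_valP g; exact.
have evc : continuous
    (fun f : {uniform` `[0, T] -> 'cV[R]_d} => (f : R -> 'cV[R]_d) t).
  move=> f U /nbhsP[E entE EU]; apply/uniform_nbhs; exists E; split => // h hE.
  by apply: EU; apply/xsectionP; exact: hE.
by move=> g; have /= := continuous_comp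
  (@initial_continuous _ _ (set_val : Gamma_set -> _) g) (evc (set_val g)).
Qed.

Lemma measurable_evaluation (t : R) : measurable_fun setT (evaluation t).
Proof.
apply: (measurability (@open 'cV[R]_d)) => // _ [U oU <-].
apply: sub_sigma_algebra; rewrite setTI.
by have /continuousP := @evaluation_continuous t; exact.
Qed.

HB.instance Definition _ (t : R) :=
  isMeasurableFun.Build _ _ _ _ (evaluation t) (measurable_evaluation t).

Definition time_marginal (t : R) (eta : probability Gamma R)
  : probability 'cV[R]_d R := distribution eta (evaluation t).

(* gamma(.; x, u); the solution exists and is unique for every u in L^1. *)
Definition trajectory (x : 'cV[R]_d) (u : R -> 'cV[R]_k) : Gamma :=
  get [set g : Gamma | solution x u g].

Definition Gamma_at (x : 'cV[R]_d) : set Gamma := [set g | g 0 = x].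

Section ereal_defs.
Local Open Scope ereal_scope.

(* L^2(0, T) norm of the derivative, which exists almost everywhere *)
Definition speed_norm (g : Gamma) : \bar R :=
  (\int[lebesgue_measure]_(t in `[0%R, T]) (enorm (derive1 g t) ^+ 2)%:E)
    `^ (2^-1)%R.

Definition PGamma (alpha : R) (m0 : probability 'cV[R]_d R) (r : R)
    : set (probability Gamma R) :=
  [set eta : probability Gamma R | \int[eta]_g (speed_norm g `^ alpha) <= r%:E /\
    forall S : set 'cV[R]_d, measurable S -> time_marginal 0 eta S = m0 S].

Variables (L : 'cV[R]_d -> 'cV[R]_k -> probability 'cV[R]_d R -> R)
  (G : 'cV[R]_d -> probability 'cV[R]_d R -> R).

Definition cost (eta : probability Gamma R) (x : 'cV[R]_d)
    (u : R -> 'cV[R]_k) : \bar R :=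
  \int[lebesgue_measure]_(t in `[0%R, T])
    (L (trajectory x u t) (u t) (time_marginal t eta))%:E
  + (G (trajectory x u T) (time_marginal T eta))%:E.

Definition minimizer (eta : probability Gamma R) (x : 'cV[R]_d)
    (u : R -> 'cV[R]_k) : Prop :=
  Lp_control 2 u /\ forall v, Lp_control 2 v -> cost eta x u <= cost eta x v.

Definition Gamma_opt (eta : probability Gamma R) (x : 'cV[R]_d) : set Gamma :=
  [set trajectory x u | u in minimizer eta x].

Definition supp (mu : set Gamma -> \bar R) : set Gamma :=
  [set g | forall V : set Gamma, open V -> V g -> 0 < mu V].

Definition disintegration (m0 : probability 'cV[R]_d R)
    (nu : probability Gamma R) (nux : R.-pker 'cV[R]_d ~> Gamma) : Prop :=
  (forall S : set Gamma, measurable S -> nu S = \int[m0]_x nux x S) /\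
  {ae m0, forall x, supp (nux x) `<=` Gamma_at x}.

(* The disintegration is m0-a.e. unique, so the choice of [nux] is immaterial. *)
Definition Emap (alpha : R) (m0 : probability 'cV[R]_d R) (r : R)
    (eta : probability Gamma R) : set (probability Gamma R) :=
  [set nu : probability Gamma R | PGamma alpha m0 r nu /\
    exists2 nux : R.-pker 'cV[R]_d ~> Gamma, disintegration m0 nu nux &
      {ae m0, forall x, supp (nux x) `<=` Gamma_opt eta x}].

(* The property defining the constant R(alpha, [m0]_alpha) *)
Definition admissible_bound (alpha : R) (m0 : probability 'cV[R]_d R) (r0 : R)
    : Prop :=
  [/\ (0 < r0)%R, moment alpha m0 <= r0%:E &
    forall r : R, (r0 <= r)%R -> PGamma alpha m0 r !=set0 /\
      forall eta, PGamma alpha m0 r eta -> Emap alpha m0 r eta !=set0].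

End ereal_defs.

End curves.

Arguments PGamma {R d k} T A B alpha m0 r _.
Arguments Emap {R d k} T A B L G alpha m0 r eta _.

(* Main.v *)
(* Every minimizer has energy at most an explicit constant c, so the values of E
   are carried by the curves of energy at most c, a totally bounded class. Curves
   are coded by binary sequences (cells of a countable base of the topology), and
   the costs depend on a measure, up to a small error, only through finitely many
   cell masses. Scarf's lemma gives an approximate Kakutani theorem: for each
   level j there is eta_j which is a convex combination of elements of values
   E(eta'), for measures eta' whose level-j cell masses are close to those of
   eta_j.
   Along an ultrafilter, the masses of {gamma(0) in S} n cell(b) under eta_j
   converge, and Radon-Nikodym turns the limits into densities g_b(x) which split
   along b. They define nested intervals in [0, 1) and hence, for almost every x
   and every z in [0, 1), a limit curve psi(x, z). The image q of m0 x Lebesgue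
   under psi is the equilibrium: a code of positive density at x contains curves
   that are almost optimal for q, and almost optimal curves are closed in the
   limit; the bound on the speeds passes to the limit by Fatou's lemma and weak
   lower semicontinuity of the energy. *)
Require Import Defs.
From HB Require Import structures.
From mathcomp Require Import all_boot all_order all_algebra.
From mathcomp Require Import all_classical all_reals all_analysis.
From mathcomp Require Import measurable_realfun ring lra zify.

Set Implicit Arguments.
Unset Strict Implicit.
Unset Printing Implicit Defensive.

(** * Scarf's lemma *)

(** A direct use of Kakutani's theorem would need a compact convex set of measures on [Gamma] and a
    closed graph for [E]; neither is built here. Cell masses give finite-dimensional coordinates,
    but they are not continuous for weak convergence, so at level [j] only a weakened fixed point
    [eta_j] is reached: a mixture of measures, each optimal against its own measure near [eta_j].
    What passes to the limit is therefore not optimality but the property [selects], which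
    quantifies over all families [P x] of curves. It can be instantiated after the limit [q] is
    known, with [P x] the curves almost optimal for [q]; that the mixed measures answer different
    opponents then no longer matters. An ultrafilter replaces subsequences because limits are needed
    for all Borel sets of starting points at once, and domination by [m0] makes these limits
    sigma-additive. Starting points are unbounded, so finitely many cells control the costs only up
    to a tail of the first moment of [m0]. The speed is never shown to be measurable as a function
    of the curve: its integrals are handled as lower integrals. *)

Section scarf.
Variables (X I : finType) (key : I -> X -> nat).
Hypothesis key_inj : forall i, injective (key i).

(** Scarf's dominance: each [key i] is a linear order on [X], and no point of [X] lies strictly
    above the minimum of [s] in all the orders of [C] simultaneously. *)
Definition dominant (s : {set X}) (C : {set I}) :=
  [forall y, [exists i in C, [forall x in s, key i y <= key i x]]].

Lemma dominantP (s : {set X}) (C : {set I}) : reflect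
  (forall y, exists2 i, i \in C & forall x, x \in s -> key i y <= key i x)
  (dominant s C).
Proof.
apply: (iffP forallP) => [H y|H y].
  by have /exists_inP[i iC /forall_inP yi] := H y; exists i.
by have [i iC yi] := H y; apply/exists_inP; exists i => //; apply/forall_inP.
Qed.

Lemma dominantS (s s' : {set X}) (C C' : {set I}) :
  s' \subset s -> C \subset C' -> dominant s C -> dominant s' C'.
Proof.
move=> ss' CC' /dominantP H; apply/dominantP => y.
have [i iC yi] := H y; exists i; first exact: (fintype.subsetP CC').
by move=> x xs'; apply: yi; exact: (fintype.subsetP ss').
Qed.

(** Rooms and doors play the roles of the simplices and walls of a triangulation in Sperner's lemma;
    passing a wall exchanges either a point or an order. *)
Definition room (r : {set X} * {set I}) := (#|r.1| == #|r.2|) && dominant r.1 r.2.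

Definition door (d : {set X} * {set I}) := (#|d.2| == #|d.1|.+1) && dominant d.1 d.2.

Definition facet (d r : {set X} * {set I}) :=
  (d.2 == r.2) && [exists x in r.1, d.1 == r.1 :\ x] ||
  (d.1 == r.1) && [exists j, (j \notin r.2) && (d.2 == j |: r.2)].

Lemma facet_cases d r : facet d r ->
  (exists2 x, x \in r.1 & d = (r.1 :\ x, r.2)) \/
  (exists2 j, j \notin r.2 & d = (r.1, j |: r.2)).
Proof.
case: d r => [t D] [s C]; rewrite /facet /=.
case/orP => /andP[/eqP -> /existsP[x /andP[xs /eqP ->]]].
  by left; exists x.
by right; exists x.
Qed.

Lemma facet_del (r : {set X} * {set I}) x : x \in r.1 -> facet (r.1 :\ x, r.2) r.
Proof.
by move=> xs; rewrite /facet /= eqxx/=; apply/orP; left; apply/exists_inP; exists x.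
Qed.

Lemma facet_add (r : {set X} * {set I}) j : j \notin r.2 -> facet (r.1, j |: r.2) r.
Proof.
move=> xs; rewrite /facet /= eqxx/=; apply/orP; right; apply/existsP; exists j.
by rewrite xs eqxx.
Qed.

Lemma facet_door d r : facet d r -> room r -> door d.
Proof.
move=> /facet_cases[[x xs ->]|[j jC ->]] /andP[/eqP e dom]; rewrite /door /=.
  by rewrite (dominantS _ _ dom) ?finset.subD1set// andbT -e (cardsD1 x r.1) xs.
by rewrite (dominantS _ _ dom) ?finset.subsetUr// andbT cardsU1 jC -e.
Qed.

(** * Pivoting: the two rooms on the sides of an internal door *)

Section internal_door.
Variables (t : {set X}) (D : {set I}) (x0 : X).
Hypotheses (tx0 : x0 \in t) (cD : #|D| = #|t|.+1) (domtD : dominant t D).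

(** Dominance makes every point of [t] the minimum of [t] for some order in [D], so [m] maps [D]
    onto [t]. As [D] has one more element than [t], two indices collide; these are the two indices
    at which one can pivot. *)
Let m i := [arg min_(x < x0 in t) key i x].

Let m_in i : m i \in t. Proof. by rewrite /m; case: arg_minnP. Qed.

Let m_min i x : x \in t -> key i (m i) <= key i x.
Proof. by rewrite /m; case: arg_minnP => // y _ + xt; apply. Qed.

Let m_eq i x : x \in t -> (forall y, y \in t -> key i x <= key i y) -> x = m i.
Proof.
move=> xt H; apply: (@key_inj i); apply/eqP.
by rewrite eqn_leq H//= m_min.
Qed.

Let m_imset (C : {set I}) : dominant t C -> t \subset m @: C.
Proof.
move=> /dominantP H; apply/fintype.subsetP => x xt; have [i iC xi] := H x.
by apply/imsetP; exists i => //; exact: m_eq.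
Qed.

Let imset_m (C : {set I}) : m @: C \subset t.
Proof. by apply/fintype.subsetP => _ /imsetP[i _ ->]. Qed.

Let m_inj e : e \in D -> t \subset m @: (D :\ e) -> {in D :\ e &, injective m}.
Proof.
move=> eD H; apply/imset_injP/eqP.
have /eqP -> : m @: (D :\ e) == t by rewrite finset.eqEsubset imset_m.
by move: cD; rewrite (cardsD1 e D) eD/= add1n => -[->].
Qed.

Let collision : exists a b, [/\ a \in D, b \in D, a != b & m a = m b].
Proof.
have : ~ {in D &, injective m}.
  move/imset_injP => /eqP; have /eqP -> : m @: D == t.
    by rewrite finset.eqEsubset imset_m m_imset.
  by rewrite cD => /eqP; rewrite -[_ == _]/(#|t| == #|t|.+1) ltn_eqF.
move=> H; have /dinjectivePn[a aD [b + mab]] : ~~ dinjectiveb m [in D].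
  by apply/negP => /dinjectiveP; exact: H.
rewrite !inE => /andP[ba bD]; exists a, b; split => //.
by rewrite eq_sym.
Qed.

Let M e := [set y | [forall k in D :\ e, key k (m k) < key k y]].

Let MP e y : reflect (forall k, k \in D -> k != e -> key k (m k) < key k y) (y \in M e).
Proof.
rewrite inE; apply: (iffP forall_inP) => H k; first by move=> kD ke; apply: H; rewrite !inE ke.
by rewrite !inE => /andP[ke kD]; exact: H.
Qed.

(** Scarf's pivot, which relaxes the order [e]. If some points beat the minima of [t] in all the
    other orders, the [e]-largest of them joins [t]; otherwise [D :\ e] already dominates and [e] is
    dropped. *)
Let nxt e := if [pick y in M e] is Some y
  then ([arg max_(z > y in M e) key e z] |: t, D) else (t, D :\ e).

Let nxt_room e f : e \in D -> f \in D -> f != e -> m e = m f ->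
  [/\ room (nxt e), facet (t, D) (nxt e) &
   ((nxt e).2 = D -> exists2 x, (nxt e).1 = x |: t & [/\ x \notin t, x \in M e &
      key e x < key e (m e)])].
Proof.
move=> eD fD fe mef; rewrite /nxt; case: pickP => [y0 y0M|M0]; last first.
  split => //; last first.
  - by move=> /= /setP /(_ e); rewrite !inE eqxx eD.
  - have := @facet_add (t, D :\ e) e; rewrite /= finset.setD1K//; apply.
    by rewrite !inE eqxx.
  rewrite /room /= (_ : #|D :\ e| = #|t|); last first.
    by move: cD; rewrite (cardsD1 e D) eD/= add1n => -[->].
  rewrite eqxx/=; apply/dominantP => y.
  have : y \notin M e by rewrite M0.
  rewrite inE negb_forall => /existsP[k]; rewrite negb_imply -leqNgt => /andP[kD yk].
  exists k => // x xt; exact: (leq_trans yk (m_min _ xt)).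
case: arg_maxnP => // y yM ymax.
have ye : key e y < key e (m e).
  have /dominantP/(_ y)[i iD yi] := domtD.
  have [ie|ie] := eqVneq i e; last first.
    have /MP/(_ _ iD ie) := yM; rewrite ltnNge yi//.
  rewrite -ie ltn_neqAle yi// andbT; apply/eqP => /key_inj yme.
  have /MP/(_ _ fD fe) := yM; by rewrite yme ie mef ltnn.
have yt : y \notin t.
  by apply/negP => /(m_min e); rewrite leqNgt ye.
split => //; last by move=> _; exists y.
  rewrite /room/= cardsU1 yt cD eqxx/=; apply/dominantP => z.
  have [zM|] := boolP (z \in M e).
    exists e => // x; rewrite !inE => /orP[/eqP ->|xt]; first exact: ymax.
    apply: (leq_trans (ymax _ zM)); apply: (leq_trans (ltnW ye)); exact: m_min.
  rewrite inE negb_forall => /existsP[k]; rewrite negb_imply -leqNgt !inE.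
  move=> /andP[/andP[ke kD] zk]; exists k => // x; rewrite !inE => /orP[/eqP ->|xt].
    by apply: (leq_trans zk); apply: ltnW; exact: (MP _ _ yM).
  exact: (leq_trans zk (m_min _ xt)).
have := @facet_del (y |: t, D) y; rewrite /= finset.setU1K//; apply.
by rewrite !inE eqxx.
Qed.

(** Completeness of the pivots. The index [e] must leave [m] onto [t] on [D :\ e], hence injective
    there, so [e] is one of the two colliding indices. *)
Let room_nxt r : room r -> facet (t, D) r ->
  exists2 e, e \in D /\ t \subset m @: (D :\ e) & r = nxt e.
Proof.
move=> rr; have /andP[_ dom] := rr; case/facet_cases => [[x xr [tr Dr]]|[j jr [tr Dr]]].
  have xt : x \notin t by rewrite tr !inE eqxx.
  have rt : r.1 = x |: t by rewrite tr finset.setD1K.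
  have /dominantP/(_ x)[e] := dom; rewrite -Dr rt => eD xe.
  have te : t \subset m @: (D :\ e).
    apply/fintype.subsetP => y yt; have /dominantP/(_ y)[i] := dom.
    rewrite -Dr rt => iD yi; apply/imsetP; exists i.
      rewrite !inE iD andbT; apply/eqP => ie; move: xt; suff -> : x = y by rewrite yt.
      apply: (@key_inj e); apply/eqP; rewrite eqn_leq xe ?inE ?yt ?orbT//=.
      by rewrite -ie yi// !inE eqxx.
    by apply: m_eq => // z zt; apply: yi; rewrite !inE zt orbT.
  exists e => //.
  have xM : x \in M e.
    apply/MP => k kD ke; have /dominantP/(_ (m k))[i] := dom.
    rewrite -Dr rt => iD mki.
    have ie : i != e.
      apply/eqP => ie; move: xt; suff -> : x = m k by rewrite m_in.
      apply: (@key_inj e); apply/eqP; rewrite eqn_leq xe ?inE ?m_in ?orbT//=.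
      by rewrite -ie mki// !inE eqxx.
    have : m k = m i by apply: m_eq => // z zt; apply: mki; rewrite !inE zt orbT.
    move/(m_inj eD te); rewrite !inE kD iD ke ie => /(_ isT isT) ki.
    rewrite ltn_neqAle [X in _ && X](_ : _ = true) ?andbT; last by have := mki x; rewrite -ki; apply; rewrite !inE eqxx.
    by apply/eqP => /key_inj mkx; move: xt; rewrite -mkx m_in.
  rewrite /nxt; case: pickP => [y0 y0M|/(_ x)]; last by rewrite xM.
  case: arg_maxnP => // y yM ymax.
  suff -> : y = x by rewrite -rt Dr; case: (r).
  apply: (@key_inj e); apply/eqP; rewrite eqn_leq; apply/andP; split; last exact: ymax.
  have /dominantP/(_ y)[i] := dom; rewrite -Dr rt => iD yi.
  have [ie|ie] := eqVneq i e; first by rewrite -ie yi// !inE eqxx.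
  have /MP/(_ _ iD ie) := yM; rewrite ltnNge yi// !inE.
  by rewrite m_in orbT.
have rC : r.2 = D :\ j by rewrite Dr finset.setU1K.
have jD : j \in D by rewrite Dr !inE eqxx.
have tj : t \subset m @: (D :\ j) by rewrite -rC m_imset// tr.
exists j => //; rewrite /nxt; case: pickP => [y|_]; last first.
  by rewrite tr -rC; case: (r).
move=> /MP yM; have /dominantP/(_ y)[i] := dom.
rewrite rC !inE => /andP[ij iD]; move/(_ (m i)); rewrite -tr m_in.
by move=> /(_ isT); rewrite leqNgt yM.
Qed.

Lemma card_internal_door : #|[set r | room r && facet (t, D) r]| = 2.
Proof.
have [a [b [aD bD ab mab]]] := collision.
have [ra fa Ha] := nxt_room bD aD ab (esym mab).
have ba : b != a by rewrite eq_sym.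
have [rb fb Hb] := nxt_room aD bD ba mab.
have -> : [set r | room r && facet (t, D) r] = [set nxt a; nxt b].
  apply/setP => r; rewrite !inE; apply/andP/orP; last first.
    by case => /eqP ->.
  case=> rr fr; have [e [eD te] ->] := room_nxt rr fr.
  have [->|ea] := eqVneq e a; first by left.
  have [->|eb] := eqVneq e b; first by right.
  have := m_inj eD te => /(_ a b); rewrite !inE aD bD.
  rewrite (eq_sym a) (eq_sym b) ea eb => /(_ isT isT mab) /eqP.
  by rewrite (negbTE ab).
(* The two pivots differ. A common new point would lie above the [b]-minimum, being in [M a], and
   below it, being added by the pivot at [b]; if an index is dropped, the index sets already
   differ. *)
rewrite cards2; suff -> : nxt a != nxt b by [].
apply/eqP => nab.
have nD e : e \in D -> (nxt e).2 = D \/ (nxt e).2 = D :\ e.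
  by move=> eD; rewrite /nxt; case: pickP => [y yM|_]; [left|right].
have [aE|aE] := nD _ aD.
  have [x xE [xt xM xa]] := Hb aE; have [y yE [yt yM yb]] := Ha (etrans (congr1 snd (esym nab)) aE).
  have xy : x = y.
    have /setP/(_ x) : x |: t = y |: t by rewrite -xE -yE nab.
    move=> H; have : x \in y |: t by rewrite -H !inE eqxx.
    by rewrite !inE (negbTE xt) orbF => /eqP.
  have /MP/(_ _ bD ba) := xM; rewrite xy => H.
  by move: yb; rewrite ltnNge ltnW.
have [bE|bE] := nD _ bD; have : (nxt a).2 = (nxt b).2 by rewrite nab.
  by rewrite aE bE => /setP/(_ a); rewrite !inE eqxx aD.
by rewrite aE bE => /setP/(_ a); rewrite !inE eqxx aD (negbTE ab).
Qed.

End internal_door.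

(** With the single order [i], a one-point set is dominant only if its point is the largest one for
    [key i]. *)
Lemma card_outer_door (x0 : X) i : #|[set r | room r && facet (finset.set0, [set i]) r]| = 1.
Proof.
have [x _ xmax] := @arg_maxnP _ x0 predT (key i) isT.
rewrite (_ : [set _ | _] = [set ([set x], [set i])]) ?cards1//.
apply/setP => r; rewrite !inE; apply/andP/eqP => [[rr]|->].
  have /andP[/eqP cr dom] := rr.
  case/facet_cases => [[y yr [tr Dr]]|[j jr [tr Dr]]]; last first.
    move: cr; rewrite -tr cards0 => /esym/eqP; rewrite cards_eq0 => /eqP r2.
    by have /dominantP/(_ x0)[k] := dom; rewrite r2 inE.
  have ry : r.1 = [set y] by rewrite -(finset.setD1K yr) -tr finset.setU0.
  suff -> : x = y by rewrite -ry Dr; case: (r).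
  have /dominantP/(_ x)[k] := dom; rewrite -Dr inE => /eqP -> xy.
  apply: (@key_inj i); apply/eqP; rewrite eqn_leq; apply/andP; split; last exact: xmax.
  by apply: xy; rewrite ry inE.
split; last first.
  by have := @facet_del ([set x], [set i]) x; rewrite /= finset.setDv; apply; rewrite inE.
rewrite /room /= !cards1 eqxx/=; apply/dominantP => y; exists i; first by rewrite inE.
by move=> z; rewrite inE => /eqP ->; exact: xmax.
Qed.

Variable c : X -> I.

Definition nearly_colorful i0 (d : {set X} * {set I}) :=
  (i0 \in d.2) && (c @: d.1 == d.2 :\ i0).

(** Follow the repeated colour. Once removing [x] gives a nearly colorful door, there is exactly one
    other: either the colour of [x] also occurs at another point, which can be removed instead, or
    it lies outside [C] and can be added to the orders. *)
Lemma colorless_room_even i0 r : room r -> c @: r.1 != r.2 ->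
  ~~ odd #|[set d | nearly_colorful i0 d && facet d r]|.
Proof.
case: r => s C; rewrite /room /= => /andP[/eqP cC _] nC.
set N := [set d | _].
(* A door that adds an index [j] reduces to this case: the point coloured [j] can be removed
   instead. *)
suff H x : x \in s -> (s :\ x, C) \in N -> #|N| = 2.
  have [->|[d]] := finset.set_0Vmem N; first by rewrite cards0.
  move=> dN; have := dN; rewrite inE => /andP[/andP[+ +] /facet_cases].
  move=> i0d cd [[x xs dE]|[j jC dE]]; move: i0d cd.
    by move: dN; rewrite dE /= => /(H _ xs) ->.
  rewrite dE /= => i0jC /eqP cs.
  have ji0 : j != i0.
    by apply/eqP => ji0; move: nC; rewrite cs -ji0 finset.setU1K// eqxx.
  have i0C : i0 \in C by move: i0jC; rewrite !inE eq_sym (negbTE ji0).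
  have : j \in c @: s by rewrite cs !inE eqxx ji0.
  case/imsetP => x xs jx.
  rewrite (H x)// inE /nearly_colorful /= i0C /=.
  rewrite (@facet_del (s, C) x)// andbT finset.eqEsubset; apply/andP; split.
    apply/fintype.subsetP => _ /imsetP[y + ->]; rewrite !inE => /andP[yx ys].
    have : c y \in c @: s by apply: imset_f.
    rewrite cs !inE => /andP[-> /=] /orP[/eqP cyj|//].
    suff : {in s &, injective c} by move/(_ y x ys xs); rewrite cyj => /(_ jx)/eqP; rewrite (negbTE yx).
    apply/imset_injP; rewrite cs cC; apply/eqP.
    have := cardsD1 i0 (j |: C); rewrite i0jC cardsU1 jC !add1n => -[<-]//.
  apply/fintype.subsetP => k kC; have : k \in c @: s by rewrite cs; apply: fintype.subsetP kC; rewrite finset.setSD// finset.subsetUr.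
  case/imsetP => y ys ky; apply/imsetP; exists y => //; rewrite !inE ys andbT.
  apply/eqP => yx; move: kC; rewrite !inE ky yx -jx => /andP[_].
  by rewrite (negbTE jC).
move=> xs; rewrite inE => /andP[/andP[/= i0C /eqP cx] _].
have cinj : {in s :\ x &, injective c}.
  apply/imset_injP; rewrite cx; apply/eqP.
  by move: cC; rewrite (cardsD1 x s) xs (cardsD1 i0 C) i0C !add1n => -[].
have csx : c @: s = c x |: (C :\ i0) by rewrite -cx -imsetU1 finset.setD1K.
have cxi0 : c x != i0.
  by apply/eqP => cxi0; move: nC; rewrite csx cxi0 finset.setD1K// eqxx.
have [cxC|cxC] := boolP (c x \in C).
  have : c x \in c @: (s :\ x) by rewrite cx !inE cxi0.
  case/imsetP => x' x's cxx'; have := x's; rewrite !inE => /andP[x'x x's'].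
  rewrite (_ : N = [set (s :\ x, C); (s :\ x', C)]).
    rewrite cards2; suff -> : (s :\ x, C) != (s :\ x', C) by [].
    by apply/eqP => -[] /setP/(_ x); rewrite !inE eqxx xs eq_sym x'x.
  have inN z : z \in s -> c @: (s :\ z) = C :\ i0 -> (s :\ z, C) \in N.
    by move=> zs cz; rewrite inE /nearly_colorful/= i0C cz eqxx/= (@facet_del (s, C) z).
  apply/setP => d; rewrite [in RHS]inE [in RHS]inE [in RHS]inE; apply/idP/orP; last first.
    case=> /eqP ->; apply: inN => //.
    apply/setP => k; apply/imsetP/idP => [[y]|].
      rewrite !inE => /andP[yx' ys] ->.
      suff : c y \in C :\ i0 by rewrite !inE.
      have [->|yx] := eqVneq y x; first by rewrite !inE cxi0.
      by rewrite -cx imset_f// !inE yx.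
    rewrite -cx => /imsetP[y + ky]; rewrite !inE => /andP[yx ys].
    have [yx'|yx'] := eqVneq y x'; last by exists y => //; rewrite !inE yx'.
    exists x; last by rewrite ky yx'.
    by rewrite !inE eq_sym x'x.
  rewrite inE => /andP[/andP[id cd] /facet_cases[[z /= zs dE]|[j /= jC dE]]]; move: cd; rewrite dE /=.
    move=> /eqP cz; have [->|zx] := eqVneq z x; first by left.
    have [->|zx'] := eqVneq z x'; first by right.
    have : {in s :\ z &, injective c}.
      apply/imset_injP; rewrite cz; apply/eqP.
      by move: cC; rewrite (cardsD1 z s) zs (cardsD1 i0 C) i0C !add1n => -[].
    move=> /(_ x x'); rewrite !inE xs x's' (eq_sym x) (eq_sym x') zx zx'.
    by move=> /(_ isT isT cxx') /eqP; rewrite eq_sym (negbTE x'x).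
  move=> /eqP cs; have : j \in c @: s.
    rewrite cs !inE eqxx /= andbT; apply/eqP => ji0.
    by move: jC; rewrite ji0 i0C.
  rewrite csx !inE => /orP[/eqP jE|]; first by move: jC; rewrite jE cxC.
  by rewrite (negbTE jC) andbF.
rewrite (_ : N = [set (s :\ x, C); (s, c x |: C)]).
  rewrite cards2; suff -> : (s :\ x, C) != (s, c x |: C) by [].
  by apply/eqP => -[] /setP/(_ x); rewrite !inE eqxx xs.
apply/setP => d; rewrite [in RHS]inE [in RHS]inE [in RHS]inE; apply/idP/orP; last first.
  case=> /eqP ->; rewrite inE /nearly_colorful /=.
    by rewrite i0C cx eqxx/= (@facet_del (s, C) x).
  rewrite !inE i0C orbT /= (@facet_add (s, C) (c x))// andbT csx.
  apply/eqP/setP => k; rewrite !inE.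
  by case: (eqVneq k (c x)) => [->|]; rewrite ?cxi0.
rewrite inE => /andP[/andP[id cd] /facet_cases[[z /= zs dE]|[j /= jC dE]]]; move: cd; rewrite dE /=.
  move=> /eqP cz; have [->|zx] := eqVneq z x; first by left.
  have : c x \in c @: (s :\ z) by rewrite imset_f// !inE xs eq_sym zx.
  by rewrite cz !inE (negbTE cxC) andbF.
move=> /eqP cs; have : j \in c @: s.
  rewrite cs !inE eqxx /= andbT; apply/eqP => ji0.
  by move: jC; rewrite ji0 i0C.
rewrite csx !inE => /orP[/eqP ->|]; first by right.
by rewrite (negbTE jC) andbF.
Qed.

(* Scarf's lemma. Parity: an internal door lies in exactly two rooms, the only
   nearly colorful outer door in exactly one, and a room that is not colorful
   has zero or two nearly colorful doors. *)
Lemma scarf (x0 : X) : exists s C, [/\ s != finset.set0, c @: s = C & dominant s C].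
Proof.
pose i0 := c x0.
have [r|noroom] := pickP (fun r => room r && (c @: r.1 == r.2)).
  move=> /andP[/andP[/eqP cC dom] /eqP cs]; exists r.1, r.2; split => //.
  apply/eqP => s0; move: cC; rewrite s0 cards0 => /esym/eqP; rewrite cards_eq0 => /eqP C0.
  by move: dom => /dominantP/(_ x0)[k]; rewrite C0 inE.
pose NC := [pred d | nearly_colorful i0 d && door d].
have dc : \sum_(d | NC d) #|[set r | room r && facet d r]| =
          \sum_(r | room r) #|[set d | nearly_colorful i0 d && facet d r]|.
  transitivity (\sum_(d | NC d) \sum_(r | room r) facet d r).
    apply: eq_bigr => d _; rewrite -sum1_card big_mkcond [RHS]big_mkcond /=.
    by apply: eq_bigr => r _; rewrite inE; case: (room r) => //=; case: facet.
  rewrite exchange_big /=; apply: eq_bigr => r rr.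
  rewrite -sum1_card big_mkcond [RHS]big_mkcond /=.
  apply: eq_bigr => d _; rewrite inE.
  have [fd|] := boolP (facet d r); last by rewrite !andbF; case: ifP.
  by rewrite (facet_door fd rr) !andbT.
pose o := (finset.set0 : {set X}, [set i0]).
have No : NC o.
  rewrite /NC /= /nearly_colorful /= inE eqxx imset0 finset.setDv eqxx /door/= cards1 cards0 eqxx /=.
  by apply/dominantP => y; exists i0; rewrite ?inE// => x; rewrite inE.
have : odd (\sum_(d | NC d) #|[set r | room r && facet d r]|).
  rewrite (bigD1 o) //= (card_outer_door x0) oddD /=.
  elim/big_rec: _ => // -[t D] n /andP[/andP[/andP[/= i0D /eqP ct] /andP[/eqP cD dom]]] tDo.
  rewrite oddD; have [t0|[x xt]] := finset.set_0Vmem t.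
    case/negP: tDo; rewrite /o t0; suff -> : D = [set i0] by [].
    apply/eqP; rewrite finset.eqEsubset finset.sub1set i0D andbT.
    by rewrite -finset.setD_eq0 -ct t0 imset0.
  by rewrite (@card_internal_door _ _ x).
rewrite dc; elim/big_rec: _ => // r n rr IH; rewrite oddD.
move: (noroom r); rewrite rr /= => /negbT/(colorless_room_even i0 rr)/negbTE -> /=.
exact: IH.
Qed.

End scarf.

Import Order.TTheory GRing.Theory Num.Theory.
Local Open Scope ring_scope.

(** * Approximate fixed points *)

Section approximate_kakutani.
Variables (R : realType) (I F : finType) (i0 : I).
Variables (z w : I -> F -> R) (e : R).
Hypothesis w1 : forall i f, `|w i f| <= 1.
Hypothesis net : forall p : I -> R, (forall i, 0 <= p i) -> \sum_i p i = 1 ->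
  exists i, forall f, `|\sum_j p j * w j f - z i f| <= e.

Let bary n (v : I -> nat) f : R := \sum_j ((v j)%:R / n%:R) * w j f.

Let bary_near n (l v : I -> nat) f : (0 < n)%N -> (forall i, l i <= v i)%N ->
  `|bary n v f - bary n l f| <= (\sum_i v i - \sum_i l i)%:R / n%:R.
Proof.
move=> n0 lv; rewrite /bary -sumrB; apply: (le_trans (ler_norm_sum _ _ _)).
rewrite -sumnB => [|i _]; last exact: lv.
rewrite natr_sum mulr_suml; apply: ler_sum => i _.
rewrite -mulrBl -mulrBl -natrB// normrM ger0_norm; last first.
  by rewrite divr_ge0.
by rewrite ler_piMr// divr_ge0.
Qed.

(** The [z i] form a net of sample points and [w i] is a value chosen at [z i]. Grid points of the
    simplex are coloured by a nearby sample of their barycentre. Scarf's lemma for the coordinate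
    orders gives grid points that are close to each other and whose colours are all the indices that
    may carry weight, so each [w i] that enters the mixture is a value at a sample close to the
    mixture. *)
Lemma approximate_kakutani (d : R) : 0 < d -> exists p : I -> R,
  [/\ forall i, 0 <= p i, \sum_i p i = 1 &
      forall i, 0 < p i -> forall f, `|\sum_j p j * w j f - z i f| <= e + d].
Proof.
move=> d0.
(* The factor 2: a grid point of the dominant set and the output [p'] each differ from their common
   lower bound [l] by at most [#|I|] units of size [1/n]. *)
pose n := (Num.truncn ((2 * #|I|)%:R / d)).+1.
have nd : (2 * #|I|)%:R / n%:R <= d.
  rewrite ler_pdivrMr ?ltr0n// mulrC -ler_pdivrMr//.
  by apply/ltW/truncnS_gt.
pose X : finType := {v : {ffun I -> 'I_n.+1} | (\sum_i v i)%N == n}.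
(* The order by the [i]-th coordinate; [enum_rank v], which is below [#|X|], only breaks ties. *)
pose key i (v : X) := (val v i * #|X| + enum_rank v)%N.
have rk (v : X) : (enum_rank v < #|X|)%N by [].
have key_inj i : injective (key i).
  move=> v v' /(congr1 (modn^~ #|X|)); rewrite !modnMDl !modn_small//.
  by move=> /ord_inj/enum_rank_inj.
have sumX (v : X) : (\sum_i val v i)%N = n by apply/eqP; exact: (valP v).
have mkX (g : I -> nat) : (\sum_i g i)%N = n -> exists v : X, forall i, val v i = g i :> nat.
  move=> gn; have gb i : (g i < n.+1)%N by rewrite ltnS -gn (bigD1 i)//= leq_addr.
  pose v0 : {ffun I -> 'I_n.+1} := [ffun i => Ordinal (gb i)].
  have v0P : (\sum_i v0 i)%N == n.
    by rewrite -[X in _ == X]gn; apply/eqP/eq_bigr => i _; rewrite ffunE.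
  by exists (exist _ v0 v0P) => i; rewrite /= ffunE.
pose good (v : X) i := [forall f, `|bary n (fun j => val v j) f - z i f| <= e].
have goodP v : exists i, good v i.
  have [||i ni] := net (p := fun j => (val v j)%:R / n%:R).
  - by move=> i; rewrite divr_ge0.
  - by rewrite -mulr_suml -natr_sum sumX divff// pnatr_eq0.
  - by exists i; apply/forallP => f; exact: ni.
pose c v := xchoose (goodP v).
have cP (v : X) f : `|bary n (fun j => val v j) f - z (c v) f| <= e.
  by have /forallP := xchooseP (goodP v); exact.
have delta (j : I) m : (\sum_i (i == j) * m)%N = m.
  by rewrite (bigD1 j)//= eqxx mul1n big1 ?addn0// => i /negbTE->.
have [x0 _] := mkX _ (delta i0 n).
have [s [C [s0 cs /dominantP dom]]] := scarf key_inj c x0.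
have [x xs] := set0Pn _ s0.
have C0 : c x \in C by rewrite -cs imset_f.
have /choice[lx lxP] : forall i, exists x : X, x \in s /\
    forall y : X, y \in s -> (val x i <= val y i)%N.
  by move=> i; have [y ys ymin] := @arg_minnP _ x (fun y : X => y \in s) (fun y : X => val y i : nat) xs; exists y.
pose l i := if i \in C then nat_of_ord (val (lx i) i) else 0%N.
have lle (y : X) : y \in s -> forall i, (l i <= val y i)%N.
  by move=> ys i; rewrite /l; case: ifP => // _; have [_] := lxP i; apply.
have suml : (\sum_i l i <= n)%N.
  by rewrite -(sumX x); apply: leq_sum => i _; exact: lle.
(* Otherwise there is room to raise every coordinate of [C] above its minimum [l] by one and put the
   remainder on [c x], which contradicts dominance. *)
have nl : (n - \sum_i l i <= #|I|)%N.
  rewrite leqNgt; apply/negP => ltn.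
  have [|y yE] := mkX (fun i => l i + (i \in C) + (i == c x) * (n - \sum_i l i - #|C|))%N.
    rewrite !big_split /= delta.
    have -> : (\sum_i (i \in C))%N = #|C|.
      by rewrite -sum1_card [RHS]big_mkcond; apply: eq_bigr => i _; case: (i \in C).
    have : (#|C| <= #|I|)%N by exact: max_card.
    by lia.
  have [i iC yi] := dom y.
  have [ls lm] := lxP i; have := yi _ ls.
  rewrite /key yE /l iC leqNgt => /negP; apply.
  apply: (@leq_trans ((val (lx i) i).+1 * #|X|)%N); first by rewrite mulSn addnC ltn_add2r.
  apply: (leq_trans _ (leq_addr _ _)); rewrite leq_mul2r; apply/orP; right.
  by rewrite -addn1 leq_addr.
(* Since [l] vanishes off [C] and [c x] is in [C], only indices of [C], that is, colours of points
   of [s], get positive weight. *)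
pose p' i := (l i + (i == c x) * (n - \sum_i l i))%N.
have sump' : (\sum_i p' i)%N = n by rewrite big_split /= delta subnKC.
exists (fun i => (p' i)%:R / n%:R); split.
- by move=> i; rewrite divr_ge0.
- by rewrite -mulr_suml -natr_sum sump' divff// pnatr_eq0.
move=> i pi f.
have iC : i \in C.
  apply: contraTT pi => iC; rewrite /p' /l (negbTE iC).
  have [icx|_] := eqVneq i (c x); first by rewrite icx C0 in iC.
  by rewrite mul0n mul0r ltxx.
move: iC; rewrite -cs => /imsetP[y ys ->].
have H1 := cP y f.
have H2 := bary_near f (isT : 0 < n)%N (lle _ ys); rewrite sumX in H2.
have H3 := @bary_near n l p' f isT (fun i => leq_addr _ _); rewrite sump' in H3.
have H4 : (n - \sum_i l i)%:R / n%:R <= d / 2.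
  rewrite ler_pdivlMr// mulrC; apply: le_trans nd; rewrite mulrA ler_pM2r ?invr_gt0 ?ltr0n//.
  by rewrite -natrM ler_nat leq_mul2l nl.
rewrite -/(bary n p' f).
rewrite ler_norml in H1; rewrite ler_norml in H2; rewrite ler_norml in H3.
rewrite ler_norml; lra.
Qed.
End approximate_kakutani.

Import numFieldNormedType.Exports.
Import HBNNSimple.
Local Open Scope classical_set_scope.
Local Open Scope ring_scope.

(** * Euclidean norm and Borel structure *)

Section enorm.
Variables (R : realType) (n : nat).
Implicit Types x y : 'cV[R]_n.

Lemma enorm_ge0 x : 0 <= enorm x. Proof. exact: sqrtr_ge0. Qed.

Lemma enorm_sqr x : enorm x ^+ 2 = \sum_i x i 0 ^+ 2.
Proof. by rewrite sqr_sqrtr// sumr_ge0// => i _; rewrite sqr_ge0. Qed.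

Lemma enorm0 : enorm (0 : 'cV[R]_n) = 0.
Proof. by rewrite /enorm big1 ?sqrtr0// => i _; rewrite mxE expr0n. Qed.

Lemma enormZ (a : R) x : enorm (a *: x) = `|a| * enorm x.
Proof.
apply/eqP; rewrite -(@eqrXn2 _ 2)// ?mulr_ge0 ?enorm_ge0//.
rewrite exprMn !enorm_sqr mulr_sumr real_normK ?num_real//.
by apply/eqP/eq_bigr => i _; rewrite mxE exprMn.
Qed.

Lemma enormN x : enorm (- x) = enorm x.
Proof. by rewrite -scaleN1r enormZ normrN1 mul1r. Qed.

Lemma entry_le_enorm x i : `|x i 0| <= enorm x.
Proof.
rewrite -(@ler_pXn2r _ 2) ?nnegrE ?enorm_ge0// enorm_sqr real_normK ?num_real//.
by rewrite (bigD1 i)//= lerDl sumr_ge0// => j _; rewrite sqr_ge0.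
Qed.

Lemma cauchy_schwarz x y : `|\sum_i x i 0 * y i 0| <= enorm x * enorm y.
Proof.
have key (s t : R) : 0 <= s ^+ 2 * enorm x ^+ 2 + 2 * s * t * (\sum_i x i 0 * y i 0) + t ^+ 2 * enorm y ^+ 2.
  rewrite !enorm_sqr !mulr_sumr -!big_split/= sumr_ge0// => i _.
  suff -> : s ^+ 2 * x i 0 ^+ 2 + 2 * s * t * (x i 0 * y i 0) + t ^+ 2 * y i 0 ^+ 2 = (s * x i 0 + t * y i 0) ^+ 2 by rewrite sqr_ge0.
  by ring.
set c := \sum_i _ in key *.
have h : c ^+ 2 <= (enorm x * enorm y) ^+ 2.
  have [y0|y0] := eqVneq (enorm y) 0; last first.
    have := key (enorm y ^+ 2) (- c).
    have -> : enorm y ^+ 2 ^+ 2 * enorm x ^+ 2 + 2 * enorm y ^+ 2 * - c * c + (- c) ^+ 2 * enorm y ^+ 2 = enorm y ^+ 2 * ((enorm x * enorm y) ^+ 2 - c ^+ 2) by ring.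
    by rewrite pmulr_rge0 ?subr_ge0// exprn_gt0// lt_neqAle eq_sym y0 enorm_ge0.
  rewrite y0 mulr0 expr0n /=.
  suff -> : c = 0 by rewrite expr0n.
  rewrite /c big1// => i _; suff -> : y i 0 = 0 by rewrite mulr0.
  by apply/eqP; rewrite -normr_le0 -y0 entry_le_enorm.
by rewrite -(@ler_pXn2r _ 2)// ?nnegrE ?mulr_ge0 ?enorm_ge0// real_normK ?num_real.
Qed.

Lemma enormD x y : enorm (x + y) <= enorm x + enorm y.
Proof.
rewrite -(@ler_pXn2r _ 2) ?nnegrE ?addr_ge0 ?enorm_ge0// sqrrD !enorm_sqr.
rewrite (eq_bigr (fun i => x i 0 ^+ 2 + 2 * (x i 0 * y i 0) + y i 0 ^+ 2)); last first.
  by move=> i _; rewrite mxE sqrrD mulr_natl.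
rewrite !big_split/= lerD2r lerD2l -mulr_sumr -[leRHS]mulr_natl ler_pM2l//.
by apply: le_trans (cauchy_schwarz _ _); rewrite ler_norm.
Qed.

Lemma enormB x y : enorm (x - y) <= enorm x + enorm y.
Proof. by rewrite (le_trans (enormD _ _))// enormN. Qed.

Lemma enormBC x y : enorm (x - y) = enorm (y - x).
Proof. by rewrite -enormN opprB. Qed.

Lemma enorm_dist3 x y z : enorm (x - z) <= enorm (x - y) + enorm (y - z).
Proof. by apply: le_trans (enormD _ _); rewrite addrA subrK. Qed.

Lemma enorm_parallelogram x y :
  enorm (2^-1 *: (x + y)) ^+ 2 + enorm (2^-1 *: (x - y)) ^+ 2
  = (enorm x ^+ 2 + enorm y ^+ 2) / 2.
Proof.
rewrite !enorm_sqr -!big_split/= mulr_suml.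
by apply: eq_bigr => i _; rewrite !mxE; field.
Qed.

Lemma enorm_le_sum x : enorm x <= \sum_i `|x i 0|.
Proof.
rewrite -(@ler_pXn2r _ 2) ?nnegrE ?enorm_ge0 ?sumr_ge0// enorm_sqr.
rewrite expr2 mulr_suml; apply: ler_sum => i _.
rewrite -real_normK ?num_real// expr2 ler_wpM2l// (bigD1 i)//= lerDl sumr_ge0//.
Qed.

Lemma enorm_eq0 x : enorm x = 0 -> x = 0.
Proof.
move=> x0; apply/colP => i; rewrite mxE; apply/eqP.
by rewrite -normr_le0 -x0 entry_le_enorm.
Qed.

Lemma enorm_lt_entries x (e : R) : 0 < e ->
  (forall i, `|x i 0| < e / n.+1%:R) -> enorm x < e.
Proof.
move=> e0 H; apply: (le_lt_trans (enorm_le_sum _)).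
apply: (@le_lt_trans _ _ (\sum_(i < n) e / n.+1%:R)).
  by apply: ler_sum => i _; exact: ltW.
rewrite sumr_const card_ord -[X in X < _]mulr_natr mulrAC ltr_pdivrMr//.
by rewrite ltr_pM2l// ltr_nat.
Qed.

Lemma enorm_dist x y : `|enorm x - enorm y| <= enorm (x - y).
Proof.
have h1 : enorm x <= enorm (x - y) + enorm y by apply: le_trans (enormD _ _); rewrite subrK.
have h2 : enorm y <= enorm (x - y) + enorm x.
  by rewrite enormBC; apply: le_trans (enormD _ _); rewrite subrK.
by rewrite ler_norml; lra.
Qed.

Lemma continuous_enorm : continuous (@enorm R n).
Proof.
move=> x; have FF : Filter (nbhs x) by exact: nbhs_filter.
apply/(@cvgrPdist_lt _ _ _ (nbhs x)) => e e0.
have e0' : 0 < e / n.+1%:R by rewrite divr_gt0.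
have := @nbhsx_ballx _ _ x _ e0'.
apply: filterS => y [_ xy]; apply: (le_lt_trans (enorm_dist _ _)).
by apply: enorm_lt_entries => // i; have := xy i 0; rewrite /ball/= !mxE.
Qed.

End enorm.

Section mulmx_bound.
Variables (R : realType) (m n : nat) (A : 'M[R]_(m, n)).

Definition mxbound : R := \sum_i \sum_j `|A i j|.

Lemma mxbound_ge0 : 0 <= mxbound.
Proof. by rewrite sumr_ge0// => i _; rewrite sumr_ge0. Qed.

Lemma enorm_mulmx x : enorm (A *m x) <= mxbound * enorm x.
Proof.
apply: (le_trans (enorm_le_sum _)); rewrite mulr_suml; apply: ler_sum => i _.
rewrite mxE (le_trans (ler_norm_sum _ _ _))// mulr_suml ler_sum// => j _.
by rewrite normrM ler_wpM2l// entry_le_enorm.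
Qed.
End mulmx_bound.

Section matrix_topology.
Variables (R : realType) (m n : nat).

Lemma cvg_mx (T : Type) (F : set_system T) (f : T -> 'M[R]_(m, n)) (M : 'M[R]_(m, n)) :
  Filter F -> (forall i j, f x i j @[x --> F] --> M i j) -> f x @[x --> F] --> M.
Proof.
move=> FF H; apply/cvg_mx_entourageP => E entE.
apply: filter_forall => i; apply: filter_forall => j.
have /cvg_entourageP/(_ _ entE) := H i j.
by rewrite !near_simpl; apply: filterS => x /= ?; rewrite inE.
Qed.

End matrix_topology.

Section matrix_measurability.
Variables (R : realType) (m n : nat).

(** An open set of matrices is a countable union of boxes with rational centres and radii, and the
    preimage of a box is cut out by finitely many conditions on the entries. *)
Lemma measurable_fun_mx d (T : measurableType d) (D : set T) (f : T -> 'M[R]_(m, n)) :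
  measurable D -> (forall i j, measurable_fun D (fun t => f t i j)) ->
  measurable_fun D f.
Proof.
move=> mD mf; apply: (measurability (@open 'M[R]_(m, n))) => // _ [U oU <-].
pose box (ce : 'M[rat]_(m, n) * rat) : set 'M[R]_(m, n) :=
  [set y : 'M[R]_(m, n) | forall i j, `|y i j - ratr (ce.1 i j)| < ratr ce.2].
have mbox ce : measurable (D `&` f @^-1` box ce).
  have -> : D `&` f @^-1` box ce = D `\` \bigcup_(i in [set: 'I_m]) \bigcup_(j in [set: 'I_n])
      (D `&` [set t | ratr ce.2 <= `|f t i j - ratr (ce.1 i j)|]).
    apply/seteqP; split=> t /= [Dt H].
      by split => // -[i _ [j _ [_ /= le_ce]]]; have := H i j; rewrite ltNge le_ce.
    split => // i j; rewrite ltNge; apply/negP => le_ce.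
    by apply: H; exists i => //; exists j.
  apply: measurableD => //; apply: fin_bigcup_measurable; first exact: finite_finset.
  move=> i _; apply: fin_bigcup_measurable; first exact: finite_finset.
  move=> j _; have mg : measurable_fun D (fun t => `|f t i j - ratr (ce.1 i j)|).
    by apply: measurableT_comp => //; apply: measurable_funB.
  have := mg mD _ (measurable_itv `[ratr ce.2, +oo[); congr measurable.
  by apply/seteqP; split=> t /= [Dt]; rewrite in_itv/= andbT.
pose F k := if unpickle k is Some ce then
  if `[< box ce `<=` U >] then D `&` f @^-1` box ce else set0 else set0.
have -> : D `&` f @^-1` U = \bigcup_k F k.
  apply/seteqP; split=> t; last first.
    move=> [k _]; rewrite /F; case: unpickle => // ce; case: ifP => // /asboolP sub [Dt bt].
    by split => //; exact: sub.
  move=> [Dt Ut]; have /nbhs_ballP[e /= e0 eU] := open_nbhs_nbhs (conj oU Ut).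
  have [q] := rat_in_itvoo (divr_gt0 e0 (ltr0Sn R 1)); rewrite in_itv/= => /andP[q0 qe].
  have /choice[c cP] (ij : 'I_m * 'I_n) : exists c : rat, `|f t ij.1 ij.2 - ratr c| < ratr q.
    have ltq : f t ij.1 ij.2 - ratr q < f t ij.1 ij.2 + ratr q by lra.
    have [c] := rat_in_itvoo ltq; rewrite in_itv/= => /andP[cl ch].
    by exists c; rewrite ltr_norml; lra.
  pose ce : 'M[rat]_(m, n) * rat := (\matrix_(i, j) c (i, j), q).
  have bt : box ce (f t) by move=> i j; rewrite /= mxE; exact: (cP (i, j)).
  exists (pickle ce) => //; rewrite /F pickleK; case: asboolP => // H; exfalso; apply: H.
  move=> y yb; apply: eU; split => // i j; rewrite /ball/=.
  have := bt i j; have := yb i j; rewrite /= !mxE !ltr_norml; lra.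
apply: bigcup_measurable => k _; rewrite /F; case: unpickle => // ce; case: ifP => //.
Qed.

Lemma continuous_measurable_mx (f : 'M[R]_(m, n) -> R) : continuous f ->
  measurable_fun setT f.
Proof.
move=> /continuousP cf; apply: (measurability _ (RGenOpens.measurableE R)).
move=> _ [U [a [b ->]] <-]; rewrite setTI; apply: sub_sigma_algebra.
by apply: cf; exact: interval_open.
Qed.

Lemma measurable_coord d (T : measurableType d) (D : set T) (f : T -> 'M[R]_(m, n)) i j :
  measurable_fun D f -> measurable_fun D (fun t => f t i j).
Proof.
move=> mf; apply: (@measurableT_comp _ _ _ _ _ _ (fun M : 'M[R]_(m, n) => M i j)) => //.
by apply: continuous_measurable_mx; exact: coord_continuous.
Qed.

End matrix_measurability.

Lemma measurable_enorm (R : realType) n : measurable_fun setT (@enorm R n).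
Proof. by apply: continuous_measurable_mx; exact: continuous_enorm. Qed.

Lemma measurable_mulmx (R : realType) m n p d (T : measurableType d) (D : set T)
    (A : 'M[R]_(p, m)) (f : T -> 'M[R]_(m, n)) :
  measurable D -> measurable_fun D f -> measurable_fun D (fun t => A *m f t).
Proof.
move=> mD mf; apply: measurable_fun_mx => // i j.
under eq_fun do rewrite mxE.
apply: measurable_sum => k; apply: measurable_funM; first exact: measurable_cst.
exact: measurable_coord.
Qed.

(** * Convexity and growth of the Lagrangian *)

Section directional.
Variables (R : realType) (V : normedModType R).
Implicit Types (f : V -> R) (a v : V).

Lemma is_derive_line f a v (s : R) : differentiable f (a + s *: v) ->
  is_derive s 1 (fun r : R => f (a + r *: v)) ('D_v f (a + s *: v)).
Proof.
move=> df; have dv := @diff_derivable _ _ _ f _ v df.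
have E : (fun h : R => h^-1 *: (((fun r : R => f (a + r *: v)) \o shift s) (h *: 1) - f (a + s *: v)))
   = (fun h : R => h^-1 *: ((f \o shift (a + s *: v)) (h *: v) - f (a + s *: v))).
  apply/funext => h /=; congr (_ *: (f _ - _)).
  by rewrite [h *: 1]mulr1 scalerDl addrCA.
apply: DeriveDef; first by rewrite /derivable E.
by rewrite /derive E.
Qed.

Lemma line_within (f : R -> R) (df : R -> R) (a b : R) :
  (forall s : R, is_derive s 1 f (df s)) -> {within `[a, b], continuous f}.
Proof.
move=> Hf; apply: continuous_subspaceT => s.
by apply: differentiable_continuous; apply/derivable1_diffP.
Qed.

Lemma mvt_line f a v : (forall x, differentiable f x) ->
  exists2 s : R, 0 <= s <= 1 & f (a + v) - f a = 'D_v f (a + s *: v).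
Proof.
move=> df; have Hd s := is_derive_line (df (a + s *: v)).
have [s s01] := MVT_segment ler01 (fun x _ => Hd x) (line_within Hd).
rewrite scale1r scale0r addr0 subr0 mulr1 => ->; exists s => //.

Qed.

(** Two nested mean-value arguments: one for [f] along the segment minus the quadratic with slope
    ['D_v f a] and curvature [c], one for ['D_v f] itself. *)
Lemma taylor2_line f a v (c : R) : (forall x, differentiable f x) ->
  (forall x, differentiable ('D_v f) x) ->
  (forall x, c <= 'D_v ('D_v f) x) ->
  f a + 'D_v f a + c / 2 <= f (a + v).
Proof.
move=> df ddf Hc.
pose psi (s : R) := f (a + s *: v) - ('D_v f a * s + c / 2 * (s * s)).
have Hd (s : R) : is_derive s 1 psi ('D_v f (a + s *: v) - ('D_v f a + c * s)).
  have H1 := is_derive_line (df (a + s *: v)).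
  apply: is_derive_eq.
  have e (x : R) : x%:A = x :> R by rewrite /GRing.scale/= mulr1.
  by rewrite !e -[_ *: (s + s)]/(c / 2 * (s + s)); field.
have [s] := MVT_segment ler01 (fun x _ => Hd x) (line_within Hd).
rewrite in_itv /= => /andP[s0 s1].
rewrite /psi scale1r scale0r addr0 !(mulr0, mulr1, subr0, addr0) => H.
have [t t01 Ht] := @mvt_line ('D_v f) a (s *: v) ddf.
have Hsv : 'D_(s *: v) ('D_v f) (a + t *: (s *: v)) = s * 'D_v ('D_v f) (a + t *: (s *: v)).
  by rewrite !deriveE// linearZ.
have Hge : s * c <= 'D_v f (a + s *: v) - 'D_v f a by rewrite Ht Hsv ler_wpM2l.
move: H Hge; rewrite [c * s]mulrC; move: ('D_v f (a + s *: v)) ('D_v f a) (f (a + v)) (f a) (s * c) => p q p' q' t'.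
by clear -c; lra.
Qed.

End directional.

Section coordinates.
Variables (R : realType) (n : nat).

Lemma basis_decomp (u : 'cV[R]_n) : u = \sum_i u i 0 *: basis_vec i.
Proof.
apply/colP => i; rewrite summxE (bigD1 i)//= !mxE !eqxx mulr1 big1 ?addr0// => j ji.
by rewrite !mxE eq_sym (negbTE ji) mulr0.
Qed.

Lemma derive_coord (f : 'cV[R]_n -> R) x u : differentiable f x ->
  'D_u f x = \sum_i u i 0 * 'D_(basis_vec i) f x.
Proof.
move=> df; rewrite {1}[u]basis_decomp deriveE// linear_sum.
by apply: eq_bigr => i _; rewrite linearZ deriveE.
Qed.

Lemma differentiable_lincomb (V : normedModType R) (F : 'I_n -> V -> R) (c : 'I_n -> R) x :
  (forall j, differentiable (F j) x) -> differentiable (fun y => \sum_j c j * F j y) x.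
Proof.
move=> dF; rewrite (_ : (fun y => _) = \sum_(j < n) (c j \*: F j)).
  by apply: differentiable_sum => j; apply: differentiableZ.
by apply/funext => y; rewrite fct_sumE.
Qed.

Lemma derive_lincomb (V : normedModType R) (F : 'I_n -> V -> R) (c : 'I_n -> R) x v :
  (forall j, differentiable (F j) x) ->
  'D_v (fun y => \sum_j c j * F j y) x = \sum_j c j * 'D_v (F j) x.
Proof.
move=> dF; rewrite (_ : (fun y => _) = \sum_(j < n) (c j \*: F j)).
  rewrite derive_sum => [|j]; last by apply: diff_derivable; apply: differentiableZ.
  by apply: eq_bigr => j _; rewrite deriveZ//; exact: diff_derivable.
by apply/funext => y; rewrite fct_sumE.
Qed.

Lemma gradient_bound (f : 'cV[R]_n -> R) x u : differentiable f x ->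
  `|'D_u f x| <= enorm u * enorm (gradient f x).
Proof.
move=> df; rewrite derive_coord//.
rewrite (eq_bigr (fun i => u i 0 * gradient f x i 0)); first exact: cauchy_schwarz.
by move=> i _; rewrite mxE.
Qed.

Lemma hessian_form (f : 'cV[R]_n -> R) x u :
  (forall y, differentiable f y) -> (forall i y, differentiable ('D_(basis_vec i) f) y) ->
  'D_u ('D_u f) x = (u^T *m hessian f x *m u) 0 0.
Proof.
move=> df ddf; have -> : 'D_u f = fun y => \sum_j u j 0 * 'D_(basis_vec j) f y.
  by apply/funext => y; exact: derive_coord.
rewrite derive_lincomb// mxE; apply: eq_bigr => j _.
rewrite mxE mulrC derive_coord//; congr (_ * _); apply: eq_bigr => i _.
by rewrite !mxE.
Qed.

End coordinates.

Section opnorm.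
Variables (R : realType) (m n : nat) (M : 'M[R]_(m, n)).

Lemma enorm_opnorm v : enorm (M *m v) <= opnorm M * enorm v.
Proof.
have [/enorm_eq0 ->|v0] := eqVneq (enorm v) 0; first by rewrite mulmx0 !enorm0 mulr0.
have vp : 0 < enorm v by rewrite lt_neqAle eq_sym v0 enorm_ge0.
rewrite -ler_pdivrMr// /opnorm; apply: ub_le_sup.
  exists (mxbound M) => _ [w /= w1 <-]; apply: (le_trans (enorm_mulmx _ _)).
  by rewrite ler_piMr// mxbound_ge0.
exists ((enorm v)^-1 *: v) => /=; last first.
  by rewrite -scalemxAr enormZ ger0_norm ?invr_ge0 ?enorm_ge0// mulrC.
by rewrite enormZ ger0_norm ?invr_ge0 ?enorm_ge0// mulVf.
Qed.

Lemma bilinear_opnorm (u : 'cV[R]_m) (v : 'cV[R]_n) : `|\sum_i u i 0 * (M *m v) i 0| <= opnorm M * (enorm u * enorm v).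
Proof.
apply: (le_trans (cauchy_schwarz _ _)); rewrite mulrCA.
by apply: ler_wpM2l; [exact: enorm_ge0|exact: enorm_opnorm].
Qed.
End opnorm.

Section partials.
Variables (R : realType) (d k : nat) (L : 'cV[R]_d -> 'cV[R]_k -> R).
Hypothesis L2 : C2 (fun z : 'cV[R]_d * 'cV[R]_k => L z.1 z.2).
Let g := (fun z : 'cV[R]_d * 'cV[R]_k => L z.1 z.2).

Lemma differentiable_snd_partial (f : 'cV[R]_d * 'cV[R]_k -> R) x u :
  differentiable f (x, u) -> differentiable (fun w => f (x, w)) u.
Proof.
move=> df; apply: (@differentiable_comp _ _ _ _ (fun w => (x, w)) f) => //.

Qed.

Lemma differentiable_fst_partial (f : 'cV[R]_d * 'cV[R]_k -> R) x u :
  differentiable f (x, u) -> differentiable (fun y => f (y, u)) x.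
Proof.
move=> df; apply: (@differentiable_comp _ _ _ _ (fun w => (w, u)) f) => //.

Qed.

Lemma derive_snd_partial (f : 'cV[R]_d * 'cV[R]_k -> R) x u v :
  'D_v (fun w => f (x, w)) u = 'D_((0 : 'cV[R]_d), v) f (x, u).
Proof.
have E : (fun h : R => h^-1 *: (((fun w => f (x, w)) \o shift u) (h *: v) - f (x, u)))
    = (fun h : R => h^-1 *: ((f \o shift (x, u)) (h *: ((0 : 'cV[R]_d), v)) - f (x, u))).
  apply/funext => h /=; congr (_ *: (f _ - _)).
  by apply/eqP; rewrite /shift/= -pair_eqE /pair_eq/= scaler0 add0r !eqxx.
by rewrite /derive E.
Qed.

Lemma dL_u x u : differentiable (L x) u.
Proof. by case: L2 => -[dg _] _; apply: (@differentiable_snd_partial g). Qed.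

Lemma dL_x x u : differentiable (L^~ u) x.
Proof. by case: L2 => -[dg _] _; apply: (@differentiable_fst_partial g). Qed.

Lemma ddL_u x v u : differentiable ('D_v (L x)) u.
Proof.
case: L2 => _ /(_ (0, v))[dg _].
rewrite (_ : 'D_v (L x) = fun w => 'D_((0 : 'cV[R]_d), v) g (x, w)).
  exact: (@differentiable_snd_partial ('D_((0 : 'cV[R]_d), v) g) x u (dg (x, u))).
by apply/funext => w; rewrite -(derive_snd_partial g).
Qed.

Lemma ddL_x u v x : differentiable (fun y => 'D_v (L y) u) x.
Proof.
case: L2 => _ /(_ (0, v))[dg _].
rewrite (_ : (fun y => _) = fun y => 'D_((0 : 'cV[R]_d), v) g (y, u)).
  exact: (@differentiable_fst_partial ('D_((0 : 'cV[R]_d), v) g) x u (dg (x, u))).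
by apply/funext => y; rewrite -(derive_snd_partial g).
Qed.

Lemma continuous_C2 : continuous g.
Proof. by case: L2 => -[dg _] _ z; apply: differentiable_continuous; exact: dg. Qed.

Variables c0 c1 c2 : R.
Hypotheses (c0_gt0 : 0 < c0) (c1_ge0 : 0 <= c1).
Hypothesis hess_ge : forall x u, loewner_le (c0^-1)%:M (hessian (L x) u).
Hypothesis mixed_le : forall x u, opnorm (mixed_hessian L x u) <= c1 * (1 + enorm u).
Hypothesis growth0 : forall x,
  `|L x 0| + enorm (gradient (L^~ 0) x) + enorm (gradient (L x) 0) <= c2.

Lemma taylor_u x u w : L x u + 'D_w (L x) u + enorm w ^+ 2 / (2 * c0) <= L x (u + w).
Proof.
have -> : enorm w ^+ 2 / (2 * c0) = (enorm w ^+ 2 / c0) / 2 by rewrite -[RHS]mulrA -invfM (mulrC c0).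
apply: taylor2_line => [y|y|y]; [exact: dL_u|exact: ddL_u|].
rewrite hessian_form; [|by move=> z; exact: dL_u|by move=> i z; exact: ddL_u].
have := hess_ge x y w; rewrite mulmxBr mulmxBl mxE [X in _ + X]mxE subr_ge0; apply: le_trans.
rewrite -scalemx1 -scalemxAr mulmx1 -scalemxAl mxE mulrC ler_wpM2l ?invr_ge0 ?(ltW c0_gt0)//.
by rewrite enorm_sqr mxE ler_sum// => i _; rewrite mxE.
Qed.

(** The second-order bound is applied at the midpoint in the directions [w] and [- w]; the
    first-order terms cancel on summation. *)
Lemma L_midpoint x u v : L x (2^-1 *: (u + v)) <= (L x u + L x v) / 2.
Proof.
set z := 2^-1 *: (u + v); set w := 2^-1 *: (u - v).
have zu : z + w = u.
  by apply/colP => i; rewrite !mxE; field.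
have zv : z + (- w) = v.
  by apply/colP => i; rewrite !mxE; field.
have H1 := taylor_u x z w; have H2 := taylor_u x z (- w).
have e : 'D_(- w) (L x) z = - 'D_w (L x) z.
  by rewrite !deriveE ?linearN//; exact: dL_u.
have p (a : 'cV[R]_k) : 0 <= enorm a ^+ 2 / (2 * c0) by rewrite divr_ge0 ?sqr_ge0// mulr_ge0// ltW.
have p1 := p w; have p2 := p (- w).
rewrite zu in H1; rewrite zv e in H2.
move: H1 H2 p1 p2; move: (_ / _) (_ / _) ('D_w _ _) (L x z) (L x u) (L x v) => a b c p1 p2 p3.
by clear zu zv e p; lra.
Qed.

Lemma L_coercive x u : enorm u ^+ 2 / (2 * c0) - c2 * enorm u - c2 <= L x u.
Proof.
have := taylor_u x 0 u; rewrite add0r.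
have := gradient_bound u (dL_u x 0); have := growth0 x.
have g1 := enorm_ge0 (gradient (L^~ 0) x); have g2 := enorm_ge0 (gradient (L x) 0).
have u0 := enorm_ge0 u; have l0 := normr_ge0 (L x 0).
have := ler_norm (- L x 0); rewrite normrN.
have := ler_norm (- 'D_u (L x) 0); rewrite normrN.
move=> h1 h2 h3 h4 h5.
have h6 : enorm u * enorm (gradient (L x) 0) <= enorm u * c2 by rewrite ler_wpM2l//; lra.
rewrite (mulrC c2); lra.
Qed.

(** The difference [D w = L x w - L y w] at [w = 0] is bounded through the gradient in [x]. Going
    from [0] to [u] uses one mean value in [u] and one in [x], where the mixed Hessian appears; its
    growth in [u] makes the Lipschitz constant quadratic in [enorm u], which energy bounds can
    absorb. *)
Lemma L_lipschitz_x x y u :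
  `|L x u - L y u| <= (c2 + c1 * (1 + enorm u) * enorm u) * enorm (x - y).
Proof.
pose D (w : 'cV[R]_k) := L x w - L y w.
have H0 : `|D 0| <= c2 * enorm (x - y).
  have [s _] := @mvt_line _ _ (L^~ 0) y (x - y) (fun z => dL_x z 0).
  rewrite subrKC -/(D 0) => ->; apply: (le_trans (gradient_bound _ _)); first exact: dL_x.
  rewrite mulrC ler_wpM2r ?enorm_ge0//.
  apply: le_trans (growth0 (y + s *: (x - y))).
  by rewrite -addrA addrCA lerDl addr_ge0// enorm_ge0.
have dD w : differentiable D w by apply: differentiableB; exact: dL_u.
have [s /andP[s0 s1]] := @mvt_line _ _ D 0 u dD; rewrite !add0r => H1.
have H2 : 'D_u D (s *: u) = 'D_u (L x) (s *: u) - 'D_u (L y) (s *: u).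
  by rewrite deriveB//; apply: diff_derivable; exact: dL_u.
pose F z := \sum_j u j 0 * 'D_(basis_vec j) (L z) (s *: u).
have FE z : 'D_u (L z) (s *: u) = F z by apply: derive_coord; exact: dL_u.
have dF z : differentiable F z.
  by apply: differentiable_lincomb => j; exact: ddL_x.
have [t _] := @mvt_line _ _ F y (x - y) dF.
rewrite subrKC => H3; rewrite -!FE -H2 -H1 in H3.
set z := y + _ in H3.
have H4 : 'D_(x - y) F z = \sum_i (x - y) i 0 * (mixed_hessian L z (s *: u) *m u) i 0.
  rewrite derive_lincomb => [|j]; last exact: ddL_x.
  under eq_bigr => j _ do (rewrite derive_coord; last exact: ddL_x).
  under [RHS]eq_bigr do rewrite [X in _ * X]mxE mulr_sumr.
  under eq_bigr do rewrite mulr_sumr.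
  rewrite exchange_big; apply: eq_bigr => i _; apply: eq_bigr => j _.
  by rewrite !mxE mulrCA; congr (_ * _); rewrite mulrC.
have H5 : `|D u - D 0| <= c1 * (1 + enorm u) * enorm u * enorm (x - y).
  rewrite H3 H4; apply: (le_trans (bilinear_opnorm _ _ _)).
  rewrite (mulrC (enorm (x - y))) mulrA; do 2 (apply: ler_wpM2r; first exact: enorm_ge0).
  apply: (le_trans (mixed_le _ _)); apply: ler_wpM2l => //.
  by rewrite lerD2l enormZ ger0_norm// ler_piMl// enorm_ge0.
have -> : L x u - L y u = D 0 + (D u - D 0) by rewrite subrKC.
by rewrite (le_trans (ler_normD _ _))// mulrDl lerD.
Qed.

End partials.

(** * Vector-valued integrals *)

(** The intervals of radius [2 * C / 2 ^+ n] around [a n] are nested, and the supremum of their left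
    ends lies in all of them; this gives the rate along with the limit. *)
Lemma geometric_cvg (R : realType) (a : nat -> R) (C : R) : 0 <= C ->
  (forall n, `|a n.+1 - a n| <= C / 2 ^+ n) ->
  exists l, forall n, `|a n - l| <= 2 * C / 2 ^+ n.
Proof.
move=> C0 H; pose b n := a n - 2 * C / 2 ^+ n; pose c n := a n + 2 * C / 2 ^+ n.
have Cn n : 0 <= 2 * C / 2 ^+ n by rewrite divr_ge0 ?mulr_ge0 ?exprn_ge0.
have half n : 2 * C / 2 ^+ n = 2 * C / 2 ^+ n.+1 + C / 2 ^+ n.
  by rewrite exprS; field; rewrite expf_neq0.
have bS n : b n <= b n.+1 by have := H n; rewrite /b half ler_norml; lra.
have cS n : c n.+1 <= c n by have := H n; rewrite /c (half n) ler_norml; lra.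
have bm n m : (n <= m)%N -> b n <= b m.
  by move=> /subnK <-; elim: (m - n)%N => // k IH; apply: le_trans IH _; exact: bS.
have cm n m : (n <= m)%N -> c m <= c n.
  by move=> /subnK <-; elim: (m - n)%N => // k IH; apply: le_trans IH; exact: cS.
have bc n m : b n <= c m.
  apply: (le_trans (bm _ _ (leq_maxl n m))); apply: le_trans (cm _ _ (leq_maxr n m)).
  by have := Cn (maxn n m); rewrite /b /c; lra.
exists (sup (range b)) => n.
have h1 : b n <= sup (range b).
  by apply: ub_le_sup; [exists (c 0%N) => _ [k _ <-]|exists n].
have h2 : sup (range b) <= c n.
  by apply: sup_le_ub; [exists (b 0%N), 0%N|move=> _ [k _ <-]].
by rewrite ler_norml; move: h1 h2; rewrite /b /c; lra.
Qed.

Lemma geometric_small (R : realType) (C e : R) : 0 < e -> exists n : nat, C / 2 ^+ n < e.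
Proof.
move=> e0; exists (Num.truncn (C / e)).+1.
rewrite ltr_pdivrMr ?exprn_gt0// mulrC -ltr_pdivrMr//.
apply: (lt_trans (truncnS_gt _)); rewrite -natrX ltr_nat.
exact: ltn_expl.
Qed.

Section within_segment.
Variables (R : realType) (n : nat) (T : R).
Implicit Types g : R -> 'cV[R]_n.

Lemma within_continuousP g : {within `[0, T], continuous g} <->
  forall t, 0 <= t <= T -> forall e, 0 < e -> exists2 d, 0 < d &
    forall s, 0 <= s <= T -> `|s - t| < d -> enorm (g s - g t) < e.
Proof.
split=> [/subspace_continuousP gc t tT e e0|H].
  have e0' : 0 < e / n.+1%:R by rewrite divr_gt0.
  have tT' : `[0, T]%classic t by rewrite /= in_itv.
  have := gc _ tT' _ (nbhsx_ballx (g t) _ e0').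
  move=> /nbhs_ballP[d /= d0 dH]; exists d => // s sT st.
  apply: enorm_lt_entries => // i; rewrite !mxE.
  have sd : ball t d s by rewrite /ball/= distrC.
  have sI : s \in `[0, T] by rewrite in_itv.
  by have [_ /(_ i 0)] := dH s sd sI; rewrite /ball/= distrC.
apply/subspace_continuousP => t; rewrite /= in_itv/= => tT.
apply: cvg_mx => i j; rewrite ord1; apply/cvgrPdist_lt => e e0.
have [d d0 dH] := H t tT e e0.
apply/nbhs_ballP; exists d => //= s; rewrite /ball/= distrC => st.
rewrite in_itv/= => sT; rewrite distrC; apply: le_lt_trans (dH _ sT st).
by have := entry_le_enorm (g s - g t) i; rewrite !mxE.
Qed.

Lemma within_continuous_coord g i : {within `[0, T], continuous g} ->
  {within `[0, T], continuous (fun t => g t i 0)}.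
Proof.
move=> gc t; apply: (@continuous_comp _ _ _ (g : subspace `[0, T] -> 'cV[R]_n) (fun M : 'cV[R]_n => M i 0)).
  exact: gc.
exact: coord_continuous.
Qed.

Lemma within_continuous_mx g : (forall i, {within `[0, T], continuous (fun t => g t i 0)}) ->
  {within `[0, T], continuous g}.
Proof.
move=> gc; apply/subspace_continuousP => t tT; apply: cvg_mx => i j; rewrite ord1.
by have /subspace_continuousP := gc i; exact.
Qed.

Lemma within_continuous_enorm g : {within `[0, T], continuous g} ->
  {within `[0, T], continuous (fun t => enorm (g t))}.
Proof.
move=> gc t; apply: (@continuous_comp _ _ _ (g : subspace `[0, T] -> 'cV[R]_n) (@enorm R n)).
  exact: gc.
exact: continuous_enorm.
Qed.

Lemma uniform_limit_within (gn : nat -> R -> 'cV[R]_n) g :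
  (forall k, {within `[0, T], continuous (gn k)}) ->
  (forall e, 0 < e -> exists k, forall t, 0 <= t <= T -> enorm (gn k t - g t) < e) ->
  {within `[0, T], continuous g}.
Proof.
move=> gc gu; apply/within_continuousP => t tT e e0.
have e3 : 0 < e / 3 by rewrite divr_gt0.
have [k kH] := gu _ e3.
have /within_continuousP/(_ t tT _ e3)[d d0 dH] := gc k.
exists d => // s sT st.
have := enorm_dist3 (g s) (gn k s) (g t); have := enorm_dist3 (gn k s) (gn k t) (g t).
have := dH s sT st; have := kH _ sT; have := kH _ tT.
have := enormBC (g s) (gn k s); lra.
Qed.

Lemma within_continuous_bounded g : {within `[0, T], continuous g} ->
  exists2 M, 0 <= M & forall t, 0 <= t <= T -> enorm (g t) <= M.
Proof.
move=> gc; have := @segment_compact R 0 T.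
move=> /(continuous_compact (within_continuous_enorm gc))/compact_bounded[M [_ HM]].
exists (`|M| + 1) => [|t tT]; first by rewrite addr_ge0.
have MM : M < `|M| + 1 by rewrite (le_lt_trans (ler_norm _)) ?ltrDl.
have := HM _ MM (enorm (g t)); rewrite /= ger0_norm ?enorm_ge0//; apply.
by exists t => //=; rewrite in_itv.
Qed.

End within_segment.

Section vintegrable.
Variables (R : realType) (T : R).
Local Notation mu := (@lebesgue_measure R).
Local Notation I := (`[0, T]%classic : set R).

Definition vintegrable n (f : R -> 'cV[R]_n) :=
  measurable_fun I f /\ mu.-integrable I (EFin \o (fun t => enorm (f t))).

Lemma measurable_fun_enorm n (f : R -> 'cV[R]_n) (D : set R) :
  measurable_fun D f -> measurable_fun D (fun t => enorm (f t)).
Proof. by move=> mf; apply: (measurableT_comp (@measurable_enorm R n)). Qed.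

Lemma measurable_within n (f : R -> 'cV[R]_n) : {within I, continuous f} -> measurable_fun I f.
Proof.
move=> fc; apply: measurable_fun_mx => // i j; rewrite ord1.
by apply: subspace_continuous_measurable_fun => //; exact: within_continuous_coord.
Qed.

Lemma vintegrable_coord n (f : R -> 'cV[R]_n) i : vintegrable f ->
  mu.-integrable I (EFin \o (fun t => f t i 0)).
Proof.
move=> [mf intf]; apply: le_integrable intf => //.
  by apply/measurable_EFinP; exact: measurable_coord.
by move=> t _ /=; rewrite lee_fin (ger0_norm (enorm_ge0 _)) entry_le_enorm.
Qed.

Lemma vintegrable_within n (f : R -> 'cV[R]_n) : {within I, continuous f} -> vintegrable f.
Proof.
move=> fc; split; first exact: measurable_within.
apply: continuous_compact_integrable; first exact: segment_compact.
exact: within_continuous_enorm.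
Qed.

Lemma vintegrableD n (f g : R -> 'cV[R]_n) : vintegrable f -> vintegrable g ->
  vintegrable (fun t => f t + g t).
Proof.
move=> [mf intf] [mg intg].
have mfg : measurable_fun I (fun t => f t + g t).
  apply: measurable_fun_mx => // i j.
  rewrite (_ : (fun t => _) = (fun t => f t i j) \+ (fun t => g t i j)); last first.
    by apply/funext => t; rewrite mxE.
  by apply: measurable_funD; exact: measurable_coord.
split => //; apply: le_integrable (integrableD _ intf intg) => //.
  by apply/measurable_EFinP; exact: measurable_fun_enorm.
move=> t _ /=; rewrite lee_fin (ger0_norm (enorm_ge0 _)) ger0_norm ?enormD//.
by rewrite addr_ge0 ?enorm_ge0.
Qed.

Lemma vintegrable_mulmx m n (A : 'M[R]_(m, n)) f : vintegrable f ->
  vintegrable (fun t => A *m f t).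
Proof.
move=> [mf intf].
have mAf : measurable_fun I (fun t => A *m f t) by exact: measurable_mulmx.
split => //; have intA : mu.-integrable I (fun x => (mxbound A)%:E * (EFin \o (fun t => enorm (f t))) x)%E.
  exact: integrableZl.
apply: le_integrable intA => //.
  by apply/measurable_EFinP; exact: measurable_fun_enorm.
move=> t _ /=; rewrite lee_fin (ger0_norm (enorm_ge0 _)) ger0_norm ?enorm_mulmx//.
by rewrite mulr_ge0 ?enorm_ge0 ?mxbound_ge0.
Qed.

Lemma Lp_control1P n (f : R -> 'cV[R]_n) : Lp_control T 1 f <-> vintegrable f.
Proof.
split=> [[mf intf]|[mf /integrableP[_ intf]]]; split => //.
  apply/integrableP; split; first by apply/measurable_EFinP; exact: measurable_fun_enorm.
  apply: le_lt_trans intf; rewrite le_eqVlt; apply/orP; left; apply/eqP.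
  by apply: eq_integral => t _; rewrite /= ger0_norm ?enorm_ge0 ?expr1.
apply: le_lt_trans intf; rewrite le_eqVlt; apply/orP; left; apply/eqP.
by apply: eq_integral => t _; rewrite /= ger0_norm ?enorm_ge0 ?expr1.
Qed.

Lemma sub_segment a b : 0 <= a -> b <= T -> `[a, b]%classic `<=` I.
Proof.
move=> a0 bT t /=; rewrite !in_itv/= => /andP[at_ tb].
by rewrite (le_trans a0 at_) (le_trans tb bT).
Qed.

Lemma integrable_segment (f : R -> \bar R) a b : 0 <= a -> b <= T ->
  mu.-integrable I f -> mu.-integrable `[a, b] f.
Proof. by move=> a0 bT; apply: integrableS => //; exact: sub_segment. Qed.

Lemma enorm_vint n (f : R -> 'cV[R]_n) a b : 0 <= a -> b <= T -> vintegrable f ->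
  enorm (\col_i \int[mu]_(s in `[a, b]) f s i 0) <=
    n%:R * \int[mu]_(s in `[a, b]) enorm (f s).
Proof.
move=> a0 bT vf; apply: (le_trans (enorm_le_sum _)).
apply: (@le_trans _ _ (\sum_(i < n) \int[mu]_(s in `[a, b]) enorm (f s))); last first.
  by rewrite sumr_const card_ord mulr_natl.
apply: ler_sum => i _; rewrite mxE.
have intf : mu.-integrable `[a, b] (EFin \o (fun t => f t i 0)).
  by apply: integrable_segment => //; exact: vintegrable_coord.
apply: (le_trans (le_normr_Rintegral _ intf)) => //.
apply: le_Rintegral => //.
- exact: integrable_norm.
- by apply: integrable_segment => //; case: vf.
- by move=> t _; exact: entry_le_enorm.
Qed.

End vintegrable.

Lemma integral_exp_le (R : realType) (l t : R) : 0 < l -> 0 <= t ->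
  \int[lebesgue_measure]_(s in `[0, t]) expR (l * s) <= expR (l * t) / l.
Proof.
move=> l0; rewrite le_eqVlt => /predU1P[<-|t0].
  by rewrite set_itv1 Rintegral_set1 divr_ge0 ?expR_ge0 ?ltW.
have dF s : is_derive (s : R) 1 (fun s => expR (l * s) / l) (expR (l * s)).
  apply: is_derive_eq; rewrite /GRing.scale/= !mulr1; field; exact: lt0r_neq0.
have cE : {within `[0, t], continuous (fun s => expR (l * s))}.
  apply: continuous_subspaceT => s; apply: (@continuous_comp _ _ _ ( *%R l) expR).
    exact: mulrl_continuous.
  exact: continuous_expR.
have cF : continuous (fun s => expR (l * s) / l).
  by move=> s; apply: differentiable_continuous; apply/derivable1_diffP; case: (dF s).
rewrite /Rintegral (@continuous_FTC2 _ _ (fun s => expR (l * s) / l))//.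
- by rewrite -EFinB /= lerBlDr lerDl divr_ge0 ?expR_ge0 ?ltW.
- split=> //=.
  + exact/cvg_at_right_filter/cF.
  + exact/cvg_at_left_filter/cF.
- by move=> s _; rewrite derive1E derive_val.
Qed.

(** * The linear control system *)

Lemma integrable_scale (R : realType) (D : set R) (f : R -> R) (c : R) :
  measurable D -> lebesgue_measure.-integrable D (EFin \o f) ->
  lebesgue_measure.-integrable D (EFin \o (fun x => c * f x)).
Proof.
move=> mD intf; rewrite (_ : _ \o _ = (fun x => c%:E * (EFin \o f) x)%E)//.
exact: integrableZl.
Qed.

Section ode.
Variables (R : realType) (d k : nat) (T : R) (A : 'M[R]_d) (B : 'M[R]_(d, k)).
Local Notation mu := (@lebesgue_measure R).
Local Notation I := (`[0, T]%classic : set R).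
Local Notation vint := (vintegrable T).
Implicit Types (x : 'cV[R]_d) (u : R -> 'cV[R]_k) (g h : R -> 'cV[R]_d).

Definition rhs h u s : 'cV[R]_d := A *m h s + B *m u s.

Definition picard x u h t : 'cV[R]_d := x + \col_i \int[mu]_(s in `[0, t]) rhs h u s i 0.

(** The Lipschitz constant of the drift, with the factor [d] lost in [enorm_vint] and 1 added for
    positivity. In the weighted norm with weight [expR (2 * K * t)] (Bielecki's norm) the Picard map
    contracts by 1/2 on all of [[0, T]], whatever [T] is. *)
Definition gronwall_rate : R := d%:R * mxbound A + 1.
Let K := gronwall_rate.

Lemma gronwall_rate_gt0 : 0 < K.
Proof. by rewrite ltr_wpDl// mulr_ge0// mxbound_ge0. Qed.

Let K2 : 0 < 2 * K. Proof. by rewrite mulr_gt0// gronwall_rate_gt0. Qed.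

Lemma vintegrable_rhs h u : {within I, continuous h} -> vint u -> vint (rhs h u).
Proof.
move=> hc vu; apply: vintegrableD; apply: vintegrable_mulmx => //.
exact: vintegrable_within.
Qed.

Lemma solutionE x u g : solution T A B x u g <->
  {within I, continuous g} /\ forall t, 0 <= t <= T -> g t = picard x u g t.
Proof.
split=> -[gc H]; split => // t.
  by move=> tT; apply/colP => i; rewrite H ?in_itv// !mxE.
by rewrite in_itv /= => tT i; rewrite {1}(H t tT) !mxE.
Qed.

Lemma integrable_expR (l : R) : mu.-integrable I (EFin \o (fun s => expR (l * s))).
Proof.
apply: continuous_compact_integrable; first exact: segment_compact.
apply: continuous_subspaceT => s; apply: (@continuous_comp _ _ _ ( *%R l) expR).
  exact: mulrl_continuous.
exact: continuous_expR.
Qed.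

Lemma integral_le_exp (f : R -> R) c t : 0 <= c -> 0 <= t <= T ->
  mu.-integrable I (EFin \o f) -> (forall s, 0 <= s <= T -> f s <= c * expR (2 * K * s)) ->
  K * (\int[mu]_(s in `[0, t]) f s) <= c / 2 * expR (2 * K * t).
Proof.
move=> c0 /andP[t0 tT] intf fle.
have intE : mu.-integrable `[0, t] (EFin \o (fun s => expR (2 * K * s))).
  by apply: (integrable_segment _ tT) => //; exact: integrable_expR.
have h1 : \int[mu]_(s in `[0, t]) f s <= \int[mu]_(s in `[0, t]) (c * expR (2 * K * s)).
  apply: le_Rintegral => //.
  - exact: (integrable_segment _ tT).
  - exact: integrable_scale.
  - by move=> s /=; rewrite in_itv/= => /andP[s0 st]; apply: fle; rewrite s0 (le_trans st).
have h2 := integral_exp_le K2 t0.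
rewrite RintegralZl// in h1.
have h3 : K * (c * \int[mu]_(s in `[0, t]) expR (2 * K * s)) <= K * (c * (expR (2 * K * t) / (2 * K))).
  by apply: ler_wpM2l; [exact: ltW gronwall_rate_gt0|apply: ler_wpM2l].
have h4 : K * (c * (expR (2 * K * t) / (2 * K))) = c / 2 * expR (2 * K * t).
  by field; exact: lt0r_neq0 gronwall_rate_gt0.
rewrite -h4; apply: le_trans h3.
by apply: ler_wpM2l => //; exact: ltW gronwall_rate_gt0.
Qed.

Lemma picard_continuous x u h : 0 <= T -> {within I, continuous h} -> vint u ->
  {within I, continuous (picard x u h)}.
Proof.
move=> T0 hc vu; apply: within_continuous_mx => i.
rewrite (_ : (fun t => _) = (fun t => x i 0 + \int[mu]_(s in `[0, t]) rhs h u s i 0)); last first.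
  by apply/funext => t; rewrite !mxE.
move=> t; apply: (@continuousD _ _ _ (cst (x i 0) : subspace I -> R)); first exact: cvg_cst.
apply: (@parameterized_integral_continuous R 0 T (fun s => rhs h u s i 0) T0 _ t).
by apply: vintegrable_coord; exact: vintegrable_rhs.
Qed.

Lemma picard_contract x u h h' c : {within I, continuous h} -> {within I, continuous h'} ->
  vint u -> 0 <= c -> (forall s, 0 <= s <= T -> enorm (h s - h' s) <= c * expR (2 * K * s)) ->
  forall t, 0 <= t <= T -> enorm (picard x u h t - picard x u h' t) <= c / 2 * expR (2 * K * t).
Proof.
move=> hc h'c vu c0 H t /andP[t0 tT].
pose f s := A *m h s + (- A) *m h' s.
have vf : vint f.
  by apply: vintegrableD; apply: vintegrable_mulmx; exact: vintegrable_within.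
have -> : picard x u h t - picard x u h' t = \col_i \int[mu]_(s in `[0, t]) f s i 0.
  apply/colP => i; rewrite !mxE opprD addrACA subrr add0r -RintegralB//.
  - apply: eq_Rintegral => s _.
    have -> : rhs h u s i 0 - rhs h' u s i 0 = (rhs h u s - rhs h' u s) i 0.
      by rewrite [in RHS]mxE [X in _ = _ + X]mxE.
    by rewrite /rhs /f opprD addrACA subrr addr0 mulNmx.
  - by apply: (integrable_segment _ tT) => //; apply: vintegrable_coord; exact: vintegrable_rhs.
  - by apply: (integrable_segment _ tT) => //; apply: vintegrable_coord; exact: vintegrable_rhs.
apply: (le_trans (enorm_vint _ tT vf)) => //.
have intf : mu.-integrable I (EFin \o (fun s => enorm (h s - h' s))).
  rewrite (_ : (fun s => _) = fun s => enorm (h s + (- 1%:M) *m h' s)); last first.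
    by apply/funext => s; rewrite mulNmx mul1mx.
  have : vint (fun s => h s + (- 1%:M) *m h' s).
    apply: vintegrableD; first exact: vintegrable_within.
    by apply: vintegrable_mulmx; exact: vintegrable_within.
  by case.
have tI : 0 <= t <= T by rewrite t0.
apply: le_trans (integral_le_exp c0 tI intf H).
apply: (@le_trans _ _ (d%:R * (mxbound A * \int[mu]_(s in `[0, t]) enorm (h s - h' s)))).
  apply: ler_wpM2l => //; rewrite -RintegralZl//; last exact: (integrable_segment _ tT).
  apply: le_Rintegral => //.
  - by apply: (integrable_segment _ tT) => //; case: vf.
  - by apply: integrable_scale => //; exact: (integrable_segment _ tT).
  - by move=> s _; rewrite /f mulNmx -mulmxBr enorm_mulmx.
rewrite mulrA; apply: ler_wpM2r; last by rewrite lerDl.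
by apply: Rintegral_ge0 => s _; exact: enorm_ge0.
Qed.

Lemma solution_exists x u : 0 <= T -> vint u ->
  exists g, solution T A B x u g /\ forall t, t \notin `[0, T] -> g t = 0.
Proof.
move=> T0 vu; pose h n := iter n (picard x u) (fun=> 0).
have hc n : {within I, continuous (h n)}.
  elim: n => [|n IH]; last exact: picard_continuous.
  by apply: continuous_subspaceT => t; exact: cvg_cst.
have [M M0 HM] := within_continuous_bounded (hc 1%N).
have geo n t : 0 <= t <= T -> enorm (h n.+1 t - h n t) <= M / 2 ^+ n * expR (2 * K * t).
  elim: n t => [t tT|n IH t tT].
    rewrite expr0 divr1 subr0; apply: (le_trans (HM t tT)); rewrite ler_peMr//.
    by rewrite -[X in X <= _]expR0 ler_expR mulr_ge0 ?(ltW K2)//; case/andP: tT.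
  have -> : M / 2 ^+ n.+1 = M / 2 ^+ n / 2 by rewrite exprS; field; rewrite expf_neq0.
  apply: (@picard_contract x u (h n.+1) (h n)) => //.
  by rewrite divr_ge0 ?exprn_ge0.
pose C := M * expR (2 * K * T).
have C0 : 0 <= C by rewrite mulr_ge0 ?expR_ge0.
have geoC n t : 0 <= t <= T -> enorm (h n.+1 t - h n t) <= C / 2 ^+ n.
  move=> tT; apply: (le_trans (geo n t tT)); rewrite /C mulrAC ler_pM2r ?invr_gt0 ?exprn_gt0//.
  by apply: ler_wpM2l => //; rewrite ler_expR ler_pM2l//; case/andP: tT.
have lim t : exists l : 'cV[R]_d, 0 <= t <= T -> forall n i, `|h n t i 0 - l i 0| <= 2 * C / 2 ^+ n.
  have [tT|_] := boolP (0 <= t <= T); last by exists 0.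
  have /choice[l lP] : forall i, exists l, forall n, `|h n t i 0 - l| <= 2 * C / 2 ^+ n.
    move=> i; apply: geometric_cvg => // n; apply: le_trans (geoC n t tT).
    by have := entry_le_enorm (h n.+1 t - h n t) i; rewrite !mxE.
  by exists (\col_i l i) => _ n i; rewrite mxE.
have [g0 g0P] := choice lim.
(* The value 0 off [[0, T]] is the normalisation imposed by [Gamma_set]. *)
pose g t := if t \in `[0, T] then g0 t else 0.
have gP n t : 0 <= t <= T -> enorm (h n t - g t) <= d%:R * (2 * C) / 2 ^+ n.
  move=> tT; rewrite /g in_itv /= tT; apply: (le_trans (enorm_le_sum _)).
  apply: (@le_trans _ _ (\sum_(i < d) 2 * C / 2 ^+ n)).
    by apply: ler_sum => i _; rewrite !mxE; exact: g0P.
  by rewrite sumr_const card_ord -[X in X <= _]mulr_natl mulrA.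
have gc : {within I, continuous g}.
  apply: (uniform_limit_within hc) => e e0.
  have [n nP] := geometric_small (d%:R * (2 * C)) e0.
  by exists n => t tT; apply: le_lt_trans nP; exact: gP.
exists g; split; last by move=> t /negbTE tT; rewrite /g tT.
apply/solutionE; split => // t tT.
have D0 : 0 <= d%:R * (2 * C) by rewrite mulr_ge0// mulr_ge0.
pose E := expR (2 * K * T).
suff /eqP : enorm (g t - picard x u g t) = 0 by move=> /eqP/enorm_eq0/eqP; rewrite subr_eq0 => /eqP.
apply/eqP; rewrite eq_le enorm_ge0 andbT; apply/ler_addgt0Pl => e e0.
have [n nP] := geometric_small (d%:R * (2 * C) * (1 + E)) e0.
rewrite addr0; apply: ltW; apply: le_lt_trans nP.
apply: (le_trans (enorm_dist3 _ (h n.+1 t) _)).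
have H1 := gP n.+1 t tT; rewrite enormBC in H1.
have H2 : enorm (h n.+1 t - picard x u g t) <= d%:R * (2 * C) / 2 ^+ n / 2 * expR (2 * K * t).
  apply: picard_contract => //; first by rewrite divr_ge0 ?exprn_ge0.
  move=> s sT; apply: (le_trans (gP n s sT)); rewrite ler_peMr ?divr_ge0 ?exprn_ge0//.
  by rewrite -[X in X <= _]expR0 ler_expR mulr_ge0 ?(ltW K2)//; case/andP: sT.
have H3 : expR (2 * K * t) <= E by rewrite ler_expR ler_pM2l//; case/andP: tT.
have H4 : d%:R * (2 * C) / 2 ^+ n.+1 <= d%:R * (2 * C) / 2 ^+ n.
  by rewrite ler_wpM2l// lef_pV2 ?posrE ?exprn_gt0// exprS ler_peMl ?exprn_ge0 ?ler1n.
have H5 : d%:R * (2 * C) / 2 ^+ n / 2 * expR (2 * K * t) <= d%:R * (2 * C) / 2 ^+ n * E.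
  apply: ler_pM => //; rewrite ?expR_ge0 ?divr_ge0 ?exprn_ge0//.
  by rewrite ler_pdivrMr// ler_peMr ?divr_ge0 ?exprn_ge0 ?ler1n.
have -> : d%:R * (2 * C) * (1 + E) / 2 ^+ n = d%:R * (2 * C) / 2 ^+ n + d%:R * (2 * C) / 2 ^+ n * E by ring.
by apply: lerD; [apply: le_trans H1 H4|apply: le_trans H2 H5].
Qed.

Lemma solution_unique x u g g' : vint u -> solution T A B x u g -> solution T A B x u g' ->
  forall t, 0 <= t <= T -> g t = g' t.
Proof.
move=> vu /solutionE[gc gE] /solutionE[g'c g'E].
have [M M0 HM] := within_continuous_bounded gc.
have [M' M'0 HM'] := within_continuous_bounded g'c.
have geo n t : 0 <= t <= T -> enorm (g t - g' t) <= (M + M') / 2 ^+ n * expR (2 * K * t).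
  elim: n t => [t tT|n IH t tT].
    rewrite expr0 divr1; apply: (@le_trans _ _ (M + M')).
      by apply: (le_trans (enormB _ _)); apply: lerD; [exact: HM|exact: HM'].
    rewrite ler_peMr ?addr_ge0// -[X in X <= _]expR0 ler_expR mulr_ge0 ?(ltW K2)//.
    by case/andP: tT.
  have -> : (M + M') / 2 ^+ n.+1 = (M + M') / 2 ^+ n / 2 by rewrite exprS; field; rewrite expf_neq0.
  rewrite gE// g'E//; apply: picard_contract => //.
  by rewrite divr_ge0 ?addr_ge0 ?exprn_ge0.
move=> t tT; apply/eqP; rewrite -subr_eq0; apply/eqP/enorm_eq0/eqP.
rewrite eq_le enorm_ge0 andbT; apply/ler_addgt0Pl => e e0.
have [n nP] := geometric_small ((M + M') * expR (2 * K * t)) e0.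
rewrite addr0; apply: ltW; apply: le_lt_trans nP; rewrite mulrAC; exact: geo.
Qed.

Lemma integral_rhs_le u g a b : 0 <= a -> b <= T -> vint u -> {within I, continuous g} ->
  enorm (\col_i \int[mu]_(s in `[a, b]) rhs g u s i 0) <=
  d%:R * (mxbound A * \int[mu]_(s in `[a, b]) enorm (g s) +
          mxbound B * \int[mu]_(s in `[a, b]) enorm (u s)).
Proof.
move=> a0 bT vu gc; apply: (le_trans (enorm_vint a0 bT (vintegrable_rhs gc vu))).
apply: ler_wpM2l => //.
have ig : mu.-integrable `[a, b] (EFin \o (fun s => enorm (g s))).
  by apply: (integrable_segment a0 bT); have [] := vintegrable_within gc.
have iu : mu.-integrable `[a, b] (EFin \o (fun s => enorm (u s))).
  by apply: (integrable_segment a0 bT); case: vu.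
have igA : mu.-integrable `[a, b] (EFin \o (fun s => mxbound A * enorm (g s))).
  exact: integrable_scale.
have iuB : mu.-integrable `[a, b] (EFin \o (fun s => mxbound B * enorm (u s))).
  exact: integrable_scale.
rewrite -!RintegralZl// -RintegralD//; apply: le_Rintegral => //.
- by apply: (integrable_segment a0 bT); have [] := vintegrable_rhs gc vu.
- exact: (integrableD _ igA iuB).
- by move=> s _; apply: (le_trans (enormD _ _)); apply: lerD; exact: enorm_mulmx.
Qed.

(** Gronwall's inequality by iteration: some bound [M] exists by continuity, and each pass through
    the equation replaces a weighted bound [y] by [a + y / 2]. The fixed point [2 * a] is
    independent of [M], whose contribution decays like [M / 2 ^+ n]. *)
Lemma solution_bound x u g : vint u -> solution T A B x u g -> forall t, 0 <= t <= T ->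
  enorm (g t) <= 2 * (enorm x + d%:R * mxbound B * \int[mu]_(s in I) enorm (u s))
                   * expR (2 * K * T).
Proof.
move=> vu /solutionE[gc gE].
have [M M0 HM] := within_continuous_bounded gc.
set a := enorm x + _.
have U0 : 0 <= \int[mu]_(s in I) enorm (u s) by apply: Rintegral_ge0 => s _; exact: enorm_ge0.
have a0 : 0 <= a by rewrite addr_ge0 ?enorm_ge0// mulr_ge0// mulr_ge0 ?mxbound_ge0.
have one t : 0 <= t <= T -> 1 <= expR (2 * K * t).
  by move=> /andP[t0 _]; rewrite -[X in X <= _]expR0 ler_expR mulr_ge0 ?(ltW K2).
have geo n t : 0 <= t <= T -> enorm (g t) <= (2 * a + M / 2 ^+ n) * expR (2 * K * t).
  elim: n t => [t tT|n IH t tT].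
    rewrite expr0 divr1 (le_trans (HM t tT))//.
    rewrite (@le_trans _ _ (2 * a + M))// ?lerDr ?mulr_ge0//.
    by rewrite ler_peMr ?one// addr_ge0// mulr_ge0.
  have c0 : 0 <= 2 * a + M / 2 ^+ n by rewrite addr_ge0 ?mulr_ge0 ?divr_ge0 ?exprn_ge0.
  have ig : mu.-integrable I (EFin \o (fun s => enorm (g s))).
    by have [] := vintegrable_within gc.
  have H1 := integral_le_exp c0 tT ig IH.
  have /andP[t0 t1] := tT.
  have H2 := integral_rhs_le (lexx 0) t1 vu gc.
  have -> : (2 * a + M / 2 ^+ n.+1) * expR (2 * K * t) =
     a * expR (2 * K * t) + (2 * a + M / 2 ^+ n) / 2 * expR (2 * K * t).
    by rewrite exprS; field; rewrite expf_neq0.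
  rewrite gE//; apply: (le_trans (enormD _ _)).
  have G0 : 0 <= \int[mu]_(s in `[0, t]) enorm (g s).
    by apply: Rintegral_ge0 => s _; exact: enorm_ge0.
  have H3 : \int[mu]_(s in `[0, t]) enorm (u s) <= \int[mu]_(s in I) enorm (u s).
    rewrite -lee_fin /Rintegral !fineK//; last first.
    - by apply: integrable_fin_num => //; apply: (integrable_segment _ t1) => //; case: vu.
    - by apply: integrable_fin_num => //; case: vu.
    apply: ge0_subset_integral => //.
    - by apply/measurable_EFinP; apply: measurable_fun_enorm; case: vu.
    - by move=> s _; rewrite lee_fin enorm_ge0.
    - exact: sub_segment.
  have H4 : d%:R * (mxbound A * \int[mu]_(s in `[0, t]) enorm (g s)) <=
     K * \int[mu]_(s in `[0, t]) enorm (g s).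
    by rewrite mulrA ler_wpM2r// lerDl.
  have H5 : d%:R * mxbound B * \int[mu]_(s in `[0, t]) enorm (u s) <=
     d%:R * mxbound B * \int[mu]_(s in I) enorm (u s).
    by rewrite ler_wpM2l// mulr_ge0 ?mxbound_ge0.
  have H6 : a <= a * expR (2 * K * t) by rewrite ler_peMr ?one.
  apply: (@le_trans _ _ (a + K * \int[mu]_(s in `[0, t]) enorm (g s))); last exact: lerD.
  rewrite /a -addrA lerD2l (le_trans H2)// mulrDr addrC; apply: lerD => //.
  by rewrite mulrA.
move=> t tT; apply/ler_addgt0Pl => e e0.
have [n nP] := geometric_small (M * expR (2 * K * T)) e0.
have H := geo n t tT.
have HE : expR (2 * K * t) <= expR (2 * K * T) by rewrite ler_expR ler_pM2l//; case/andP: tT.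
apply: (le_trans H).
apply: (@le_trans _ _ ((2 * a + M / 2 ^+ n) * expR (2 * K * T))).
  by rewrite ler_wpM2l// addr_ge0 ?mulr_ge0 ?divr_ge0 ?exprn_ge0.
by rewrite mulrDl [M / _ * _]mulrAC addrC lerD2r ltW.
Qed.

End ode.

(** * Energy of controls *)

(* Integrals of nonmeasurable nonnegative functions are lower integrals, hence
   still monotone. *)
Lemma le_integral_ae d (X : measurableType d) (R : realType)
    (m : {measure set X -> \bar R}) (D : set X) (f h : X -> \bar R) :
  measurable D -> (forall x, D x -> 0 <= f x)%E -> (forall x, D x -> 0 <= h x)%E ->
  {ae m, forall x, D x -> (f x <= h x)%E} ->
  (\int[m]_(x in D) f x <= \int[m]_(x in D) h x)%E.
Proof.
move=> mD f0 h0 [N [mN N0 fhN]].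
rewrite (ge0_integralE _ f0); apply: ge_ereal_sup => _ [/= phi phif <-].
rewrite -integralT_nnsfun.
have mNc : measurable (~` N) by exact: measurableC.
have E : (\int[m]_x (phi x)%:E = \int[m]_x (proj_nnsfun phi mNc x)%:E)%E.
  apply: ae_eq_integral => //.
  - by apply/measurable_EFinP; exact: measurable_funPT.
  - by apply/measurable_EFinP; exact: measurable_funPT.
  exists N; split => // x /= H; apply: contrapT => Nx; apply: H => _.
  by rewrite /proj_nnsfun/= mindicE mem_set// mulr1.
rewrite E integralT_nnsfun (ge0_integralE _ h0).
apply: ereal_sup_ubound; exists (proj_nnsfun phi mNc) => // x.
have := phif x; rewrite /patch/= mindicE.
have h00 : (0 <= (if x \in D then h x else 0))%E by case: ifP => // /set_mem/h0.
have [xN|xN] := boolP (x \in ~` N); last by rewrite mulr0.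
rewrite mulr1; case: ifP => // /set_mem Dx /le_trans; apply.
apply: contrapT => H; move: xN; rewrite inE; apply; apply: fhN => /= /(_ Dx).
exact: H.
Qed.

Lemma le_integral_nonneg d (X : measurableType d) (R : realType)
    (m : {measure set X -> \bar R}) (D : set X) (f h : X -> \bar R) :
  measurable D -> (forall x, D x -> 0 <= f x)%E ->
  (forall x, D x -> f x <= h x)%E ->
  (\int[m]_(x in D) f x <= \int[m]_(x in D) h x)%E.
Proof.
move=> mD f0 fh; apply: le_integral_ae => //.
  by move=> x Dx; rewrite (le_trans (f0 _ Dx))// fh.
by apply: aeW => x; exact: fh.
Qed.

Section energy.
Variables (R : realType) (T : R) (n : nat).
Local Notation mu := (@lebesgue_measure R).
Local Notation I := (`[0, T]%classic : set R).
Implicit Types u v : R -> 'cV[R]_n.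

Definition energy u : \bar R := (\int[mu]_(t in I) (enorm (u t) ^+ 2)%:E)%E.

Lemma Lp_control2P u c : measurable_fun I u -> (energy u <= c%:E)%E -> Lp_control T 2 u.
Proof. by move=> mu_ uc; split => //; apply: le_lt_trans uc _; exact: ltry. Qed.

Lemma integrable_cst_segment (c a b : R) : mu.-integrable `[a, b] (EFin \o cst c).
Proof. by apply: continuous_compact_integrable; [exact: segment_compact|move=> ?; exact: cvg_cst]. Qed.

Lemma integrable_energy u : Lp_control T 2 u ->
  mu.-integrable I (EFin \o (fun t => enorm (u t) ^+ 2)).
Proof.
move=> [mf uc]; apply/integrableP; split.
  by apply/measurable_EFinP; apply: measurable_funX; exact: measurable_fun_enorm.
apply: le_lt_trans uc; rewrite le_eqVlt; apply/orP; left; apply/eqP.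
by apply: eq_integral => t _; rewrite /= ger0_norm// exprn_ge0 ?enorm_ge0.
Qed.

Lemma vintegrable_energy u : Lp_control T 2 u -> vintegrable T u.
Proof.
move=> uc; have [mf _] := uc; split => //.
have H : mu.-integrable I (EFin \o (fun t => 1 + enorm (u t) ^+ 2)).
  exact: (integrableD _ (integrable_cst_segment 1 0 T) (integrable_energy uc)).
apply: le_integrable H => //.
  by apply/measurable_EFinP; exact: measurable_fun_enorm.
move=> t _ /=; rewrite lee_fin (ger0_norm (enorm_ge0 _)) ger0_norm ?addr_ge0 ?exprn_ge0 ?enorm_ge0//.
have := enorm_ge0 (u t); have := sqr_ge0 (enorm (u t) - 1); move: (enorm (u t)) => z; nra.
Qed.

Lemma energy_fine u : Lp_control T 2 u ->
  energy u = (\int[mu]_(t in I) enorm (u t) ^+ 2)%:E.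
Proof.
by move=> uc; rewrite /Rintegral fineK//; apply: integrable_fin_num => //; exact: integrable_energy.
Qed.

(** Integrates the pointwise inequality [enorm (u s) <= e^-1 + e * enorm (u s) ^+ 2]. The free
    parameter [e] balances the length of the interval against the energy and replaces the
    Cauchy-Schwarz inequality for integrals. *)
Lemma integral_enorm_le u c a b e : Lp_control T 2 u -> (energy u <= c%:E)%E ->
  0 <= a -> a <= b -> b <= T -> 0 < e ->
  \int[mu]_(s in `[a, b]) enorm (u s) <= (b - a) / e + e * c.
Proof.
move=> uc ule a0 ab bT e0.
have iu := integrable_segment a0 bT (vintegrable_energy uc).2.
have ie := integrable_segment a0 bT (integrable_energy uc).
have ie' := integrable_scale e _ ie.
have i1 := integrable_cst_segment e^-1 a b.
apply: (@le_trans _ _ (\int[mu]_(s in `[a, b]) (e^-1 + e * enorm (u s) ^+ 2))).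
  apply: le_Rintegral => //; first exact: (integrableD _ i1 (ie' _)).
  move=> s _; rewrite -(ler_pM2l e0) mulrDr divff ?gt_eqF//.
  have := sqr_ge0 (e * enorm (u s) - 1); have := enorm_ge0 (u s); move: (enorm (u s)) => z; nra.
rewrite RintegralD//; last exact: ie'.
rewrite Rintegral_cst// RintegralZl//= lebesgue_measure_itv/= lte_fin.
apply: lerD.
  by case: ltP => // _; rewrite ?mulr0 ?divr_ge0 ?subr_ge0 ?(ltW e0)//= mulrC.
rewrite ler_pM2l// -lee_fin; apply: le_trans ule.
rewrite /Rintegral fineK//; last exact: integrable_fin_num.
apply: ge0_subset_integral => //.
- apply/measurable_EFinP; apply: measurable_funX; apply: measurable_fun_enorm; by case: uc.
- by move=> s _; rewrite lee_fin exprn_ge0 ?enorm_ge0.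
- exact: sub_segment.
Qed.

End energy.

Section curve_regularity.
Variables (R : realType) (d k : nat) (T : R) (A : 'M[R]_d) (B : 'M[R]_(d, k)).
Hypothesis T0 : 0 <= T.
Local Notation mu := (@lebesgue_measure R).
Local Notation I := (`[0, T]%classic : set R).
Local Notation vint := (vintegrable T).
Implicit Types (x : 'cV[R]_d) (u : R -> 'cV[R]_k) (g h : R -> 'cV[R]_d).

Lemma solution_energy_bound c : 0 <= c -> exists2 K, 0 <= K & forall x u g,
  Lp_control T 2 u -> (energy T u <= c%:E)%E -> solution T A B x u g ->
  forall t, 0 <= t <= T -> enorm (g t) <= K * (1 + enorm x).
Proof.
move=> c0; pose E := expR (2 * gronwall_rate A * T).
pose b := d%:R * mxbound B * (T + c).
have b0 : 0 <= b by rewrite mulr_ge0 ?mulr_ge0 ?mxbound_ge0 ?addr_ge0.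
have E0 : 0 <= E by exact: expR_ge0.
exists (2 * (1 + b) * E) => [|x u g uc ule sol t tT].
  by rewrite mulr_ge0// mulr_ge0// addr_ge0.
apply: (le_trans (solution_bound (vintegrable_energy uc) sol tT)).
rewrite -/E -[X in _ <= X]mulrA [E * _]mulrC mulrA ler_wpM2r//.
rewrite -[X in _ <= X]mulrA ler_pM2l//.
have := integral_enorm_le uc ule (lexx 0) T0 (lexx T) ltr01.
rewrite subr0 divr1 mul1r => H.
have H1 : d%:R * mxbound B * \int[mu]_(s in I) enorm (u s) <= b.
  by rewrite /b ler_wpM2l// mulr_ge0 ?mxbound_ge0.
have H2 : 0 <= b * enorm x by rewrite mulr_ge0 ?enorm_ge0.
by rewrite mulrDr mulr1 mulrDl mul1r; lra.
Qed.

Lemma solution_increment x u g s t : vint u -> solution T A B x u g ->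
  0 <= s -> s <= t -> t <= T ->
  g t - g s = \col_i \int[mu]_(r in `[s, t]) rhs A B g u r i 0.
Proof.
move=> vu /solutionE[gc gE] s0 st tT.
apply/colP => i; rewrite gE ?(le_trans s0 st)// gE ?s0 ?(le_trans st)// !mxE.
rewrite opprD addrACA subrr add0r.
have vr := vintegrable_rhs A B gc vu.
have it := integrable_segment (lexx 0) tT (vintegrable_coord i vr).
rewrite (@Rintegral_itvB R _ _ _ s)// Rintegral_itv_obnd_cbnd//.
apply: integrableS it => //= r /=; rewrite !in_itv/= => /andP[sr ->].
by rewrite (le_trans s0)// ltW.
Qed.

(** The parameter [e] is left free on purpose: with [t - s <= r * r] and [e = r] the last factor is
    at most [2 * r], the Hölder modulus of exponent 1/2. The constant depends on [c] only, the
    starting point entering linearly. *)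
Lemma solution_modulus c : 0 <= c -> exists2 K, 0 <= K & forall x u g,
  Lp_control T 2 u -> (energy T u <= c%:E)%E -> solution T A B x u g ->
  forall s t e, 0 <= s -> s <= t -> t <= T -> 0 < e <= 1 ->
  enorm (g t - g s) <= K * (1 + enorm x) * ((t - s) / e + e).
Proof.
move=> c0; have [K K0 KP] := solution_energy_bound c0.
have a0 := mxbound_ge0 A; have b0 := mxbound_ge0 B.
exists (d%:R * (mxbound A * K + mxbound B * (1 + c))).
  by rewrite mulr_ge0// addr_ge0 ?mulr_ge0 ?addr_ge0.
move=> x u g uc ule sol s t e s0 st tT /andP[e0 e1].
have vu := vintegrable_energy uc.
have [gc _] := sol.
rewrite (solution_increment vu sol)//.
apply: (le_trans (integral_rhs_le _ _ s0 tT vu gc)).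
rewrite -!mulrA ler_wpM2l//.
have x0 := enorm_ge0 x.
have ts : 0 <= t - s by rewrite subr_ge0.
have tse : t - s <= (t - s) / e by rewrite ler_pdivlMr// ler_piMr.
have H1 : \int[mu]_(r in `[s, t]) enorm (g r) <= K * (1 + enorm x) * (t - s).
  apply: (@le_trans _ _ (\int[mu]_(r in `[s, t]) (K * (1 + enorm x)))).
    apply: le_Rintegral => //.
    - by apply: (integrable_segment s0 tT); have [] := vintegrable_within gc.
    - exact: (integrable_cst_segment (K * (1 + enorm x))).
    - move=> r /=; rewrite in_itv/= => /andP[sr rt]; apply: (KP _ _ _ uc ule sol).
      by rewrite (le_trans s0 sr) (le_trans rt tT).
  rewrite Rintegral_cst//= lebesgue_measure_itv/= lte_fin; case: ltP => //= _.
  by rewrite mulr0 !mulr_ge0// addr_ge0.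
have H2 := integral_enorm_le uc ule s0 st tT e0.
have H3 : (t - s) / e + e * c <= (1 + c) * ((t - s) / e + e).
  have p1 : 0 <= (t - s) / e by rewrite divr_ge0 // ltW.
  have p2 : 0 <= c * ((t - s) / e) by rewrite mulr_ge0.
  rewrite -subr_ge0 (_ : _ - _ = e + c * ((t - s) / e)); last by ring.
  by rewrite addr_ge0// ltW.
have Q0 : 0 <= (t - s) / e + e by rewrite addr_ge0 ?divr_ge0 // ltW.
rewrite [X in _ <= X]mulrDl; apply: lerD.
  rewrite -[X in _ <= X]mulrA ler_wpM2l//; apply: (le_trans H1).
  rewrite -mulrA ler_wpM2l// ler_wpM2l ?addr_ge0//.
  by rewrite (le_trans tse)// lerDl ltW.
rewrite -[X in _ <= X]mulrA ler_wpM2l//; apply: (le_trans H2); apply: (le_trans H3).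
by rewrite ler_wpM2l ?addr_ge0// ler_peMl// lerDl.
Qed.

(** Lebesgue's differentiation theorem, coordinate by coordinate. The right-hand side is cut off by
    0 outside [[0, T]] to be integrable on the whole line. *)
Lemma solution_derive1 x u g : 0 < T -> vint u -> solution T A B x u g ->
  {ae mu, forall t, 0 < t < T -> is_derive t 1 g (rhs A B g u t)}.
Proof.
move=> Tp vu /solutionE[gc gE].
have vr := vintegrable_rhs A B gc vu.
pose f i := (fun t => rhs A B g u t i 0) \_ I.
have intf i : mu.-integrable I (EFin \o (fun t => rhs A B g u t i 0)) by exact: vintegrable_coord.
have AF := ae_filter_ringOfSetsType mu.
have H i : {ae mu, forall t, 0 < t < T -> is_derive t 1 (fun t => g t i 0) (rhs A B g u t i 0)}.
  have int y : mu.-integrable [set` Interval (BLeft 0) (BRight y)] (EFin \o f i).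
    apply: (@integrableS _ _ _ mu setT) => //.
    rewrite (_ : EFin \o f i = (EFin \o (fun t => rhs A B g u t i 0)) \_ I); last first.
      by apply/funext => t; rewrite /f /= restrict_EFin.
    by apply/(integrable_mkcond _ _).1.
  have loc : locally_integrable setT (f i) by exact: integrable_locally_restrict.
  have := FTC1 int loc; apply: filterS => t Ht /andP[t0 tT].
  have lt0t : (BLeft 0%R < BRight t)%E by exact: t0.
  have [dF F't] := Ht lt0t.
  have ft : f i t = rhs A B g u t i 0.
    by rewrite /f patchE mem_set//= in_itv/= (ltW t0) (ltW tT).
  set F := (fun y : R => _) in dF F't.
  apply: (@near_eq_is_derive _ _ _ (fun y => x i 0 + F y)).
  - near=> s.
    have s0 : 0 < s by near: s; exact: lt_nbhsr.
    have sT : s < T by near: s; exact: lt_nbhsl.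
    rewrite gE ?(ltW s0) ?(ltW sT)// !mxE; congr (_ + _).
    apply: eq_Rintegral => r; rewrite inE/= in_itv/= => /andP[r0 rs].
    by rewrite /f patchE mem_set//= in_itv/= r0 (le_trans rs (ltW sT)).
  - have := @derivableP _ _ _ _ _ _ dF => dF'.
    have -> : rhs A B g u t i 0 = 0 + 'D_1 F t by rewrite add0r -derive1E F't ft.
    exact: (@is_deriveD _ _ _ (cst (x i 0)) F).
have : {ae mu, forall t i, 0 < t < T -> is_derive t 1 (fun t => g t i 0) (rhs A B g u t i 0)}.
  exact: filter_forall.
apply: filterS => t Ht tT.
have C : (fun r : R => r^-1 *: ((g \o shift t) (r *: 1) - g t)) @ 0^' --> rhs A B g u t.
  apply: cvg_mx => i j; rewrite ord1.
  have [D1 D2] := Ht i tT.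
  rewrite -D2 (_ : (fun r => _) = (fun r : R => r^-1 *: (((fun t => g t i 0) \o shift t) (r *: 1) - g t i 0))).
    exact: D1.
  by apply/funext => r; rewrite !mxE.
apply: DeriveDef; first exact/cvgP/C.
by apply: cvg_lim => //; exact: C.
Unshelve. all: by end_near. Qed.
End curve_regularity.

(** * Fatou's lemma and L2 limits *)

Section fatou_bound.
Variables (R : realType).
Local Open Scope ereal_scope.

Lemma limn_einf_le (u : nat -> \bar R) (c : \bar R) :
  (exists N, forall n, (N <= n)%N -> u n <= c) -> limn_einf u <= c.
Proof.
move=> [N H]; rewrite limn_einf_lim; apply: lime_le; first exact: is_cvg_einfs.
apply: nearW => n; apply: (@le_trans _ _ (u (maxn n N))).
  by apply: ereal_inf_lbound; exists (maxn n N) => //=; rewrite leq_maxl.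
by apply: H; rewrite leq_maxr.
Qed.

Lemma le_limn_einf (u : nat -> \bar R) (h : \bar R) : 0 <= h -> (forall n, 0 <= u n) ->
  (forall c : R, c%:E < h -> exists N, forall n, (N <= n)%N -> c%:E <= u n) ->
  h <= limn_einf u.
Proof.
move=> h0 u0 H.
have K (c : R) : c%:E < h -> c%:E <= limn_einf u.
  move=> /H[N HN]; rewrite limn_einf_lim; apply: lime_ge; first exact: is_cvg_einfs.
  near=> n; apply: le_ereal_inf_tmp => _ [m /= nm <-]; apply: HN.
  by apply: leq_trans nm; near: n; exact: nbhs_infty_ge.
have P : 0 <= limn_einf u.
  rewrite limn_einf_lim; apply: lime_ge; first exact: is_cvg_einfs.
  by apply: nearW => n; apply: le_ereal_inf_tmp => _ [m _ <-].
case: h h0 H K => [h||] // h0 _ K.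
- apply/lee_addgt0Pr => e e0; rewrite -leeBlDr// -EFinB; apply: K.
  by rewrite lte_fin ltrBlDr ltrDl.
- rewrite leye_eq; apply/eqP; move: P K; case: (limn_einf u) => [r _ /(_ (r + 1)%R)||] //.
  by rewrite ltry lee_fin => /(_ isT); rewrite gerDl ler10.
Unshelve. all: by end_near. Qed.

Lemma fatou_bound d (X : measurableType d) (m : {measure set X -> \bar R}) (D : set X)
    (f : nat -> X -> \bar R) (h : X -> \bar R) (b : R) :
  measurable D -> (forall n, measurable_fun D (f n)) ->
  (forall n x, D x -> 0 <= f n x) -> (forall x, D x -> 0 <= h x) ->
  {ae m, forall x, D x -> h x <= limn_einf (f^~ x)} ->
  (forall e : R, (0 < e)%R -> exists N, forall n, (N <= n)%N ->
     \int[m]_(x in D) f n x <= (b + e)%:E) ->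
  \int[m]_(x in D) h x <= b%:E.
Proof.
move=> mD mf f0 h0 hle fb.
have P x : D x -> 0 <= limn_einf (f^~ x).
  move=> Dx; rewrite limn_einf_lim; apply: lime_ge; first exact: is_cvg_einfs.
  by apply: nearW => n; apply: le_ereal_inf_tmp => _ [k _ <-]; exact: f0.
apply: (le_trans (le_integral_ae mD h0 P hle)).
apply: (le_trans (fatou m mD mf f0)).
apply/lee_addgt0Pr => e e0; apply: limn_einf_le.
by have [N HN] := fb e e0; exists N => n /HN; rewrite EFinD.
Qed.
End fatou_bound.

Section L2_limit.
Variables (R : realType) (T : R) (n : nat).
Local Notation mu := (@lebesgue_measure R).
Local Notation I := (`[0, T]%classic : set R).
Implicit Types u v : R -> 'cV[R]_n.

Lemma measurable_vB u v : measurable_fun I u -> measurable_fun I v ->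
  measurable_fun I (fun t => u t - v t).
Proof.
move=> mu_ mv; apply: measurable_fun_mx => // i j.
rewrite (_ : (fun t => _) = (fun t => u t i j) \- (fun t => v t i j)); last first.
  by apply/funext => t; rewrite !mxE.
by apply: measurable_funB; exact: measurable_coord.
Qed.

Lemma measurable_sqr_enorm u : measurable_fun I u ->
  measurable_fun I (fun t => (enorm (u t) ^+ 2)%:E).
Proof.
by move=> mu_; apply/measurable_EFinP; apply: measurable_funX; exact: measurable_fun_enorm.
Qed.

(** Riesz-Fischer with an explicit rate, hence without a subsequence. The weight [4 ^+ i] against
    the rate [8^-1 ^+ i] leaves a summable series of integrals, so almost everywhere the weighted
    sum is finite and the increments decay like [2^-i]. *)
Lemma L2_cauchy_limit (p : nat -> R -> 'cV[R]_n) :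
  (forall i, measurable_fun I (p i)) ->
  (forall i j, (i <= j)%N -> (energy T (fun t => (p i t - p j t)%R) <= ((8^-1) ^+ i)%:E)%E) ->
  exists u, [/\ measurable_fun I u,
    {ae mu, forall t, I t -> p i t @[i --> \oo] --> u t} &
    forall i, (energy T (fun t => (p i t - u t)%R) <= ((8^-1) ^+ i)%:E)%E].
Proof.
move=> mp pc.
pose f i t := ((4 ^+ i * enorm (p i t - p i.+1 t) ^+ 2)%:E : \bar R).
have f0 i t : (0 <= f i t)%E by rewrite lee_fin mulr_ge0 ?exprn_ge0 ?enorm_ge0.
have mf i : measurable_fun I (f i).
  apply/measurable_EFinP; apply: measurable_funM; first exact: measurable_cst.
  by apply/measurable_EFinP; apply: measurable_sqr_enorm; exact: measurable_vB.
have intf i : (\int[mu]_(t in I) f i t <= ((2^-1) ^+ i)%:E)%E.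
  rewrite /f; under eq_integral do rewrite EFinM.
  have e0 t : I t -> (0 <= (enorm (p i t - p i.+1 t) ^+ 2)%:E)%E.
    by move=> _; rewrite lee_fin exprn_ge0 ?enorm_ge0.
  have me : measurable_fun I (fun t => (enorm (p i t - p i.+1 t) ^+ 2)%:E).
    by apply: measurable_sqr_enorm; exact: measurable_vB.
  have i0 : 0 <= 4 ^+ i :> R by rewrite exprn_ge0.
  rewrite ge0_integralZl_EFin//.
  apply: (@le_trans _ _ ((4 ^+ i)%:E * ((8^-1) ^+ i)%:E)%E).
    by apply: lee_wpmul2l; [rewrite lee_fin|exact: pc].
  rewrite -EFinM lee_fin -exprMn; have -> : 4 * 8^-1 = 2^-1 :> R by field.
  by [].
pose h t := (\sum_(i <oo) f i t)%E.
have h0 t : (0 <= h t)%E by apply: nneseries_ge0 => i _ _.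
have mh : measurable_fun I h by apply: ge0_emeasurable_sum => // i; exact: mf.
have inth : mu.-integrable I h.
  apply/integrableP; split => //.
  under eq_integral => t _ do rewrite gee0_abs//.
  rewrite /h integral_nneseries//.
  apply: (@le_lt_trans _ _ (\sum_(i <oo) ((2^-1) ^+ i)%:E)%E).
    by apply: lee_nneseries => // i _ _; exact: integral_ge0.
  have := @cvg_geometric_eseries_half R 2 0; rewrite expr0 divr1.
  move=> /cvg_lim H; suff -> : (\sum_(i <oo) ((2^-1 : R) ^+ i)%:E)%E = (2 : R)%:E by rewrite ltry.
  rewrite -H//; congr (limn _); apply/funext => k; apply: eq_bigr => i _.
  by rewrite addn1 natrX exprS invfM mulrA divff// mul1r exprVn.
have [N [mN N0 HN]] : {ae mu, forall t, I t -> h t \is a fin_num}.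
  exact: (integrable_ae _ inth).
have cv t : I t -> ~ N t -> exists l : 'cV[R]_n, p i t @[i --> \oo] --> l.
  move=> It Nt; have /fineK hE : h t \is a fin_num.
    by apply: contrapT => K; apply: Nt; apply: HN => /= /(_ It).
  pose C := Num.sqrt (fine (h t)).
  have C0 : 0 <= C by exact: sqrtr_ge0.
  have step i : enorm (p i t - p i.+1 t) <= C / 2 ^+ i.
    rewrite -(@ler_pXn2r _ 2) ?nnegrE ?enorm_ge0 ?divr_ge0 ?exprn_ge0//.
    have -> : (C / 2 ^+ i) ^+ 2 = fine (h t) / 4 ^+ i.
      rewrite expr_div_n /C sqr_sqrtr ?fine_ge0//; congr (_ / _).
      by rewrite exprAC; congr (_ ^+ _); rewrite -natrX.
    rewrite ler_pdivlMr ?exprn_gt0// mulrC.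
    rewrite -lee_fin hE.
    have := nneseries_lim_ge i.+1 (fun k (_ : (0 <= k)%N) (_ : xpredT k) => f0 k t).
    apply: le_trans.
    rewrite big_mkord big_ord_recr /= /f.
    by rewrite leeDr// sume_ge0// => k _; exact: f0.
  have /choice[l lP] : forall i, exists l, forall j, `|p j t i 0 - l| <= 2 * C / 2 ^+ j.
    move=> i; apply: geometric_cvg => // j; apply: le_trans (step j).
    by rewrite distrC; have := entry_le_enorm (p j t - p j.+1 t) i; rewrite !mxE.
  exists (\col_i l i); apply: cvg_mx => i j; rewrite ord1 mxE.
  apply/cvgrPdist_lt => e e0; have [k kP] := geometric_small (2 * C) e0.
  near=> q; rewrite distrC; apply: (le_lt_trans (lP i q)); apply: le_lt_trans kP.
  rewrite ler_wpM2l ?mulr_ge0// lef_pV2 ?posrE ?exprn_gt0//.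
  rewrite ler_weXn2l ?ler1n//; near: q; exact: nbhs_infty_ge.
have /choice[u0 u0P] : forall t, exists l : 'cV[R]_n, I t -> ~ N t -> p i t @[i --> \oo] --> l.
  move=> t; have [It|It] := pselect (I t); last by exists 0.
  have [Nt|Nt] := pselect (N t); first by exists 0.
  by have [l lP] := cv t It Nt; exists l.
(* Both the limit and the sequence are set to 0 on the null set, so that [u] is an everywhere
   pointwise limit on [[0, T]] and therefore measurable. *)
pose u t : 'cV[R]_n := if t \in N then 0 else u0 t.
pose p' i t : 'cV[R]_n := if t \in N then 0 else p i t.
have p'u t : I t -> p' i t @[i --> \oo] --> u t.
  move=> It; rewrite /p' /u; case: (boolP (t \in N)) => Nt; first exact: cvg_cst.
  by apply: u0P => //; move/mem_set; rewrite (negbTE Nt).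
have mp' i : measurable_fun I (p' i).
  apply: measurable_fun_mx => // a b.
  rewrite (_ : (fun t => _) = (fun t => p i t a b) \* \1_(~` N)); last first.
    apply/funext => t; rewrite /p' /= indicE in_setC.
    by case: (t \in N); rewrite ?mulr0 ?mulr1 ?mxE.
  apply: measurable_funM; first exact: measurable_coord.
  by apply: measurable_indic; exact: measurableC.
have mu_ : measurable_fun I u.
  apply: measurable_fun_mx => // i j.
  apply: (@measurable_fun_cvg _ _ _ I (fun k t => p' k t i j)) => [k|t It].
    exact: measurable_coord.
  by apply: (@cvg_comp _ _ _ (fun k => p' k t) (fun M : 'cV[R]_n => M i j)); [exact: p'u|exact: coord_continuous].
have aeu : {ae mu, forall t, I t -> p i t @[i --> \oo] --> u t}.
  exists N; split => // t /= K; apply: contrapT => Nt; apply: K => It.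
  rewrite /u; case: (boolP (t \in N)) => [/set_mem//|_]; exact: u0P.
exists u; split => // i.
apply: (@fatou_bound _ _ _ mu I (fun j t => (enorm (p i t - p j t)%R ^+ 2)%:E)) => //.
- by move=> j; apply: measurable_sqr_enorm; exact: measurable_vB.
- by move=> j t _; rewrite lee_fin exprn_ge0 ?enorm_ge0.
- by move=> t _; rewrite lee_fin exprn_ge0 ?enorm_ge0.
- have AF := ae_filter_ringOfSetsType mu.
  have := aeu; apply: filterS => t H It.
  suff C : (fun j => (enorm (p i t - p j t)%R ^+ 2)%:E) @ \oo --> (enorm (p i t - u t)%R ^+ 2)%:E.
    by rewrite (cvg_limn_einf_sup C).1.
  apply: cvg_EFin; first exact: nearW.
  apply: (@cvg_comp _ _ _ (fun j => p i t - p j t) (fun v : 'cV[R]_n => enorm v ^+ 2)).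
    by apply: cvgB; [exact: cvg_cst|exact: H].
  apply: (@continuous_comp _ _ _ (@enorm R n) (fun z : R => z ^+ 2)); first exact: continuous_enorm.
  exact: exprn_continuous.
- move=> e e0; exists i => j ij; apply: (le_trans (pc i j ij)).
  by rewrite lee_fin lerDl ltW.
Unshelve. all: by end_near. Qed.
End L2_limit.

(** * Weak compactness by convex combinations *)

(** In the application [a3] and [a2] are the energies of near minimizers at two levels and [a1] that
    of their midpoint; [r3] and [r4] are the infima at these levels, [r5] the supremum of all
    infima, [r1] and [r2] the tolerances. *)
Lemma parallelogram_gap (R : realType) (a1 a2 a3 r1 r2 r3 r4 r5 : R) :
  0 <= r1 -> a3 <= r3 + r1 -> a2 <= r4 + r2 -> r3 <= a1 -> r2 <= r1 -> r4 <= r5 -> r5 - r1 <= r3 ->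
  2^-1 * (a3 + a2) - a1 <= 2 * r1.
Proof. lra. Qed.

Section mazur.
Variables (R : realType) (d k : nat) (T : R) (A : 'M[R]_d) (B : 'M[R]_(d, k)).
Local Notation mu := (@lebesgue_measure R).
Local Notation I := (`[0, T]%classic : set R).
Local Notation vint := (vintegrable T).

(** Midpoints suffice in place of general convex combinations: the parallelogram identity and
    midpoint convexity of the integrands are all that is used. *)
Definition mid n (u v : 'cV[R]_n) : 'cV[R]_n := 2^-1 *: (u + v).

Lemma measurable_mid n (u v : R -> 'cV[R]_n) : measurable_fun I u -> measurable_fun I v ->
  measurable_fun I (fun t => mid (u t) (v t)).
Proof.
move=> mu_ mv; apply: measurable_fun_mx => // i j.
rewrite (_ : (fun t => _) = (fun t => 2^-1 * (u t i j + v t i j))); last first.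
  by apply/funext => t; rewrite !mxE.
apply: measurable_funM; first exact: measurable_cst.
by apply: measurable_funD; exact: measurable_coord.
Qed.

Lemma mid_close n (x y z : 'cV[R]_n) e : enorm (x - z) <= e -> enorm (y - z) <= e ->
  enorm (mid x y - z) <= e.
Proof.
move=> xz yz; have -> : mid x y - z = 2^-1 *: (x - z) + 2^-1 *: (y - z).
  by apply/colP => i; rewrite !mxE; field.
apply: (le_trans (enormD _ _)); rewrite !enormZ ger0_norm ?invr_ge0//; lra.
Qed.

Lemma integral_mid_le n (l : R -> 'cV[R]_n -> R) (u v : R -> 'cV[R]_n) (b : R) :
  (forall t w, I t -> 0 <= l t w) ->
  (forall t w w', I t -> l t (mid w w') <= (l t w + l t w') / 2) ->
  measurable_fun I (fun t => l t (u t)) -> measurable_fun I (fun t => l t (v t)) ->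
  (\int[mu]_(t in I) (l t (u t))%:E <= b%:E)%E ->
  (\int[mu]_(t in I) (l t (v t))%:E <= b%:E)%E ->
  (\int[mu]_(t in I) (l t (mid (u t) (v t)))%:E <= b%:E)%E.
Proof.
move=> l0 lmid mlu mlv ub vb.
apply: (@le_trans _ _ (\int[mu]_(t in I) ((2^-1)%:E * (l t (u t) + l t (v t))%:E))%E).
  apply: le_integral_nonneg => // t It; first by rewrite lee_fin l0.
  by rewrite -EFinM lee_fin mulrC lmid.
rewrite ge0_integralZl_EFin//; last 2 first.
- by move=> t It; rewrite lee_fin addr_ge0 ?l0.
- by apply/measurable_EFinP; exact: measurable_funD.
under eq_integral do rewrite EFinD.
rewrite ge0_integralD//; last 4 first.
- by move=> t It; rewrite lee_fin l0.
- exact/measurable_EFinP.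
- by move=> t It; rewrite lee_fin l0.
- exact/measurable_EFinP.
apply: (@le_trans _ _ ((2^-1)%:E * (b%:E + b%:E))%E).
  by apply: lee_wpmul2l; [rewrite lee_fin invr_ge0|exact: leeD].
by rewrite -EFinD -EFinM lee_fin (_ : 2^-1 * (b + b) = b)//; field.
Qed.

Lemma sqr_enorm_mid n (u v : 'cV[R]_n) :
  enorm (mid u v) ^+ 2 <= (enorm u ^+ 2 + enorm v ^+ 2) / 2.
Proof. by rewrite -enorm_parallelogram lerDl exprn_ge0 ?enorm_ge0. Qed.

Lemma energy_mid_le n (u v : R -> 'cV[R]_n) c : measurable_fun I u -> measurable_fun I v ->
  (energy T u <= c%:E)%E -> (energy T v <= c%:E)%E ->
  (energy T (fun t => mid (u t) (v t)) <= c%:E)%E.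
Proof.
move=> mu_ mv; apply: (@integral_mid_le _ (fun _ w => enorm w ^+ 2)) => //.
- by move=> t w _; rewrite exprn_ge0 ?enorm_ge0.
- by move=> t w w' _; exact: sqr_enorm_mid.
- by apply/measurable_EFinP; exact: measurable_sqr_enorm.
- by apply/measurable_EFinP; exact: measurable_sqr_enorm.
Qed.

Lemma solution_mid x u g x' u' g' : vint u -> vint u' ->
  solution T A B x u g -> solution T A B x' u' g' ->
  solution T A B (mid x x') (fun t => mid (u t) (u' t)) (fun t => mid (g t) (g' t)).
Proof.
move=> vu vu' [gc gE] [g'c g'E]; split.
  apply: within_continuous_mx => i.
  rewrite (_ : (fun t => _) = (fun t => 2^-1 * (g t i 0 + g' t i 0))); last first.
    by apply/funext => t; rewrite !mxE.
  apply/subspace_continuousP => t tT; apply: cvgM; first exact: cvg_cst.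
  by apply: cvgD; [have /subspace_continuousP := @within_continuous_coord _ _ _ g i gc
                  |have /subspace_continuousP := @within_continuous_coord _ _ _ g' i g'c]; exact.
move=> t tT i; have := gE t tT i; have := g'E t tT i.
move: tT; rewrite in_itv/= => /andP[t0 tT].
have vr := vintegrable_rhs A B gc vu; have vr' := vintegrable_rhs A B g'c vu'.
have ir := integrable_segment (lexx 0) tT (vintegrable_coord i vr).
have ir' := integrable_segment (lexx 0) tT (vintegrable_coord i vr').
have ird : mu.-integrable `[0, t] (EFin \o (fun s => rhs A B g u s i 0 + rhs A B g' u' s i 0)).
  exact: (integrableD _ ir ir').
rewrite !mxE => -> ->.
rewrite [X in _ = _ + X](_ : _ = \int[mu]_(s in `[0, t]) (2^-1 * (rhs A B g u s i 0 + rhs A B g' u' s i 0))).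
  rewrite RintegralZl// RintegralD// /rhs; ring.
apply: eq_Rintegral => s _.
have -> : A *m mid (g s) (g' s) + B *m mid (u s) (u' s) = 2^-1 *: (rhs A B g u s + rhs A B g' u' s).
  by rewrite /mid /rhs -!scalemxAr -scalerDr !mulmxDr addrACA.
by rewrite [LHS]mxE; congr (_ * _); rewrite mxE.
Qed.

Lemma solution_limit (x : 'cV[R]_d) (u : R -> 'cV[R]_k) (g : R -> 'cV[R]_d) : 0 <= T -> vint u -> {within I, continuous g} ->
  (forall e, 0 < e -> exists (x' : 'cV[R]_d) (u' : R -> 'cV[R]_k) (g' : R -> 'cV[R]_d), [/\ vint u', solution T A B x' u' g',
    enorm (x' - x) <= e, forall t, 0 <= t <= T -> enorm (g' t - g t) <= e &
    \int[mu]_(t in I) enorm (u' t - u t) <= e]) ->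
  solution T A B x u g.
Proof.
move=> T0 vu gc H; apply/solutionE; split => // t tT.
have a0 := mxbound_ge0 A; have b0 := mxbound_ge0 B.
pose K := 2 + d%:R * (mxbound A * T + mxbound B).
have K0 : 0 < K by rewrite ltr_wpDr// mulr_ge0// addr_ge0// mulr_ge0.
apply/eqP; rewrite -subr_eq0; apply/eqP/enorm_eq0/eqP.
rewrite eq_le enorm_ge0 andbT; apply/ler_addgt0Pl => e e0; rewrite addr0.
have eK : 0 < e / K by rewrite divr_gt0.
have [x' [u' [g' [vu' sol' xx' gg' uu']]]] := H _ eK.
have /solutionE[g'c g'E] := sol'.
have /andP[t0 t1] := tT.
pose w s := u' s - u s; pose f s := g' s - g s.
have fc : {within I, continuous f}.
  by move=> s; apply: (@continuousB _ _ _ (g' : subspace I -> _)); [exact: g'c|exact: gc].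
have vw : vint w.
  rewrite (_ : w = fun s => u' s + (- 1%:M) *m u s); last first.
    by apply/funext => s; rewrite mulNmx mul1mx.
  by apply: vintegrableD => //; exact: vintegrable_mulmx.
have E : picard A B x' u' g' t - picard A B x u g t =
    (x' - x) + \col_i \int[mu]_(s in `[0, t]) rhs A B f w s i 0.
  apply/colP => i; rewrite [LHS]mxE [X in _ + X]mxE !mxE opprD addrACA; congr (_ + _).
  have vr := vintegrable_rhs A B gc vu; have vr' := vintegrable_rhs A B g'c vu'.
  rewrite -RintegralB//.
  - apply: eq_Rintegral => s _.
    have -> : rhs A B g' u' s i 0 - rhs A B g u s i 0 = (rhs A B g' u' s - rhs A B g u s) i 0.
      by rewrite [in RHS]mxE [X in _ = _ + X]mxE.
    by rewrite /rhs /f /w opprD addrACA -!mulmxBr.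
  - exact: (integrable_segment (lexx 0) t1 (vintegrable_coord i vr')).
  - exact: (integrable_segment (lexx 0) t1 (vintegrable_coord i vr)).
have H1 := integral_rhs_le A B (lexx 0) t1 vw fc.
have H2 : \int[mu]_(s in `[0, t]) enorm (f s) <= T * (e / K).
  apply: (@le_trans _ _ (\int[mu]_(s in `[0, t]) (e / K))).
    apply: le_Rintegral => //.
    - by apply: (integrable_segment (lexx 0) t1); have [] := vintegrable_within fc.
    - exact: (integrable_cst_segment (e / K)).
    - by move=> s /=; rewrite in_itv/= => /andP[s0 st]; apply: gg'; rewrite s0 (le_trans st).
  rewrite Rintegral_cst//= lebesgue_measure_itv/= lte_fin mulrC ler_pM2r//.
  by case: ltP => //= _; rewrite subr0.
have H3 : \int[mu]_(s in `[0, t]) enorm (w s) <= e / K.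
  apply: le_trans uu'.
  rewrite -lee_fin /Rintegral !fineK//; last first.
  - by apply: integrable_fin_num => //; apply: (integrable_segment _ t1) => //; case: vw.
  - by apply: integrable_fin_num => //; case: vw.
  apply: ge0_subset_integral => //.
  - by apply/measurable_EFinP; apply: measurable_fun_enorm; case: vw.
  - by move=> s _; rewrite lee_fin enorm_ge0.
  - exact: sub_segment.
rewrite (le_trans (enorm_dist3 _ (g' t) _))//.
have -> : e = e / K + (e / K + d%:R * (mxbound A * (T * (e / K)) + mxbound B * (e / K))).
  by rewrite /K; field; rewrite gt_eqF.
apply: lerD; first by rewrite enormBC; exact: gg'.
rewrite g'E// E (le_trans (enormD _ _))//; apply: lerD => //.
apply: (le_trans H1); rewrite ler_wpM2l//.
by apply: lerD; rewrite ler_wpM2l.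
Qed.

(** * Midpoint hulls of the tails of a sequence of controlled curves *)

Section hull.
Variables (xs : nat -> 'cV[R]_d) (us : nat -> R -> 'cV[R]_k) (gs : nat -> R -> 'cV[R]_d).

(** Starting point, control and curve are combined together, so that by linearity members stay
    solutions ([hull_control]); restricting to indices from [N] on keeps them close to the limit
    ([hull_close]). *)
Inductive hull (N : nat) : 'cV[R]_d -> (R -> 'cV[R]_k) -> (R -> 'cV[R]_d) -> Prop :=
| hull_in n : (N <= n)%N -> hull N (xs n) (us n) (gs n)
| hull_mid x u g x' u' g' : hull N x u g -> hull N x' u' g' ->
    hull N (mid x x') (fun t => mid (u t) (u' t)) (fun t => mid (g t) (g' t)).

Lemma hull_mono N M x u g : (N <= M)%N -> hull M x u g -> hull N x u g.
Proof.
move=> NM; elim=> [n Mn|x1 u1 g1 x2 u2 g2 _ IH1 _ IH2]; last exact: hull_mid.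
by apply: hull_in; exact: leq_trans Mn.
Qed.

Variables (c : R) (x : 'cV[R]_d) (g : R -> 'cV[R]_d).
Hypothesis T0 : 0 <= T.
Hypothesis usc : forall n, measurable_fun I (us n) /\ (energy T (us n) <= c%:E)%E.
Hypothesis sol : forall n, solution T A B (xs n) (us n) (gs n).
Hypothesis lim : forall e, 0 < e -> exists N, forall n, (N <= n)%N ->
  enorm (xs n - x) <= e /\ forall t, 0 <= t <= T -> enorm (gs n t - g t) <= e.

Lemma hull_control N x' u' g' : hull N x' u' g' ->
  [/\ measurable_fun I u', (energy T u' <= c%:E)%E & solution T A B x' u' g'].
Proof.
elim=> [n _|x1 u1 g1 x2 u2 g2 _ [m1 e1 s1] _ [m2 e2 s2]].
  by have [mn en] := usc n; split.
split; [exact: measurable_mid|exact: energy_mid_le|].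
by apply: solution_mid => //; apply: vintegrable_energy; apply: Lp_control2P; eassumption.
Qed.

Lemma hull_close N e x' u' g' :
  (forall n, (N <= n)%N -> enorm (xs n - x) <= e /\
     forall t, 0 <= t <= T -> enorm (gs n t - g t) <= e) ->
  hull N x' u' g' -> enorm (x' - x) <= e /\ forall t, 0 <= t <= T -> enorm (g' t - g t) <= e.
Proof.
move=> H; elim=> [n Nn|x1 u1 g1 x2 u2 g2 _ [c1 d1] _ [c2 d2]]; first exact: H.
by split=> [|t tT]; apply: mid_close => //; [exact: d1|exact: d2].
Qed.

Let values N := [set r : R | exists x' u' g', hull N x' u' g' /\ energy T u' = r%:E].
Let D N := inf (values N).

Let values_lb N : lbound (values N) 0.
Proof.
move=> r [x' [u' [g' [_ er]]]]; rewrite -lee_fin -er; apply: integral_ge0 => t _.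
by rewrite lee_fin exprn_ge0 ?enorm_ge0.
Qed.

Let energy_real N x' u' g' : hull N x' u' g' -> exists2 r, energy T u' = r%:E & values N r.
Proof.
move=> h; have [mu' eu' _] := hull_control h.
by rewrite energy_fine; [eexists; [reflexivity|exists x', u', g'; rewrite energy_fine//]|];
   apply: Lp_control2P eu'.
Qed.

Let values_inf N : has_inf (values N).
Proof.
split; last by exists 0; exact: values_lb.
by have [r _ vr] := energy_real (hull_in (leqnn N)); exists r.
Qed.

Let D_le N x' u' g' : hull N x' u' g' -> ((D N)%:E <= energy T u')%E.
Proof.
move=> h; have [r -> vr] := energy_real h; rewrite lee_fin.
by apply: ge_inf => //; exists 0; exact: values_lb.
Qed.

Let D_mono N M : (N <= M)%N -> D N <= D M.
Proof.
move=> NM; apply: lb_le_inf; first by case: (values_inf M).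
move=> r [x' [u' [g' [h er]]]]; rewrite -lee_fin -er.
by apply: D_le; exact: hull_mono h.
Qed.

Let D_sup : has_sup (range D).
Proof.
split; first by exists (D 0%N), 0%N.
exists c => _ [N _ <-]; rewrite -lee_fin.
by apply: le_trans (D_le (hull_in (leqnn N))) _; exact: (usc N).2.
Qed.

Let near_min e : 0 < e -> exists N0, forall N, (N0 <= N)%N -> exists x' u' g',
  hull N x' u' g' /\ (energy T u' <= (D N + e)%:E)%E /\ sup (range D) - e <= D N.
Proof.
move=> e0; have [_ [N0 _ <-] HN0] := sup_adherent e0 D_sup.
exists N0 => N NN0.
have [r [x' [u' [g' [h er]]]] rlt] := inf_adherent e0 (values_inf N).
exists x', u', g'; split => //; split; first by rewrite er lee_fin ltW.
by apply: (le_trans (ltW HN0)); exact: D_mono.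
Qed.

(** The infimum [D N] of the energy on the hull increases with [N] and is bounded by [c], so it
    stabilises. Two near minimizers at late levels have a midpoint in the larger hull, whose energy
    cannot fall much below theirs; the parallelogram identity then forces them to be close in L2. *)
Lemma mazur_sequence : exists p : nat -> 'cV[R]_d * (R -> 'cV[R]_k) * (R -> 'cV[R]_d),
  (forall j, hull j (p j).1.1 (p j).1.2 (p j).2) /\
  forall i j, (i <= j)%N ->
    (energy T (fun t => ((p i).1.2 t - (p j).1.2 t)%R) <= ((8^-1) ^+ i)%:E)%E.
Proof.
(* Half the difference of two near minimizers has energy at most [2 * e i]; multiplying by 4 for the
   full difference gives exactly [8^-1 ^+ i]. *)
pose e i : R := (8^-1) ^+ i / 8.
have e0 i : 0 < e i by rewrite divr_gt0// exprn_gt0.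
have /choice[M MP] : forall i, exists N0, forall N, (N0 <= N)%N -> exists x' u' g',
  hull N x' u' g' /\ (energy T u' <= (D N + e i)%:E)%E /\ sup (range D) - e i <= D N.
  by move=> i; exact: near_min.
(* Summing makes [N] monotone and at least [M i]; the successor also makes it at least [i]. *)
pose N i := (\sum_(j < i.+1) (M j).+1)%N.
have NM i : (M i <= N i)%N by rewrite /N big_ord_recr /= addnS; apply: leqW; rewrite leq_addl.
have Ni i : (i <= N i)%N.
  elim: i => // i IH; rewrite /N big_ord_recr /= -/(N i) addnS ltnS.
  exact: leq_trans IH (leq_addr _ _).
have Nmono i j : (i <= j)%N -> (N i <= N j)%N.
  move=> /subnK <-; elim: (j - i)%N => // q IH; apply: (leq_trans IH).
  by rewrite /N addSn [X in (_ <= X)%N]big_ord_recr /= leq_addr.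
have /choice[p pP] : forall i, exists p : 'cV[R]_d * (R -> 'cV[R]_k) * (R -> 'cV[R]_d),
  hull (N i) p.1.1 p.1.2 p.2 /\ (energy T p.1.2 <= (D (N i) + e i)%:E)%E /\ sup (range D) - e i <= D (N i).
  by move=> i; have [x' [u' [g' H]]] := MP i (N i) (NM i); exists (x', u', g').
exists p; split => [j|i j ij].
  by have [h _] := pP j; exact: hull_mono h.
have [hi [ei di]] := pP i; have [hj [ej dj]] := pP j.
have hj' := hull_mono (Nmono _ _ ij) hj.
have hm := hull_mid hi hj'.
have dm := D_le hm.
have Dsup q : D (N q) <= sup (range D) by apply: ub_le_sup; [exact: (D_sup.2)|exists (N q)].
have [mi bi _] := hull_control hi; have [mj bj _] := hull_control hj.
have [mm bm _] := hull_control hm.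
have ci := Lp_control2P mi bi; have cj := Lp_control2P mj bj; have cm := Lp_control2P mm bm.
pose u := (p i).1.2; pose v := (p j).1.2.
have eji : e j <= e i.
  by rewrite /e ler_pM2r// ler_wiXn2l// invf_le1 ?ler1n.
have Dij := Dsup j; have Dii := Dsup i.
have half : (energy T (fun t => (2^-1 *: (u t - v t))%R) <= ((8^-1) ^+ i / 4)%:E)%E.
  have intm := integrable_energy cm; have intu := integrable_energy ci.
  have intv := integrable_energy cj.
  have intuv : mu.-integrable I (EFin \o (fun t => enorm (u t) ^+ 2 + enorm (v t) ^+ 2)).
    exact: (integrableD _ intu intv).
  have intuv2 : mu.-integrable I (EFin \o (fun t => 2^-1 * (enorm (u t) ^+ 2 + enorm (v t) ^+ 2))).
    exact: integrable_scale.
  have -> : energy T (fun t => (2^-1 *: (u t - v t))%R) =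
     (\int[mu]_(t in I) (2^-1 * (enorm (u t) ^+ 2 + enorm (v t) ^+ 2) - enorm (mid (u t) (v t)) ^+ 2))%:E.
    rewrite /Rintegral fineK; last first.
      by apply: integrable_fin_num => //; exact: (integrableB _ intuv2 intm).
    apply: eq_integral => t _; congr (_%:E).
    have := enorm_parallelogram (u t) (v t); rewrite -/(mid (u t) (v t)) => P.
    rewrite [_^-1 * _]mulrC -P; ring.
  rewrite RintegralB// RintegralZl// RintegralD// lee_fin.
  move: ei ej dm; rewrite (energy_fine ci) (energy_fine cj) (energy_fine cm) !lee_fin -/u -/v.
  have e8 : (8^-1) ^+ i / 4 = 2 * e i by rewrite /e; field.
  rewrite e8.
  move: (\int[mu]_(_ in _) _) (\int[mu]_(_ in _) _) (\int[mu]_(_ in _) _) => a1 a2 a3.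
  by move=> H1 H2 H3; exact: parallelogram_gap (ltW (e0 i)) H1 H2 H3 eji Dij di.
have -> : energy T (fun t => (u t - v t)%R) = (4%:E * energy T (fun t => (2^-1 *: (u t - v t))%R))%E.
  rewrite /energy -ge0_integralZl_EFin//.
  - apply: eq_integral => t _; rewrite enormZ ger0_norm ?invr_ge0// exprMn -EFinM.
    by congr (_%:E); field.
  - by move=> t _; rewrite lee_fin exprn_ge0 ?enorm_ge0.
  - apply: measurable_sqr_enorm; apply: measurable_fun_mx => // a b.
    rewrite (_ : (fun t => _) = (fun t => 2^-1 * (u t a b - v t a b))); last first.
      by apply/funext => t; rewrite !mxE.
    apply: measurable_funM; first exact: measurable_cst.
    by apply: measurable_funB; exact: measurable_coord.
apply: (@le_trans _ _ (4%:E * ((8^-1) ^+ i / 4)%:E)%E).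
  by apply: lee_wpmul2l half; rewrite lee_fin.
by rewrite -EFinM lee_fin mulrC divfK.
Qed.

End hull.

End mazur.

Lemma cvg_enorm (R : realType) n (S : Type) (F : set_system S) (f : S -> 'cV[R]_n) (x : 'cV[R]_n) :
  Filter F -> (forall e, 0 < e -> \forall s \near F, enorm (f s - x) < e) -> f s @[s --> F] --> x.
Proof.
move=> FF H; apply: cvg_mx => i j; rewrite ord1; apply/cvgrPdist_lt => e e0.
have := H e e0; apply: filterS => s; apply: le_lt_trans.
by rewrite distrC; have := entry_le_enorm (f s - x) i; rewrite !mxE.
Qed.

Lemma near_enorm (R : realType) n (x : 'cV[R]_n) e : 0 < e ->
  \forall y \near x, enorm (y - x) < e.
Proof.
move=> e0; have e0' : 0 < e / n.+1%:R by rewrite divr_gt0.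
have := @nbhsx_ballx _ _ x _ e0'; apply: filterS => y [_ xy].
by rewrite enormBC; apply: enorm_lt_entries => // i; have := xy i 0; rewrite /ball/= !mxE.
Qed.

Lemma continuous_affine (R : realType) m n (a : 'cV[R]_m) (B : 'M[R]_(m, n)) :
  continuous (fun u : 'cV[R]_n => a + B *m u).
Proof.
move=> u; have FF : Filter (nbhs u) by exact: nbhs_filter.
apply: (@cvg_enorm _ _ _ (nbhs u)) => e e0.
have K0 : 0 < mxbound B + 1 by rewrite ltr_wpDl// mxbound_ge0.
have := @near_enorm _ _ u _ (divr_gt0 e0 K0); apply: filterS => v vu.
rewrite opprD addrACA subrr add0r -mulmxBr.
apply: (le_lt_trans (enorm_mulmx _ _)).
apply: (@le_lt_trans _ _ ((mxbound B + 1) * enorm (v - u))).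
  by rewrite ler_wpM2r ?enorm_ge0// lerDl.
by rewrite mulrC -ltr_pdivlMr.
Qed.

Section closure.
Variables (R : realType) (d k : nat) (T : R) (A : 'M[R]_d) (B : 'M[R]_(d, k)).
Hypothesis T0 : 0 <= T.
Local Notation mu := (@lebesgue_measure R).
Local Notation I := (`[0, T]%classic : set R).
Local Notation vint := (vintegrable T).

Lemma hull_integral (us : nat -> R -> 'cV[R]_k) xs gs c (l : R -> 'cV[R]_k -> R) N b x u g :
  (forall n, measurable_fun I (us n) /\ (energy T (us n) <= c%:E)%E) ->
  (forall n, solution T A B (xs n) (us n) (gs n)) ->
  (forall t w, I t -> 0 <= l t w) ->
  (forall t w w', I t -> l t (mid w w') <= (l t w + l t w') / 2) ->
  (forall u, measurable_fun I u -> measurable_fun I (fun t => l t (u t))) ->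
  (forall n, (N <= n)%N -> (\int[mu]_(t in I) (l t (us n t))%:E <= b%:E)%E) ->
  hull xs us gs N x u g -> (\int[mu]_(t in I) (l t (u t))%:E <= b%:E)%E.
Proof.
move=> usc sol l0 lmid ml H h.
suff : (\int[mu]_(t in I) (l t (u t))%:E <= b%:E)%E /\ measurable_fun I u by case.
elim: h => [n Nn|x1 u1 g1 x2 u2 g2 _ [b1 m1] _ [b2 m2]].
  by split; [exact: H|case: (usc n)].
by split; [apply: integral_mid_le => //; exact: ml|exact: measurable_mid].
Qed.

Lemma measure_segment_le : (mu I <= T%:E)%E.
Proof. by rewrite lebesgue_measure_itv/= lte_fin; case: ltP => // _; rewrite oppr0 adde0. Qed.

(* Weak compactness of L2 balls and weak lower semicontinuity of convex
   functionals, without weak topologies: convex combinations of the controls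
   whose energy is almost minimal converge strongly. *)
Lemma mazur_closure (c b : R) (xs : nat -> 'cV[R]_d) (us : nat -> R -> 'cV[R]_k)
    (gs : nat -> R -> 'cV[R]_d) x g (l : R -> 'cV[R]_k -> R) :
  (forall n, measurable_fun I (us n) /\ (energy T (us n) <= c%:E)%E) ->
  (forall n, solution T A B (xs n) (us n) (gs n)) ->
  (forall e, 0 < e -> exists N, forall n, (N <= n)%N ->
    enorm (xs n - x) <= e /\ forall t, 0 <= t <= T -> enorm (gs n t - g t) <= e) ->
  (forall t w, I t -> 0 <= l t w) ->
  (forall t w w', I t -> l t (mid w w') <= (l t w + l t w') / 2) ->
  (forall t, I t -> continuous (l t)) ->
  (forall u, measurable_fun I u -> measurable_fun I (fun t => l t (u t))) ->
  (forall e, 0 < e -> exists N, forall n, (N <= n)%N ->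
    (\int[mu]_(t in I) (l t (us n t))%:E <= (b + e)%:E)%E) ->
  exists u, [/\ measurable_fun I u, (energy T u <= c%:E)%E, solution T A B x u g &
    (\int[mu]_(t in I) (l t (u t))%:E <= b%:E)%E].
Proof.
move=> usc sol lim l0 lmid lc ml lb.
have AF := ae_filter_ringOfSetsType mu.
have [p [ph pc]] := mazur_sequence usc sol.
pose q j := (p j).1.2.
have ctrl j := hull_control usc sol (ph j).
have mq j : measurable_fun I (q j) by have [] := ctrl j.
have [u [mu_ ucv uen]] := L2_cauchy_limit mq pc.
have ue : (energy T u <= c%:E)%E.
  apply: (@fatou_bound _ _ _ mu I (fun j t => (enorm (q j t) ^+ 2)%:E)) => //.
  - by move=> j; exact: measurable_sqr_enorm.
  - by move=> j t _; rewrite lee_fin exprn_ge0 ?enorm_ge0.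
  - by move=> t _; rewrite lee_fin exprn_ge0 ?enorm_ge0.
  - have := ucv; apply: filterS => t H It.
    suff C : (fun j => (enorm (q j t) ^+ 2)%:E) @ \oo --> (enorm (u t) ^+ 2)%:E.
      by rewrite (cvg_limn_einf_sup C).1.
    apply: cvg_EFin; first exact: nearW.
    apply: (@cvg_comp _ _ _ (fun j => q j t) (fun v : 'cV[R]_k => enorm v ^+ 2)); first exact: H.
    apply: (@continuous_comp _ _ _ (@enorm R k) (fun z : R => z ^+ 2)); first exact: continuous_enorm.
    exact: exprn_continuous.
  - move=> e e0; exists 0%N => j _; have [_ ej _] := ctrl j.
    by apply: (le_trans ej); rewrite lee_fin lerDl ltW.
have uc := Lp_control2P mu_ ue.
have gc : {within I, continuous g}.
  apply: (@uniform_limit_within _ _ _ gs) => [n|e e0]; first by case: (sol n).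
  have [N HN] := lim _ (divr_gt0 e0 (ltr0Sn R 1)).
  exists N => t tT; have [_ /(_ t tT)] := HN N (leqnn N).
  by move/le_lt_trans; apply; rewrite ltr_pdivrMr// ltr_pMr// ltr1n.
exists u; split => //.
  apply: solution_limit => //; first exact: vintegrable_energy.
  move=> e e0.
  have [N HN] := lim e e0.
  have [M HM] := @geometric_small R (T + 1) e e0.
  pose j := maxn N M.
  have hj := hull_mono (leq_maxl N M) (ph j).
  have [cx cg] := hull_close HN hj.
  have [mj ej sj] := ctrl j.
  exists (p j).1.1, (q j), (p j).2; split => //.
    by apply: vintegrable_energy; apply: Lp_control2P ej.
  have mw : measurable_fun I (fun t => q j t - u t) by exact: measurable_vB.
  have wen := uen j.
  have wc := Lp_control2P mw wen.
  (* The parameter [2 ^+ j] turns the L2 rate [8^-1 ^+ j] into an L1 bound of order [2^-j]. *)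
  have := integral_enorm_le wc wen (lexx 0) T0 (lexx T) (exprn_gt0 j (ltr0Sn R 1)).
  move=> H; apply: (le_trans H); rewrite subr0.
  apply: le_trans (ltW HM).
  apply: (@le_trans _ _ ((T + 1) / 2 ^+ j)).
    rewrite mulrDl lerD2l div1r.
    have -> : 2 ^+ j * 8^-1 ^+ j = (2 ^+ j)^-1 * (2 ^+ j)^-1 :> R.
      by rewrite -exprMn -!exprVn -exprMn; congr (_ ^+ _); field.
    by rewrite ler_piMl ?invr_ge0 ?exprn_ge0// invf_le1 ?exprn_gt0// exprn_ege1 ?ler1n.
  rewrite ler_wpM2l ?addr_ge0// lef_pV2 ?posrE ?exprn_gt0//.
  by rewrite ler_weXn2l ?ler1n// leq_maxr.
apply: (@fatou_bound _ _ _ mu I (fun j t => (l t (q j t))%:E)) => //.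
- by move=> j; apply/measurable_EFinP; exact: ml.
- by move=> j t It; rewrite lee_fin l0.
- by move=> t It; rewrite lee_fin l0.
- have := ucv; apply: filterS => t H It.
  suff C : (fun j => (l t (q j t))%:E) @ \oo --> (l t (u t))%:E.
    by rewrite (cvg_limn_einf_sup C).1.
  apply: cvg_EFin; first exact: nearW.
  apply: (@cvg_comp _ _ _ (fun j => q j t) (l t)); first exact: H.
  exact: lc.
- move=> e e0; have [N HN] := lb e e0; exists N => j Nj.
  exact: (hull_integral usc sol l0 lmid ml HN (hull_mono Nj (ph j))).
Qed.

Lemma measurable_rhs g u : {within I, continuous g} -> measurable_fun I u ->
  measurable_fun I (rhs A B g u).
Proof.
move=> gc mu_; apply: measurable_fun_mx => // i j.
rewrite (_ : (fun t => _) = (fun t => (A *m g t) i j) \+ (fun t => (B *m u t) i j)); last first.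
  by apply/funext => t; rewrite /rhs [LHS]mxE.
apply: measurable_funD; apply: measurable_coord; apply: measurable_mulmx => //.
exact: measurable_within.
Qed.

(** The speed depends on curve and control together, whereas [mazur_closure] needs one convex
    functional of the control. The limit curve is therefore frozen in the integrand, and uniform
    convergence makes the error small. *)
Lemma speed_lower_semicontinuous (c b : R) (xs : nat -> 'cV[R]_d) (us : nat -> R -> 'cV[R]_k)
    (gs : nat -> R -> 'cV[R]_d) x g :
  (forall n, measurable_fun I (us n) /\ (energy T (us n) <= c%:E)%E) ->
  (forall n, solution T A B (xs n) (us n) (gs n)) ->
  (forall e, 0 < e -> exists N, forall n, (N <= n)%N ->
    enorm (xs n - x) <= e /\ forall t, 0 <= t <= T -> enorm (gs n t - g t) <= e) ->
  (forall n, (energy T (rhs A B (gs n) (us n)) <= b%:E)%E) ->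
  exists u, [/\ measurable_fun I u, (energy T u <= c%:E)%E, solution T A B x u g &
    (energy T (rhs A B g u) <= b%:E)%E].
Proof.
move=> usc sol lim sb.
have gc : {within I, continuous g}.
  apply: (@uniform_limit_within _ _ _ gs) => [n|e e0]; first by case: (sol n).
  have [N HN] := lim _ (divr_gt0 e0 (ltr0Sn R 1)).
  exists N => t tT; have [_ /(_ t tT)] := HN N (leqnn N).
  by move/le_lt_trans; apply; rewrite ltr_pdivrMr// ltr_pMr// ltr1n.
have b0 : 0 <= b.
  rewrite -lee_fin; apply: le_trans (sb 0%N); apply: integral_ge0 => t _.
  by rewrite lee_fin exprn_ge0 ?enorm_ge0.
pose l t (w : 'cV[R]_k) := enorm (A *m g t + B *m w) ^+ 2.
apply: (@mazur_closure c b xs us gs x g l) => //.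
- by move=> t w _; rewrite exprn_ge0 ?enorm_ge0.
- move=> t w w' _; rewrite /l.
  have -> : A *m g t + B *m mid w w' = mid (A *m g t + B *m w) (A *m g t + B *m w').
    apply/colP => i; rewrite /mid -scalemxAr mulmxDr !mxE.
    by field.
  exact: sqr_enorm_mid.
- move=> t _ w; apply: (@continuous_comp _ _ _ (fun w : 'cV[R]_k => A *m g t + B *m w) (fun v : 'cV[R]_d => enorm v ^+ 2)).
    exact: continuous_affine.
  apply: (@continuous_comp _ _ _ (@enorm R d) (fun z : R => z ^+ 2)); first exact: continuous_enorm.
  exact: exprn_continuous.
- by move=> u mu_; apply: measurable_funX; apply: measurable_fun_enorm; exact: measurable_rhs.
move=> e e0.
have m0 := mxbound_ge0 A.
(* Expanding the square with a relative error [h] costs [h * (K - 1)] in total, so [h <= e / K] is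
   enough. *)
pose K := b + 2 * (T * mxbound A ^+ 2) + 1.
have K0 : 0 < K by rewrite ltr_wpDl// addr_ge0// !mulr_ge0// sqr_ge0.
pose h := Num.min 1 (e / K).
have h0 : 0 < h by rewrite lt_min ltr01 divr_gt0.
have h1 : h <= 1 by rewrite ge_min lexx.
have hK : h * K <= e by rewrite -ler_pdivlMr// ge_min lexx orbT.
have [N HN] := lim h h0; exists N => n Nn; have [_ Hg] := HN n Nn.
have [mn en] := usc n; have [gnc _] := sol n.
have mr := measurable_rhs gnc mn.
apply: (@le_trans _ _ (\int[mu]_(t in I) ((1 + h)%:E * (enorm (rhs A B (gs n) (us n) t) ^+ 2)%:E + (2 * h * mxbound A ^+ 2)%:E))%E).
  apply: le_integral_nonneg => // t It; first by rewrite lee_fin exprn_ge0 ?enorm_ge0.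
  rewrite -EFinM -EFinD lee_fin /l.
  have -> : A *m g t + B *m us n t = rhs A B (gs n) (us n) t + A *m (g t - gs n t).
    by rewrite /rhs mulmxBr addrAC addrCA subrr addr0.
  set a := rhs _ _ _ _ t; set z := A *m _.
  have zh : enorm z <= mxbound A * h.
    apply: (le_trans (enorm_mulmx _ _)); rewrite ler_wpM2l// enormBC; apply: Hg.
    by move: It; rewrite /= in_itv.
  have z0 := enorm_ge0 z; have a0 := enorm_ge0 a.
  apply: (@le_trans _ _ ((enorm a + enorm z) ^+ 2)).
    by rewrite ler_pXn2r ?nnegrE ?addr_ge0 ?enorm_ge0// enormD.
  have z2 : enorm z ^+ 2 <= (mxbound A * h) ^+ 2.
    by rewrite ler_pXn2r ?nnegrE ?mulr_ge0// ltW.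
  have az : 2 * (enorm a * enorm z) <= h * enorm a ^+ 2 + h * mxbound A ^+ 2.
    have P := sqr_ge0 (enorm a - mxbound A).
    have Q : enorm a * enorm z <= enorm a * (mxbound A * h) by rewrite ler_wpM2l.
    have S : 0 <= h * (enorm a - mxbound A) ^+ 2 by rewrite mulr_ge0// ltW.
    have -> : h * enorm a ^+ 2 + h * mxbound A ^+ 2 = h * (enorm a - mxbound A) ^+ 2 + 2 * (enorm a * (mxbound A * h)) by ring.
    by apply: ler_wpDl => //; rewrite ler_pM2l.
  have hh : (mxbound A * h) ^+ 2 <= h * mxbound A ^+ 2.
    by rewrite exprMn mulrC ler_wpM2r ?sqr_ge0// expr2 ler_piMl// ltW.
  have -> : (enorm a + enorm z) ^+ 2 = enorm a ^+ 2 + 2 * (enorm a * enorm z) + enorm z ^+ 2 by ring.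
  have -> : (1 + h) * enorm a ^+ 2 + 2 * h * mxbound A ^+ 2 = enorm a ^+ 2 + (h * enorm a ^+ 2 + h * mxbound A ^+ 2) + h * mxbound A ^+ 2 by ring.
  by apply: lerD; [rewrite lerD2l|exact: le_trans hh].
have c0 : 0 <= 2 * h * mxbound A ^+ 2 by rewrite !mulr_ge0 ?sqr_ge0// ltW.
have h10 : 0 <= 1 + h by rewrite addr_ge0// ltW.
rewrite ge0_integralD//; last 2 first.
- by move=> t _; rewrite mule_ge0 ?lee_fin// exprn_ge0 ?enorm_ge0.
- by apply: measurable_funeM; exact: measurable_sqr_enorm.
rewrite ge0_integralZl_EFin//; last 2 first.
- by move=> t _; rewrite lee_fin exprn_ge0 ?enorm_ge0.
- exact: measurable_sqr_enorm.
rewrite (integral_cst mu _ (2 * h * mxbound A ^+ 2)%:E) ?lebesgue_measure_itv/= ?lte_fin; last by [].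
apply: (@le_trans _ _ ((1 + h)%:E * b%:E + (2 * h * mxbound A ^+ 2)%:E * T%:E)%E).
  apply: leeD; first by apply: lee_wpmul2l; [rewrite lee_fin|exact: sb].
  apply: lee_wpmul2l; first by rewrite lee_fin.
  exact: measure_segment_le.
rewrite -!EFinM -EFinD lee_fin.
have -> : (1 + h) * b + 2 * h * mxbound A ^+ 2 * T = b + h * (K - 1) by rewrite /K; ring.
rewrite lerD2l; apply: le_trans hK; rewrite ler_pM2l// gerBl//.
Qed.

End closure.

(** * Minimizers and their energy *)

(** Positive and negative parts are compared as lower integrals, so measurability does not enter.
    [minimizer_energy] relies on this: it knows the time marginals only to have finite first
    moments, with no regularity in time. *)
Lemma le_integral_all d (X : measurableType d) (R : realType)
    (m : {measure set X -> \bar R}) (D : set X) (f h : X -> \bar R) :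
  measurable D -> (forall x, D x -> f x <= h x)%E ->
  (\int[m]_(x in D) f x <= \int[m]_(x in D) h x)%E.
Proof.
move=> mD fh; rewrite [leLHS]integralE [leRHS]integralE; apply: leeB.
  apply: le_integral_nonneg => // x Dx.
  rewrite !funeposE.
  by rewrite ge_max !le_max lexx fh// orbT.
apply: le_integral_nonneg => // x Dx.
rewrite !funenegE.
by rewrite ge_max !le_max lexx leeN2 fh// orbT.
Qed.

Lemma integral_shift d (X : measurableType d) (R : realType)
    (m : {measure set X -> \bar R}) (D : set X) (f : X -> R) (c : R) :
  measurable D -> (m D < +oo)%E -> measurable_fun D f -> 0 <= c ->
  (forall x, D x -> 0 <= f x + c) ->
  (\int[m]_(x in D) (f x + c)%:E = \int[m]_(x in D) (f x)%:E + c%:E * m D)%E.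
Proof.
move=> mD mDoo mf c0 fc.
have mfE : measurable_fun D (EFin \o f) by exact/measurable_EFinP.
pose q := ((EFin \o f)^\-)%E; pose p := ((EFin \o f)^\+)%E.
have qc x : D x -> (q x <= c%:E)%E.
  by move=> Dx; rewrite /q funenegE /= ge_max !lee_fin c0 andbT lerNl -subr_ge0 opprK fc.
have iq : (\int[m]_(x in D) q x \is a fin_num)%E.
  rewrite ge0_fin_numE; last by apply: integral_ge0 => x _; exact: funeneg_ge0.
  apply: (@le_lt_trans _ _ (\int[m]_(x in D) (cst c%:E x))%E).
    by apply: le_integral_nonneg => // x _; exact: funeneg_ge0.
  by rewrite integral_cst// lte_mul_pinfty.
have E : (\int[m]_(x in D) (f x + c)%:E + \int[m]_(x in D) q x =
    \int[m]_(x in D) p x + c%:E * m D)%E.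
  rewrite -(integral_cst m mD) -!ge0_integralD//.
  - apply: eq_integral => x _; rewrite /q /p funeposE funenegE.
    have -> : maxe ((EFin \o f) x) 0 = (Num.max (f x) 0)%:E by rewrite EFin_max.
    have -> : maxe (- (EFin \o f) x)%E 0 = (Num.max (- f x) 0)%:E by rewrite EFin_max.
    rewrite /cst -!EFinD; congr EFin.
    by case: (leP (f x) 0) => fx; case: (leP (- f x) 0) => fx'; lra.
  - by move=> x _; exact: funepos_ge0.
  - exact: measurable_funepos.
  - by apply/measurable_EFinP; apply: measurable_funD.
  - by move=> x _; exact: funeneg_ge0.
  - exact: measurable_funeneg.
rewrite [X in (_ = X + _)%E]integralE -[LHS](addeK _ iq) E.
by rewrite addeAC.
Qed.

(** The way to bound integrals of the speed, which as a function of the curve is not known to be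
    measurable: it is enough to test simple functions below it. *)
Lemma le_lower_integral d (X : measurableType d) (R : realType)
    (m : {measure set X -> \bar R}) (f : X -> \bar R) (b : \bar R) :
  (forall x, 0 <= f x)%E ->
  (forall h : {nnsfun X >-> R}, (forall x, (h x)%:E <= f x)%E ->
     (\int[m]_x (h x)%:E <= b)%E) ->
  (\int[m]_x f x <= b)%E.
Proof.
move=> f0 H; rewrite ge0_integralTE//; apply: ge_ereal_sup => _ [h hf <-].
by rewrite -integralT_nnsfun; exact: H.
Qed.

Section gamma.
Variables (R : realType) (d k : nat) (T : R) (A : 'M[R]_d) (B : 'M[R]_(d, k)).
Hypothesis T0 : 0 < T.
Local Notation mu := (@lebesgue_measure R).
Local Notation I := (`[0, T]%classic : set R).
Local Notation vint := (vintegrable T).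
Local Notation Gam := (Gamma T A B).
Implicit Types (x : 'cV[R]_d) (u : R -> 'cV[R]_k) (g h : Gam).

Lemma Gamma_intro x u (f : R -> 'cV[R]_d) : vint u -> solution T A B x u f ->
  exists2 g : Gam, solution T A B x u g & forall t, 0 <= t <= T -> g t = f t.
Proof.
move=> vu sf; have [fc _] := sf.
pose f' t := if t \in `[0, T] then f t else 0.
have ff' t : 0 <= t <= T -> f' t = f t by move=> tT; rewrite /f' in_itv /= tT.
have s' : solution T A B x u f'.
  apply/solutionE; split.
    apply/within_continuousP => t tT e e0; have /within_continuousP := fc.
    move=> /(_ t tT e e0)[dl dl0 H]; exists dl => // s sT st.
    by rewrite !ff'//; exact: H.
  move=> t tT; rewrite ff'//.
  have [_ ->//] := (solutionE T A B x u f).1 sf.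
  rewrite /picard; congr (_ + _); apply/colP => i; rewrite !mxE; apply: eq_Rintegral => s.
  rewrite inE /= in_itv /= => /andP[s0 st]; rewrite /rhs ff'// s0 (le_trans st)//.
  by case/andP: tT.
have G' : @Gamma_set R d k T A B f'.
  split; last by move=> t /negbTE tT; rewrite /f' tT.
  by exists x, u; split => //; apply/Lp_control1P.
exists (exist _ f' (mem_set G') : Gam) => //.
Qed.

Lemma trajectoryP x u : vint u -> solution T A B x u (trajectory T A B x u).
Proof.
move=> vu; have [f [sf _]] := @solution_exists _ _ _ T A B x u (ltW T0) vu.
have [g sg _] := Gamma_intro vu sf.
by apply: (@getPex _ [set g : Gam | solution T A B x u g]); exists g.
Qed.

Lemma Gamma_ext g h : (forall t, 0 <= t <= T -> g t = h t) -> g = h.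
Proof.
move=> gh; apply: val_inj; apply/funext => t.
have [tT|tT] := boolP (t \in `[0, T]); first exact: gh.
have [_ /(_ t tT) g0] := set_valP g; have [_ /(_ t tT) h0] := set_valP h.
by move: g0 h0; rewrite /set_val /= => -> ->.
Qed.

Lemma trajectory_eq x u g : vint u -> solution T A B x u g -> g = trajectory T A B x u.
Proof.
by move=> vu sg; apply: Gamma_ext; apply: (solution_unique vu sg (trajectoryP x vu)).
Qed.

Lemma Gamma_solution g : exists2 u, vint u & solution T A B (g 0) u g.
Proof.
have [[x [u [/Lp_control1P vu sg]]] _] := set_valP g; exists u => //.
suff -> : g 0 = x by [].
apply/colP => i; have [_ /(_ 0)->] := sg; last by rewrite in_itv /= lexx ltW.
by rewrite set_itv1 Rintegral_set1 addr0.
Qed.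

Lemma solution_at0 x u g : vint u -> solution T A B x u g -> g 0 = x.
Proof.
move=> vu [_ /(_ 0) H]; apply/colP => i; rewrite H ?in_itv /= ?lexx ?ltW//.
by rewrite set_itv1 Rintegral_set1 addr0.
Qed.

(** The control is existentially quantified because a curve does not determine it when [B] has a
    kernel. *)
Definition energy_class (c : R) : set Gam :=
  [set g | exists u, [/\ measurable_fun I u, (energy T u <= c%:E)%E & solution T A B (g 0) u g]].

End gamma.

(** The derivative-free interface to the Lagrangian for the rest of the proof. The shift [c3] makes
    [L + c3] nonnegative and quadratically coercive. *)
Record tame (R : realType) (d k : nat) (L : 'cV[R]_d -> 'cV[R]_k -> probability 'cV[R]_d R -> R)
    (c0 c1 c2 c3 lam : R) : Prop := Tame {
  tame_c0 : 0 < c0; tame_c1 : 0 <= c1; tame_c2 : 0 <= c2; tame_c3 : 0 <= c3; tame_lam : 0 <= lam;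
  tame_coercive : forall x u m, Pspace 1 m -> enorm u ^+ 2 / (4 * c0) <= L x u m + c3;
  tame_at0 : forall x m, Pspace 1 m -> L x 0 m <= c2;
  tame_lipschitz : forall x y u m, Pspace 1 m ->
    `|L x u m - L y u m| <= (c2 + c1 * (1 + enorm u) * enorm u) * enorm (x - y);
  tame_midpoint : forall x u v m, Pspace 1 m -> L x (mid u v) m <= (L x u m + L x v m) / 2;
  tame_continuous : forall x m, Pspace 1 m -> continuous (fun u => L x u m);
  tame_d1 : forall x u m m', Pspace 1 m -> Pspace 1 m' ->
    (`|L x u m - L x u m'|%:E <= lam%:E * d1 m m')%E }.

(** The difference of the two sides is the square [(u - 2 * c0 * c2) ^+ 2 / (4 * c0)]: half of the
    coercivity is spent on the linear term. *)
Lemma coercive_square (R : realFieldType) (c0 c2 u : R) : 0 < c0 ->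
  u ^+ 2 / (4 * c0) <= u ^+ 2 / (2 * c0) - c2 * u - c2 + (c2 + c0 * c2 ^+ 2).
Proof.
move=> c00; rewrite -subr_ge0.
have -> : u ^+ 2 / (2 * c0) - c2 * u - c2 + (c2 + c0 * c2 ^+ 2) - u ^+ 2 / (4 * c0) =
  (u - 2 * c0 * c2) ^+ 2 / (4 * c0) by field; rewrite gt_eqF.
by rewrite divr_ge0 ?sqr_ge0// mulr_ge0// ltW.
Qed.

Lemma tameP (R : realType) (d k : nat) (L : 'cV[R]_d -> 'cV[R]_k -> probability 'cV[R]_d R -> R) :
  running_cost_regular L -> running_cost_growth L ->
  exists c0 c1 c2 c3 lam, tame L c0 c1 c2 c3 lam.
Proof.
move=> [L2 [lam lam0 HL]] [c0 [c1 [c2 [c00 c10 c20 H]]]].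
have h1 m : Pspace 1 m -> forall x u, loewner_le (c0^-1)%:M (hessian (fun w => L x w m) u).
  by move=> Pm x u; have [] := H x u m Pm.
have h2 m : Pspace 1 m -> forall x u,
    opnorm (mixed_hessian (fun y w => L y w m) x u) <= c1 * (1 + enorm u).
  by move=> Pm x u; have [] := H x u m Pm.
have h3 m : Pspace 1 m -> forall x,
    `|L x 0 m| + enorm (gradient (fun y => L y 0 m) x) + enorm (gradient (fun w => L x w m) 0) <= c2.
  by move=> Pm x; have [] := H x 0 m Pm.
exists c0, c1, c2, (c2 + c0 * c2 ^+ 2), lam; split => //.
- by rewrite addr_ge0// mulr_ge0 ?sqr_ge0// ltW.
- move=> x u m Pm; apply: (le_trans (coercive_square c2 (enorm u) c00)).
  by rewrite lerD2r; apply: (L_coercive (L2 m Pm) c00 (h1 m Pm) (h3 m Pm)).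
- move=> x m Pm; apply: le_trans (h3 m Pm x); apply: (le_trans (ler_norm _)).
  by rewrite -addrA lerDl addr_ge0 ?enorm_ge0.
- by move=> x y u m Pm; exact: (L_lipschitz_x (L2 m Pm) c10 (h2 m Pm) (h3 m Pm)).
- by move=> x u v m Pm; exact: (L_midpoint (L2 m Pm) c00 (h1 m Pm)).
- move=> x m Pm u; apply: (@continuous_comp _ _ _ (fun u => (x, u)) (fun z : 'cV[R]_d * 'cV[R]_k => L z.1 z.2 m)).
    move=> U [[P Q] /= [Px Qu] PQ]; rewrite /nbhs /=; apply: filterS Qu => v Qv.
    by apply: PQ; split => //; exact: nbhs_singleton Px.
  exact: (@continuous_C2 _ _ _ (fun x u => L x u m) (L2 m Pm) (x, u)).
Qed.

Section minimizers.
Variables (R : realType) (d k : nat) (T : R) (A : 'M[R]_d) (B : 'M[R]_(d, k)).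
Hypothesis T0 : 0 < T.
Local Notation mu := (@lebesgue_measure R).
Local Notation I := (`[0, T]%classic : set R).
Variables (L : 'cV[R]_d -> 'cV[R]_k -> probability 'cV[R]_d R -> R)
  (G : 'cV[R]_d -> probability 'cV[R]_d R -> R).
Variables (c0 c1 c2 c3 lam M : R).
Hypothesis Lt : tame L c0 c1 c2 c3 lam.
Hypothesis GM : forall x m, Pspace 1 m -> `|G x m| <= M.

Lemma measure_segment : mu I = T%:E.
Proof. by rewrite lebesgue_measure_itv/= lte_fin T0 oppr0 adde0. Qed.

Lemma integral_cst_segment c : (\int[mu]_(t in I) (cst c%:E t) = (c * T)%:E)%E.
Proof.
by rewrite integral_cst// EFinM; congr (_ * _)%E; exact: measure_segment.
Qed.

(** From comparing a minimizer with the zero control, whose running cost is at most [c2 * T]; the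
    terminal costs differ by at most [2 * M], and [c3 * T], [4 * c0] come from coercivity. It
    depends neither on the starting point nor on the measure. *)
Definition energy_bound : R := 4 * c0 * (c2 * T + 2 * M + c3 * T).

Lemma Lp_control2_0 : Lp_control T 2 (fun=> 0 : 'cV[R]_k).
Proof.
split; first exact: measurable_cst.
rewrite (eq_integral (cst 0%E)) ?integral0 ?ltry// => t _.
by rewrite enorm0 expr0n.
Qed.

Lemma minimizer_energy (eta : probability (Gamma T A B) R) x u :
  (forall t, 0 <= t <= T -> Pspace 1 (time_marginal t eta)) ->
  minimizer L G eta x u -> (energy T u <= energy_bound%:E)%E.
Proof.
move=> Pm [uc /(_ _ Lp_control2_0)]; rewrite /cost.
set X := (\int[mu]_(t in I) _)%E; set Y := (\int[mu]_(t in I) _)%E => H.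
have mI : measurable I by [].
have tT t : I t -> 0 <= t <= T by rewrite /= in_itv.
have TT : 0 <= T <= T by rewrite lexx ltW.
have Y2 : (Y <= (c2 * T)%:E)%E.
  apply: (@le_trans _ _ (\int[mu]_(t in I) (cst c2%:E t))%E).
    apply: le_integral_all => // t /tT It.
    by rewrite lee_fin; apply: (tame_at0 Lt); exact: Pm.
  by rewrite integral_cst_segment.
pose g t := enorm (u t) ^+ 2 / (4 * c0) - c3.
have c00 := tame_c0 Lt; have c30 := tame_c3 Lt.
have ie := integrable_energy uc.
have c40 : 0 <= (4 * c0)^-1 by rewrite invr_ge0 mulr_ge0 ?ltW.
have gX : (\int[mu]_(t in I) (g t)%:E <= X)%E.
  apply: le_integral_all => // t /tT It; rewrite lee_fin lerBlDr.
  by apply: (tame_coercive Lt); exact: Pm.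
have gE : (\int[mu]_(t in I) (g t + c3)%:E = \int[mu]_(t in I) (g t)%:E + c3%:E * mu I)%E.
  apply: integral_shift => //.
  - by have := ltry T; rewrite -measure_segment.
  - apply: measurable_funB; last exact: measurable_cst.
    apply: measurable_funM; last exact: measurable_cst.
    by apply: measurable_funX; apply: measurable_fun_enorm; case: uc.
  - by move=> t _; rewrite /g subrK mulr_ge0// exprn_ge0 ?enorm_ge0.
have gI : (\int[mu]_(t in I) (g t + c3)%:E = (4 * c0)^-1%:E * energy T u)%E.
  rewrite -ge0_integralZl_EFin//.
  - by apply: eq_integral => t _; rewrite /g subrK -EFinM mulrC.
  - by move=> t _; rewrite lee_fin exprn_ge0 ?enorm_ge0.
  - by apply: measurable_sqr_enorm; case: uc.
have eE := energy_fine uc; set e := (\int[mu]_(t in I) _) in eE.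
have G1 := GM (trajectory T A B x u T) (Pm T TT).
have G2 := GM (trajectory T A B x (fun=> 0) T) (Pm T TT).
move: gE; rewrite gI measure_segment eE -!EFinM => gE.
move: gX; rewrite -(@leeD2rE _ (c3 * T)%:E)// -gE => gX.
set G1' := G (trajectory T A B x u T) (time_marginal T eta) in H G1.
set G2' := G (trajectory T A B x (fun=> 0) T) (time_marginal T eta) in H G2.
have : (((4 * c0)^-1 * e)%:E <= (c2 * T + 2 * M + c3 * T)%:E)%E.
  apply: (le_trans gX); rewrite EFinD; apply: leeD2r.
  have -> : X = (X + G1'%:E - G1'%:E)%E by rewrite addeK.
  apply: (@le_trans _ _ ((c2 * T)%:E + G2'%:E - G1'%:E)%E).
    by apply: leeD2r; apply: (le_trans H); apply: leeD2r.
  rewrite -!EFinD lee_fin -addrA lerD2l.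
  rewrite (_ : 2 * M = M + M); last by ring.
  by apply: lerD; [exact: le_trans (ler_norm _) G2|apply: le_trans G1; rewrite -normrN ler_norm].
by rewrite !lee_fin /energy_bound -ler_pdivrMl ?mulr_gt0.
Qed.

Lemma energy_bound_ge0 : 0 <= M -> 0 <= energy_bound.
Proof.
move=> M0; rewrite /energy_bound mulr_ge0 ?mulr_ge0 ?(ltW (tame_c0 Lt))//.
by rewrite !addr_ge0 ?mulr_ge0 ?(tame_c2 Lt) ?(tame_c3 Lt) ?(ltW T0).
Qed.

Lemma Gamma_opt_class (eta : probability (Gamma T A B) R) x g :
  (forall t, 0 <= t <= T -> Pspace 1 (time_marginal t eta)) ->
  Gamma_opt L G eta x g -> energy_class energy_bound g /\ g 0 = x.
Proof.
move=> Pm [u um <-]; have uc := um.1; have vu := vintegrable_energy uc.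
have s := trajectoryP A B T0 x vu; have g0 := solution_at0 T0 vu s.
split => //; exists u; split; [by case: uc|exact: minimizer_energy um|by rewrite g0].
Qed.

End minimizers.

(** * Almost optimal curves *)

Lemma measurable_countable_param d (X : measurableType d) d' (Y : measurableType d')
    (D : set X) (n : X -> nat) (F : nat -> X -> Y) :
  measurable D -> (forall i, measurable (D `&` [set x | n x = i])) ->
  (forall i, measurable_fun D (F i)) -> measurable_fun D (fun x => F (n x) x).
Proof.
move=> mD mn mF _ S mS.
rewrite (_ : _ `&` _ = \bigcup_i (D `&` [set x | n x = i] `&` (D `&` F i @^-1` S))).
  by apply: bigcup_measurable => i _; apply: measurableI => //; exact: mF.
apply/seteqP; split=> x /=; first by move=> [Dx Sx]; exists (n x).
by move=> [i _ [[Dx <-] [_ Sx]]].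
Qed.

Lemma shift_le (R : realDomainType) (c : R) (a b a' b' : \bar R) :
  (a + c%:E = a')%E -> (b + c%:E = b')%E -> (a <= b)%E <-> (a' <= b')%E.
Proof. by move=> <- <-; rewrite leeD2rE. Qed.

Lemma three_parts (R : realFieldType) (V a g g' e : R) : a <= e / 3 -> g - g' <= e / 3 ->
  V + a - g' + e / 3 <= V - g + e.
Proof. by lra. Qed.

Section flows.
Variables (R : realType) (d k : nat) (T : R) (A : 'M[R]_d) (B : 'M[R]_(d, k)).
Hypothesis T0 : 0 < T.
Local Notation mu := (@lebesgue_measure R).
Local Notation I := (`[0, T]%classic : set R).
Local Notation Gam := (Gamma T A B).
Variables (L : 'cV[R]_d -> 'cV[R]_k -> probability 'cV[R]_d R -> R)
  (G : 'cV[R]_d -> probability 'cV[R]_d R -> R).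
Variables (c0 c1 c2 c3 lam : R).
Hypothesis Lt : tame L c0 c1 c2 c3 lam.

(** Uniform [d1]-continuity in time is what makes the running cost measurable in time and the cost
    functionals stable. *)
Definition flow (m : R -> probability 'cV[R]_d R) : Prop :=
  (forall t, 0 <= t <= T -> Pspace 1 (m t)) /\
  forall e, 0 < e -> exists2 h, 0 < h & forall s t, 0 <= s <= T -> 0 <= t <= T ->
    `|s - t| < h -> (d1 (m s) (m t) < e%:E)%E.

Lemma tame_close x u m m' e : Pspace 1 m -> Pspace 1 m' -> (d1 m m' <= e%:E)%E ->
  `|L x u m - L x u m'| <= lam * e.
Proof.
move=> Pm Pm' me; rewrite -lee_fin; apply: (le_trans (tame_d1 Lt x u Pm Pm')).
by rewrite EFinM; apply: lee_wpmul2l; rewrite ?lee_fin ?(tame_lam Lt).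
Qed.

Definition grid_index (N : nat) (t : R) : nat := Num.truncn (t * (N.+1%:R / T)).
Definition grid_point (N i : nat) : R := Num.min T (i%:R * (T / N.+1%:R)).

Lemma grid_point_itv N i : 0 <= grid_point N i <= T.
Proof.
rewrite /grid_point ge_min lexx le_min ltW//=.
by rewrite mulr_ge0// divr_ge0// ltW.
Qed.

Lemma grid_close N t : 0 <= t <= T -> `|grid_point N (grid_index N t) - t| <= T / N.+1%:R.
Proof.
move=> /andP[t0 tT]; rewrite /grid_point /grid_index.
have NT : 0 < N.+1%:R / T by rewrite divr_gt0.
have /Num.Theory.truncn_itv/andP[lo hi] : 0 <= t * (N.+1%:R / T) by rewrite mulr_ge0// ltW.
set i := Num.truncn _ in lo hi *.
have TN : T / N.+1%:R = (N.+1%:R / T)^-1 by rewrite invfM invrK mulrC.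
have lo' : i%:R * (T / N.+1%:R) <= t by rewrite TN ler_pdivrMr.
have hi' : t <= i%:R * (T / N.+1%:R) + T / N.+1%:R.
  by rewrite TN -[X in _ + X]mul1r -mulrDl natr1 ler_pdivlMr// ltW.
rewrite min_r ?(le_trans lo')// distrC ger0_norm ?subr_ge0//.
by rewrite lerBlDl.
Qed.

Lemma measurable_grid_fiber N i : measurable (I `&` [set t | grid_index N t = i]).
Proof.
have NT : 0 < N.+1%:R / T by rewrite divr_gt0.
rewrite (_ : _ `&` _ = I `&` (fun t => t * (N.+1%:R / T)) @^-1` `[i%:R, i.+1%:R[).
  have mI : measurable I by [].
  have mf : measurable_fun I (fun t => t * (N.+1%:R / T)).
    by apply: measurable_funM; [exact: measurable_id|exact: measurable_cst].
  exact: mf.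
apply/seteqP; split=> t [It H]; split => //; move: It H; rewrite /= !in_itv/= /grid_index => /andP[t0 _].
  by move=> <-; apply: Num.Theory.truncn_itv; rewrite mulr_ge0// ltW.
by move=> H; apply/eqP; rewrite Num.Theory.truncn_eq// mulr_ge0// ltW.
Qed.

(** State and measure are frozen at grid times while the control is kept: each approximation takes
    countably many forms, each measurable by continuity in the control, and the Lipschitz bounds in
    state and measure give pointwise convergence. *)
Lemma measurable_running m y u : flow m -> {within I, continuous y} -> measurable_fun I u ->
  measurable_fun I (fun t => L (y t) (u t) (m t)).
Proof.
move=> [m1 md] yc mu_.
pose f N t := L (y (grid_point N (grid_index N t))) (u t) (m (grid_point N (grid_index N t))).
apply: (@measurable_fun_cvg _ _ _ _ f).
  move=> N; apply: (@measurable_countable_param _ _ _ _ _ (grid_index N)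
      (fun i t => L (y (grid_point N i)) (u t) (m (grid_point N i)))) => //.
    by move=> i; exact: measurable_grid_fiber.
  move=> i; apply: (@measurableT_comp _ _ _ _ _ _ (fun w => L (y (grid_point N i)) w (m (grid_point N i)))) => //.
  apply: continuous_measurable_mx; apply: (tame_continuous Lt); apply: m1; exact: grid_point_itv.
move=> t; rewrite /= in_itv /= => tT; apply/cvgrPdist_le => e e0.
set K := c2 + c1 * (1 + enorm (u t)) * enorm (u t).
have K0 : 0 <= K.
  by rewrite addr_ge0 ?(tame_c2 Lt)// !mulr_ge0 ?(tame_c1 Lt) ?addr_ge0 ?enorm_ge0.
have K1 : 0 < K + 1 by rewrite ltr_wpDl.
have l0 := tame_lam Lt.
have l1 : 0 < lam + 1 by rewrite ltr_wpDl.
have e2 : 0 < e / 2 by rewrite divr_gt0.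
have /within_continuousP/(_ t tT _ (divr_gt0 e2 K1))[h h0 Hh] := yc.
have [h' h'0 Hh'] := md _ (divr_gt0 e2 l1).
have hh : 0 < Num.min h h' by rewrite lt_min h0.
exists (Num.truncn (T / Num.min h h')) => // N /= MN.
have gp := grid_point_itv N (grid_index N t).
have gc : `|grid_point N (grid_index N t) - t| < Num.min h h'.
  apply: (le_lt_trans (grid_close N tT)); rewrite ltr_pdivrMr// mulrC -ltr_pdivrMr//.
  by apply: (lt_le_trans (truncnS_gt _)); rewrite ler_nat ltnS.
rewrite /f; set p := grid_point _ _ in gp gc *.
move: gc; rewrite lt_min => /andP[ph ph'].
have D1 := tame_lipschitz Lt (y t) (y p) (u t) (m1 _ tT).
have D2 : `|L (y p) (u t) (m p) - L (y p) (u t) (m t)| <= lam * (e / 2 / (lam + 1)).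
  by apply: tame_close; [exact: m1|exact: m1|exact: ltW (Hh' _ _ _ _ ph')].
have D3 := ltW (Hh p gp ph).
rewrite (_ : _ - _ = (L (y t) (u t) (m t) - L (y p) (u t) (m t)) -
    (L (y p) (u t) (m p) - L (y p) (u t) (m t))); last first.
  by rewrite opprB addrA subrK.
apply: (le_trans (ler_normB _ _)); rewrite [leRHS](splitr e); apply: lerD.
  apply: (le_trans D1); rewrite enormBC; apply: (@le_trans _ _ (K * (e / 2 / (K + 1)))).
    by rewrite ler_wpM2l.
  by rewrite mulrCA ger_pMr// ler_pdivrMr// mul1r lerDl.
by apply: (le_trans D2); rewrite mulrCA ger_pMr// ler_pdivrMr// mul1r lerDl.
Qed.

(** The shift by [c3] makes the integrand nonnegative, so that Fatou's lemma applies; by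
    [cost_total] it changes the cost by the constant [c3 * T], which does not affect minimality. *)
Definition run_cost (m : R -> probability 'cV[R]_d R) (y : R -> 'cV[R]_d) (u : R -> 'cV[R]_k)
    : \bar R :=
  (\int[mu]_(t in I) (L (y t) (u t) (m t) + c3)%:E)%E.

Definition total_cost m y u : \bar R := (run_cost m y u + (G (y T) (m T))%:E)%E.

Let segP t : I t -> 0 <= t <= T. Proof. by rewrite /= in_itv. Qed.

Lemma running_ge0 m x u t : flow m -> I t -> 0 <= L x u (m t) + c3.
Proof.
move=> [m1 _] /segP tT; apply: le_trans (tame_coercive Lt x u (m1 t tT)).
by rewrite divr_ge0 ?sqr_ge0// mulr_ge0// ltW// (tame_c0 Lt).
Qed.

Lemma run_cost_ge0 m y u : flow m -> (0 <= run_cost m y u)%E.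
Proof. by move=> fm; apply: integral_ge0 => t It; rewrite lee_fin running_ge0. Qed.

Lemma measurable_shifted m y u : flow m -> {within I, continuous y} -> measurable_fun I u ->
  measurable_fun I (fun t => L (y t) (u t) (m t) + c3).
Proof.
by move=> fm yc mu_; apply: measurable_funD; [exact: measurable_running|exact: measurable_cst].
Qed.

Lemma cost_total (eta : probability Gam R) x v : flow (fun t => time_marginal t eta) ->
  Lp_control T 2 v ->
  (cost L G eta x v + (c3 * T)%:E =
   total_cost (fun t => time_marginal t eta) (trajectory T A B x v) v)%E.
Proof.
move=> fm vc; rewrite /cost /total_cost addeAC; congr (_ + _)%E.
have [tc _] := trajectoryP A B T0 x (vintegrable_energy vc).
rewrite /run_cost integral_shift//.
- by congr (_ + _)%E; rewrite EFinM; congr (_ * _)%E; rewrite -(measure_segment T0).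
- by have := ltry T; rewrite -(measure_segment T0).
- by apply: measurable_running => //; case: vc.
- exact: (tame_c3 Lt).
- by move=> t It; exact: (@running_ge0 (fun t => time_marginal t eta)).
Qed.

Lemma run_cost_close m m' y u e : flow m -> flow m' -> 0 <= e ->
  {within I, continuous y} -> measurable_fun I u ->
  (forall x w t, 0 <= t <= T -> `|L x w (m t) - L x w (m' t)| <= e) ->
  (run_cost m' y u <= run_cost m y u + (e * T)%:E)%E.
Proof.
move=> fm fm' e0 yc mu_ H; rewrite -(integral_cst_segment T0) /run_cost -ge0_integralD//.
- apply: le_integral_nonneg => // t It; first by rewrite lee_fin running_ge0.
  rewrite -EFinD lee_fin addrAC lerD2r -lerBlDl.
  apply: (le_trans (ler_norm _)); rewrite distrC; apply: H; exact: segP.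
- by move=> t It; rewrite lee_fin running_ge0.
- by apply/measurable_EFinP; exact: measurable_shifted.
Qed.

(** The energy bound is part of the definition because it supplies the compactness behind
    [near_opt_closed]. *)
Definition near_opt (c : R) (m : R -> probability 'cV[R]_d R) (x : 'cV[R]_d) (e : R) : set Gam :=
  [set g | exists u, [/\ measurable_fun I u, (energy T u <= c%:E)%E, solution T A B x u g &
    forall v, Lp_control T 2 v ->
      (total_cost m g u <= total_cost m (trajectory T A B x v) v + e%:E)%E]].

Lemma near_opt_minimizer c (eta : probability Gam R) x g :
  flow (fun t => time_marginal t eta) ->
  near_opt c (fun t => time_marginal t eta) x 0 g -> Gamma_opt L G eta x g.
Proof.
move=> fm [u [mu_ ue su H]]; have uc := Lp_control2P mu_ ue.
have gE := trajectory_eq T0 (vintegrable_energy uc) su.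
exists u; last exact: esym gE.
split=> [|v vc]; first exact: uc.
have Eu := cost_total x fm uc; rewrite -gE in Eu.
by have := H v vc; rewrite adde0; exact: (shift_le Eu (cost_total x fm vc)).2.
Qed.

Lemma minimizer_near_opt M (eta : probability Gam R) x g :
  (forall x m, Pspace 1 m -> `|G x m| <= M) ->
  flow (fun t => time_marginal t eta) -> Gamma_opt L G eta x g ->
  near_opt (energy_bound T c0 c2 c3 M) (fun t => time_marginal t eta) x 0 g.
Proof.
move=> GM fm [u um <-]; have uc := um.1; have vu := vintegrable_energy uc.
exists u; split; [by case: uc|exact: (minimizer_energy T0 Lt GM fm.1 um)|exact: trajectoryP|].
move=> v vc; rewrite adde0.
exact: (shift_le (cost_total x fm uc) (cost_total x fm vc)).1 (um.2 v vc).
Qed.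

(** A total cost moves by at most [e * T + e] when the flow is changed, and this is paid twice: for
    the curve and for its competitor. *)
Lemma near_opt_transfer c m m' x e g : flow m -> flow m' -> 0 <= e ->
  (forall x w t, 0 <= t <= T -> `|L x w (m t) - L x w (m' t)| <= e) ->
  (forall x, `|G x (m T) - G x (m' T)| <= e) ->
  near_opt c m x 0 g -> near_opt c m' x (2 * (e * T + e)) g.
Proof.
move=> fm fm' e0 HL HG [u [mu_ ue su H]]; exists u; split => // v vc.
have HL' x' w t : 0 <= t <= T -> `|L x' w (m' t) - L x' w (m t)| <= e.
  by move=> tT; rewrite distrC; exact: HL.
have tot n n' y w : flow n -> flow n' -> {within I, continuous y} -> measurable_fun I w ->
    (forall x w t, 0 <= t <= T -> `|L x w (n t) - L x w (n' t)| <= e) ->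
    (forall x, `|G x (n T) - G x (n' T)| <= e) ->
    (total_cost n' y w <= total_cost n y w + (e * T + e)%:E)%E.
  move=> fn fn' yc mw hL hG; rewrite /total_cost EFinD.
  rewrite addeACA; apply: leeD; first exact: run_cost_close.
  rewrite -EFinD lee_fin -lerBlDl; apply: (le_trans (ler_norm _)); rewrite distrC; exact: hG.
have [gc _] := su; have [tc _] := trajectoryP A B T0 x (vintegrable_energy vc).
have [mv _] := vc.
apply: (le_trans (tot _ _ _ _ fm fm' gc mu_ HL HG)).
have H1 := H v vc; rewrite adde0 in H1.
have H2 := tot _ _ _ _ fm' fm tc mv HL' (fun x => ltac:(rewrite distrC; exact: HG)).
rewrite (_ : 2 * (e * T + e) = (e * T + e) + (e * T + e)); last by ring.
rewrite [X in (_ <= _ + X)%E]EFinD addeA; apply: leeD2r.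
exact: le_trans H1 H2.
Qed.

Lemma integral_affine_energy (a b : R) (u : R -> 'cV[R]_k) : 0 <= a -> 0 <= b -> measurable_fun I u ->
  (\int[mu]_(t in I) (a + b * enorm (u t) ^+ 2)%:E = (a * T)%:E + b%:E * energy T u)%E.
Proof.
move=> a0 b0 mu_; rewrite -(integral_cst_segment T0).
have me := measurable_sqr_enorm mu_.
have e0 t : I t -> (0 <= (enorm (u t) ^+ 2)%:E)%E by rewrite lee_fin exprn_ge0 ?enorm_ge0.
rewrite -ge0_integralZl_EFin// -ge0_integralD//.
  by move=> t It; apply: mule_ge0; [rewrite lee_fin|exact: e0].
exact: measurable_funeM.
Qed.

Lemma total_cost_infimum M m x : 0 <= M -> (forall x m, Pspace 1 m -> `|G x m| <= M) -> flow m ->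
  exists V : R, (forall v, Lp_control T 2 v -> (V%:E <= total_cost m (trajectory T A B x v) v)%E) /\
    forall e, 0 < e -> exists2 v, Lp_control T 2 v &
      (total_cost m (trajectory T A B x v) v <= (V + e)%:E)%E.
Proof.
move=> M0 GM fm.
have TT : 0 <= T <= T by rewrite lexx ltW.
pose S := [set total_cost m (trajectory T A B x v) v | v in Lp_control T 2].
have lo : ((- M)%:E <= ereal_inf S)%E.
  apply: le_ereal_inf_tmp => _ [v vc <-]; rewrite -[leLHS]add0e; apply: leeD; first exact: run_cost_ge0.
  by rewrite lee_fin; have := GM (trajectory T A B x v T) _ (fm.1 T TT); rewrite ler_norml => /andP[].
have hi : (ereal_inf S < +oo)%E.
  have z2 := @Lp_control2_0 R k T.
  apply: (@le_lt_trans _ _ (total_cost m (trajectory T A B x (fun=> 0)) (fun=> 0))).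
    by apply: ereal_inf_lbound; exists (fun=> 0).
  rewrite /total_cost lte_add_pinfty ?ltry//.
  apply: (@le_lt_trans _ _ (\int[mu]_(t in I) (cst (c2 + c3)%:E t))%E).
    apply: le_integral_nonneg => // t It; rewrite lee_fin; first exact: running_ge0.
    by rewrite lerD2r; apply: (tame_at0 Lt); apply: fm.1; exact: segP.
  by rewrite integral_cst_segment// ltry.
have fS : ereal_inf S \is a fin_num.
  by rewrite fin_numE gt_eqF ?(lt_le_trans (ltNyr _) lo)//= lt_eqF.
exists (fine (ereal_inf S)); split.
  by move=> v vc; rewrite fineK//; apply: ereal_inf_lbound; exists v.
move=> e e0; have : (ereal_inf S < (fine (ereal_inf S) + e)%:E)%E.
  by rewrite EFinD fineK// lteDl// lte_fin.
by move=> /ereal_inf_lt[_ [v vc <-] /ltW H]; exists v.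
Qed.

Lemma run_cost_perturb m (y y' : R -> 'cV[R]_d) u c h : flow m -> {within I, continuous y} ->
  {within I, continuous y'} -> measurable_fun I u -> (energy T u <= c%:E)%E -> 0 <= c -> 0 <= h ->
  (forall t, 0 <= t <= T -> enorm (y' t - y t) <= h) ->
  (run_cost m y u <= run_cost m y' u + (h * ((c2 + c1) * T + 2 * c1 * c))%:E)%E.
Proof.
move=> fm yc y'c mu_ ue cc h0 yh.
have c10 := tame_c1 Lt; have c20 := tame_c2 Lt.
pose a := h * (c2 + c1); pose b := h * (2 * c1).
have a0 : 0 <= a by rewrite mulr_ge0 ?addr_ge0.
have b0 : 0 <= b by rewrite !mulr_ge0.
apply: (@le_trans _ _ (run_cost m y' u + \int[mu]_(t in I) (a + b * enorm (u t) ^+ 2)%:E)%E).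
  rewrite /run_cost -ge0_integralD//.
  - apply: le_integral_nonneg => // t It; first by rewrite lee_fin running_ge0.
    rewrite -EFinD lee_fin addrAC lerD2r -lerBlDl.
    apply: (le_trans (ler_norm _)); apply: (le_trans (tame_lipschitz Lt _ _ _ (fm.1 t (segP It)))).
    have w0 := enorm_ge0 (u t); set w := enorm (u t) in w0 *.
    have := yh t (segP It); rewrite enormBC => yt.
    apply: (@le_trans _ _ ((c2 + c1 * (1 + w) * w) * h)).
      by rewrite ler_wpM2l// addr_ge0// !mulr_ge0// addr_ge0.
    (* The factor [c2 + c1 * (1 + w) * w] is bounded by [c2 + c1 + 2 * c1 * w ^+ 2], so that only
       the energy of the control remains. *)
    rewrite /a /b -subr_ge0.
    have -> : h * (c2 + c1) + h * (2 * c1) * w ^+ 2 - (c2 + c1 * (1 + w) * w) * h =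
      h * (c1 * ((w - 2^-1) ^+ 2 + 3 / 4)) by field.
    by rewrite !mulr_ge0// addr_ge0// sqr_ge0.
  - by move=> t It; rewrite lee_fin running_ge0.
  - by apply/measurable_EFinP; exact: measurable_shifted.
  - by move=> t _; rewrite lee_fin addr_ge0// mulr_ge0// exprn_ge0 ?enorm_ge0.
  - apply/measurable_EFinP; apply: measurable_funD; first exact: measurable_cst.
    apply: measurable_funM; first exact: measurable_cst.
    by apply: measurable_funX; exact: measurable_fun_enorm.
rewrite integral_affine_energy//; apply: leeD2l.
rewrite mulrDr EFinD; apply: leeD; first by rewrite lee_fin /a mulrA.
apply: (@le_trans _ _ (b%:E * c%:E)%E); first by apply: lee_wpmul2l; rewrite ?lee_fin.
by rewrite -EFinM lee_fin /b -!mulrA.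
Qed.

(** The approximating curves have costs tending to the infimum [V]. Their states are replaced by the
    limit curve at a cost bounded through the energy ([run_cost_perturb]), after which the running
    cost is a convex functional of the control alone and [mazur_closure] applies with the target
    value [V - G (g T) (m T)]. *)
Lemma near_opt_closed M c m x (g : Gam) : 0 <= M -> 0 <= c ->
  (forall x m, Pspace 1 m -> `|G x m| <= M) ->
  (forall m, Pspace 1 m -> C1b (G ^~ m)) -> flow m ->
  (forall e, 0 < e -> exists2 g' : Gam, near_opt c m x e g' &
     forall t, 0 <= t <= T -> enorm (g' t - g t) <= e) ->
  near_opt c m x 0 g.
Proof.
move=> M0 cc GM GC fm H.
have TT : 0 <= T <= T by rewrite lexx ltW.
have [V [Vlo Vhi]] := total_cost_infimum x M0 GM fm.
have /choice[gu gP] : forall j, exists gu : Gam * (R -> 'cV[R]_k),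
  [/\ measurable_fun I gu.2, (energy T gu.2 <= c%:E)%E, solution T A B x gu.2 gu.1,
    (total_cost m gu.1 gu.2 <= (V + 2 / j.+1%:R)%:E)%E &
    forall t, 0 <= t <= T -> enorm (gu.1 t - g t) <= j.+1%:R^-1].
  move=> j; have j0 : 0 < j.+1%:R^-1 :> R by rewrite invr_gt0.
  have [g' [u [mu_ ue su Hu]] cl] := H _ j0.
  exists (g', u); split => //=.
  have [v vc Hv] := Vhi _ j0; apply: (le_trans (Hu v vc)).
  by rewrite (mulrDl 1 1) !mul1r addrA [leRHS]EFinD; apply: leeD2r.
pose l t w := L (g t) w (m t) + c3.
have [u0 _ [gc _]] := Gamma_solution T0 g.
have GTc : {for g T, continuous (G ^~ (m T))}.
  by apply: differentiable_continuous; have [_ + _] := GC _ (fm.1 T TT); apply.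
have small (C e : R) : 0 < e -> exists N, forall n, (N <= n)%N -> C / n.+1%:R <= e.
  move=> e0; exists (Num.truncn (C / e)) => n Nn.
  rewrite ler_pdivrMr// mulrC -ler_pdivrMr//; apply: (le_trans (ltW (truncnS_gt _))).
  by rewrite ler_nat ltnS.
have [u [mu_ ue su Hu]] : exists u, [/\ measurable_fun I u, (energy T u <= c%:E)%E,
    solution T A B x u g &
    (\int[mu]_(t in I) (l t (u t))%:E <= (V - G (g T) (m T))%:E)%E].
  apply: (@mazur_closure _ _ _ _ _ _ (ltW T0) c _ (fun=> x) (fun j => (gu j).2) (fun j => (gu j).1)).
  - by move=> n; have [] := gP n.
  - by move=> n; have [] := gP n.
  - move=> e e0; have [N HN] := small 1 e e0; exists N => n Nn; rewrite subrr enorm0 ltW//; split => // t tT.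
    have [_ _ _ _ /(_ t tT) cl] := gP n; apply: (le_trans cl).
    by have := HN n Nn; rewrite div1r.
  - by move=> t w It; exact: running_ge0.
  - move=> t w w' It; rewrite /l.
    have -> : (L (g t) w (m t) + c3 + (L (g t) w' (m t) + c3)) / 2 =
      (L (g t) w (m t) + L (g t) w' (m t)) / 2 + c3 by field.
    by rewrite lerD2r; apply: (tame_midpoint Lt); apply: fm.1; exact: segP.
  - move=> t It w; have C1 : {for w, continuous (fun w => L (g t) w (m t))}.
      by apply: (tame_continuous Lt); exact: fm.1 (segP It).
    exact: (cvgD C1 (cvg_cst c3)).
  - by move=> u mu_; exact: measurable_shifted.
  - move=> e e0.
    have e3 : 0 < e / 3 by rewrite divr_gt0.
    have [N1 HN1] := small 2 _ e3.
    have [N2 HN2] := small ((c2 + c1) * T + 2 * c1 * c) _ e3.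
    have /cvgrPdist_le/(_ _ e3)/nbhs_ballP[r r0 Hr] := GTc.
    have r2 : 0 < r / 2 by rewrite divr_gt0.
    have [N3 HN3] := small 1 _ r2.
    exists (N1 + N2 + N3)%N => n Nn.
    have [mn en sn tn cl] := gP n; have [gnc _] := sn.
    have n0 : 0 <= n.+1%:R^-1 :> R by rewrite invr_ge0.
    have P := run_cost_perturb fm gc gnc mn en cc n0 cl.
    apply: (le_trans P).
    have Gr : G (g T) (m T) - G ((gu n).1 T) (m T) <= e / 3.
      apply: (le_trans (ler_norm _)); apply: Hr; split => // i j; rewrite ord1.
      apply: (@le_lt_trans _ _ (r / 2)); last by rewrite ltr_pdivrMr// ltr_pMr// ltr1n.
      have := entry_le_enorm (g T - (gu n).1 T) i; rewrite !mxE => /le_trans; apply.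
      rewrite enormBC; apply: (le_trans (cl T TT)).
      by have := HN3 n (leq_trans (leq_addl _ _) Nn); rewrite div1r.
    have E2 : n.+1%:R^-1 * ((c2 + c1) * T + 2 * c1 * c) <= e / 3.
      by rewrite mulrC; apply: HN2; apply: leq_trans Nn; rewrite -addnA addnCA leq_addr.
    have E1 : 2 / n.+1%:R <= e / 3.
      by apply: HN1; apply: leq_trans Nn; rewrite -addnA leq_addr.
    apply: (@le_trans _ _ ((V + 2 / n.+1%:R - G ((gu n).1 T) (m T))%:E + (e / 3)%:E)%E).
      apply: leeD; last by rewrite lee_fin.
      by rewrite EFinB leeBrDr.
    rewrite -EFinD lee_fin; exact: three_parts.
exists u; split => // v vc; rewrite adde0; apply: le_trans (Vlo v vc).
by rewrite /total_cost -leeBrDr// -EFinB.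
Qed.

End flows.

(** * Cells and codes of curves *)

Lemma floor_range (R : realType) (x : R) n : `|x| <= n%:R ->
  0 <= Num.floor x + n%:Z <= (n + n)%:Z.
Proof.
rewrite ler_norml => /andP[lo hi]; apply/andP; split.
  by rewrite -lerBlDr sub0r floor_ge_int rmorphN.
by rewrite PoszD lerD2r -(ler_int R); apply: le_trans hi; exact: Num.Theory.floor_le.
Qed.

Lemma absz_le_nat (z : int) (n : nat) : 0 <= z <= n%:Z -> (absz z <= n)%N.
Proof. by case/andP; case: z. Qed.

Lemma absz_shift (z : int) (m n : nat) : 0 <= z + m%:Z <= n%:Z -> (absz (z + m%:Z)%R)%:Z - m%:Z = z.
Proof. by case/andP => z0 _; rewrite gez0_abs// addrK. Qed.

Lemma dist_via (R : numDomainType) (a b c e e' : R) :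
  `|a - c| <= e -> `|b - c| <= e' -> `|a - b| <= e + e'.
Proof.
by move=> ac bc; apply: (le_trans (ler_distD c _ _)); rewrite (distrC c) lerD.
Qed.

Section gamma_topology.
Variables (R : realType) (d k : nat) (T : R) (A : 'M[R]_d) (B : 'M[R]_(d, k)).
Hypothesis T0 : 0 < T.
Local Notation mu := (@lebesgue_measure R).
Local Notation I := (`[0, T]%classic : set R).
Local Notation Gam := (Gamma T A B).
Implicit Types (g h : Gam).

Definition udist_le (e : R) (f g : R -> 'cV[R]_d) : Prop :=
  forall t, 0 <= t <= T -> enorm (f t - g t) <= e.

Lemma udist_leC e f g : udist_le e f g -> udist_le e g f.
Proof. by move=> H t tT; rewrite enormBC; exact: H. Qed.

Lemma udist_le_trans a b f g h : udist_le a f g -> udist_le b g h -> udist_le (a + b) f h.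
Proof.
by move=> H1 H2 t tT; apply: (le_trans (enorm_dist3 _ (g t) _)); apply: lerD; [exact: H1|exact: H2].
Qed.

Lemma udist_le_weak a b f g : a <= b -> udist_le a f g -> udist_le b f g.
Proof. by move=> ab H t tT; apply: le_trans ab; exact: H. Qed.

Lemma nbhs_udist g e : 0 < e -> nbhs g [set h : Gam | udist_le e h g].
Proof.
move=> e0; have e0' : 0 < e / d.+1%:R by rewrite divr_gt0.
have H : nbhs (set_val g : {uniform` `[0, T] -> 'cV[R]_d})
    [set f : {uniform` `[0, T] -> 'cV[R]_d} | udist_le e (f : R -> 'cV[R]_d) g].
  apply/uniform_nbhs; exists [set xy | ball xy.1 (PosNum e0')%:num xy.2]; split.
    exact: entourage_ball.
  move=> f /= Hf t tT; rewrite enormBC ltW//; apply: enorm_lt_entries => // i.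
  have /= := Hf t; rewrite in_itv /= tT => /(_ isT)[_ /(_ i 0)].
  by rewrite /ball /= !mxE.
exact: (@initial_continuous _ _ (set_val : @Gamma_set R d k T A B -> _) g _ H).
Qed.

Lemma udist_nbhs g (V : set Gam) : nbhs g V ->
  exists2 e, 0 < e & forall h, udist_le e h g -> V h.
Proof.
move=> [W [[U oU <-] Ug] WV].
have : nbhs (set_val g : {uniform` `[0, T] -> 'cV[R]_d}) U by exact: open_nbhs_nbhs.
move=> /uniform_nbhs[E [+ EU]]; rewrite -entourage_from_ballE => -[e /= e0 eE].
have e2 : 0 < e / 2 by rewrite divr_gt0.
exists (e / 2) => // h hg; apply: WV; apply: EU => t /=; rewrite in_itv /= => tT.
apply: eE => /=; split => // i j; rewrite ord1.
have := entry_le_enorm (g t - h t) i; rewrite !mxE => /le_lt_trans; apply.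
rewrite enormBC; apply: (le_lt_trans (hg t tT)).
by rewrite ltr_pdivrMr// ltr_pMr// ltr1n.
Qed.

(** [mazur_closure] with the zero functional. The limit [f] is a mere function: being a trajectory
    is part of the conclusion, which serves completeness as well as closedness. *)
Lemma energy_class_limit c (f : R -> 'cV[R]_d) :
  (forall e, 0 < e -> exists2 g : Gam, energy_class c g & udist_le e g f) ->
  exists2 g : Gam, energy_class c g & forall t, 0 <= t <= T -> g t = f t.
Proof.
move=> H.
have /choice[gu gP] : forall j, exists gu : Gam * (R -> 'cV[R]_k),
  [/\ measurable_fun I gu.2, (energy T gu.2 <= c%:E)%E, solution T A B (gu.1 0) gu.2 gu.1 &
    udist_le j.+1%:R^-1 gu.1 f].
  move=> j; have j0 : 0 < j.+1%:R^-1 :> R by rewrite invr_gt0.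
  by have [g [u [mu_ ue su]] gf] := H _ j0; exists (g, u).
have TT : (0:R) <= 0 <= T by rewrite lexx ltW.
have [u [mu_ ue su _]] : exists u, [/\ measurable_fun I u, (energy T u <= c%:E)%E,
    solution T A B (f 0) u f & (\int[mu]_(t in I) (0:R)%:E <= (0:R)%:E)%E].
  apply: (@mazur_closure _ _ _ _ _ _ (ltW T0) c 0 (fun j => (gu j).1 0) (fun j => (gu j).2) (fun j => (gu j).1) _ _ (fun _ _ => 0)).
  - by move=> n; have [] := gP n.
  - by move=> n; have [] := gP n.
  - move=> e e0; exists (Num.truncn e^-1) => n Nn.
    have ne : n.+1%:R^-1 <= e.
      rewrite -[leRHS]invrK lef_pV2 ?posrE ?invr_gt0//; apply: (le_trans (ltW (truncnS_gt _))).
      by rewrite ler_nat ltnS.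
    have [_ _ _ cl] := gP n.
    by split => [|t tT]; apply: le_trans ne; exact: cl.
  - by [].
  - by move=> *; rewrite addr0 mul0r.
  - by move=> t _; exact: cst_continuous.
  - by move=> *; exact: measurable_cst.
  - move=> e e0; exists 0%N => n _; rewrite (eq_integral (cst 0%E))// integral0 lee_fin add0r.
    exact: ltW.
have vu := vintegrable_energy (Lp_control2P mu_ ue).
have [g sg gf] := Gamma_intro vu su; exists g => //; exists u; split => //.
by rewrite gf.
Qed.

Lemma closed_energy_class c : closed (energy_class c : set Gam).
Proof.
move=> g gC.
have [e e0|h hc hg] := @energy_class_limit c (curve_fun g).
  by have [h [hc hg]] := gC _ (nbhs_udist g e0); exists h.
by have <- : h = g by exact: Gamma_ext.
Qed.

Lemma measurable_closed (C : set Gam) : closed C -> measurable C.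
Proof.
move=> Cc; rewrite -[C]setCK; apply: measurableC; apply: sub_sigma_algebra.
by rewrite openC.
Qed.

Lemma measurable_energy_class c : measurable (energy_class c : set Gam).
Proof. by apply: measurable_closed; exact: closed_energy_class. Qed.

Definition base_index : Type := (nat * nat * 'I_d * int * nat)%type.

(** The tolerance is twice the spacing of the levels: one unit for rounding, one for the oscillation
    on a grid interval. Weak inequalities make these sets closed, hence Borel. *)
Definition base_set (s : base_index) : set Gam :=
  let: (N, l, i, z, m) := s in
  [set g : Gam | forall t, 0 <= t <= T -> l%:R * (T / N.+1%:R) <= t <= l.+1%:R * (T / N.+1%:R) ->
    `|g t i 0 - z%:~R / m.+1%:R| <= 2 / m.+1%:R].

Lemma closed_base_set s : closed (base_set s).
Proof.
case: s => [[[[N l] i] z] m] g gC t tT tl.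
apply/ler_addgt0Pr => e e0.
have [h [/(_ t tT tl) Hh hg]] := gC _ (nbhs_udist g e0).
rewrite (_ : _ - _ = ((h : Gam) t i 0 - z%:~R / m.+1%:R) - ((h : Gam) t i 0 - (g : Gam) t i 0)); last first.
  by rewrite opprB [RHS]addrC addrA subrK.
apply: (le_trans (ler_normB _ _)); apply: lerD => //.
by apply: le_trans (hg t tT); have := entry_le_enorm ((h : Gam) t - (g : Gam) t) i; rewrite !mxE.
Qed.

Definition bit_set (j : nat) : set Gam :=
  if unpickle j is Some s then base_set s else setT.

Lemma measurable_bit_set j : measurable (bit_set j).
Proof.
rewrite /bit_set; case: unpickle => [s|]; last exact: measurableT.
by apply: measurable_closed; exact: closed_base_set.
Qed.

(* Codes are read from the right: the head of the list is the last bit. *)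
Fixpoint cell (c : seq bool) : set Gam :=
  if c is b :: c' then cell c' `&` (if b then bit_set (size c') else ~` bit_set (size c'))
  else setT.

Fixpoint code n g : seq bool :=
  if n is n'.+1 then `[< bit_set n' g >] :: code n' g else [::].

Lemma size_code n g : size (code n g) = n.
Proof. by elim: n => //= n ->. Qed.

Lemma cell_code n g : cell (code n g) g.
Proof.
elim: n => //= n IH; split => //; rewrite size_code.
by case: ifPn => [/asboolP|/asboolPn].
Qed.

Lemma cell_codeP c g : cell c g <-> c = code (size c) g.
Proof.
split=> [|->]; last exact: cell_code.
elim: c => //= b c IH [/IH cE H]; congr (_ :: _) => //.
by case: b H => [Hb|Hb]; apply/esym; [apply/asboolP|apply/asboolPn].
Qed.

Lemma measurable_cell c : measurable (cell c).
Proof.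
elim: c => [|b c IH] /=; first exact: measurableT.
apply: measurableI => //; case: b; last apply: measurableC; exact: measurable_bit_set.
Qed.

Lemma same_cell c g h j : cell c g -> cell c h -> (j < size c)%N -> bit_set j g -> bit_set j h.
Proof.
elim: c => //= b c IH [cg bg] [ch bh]; rewrite ltnS leq_eqVlt => /predU1P[->|jc]; last exact: IH.
by case: b bg bh.
Qed.

(** The Arzelà-Ascoli argument: for an equibounded, equicontinuous class, finitely many base sets
    determine a curve up to [e]. Only [g] has to belong to [S]; [h] may be any curve of the same
    cell, so arbitrary representatives of cells can be chosen later. *)
Lemma prefix_close (S : set Gam) M :
  (forall g t, S g -> 0 <= t <= T -> enorm (g t) <= M) ->
  (forall e, 0 < e -> exists2 dl, 0 < dl & forall g s t, S g -> 0 <= s <= T -> 0 <= t <= T ->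
     `|s - t| <= dl -> enorm (g s - g t) <= e) ->
  forall e, 0 < e -> exists n, forall c g h, (n <= size c)%N -> S g -> cell c g -> cell c h ->
    udist_le e g h.
Proof.
move=> SM Sm e e0.
pose m := Num.truncn (d%:R * (2 + 2) / e).
have m0 : 0 < m.+1%:R :> R by [].
have me : d%:R * (2 / m.+1%:R + 2 / m.+1%:R) <= e.
  rewrite -mulrDl mulrA ler_pdivrMr// [leRHS]mulrC -ler_pdivrMr//; exact: ltW (truncnS_gt _).
have [dl dl0 Hdl] := Sm m.+1%:R^-1 (ltac:(by rewrite invr_gt0)).
pose N := Num.truncn (T / dl).
have Ndl : T / N.+1%:R <= dl.
  by rewrite ler_pdivrMr// [leRHS]mulrC -ler_pdivrMr//; exact: ltW (truncnS_gt _).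
have TN : 0 < T / N.+1%:R by rewrite divr_gt0.
pose Q := (Num.truncn (M * m.+1%:R)).+1.
(* The finitely many base sets consulted: levels range over the integers from [-Q] to [Q], shifted
   to fit an ordinal, and ['I_N.+2] leaves room for the grid index of the final time [T]. *)
pose key (p : 'I_N.+2 * 'I_d * 'I_(Q + Q).+1) : base_index :=
  (N, p.1.1 : nat, p.1.2, (p.2 : nat)%:Z - Q%:Z, m).
have [n nP] : exists n, forall p, (pickle (key p) < n)%N.
  pose F p : nat := pickle (key p).
  by exists (\max_p F p).+1 => p; rewrite ltnS; exact: (@leq_bigmax _ F p).
exists n => c g h nc Sg cg ch t tT.
apply: (le_trans (enorm_le_sum _)); apply: le_trans me.
rewrite -[X in X%:R * _]card_ord -sum1_card natr_sum mulr_suml; apply: ler_sum => i _; rewrite mul1r.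
have /andP[t0 tT'] := tT.
pose l := grid_index T N t.
have NT : 0 < N.+1%:R / T by rewrite divr_gt0.
have /Num.Theory.truncn_itv/andP[lo hi] : 0 <= t * (N.+1%:R / T) by rewrite mulr_ge0// ltW.
have TNE : T / N.+1%:R = (N.+1%:R / T)^-1 by rewrite invfM invrK mulrC.
have lo' : l%:R * (T / N.+1%:R) <= t by rewrite TNE ler_pdivrMr.
have hi' : t <= l.+1%:R * (T / N.+1%:R) by rewrite TNE ler_pdivlMr// ltW.
have lN : (l < N.+2)%N.
  have : l%:R * (T / N.+1%:R) <= T by exact: le_trans tT'.
  by rewrite mulrA ler_pdivrMr// [leRHS]mulrC ler_pM2r// ler_nat.
have pT : 0 <= l%:R * (T / N.+1%:R) <= T.
  by apply/andP; split; [apply: mulr_ge0; [exact: ler0n|exact: ltW]|exact: le_trans tT'].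
set p := l%:R * (T / N.+1%:R) in pT lo'.
pose z := Num.floor (g p i 0 * m.+1%:R).
have /andP[zlo zhi] := Num.Theory.floor_itv (g p i 0 * m.+1%:R).
have gp : `|g p i 0 * m.+1%:R| <= M * m.+1%:R.
  rewrite normrM [X in _ * X]ger0_norm ?ler0n// ler_pM2r//; apply: le_trans (SM g p Sg pT).
  exact: entry_le_enorm.
have MQ : M * m.+1%:R <= Q%:R by exact: ltW (truncnS_gt _).
have zQ := floor_range (le_trans gp MQ); rewrite -/z in zQ.
have aQ : (absz (z + Q%:Z)%R < (Q + Q).+1)%N.
  by rewrite ltnS; apply: absz_le_nat.
pose q : 'I_N.+2 * 'I_d * 'I_(Q + Q).+1 := (Ordinal lN, i : 'I_d, Ordinal aQ).
have qE : key q = (N, l, i, z, m).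
  by rewrite /key /= (absz_shift zQ).
have zE s : 0 <= s <= T -> p <= s <= l.+1%:R * (T / N.+1%:R) ->
    `|g s i 0 - z%:~R / m.+1%:R| <= 2 / m.+1%:R.
  move=> sT /andP[ps sp].
  have H1 : `|g s i 0 - g p i 0| <= m.+1%:R^-1.
    have sp' : `|s - p| <= dl.
      rewrite ger0_norm ?subr_ge0//; apply: le_trans Ndl; rewrite lerBlDl.
      by apply: (le_trans sp); rewrite /p -natr1 mulrDl mul1r.
    apply: le_trans (Hdl g s p Sg sT pT sp').
    by have := entry_le_enorm (g s - g p) i; rewrite !mxE.
  have H2 : `|g p i 0 - z%:~R / m.+1%:R| <= m.+1%:R^-1.
    rewrite -[X in `|X - _|](@mulfK _ m.+1%:R) ?gt_eqF// -mulrBl normrM [X in _ * X]ger0_norm ?invr_ge0//.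
    rewrite ger_pMl ?invr_gt0// ger0_norm ?subr_ge0// lerBlDl ltW//.
    by move: zhi; rewrite intrD.
  rewrite (_ : g s i 0 - _ = (g s i 0 - g p i 0) + (g p i 0 - z%:~R / m.+1%:R)); last by rewrite addrA subrK.
  by apply: (le_trans (ler_normD _ _)); rewrite (mulrDl 1 1) !mul1r lerD.
have gq : bit_set (pickle (key q)) g.
  by rewrite /bit_set pickleK qE => s sT ss; exact: zE.
have qn : (pickle (key q) < size c)%N by exact: leq_trans (nP q) nc.
have := same_cell cg ch qn gq; rewrite /bit_set pickleK qE => /(_ t tT).
rewrite lo' hi' => /(_ isT) ht.
have pt : p <= t <= l.+1%:R * (T / N.+1%:R) by rewrite lo' hi'.
by rewrite !mxE; exact: dist_via (zE t tT pt) ht.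
Qed.

Lemma uniformly_continuous_curve g e : 0 < e -> exists2 dl, 0 < dl &
  forall s t, 0 <= s <= T -> 0 <= t <= T -> `|s - t| <= dl -> enorm (g s - g t) <= e.
Proof.
move=> e0; have [u0 _ [gc _]] := Gamma_solution T0 g.
have /compact_near_coveringP/(_ R (0^'+)
    (fun dl t => forall s, 0 <= s <= T -> 0 <= t <= T -> `|s - t| <= dl -> enorm (g s - g t) <= e) _)
  := @segment_compact R 0 T.
move=> H; have e2 : 0 < e / 2 by rewrite divr_gt0.
have : \forall dl \near 0^'+, I `<=` (fun t => forall s, 0 <= s <= T -> 0 <= t <= T ->
    `|s - t| <= dl -> enorm (g s - g t) <= e).
  apply: H => t; rewrite /= in_itv /= => tT.
  have /within_continuousP/(_ t tT _ e2)[r r0 Hr] := gc.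
  have r2 : 0 < r / 2 by rewrite divr_gt0.
  exists ([set t' | `|t' - t| < r / 2], [set dl | dl < r / 2]).
    split => /=; last exact: nbhs_right_lt.
    by apply/nbhs_ballP; exists (r / 2) => //= t'; rewrite /ball /= distrC.
  move=> [t' dl] /= [t't dlr] s sT t'T st.
  have H1 : enorm (g t' - g t) < e / 2.
    by apply: Hr => //; apply: (lt_trans t't); rewrite ltr_pdivrMr// ltr_pMr// ltr1n.
  have H2 : enorm (g s - g t) < e / 2.
    apply: Hr => //; apply: (le_lt_trans (ler_distD t' _ _)); rewrite (splitr r).
    by apply: ltr_leD; [exact: le_lt_trans dlr|exact: ltW].
  apply: (le_trans (enorm_dist3 _ (g t) _)); rewrite (splitr e) (enormBC (g t)).
  by rewrite lerD// ltW.
move=> [r /= r0 Hr]; exists (r / 2); first by rewrite divr_gt0.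
move=> s t sT tT st.
have r2 : r / 2 < r by rewrite ltr_pdivrMr// ltr_pMr// ltr1n.
have r20 : 0 < r / 2 by rewrite divr_gt0.
have := Hr (r / 2); rewrite /ball /= sub0r normrN gtr0_norm// => /(_ r2 r20 t).
by rewrite /= in_itv /=; exact.
Qed.

(** [prefix_close] for the one-element class of [g]: the cells containing a curve shrink to it,
    which gives the countability needed for supports. *)
Lemma cell_base g (V : set Gam) : nbhs g V -> exists n, cell (code n g) `<=` V.
Proof.
move=> /udist_nbhs[e e0 eV].
have [u0 _ [gc _]] := Gamma_solution T0 g.
have [M M0 HM] := within_continuous_bounded gc.
have [n nP] : exists n, forall c g' h, (n <= size c)%N -> [set g] g' -> cell c g' -> cell c h ->
    udist_le e g' h.
  apply: (@prefix_close [set g] M) => //; first by move=> g' t ->; exact: HM.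
  move=> e' /(uniformly_continuous_curve g)[dl dl0 H]; exists dl => // g' s t ->; exact: H.
exists n => h hc; apply: eV; apply: udist_leC.
by apply: (nP (code n g)) => //; [rewrite size_code|exact: cell_code].
Qed.

Lemma energy_class_prefix (c K : R) : 0 <= c -> forall e, 0 < e -> exists n, forall b g h,
  (n <= size b)%N -> energy_class c g -> enorm (g 0) <= K -> cell b g -> cell b h -> udist_le e g h.
Proof.
move=> cc e e0.
have [C C0 HC] := solution_energy_bound A B (ltW T0) cc.
have [D D0 HD] := solution_modulus A B (ltW T0) cc.
pose S := [set g : Gam | energy_class c g /\ enorm (g 0) <= K].
have [n nP] : exists n, forall b g h, (n <= size b)%N -> S g -> cell b g -> cell b h ->
    udist_le e g h.
  apply: (@prefix_close S (C * (1 + K))) => //.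
    move=> g t [[u [mu_ ue su]] gK] tT.
    apply: (le_trans (HC _ _ _ (Lp_control2P mu_ ue) ue su t tT)).
    by rewrite ler_wpM2l// lerD2l.
  move=> e' e'0.
  pose E := D * (1 + `|K|) + 1.
  have E0 : 0 < E by rewrite ltr_wpDl// mulr_ge0// addr_ge0.
  pose r := Num.min 1 (e' / E / 2).
  have r0 : 0 < r by rewrite lt_min ltr01 !divr_gt0.
  have r1 : r <= 1 by rewrite ge_min lexx.
  have rE : E * (r + r) <= e'.
    rewrite mulrC -ler_pdivlMr// -mulr2n -mulr_natr -ler_pdivlMr//.
    by rewrite ge_min lexx orbT.
  (* With the parameter [r] in [solution_modulus], the factor [(t - s) / r + r] is at most
     [r + r]. *)
  exists (r * r); first by rewrite mulr_gt0.
  move=> g s t Sg.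
  wlog st : s t / s <= t.
    move=> W; have [st|/ltW ts] := leP s t; first exact: W.
    by move=> sT tT; rewrite distrC enormBC; exact: W.
  case: Sg => -[u [mu_ ue su]] gK /andP[s0 sT] /andP[t0 tT].
  rewrite distrC ger0_norm ?subr_ge0// => tsr; rewrite enormBC.
  have rr : 0 < r <= 1 by rewrite r0.
  apply: (le_trans (HD _ _ _ (Lp_control2P mu_ ue) ue su s t r s0 st tT rr)).
  apply: le_trans rE; apply: ler_pM.
  - by rewrite mulr_ge0// addr_ge0 ?enorm_ge0.
  - by rewrite addr_ge0 ?divr_ge0 ?subr_ge0// ltW.
  - apply: (@le_trans _ _ (D * (1 + `|K|))); last by rewrite lerDl.
    by rewrite ler_wpM2l// lerD2l (le_trans gK)// ler_norm.
  - by rewrite lerD2r ler_pdivrMr.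
by exists n => b g h nb gc gK; exact: nP.
Qed.

(** The union of all null cells is a countable union, hence null. A point of [Q] outside it is in
    the support, since every neighbourhood contains one of its cells. *)
Lemma supp_exists (kappa : {measure set Gam -> \bar R}) (Q : set Gam) : measurable Q ->
  (0 < kappa Q)%E -> exists2 g, Q g & supp kappa g.
Proof.
move=> mQ kQ; apply: contrapT => H.
pose Z j : set Gam := if unpickle j is Some c then
  (if kappa (cell c) == 0%E then cell c else set0) else set0.
have Z0 : kappa.-negligible (\bigcup_j Z j).
  apply: negligible_bigcup => j; rewrite /Z; case: unpickle => [c|]; last exact: negligible_set0.
  case: ifP => [/eqP c0|_]; last exact: negligible_set0.
  by exists (cell c); split => //; exact: measurable_cell.
suff QZ : Q `<=` \bigcup_j Z j.
  by move: kQ; rewrite (measure_negligible mQ (negligibleS QZ Z0)) ltxx.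
move=> g Qg; apply: contrapT => gZ; apply: H; exists g => // V oV Vg.
have [n nV] := cell_base (open_nbhs_nbhs (conj oV Vg)).
rewrite lt0e measure_ge0 andbT; apply/eqP => V0; apply: gZ.
exists (pickle (code n g)) => //; rewrite /Z pickleK.
have -> : kappa (cell (code n g)) == 0%E.
  rewrite -measure_le0 -V0; apply: le_measure => //; rewrite inE; first exact: measurable_cell.
  exact: sub_sigma_algebra.
exact: cell_code.
Qed.

End gamma_topology.

(** * Couplings and the Wasserstein distance *)

Section as_probability.
Context d (X : measurableType d) (R : realType) (m : {measure set X -> \bar R}).
Hypothesis m1 : m setT = 1%E.

(** The proof of total mass 1 is an argument so that the probability structure can be attached to
    this alias of [m]. *)
Definition as_probability of m setT = 1%E : set X -> \bar R := m.

HB.instance Definition _ := isMeasure.Build _ _ _ (as_probability m1)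
  (measure0 m) (measure_ge0 m) (@measure_semi_sigma_additive _ _ _ m).

HB.instance Definition _ := Measure_isProbability.Build _ _ _ (as_probability m1) m1.

Lemma probability_of_measure : exists p : probability X R, forall S, p S = m S.
Proof. by exists (as_probability m1). Qed.

End as_probability.

Lemma pushforward_probability d d' (X : measurableType d) (Y : measurableType d') (R : realType)
    (P : probability X R) (f : X -> Y) : measurable_fun setT f ->
  exists2 m : probability Y R, (forall S, measurable S -> m S = P (f @^-1` S)) &
    forall h : Y -> \bar R, measurable_fun setT h -> (forall y, 0 <= h y)%E ->
      (\int[m]_y h y = \int[P]_x h (f x))%E.
Proof.
move=> mf; pose F : {mfun X >-> Y} := mfun_Sub (mem_set mf).
exists (distribution P F) => [S mS|h mh h0]; first by [].
by rewrite ge0_integral_distribution.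
Qed.

Lemma convex_combination d (X : measurableType d) (R : realType) (J : finType) (w : J -> R)
    (m : J -> probability X R) : (forall j, 0 <= w j) -> \sum_j w j = 1 ->
  exists2 p : probability X R, (forall S, p S = \sum_j (w j)%:E * m j S)%E &
    forall h : X -> \bar R, measurable_fun setT h -> (forall x, 0 <= h x)%E ->
      (\int[p]_x h x = \sum_j (w j)%:E * \int[m j]_x h x)%E.
Proof.
move=> w0 w1.
have [j0 _] : exists j0 : J, true.
  apply: contrapT => H; move: w1; rewrite big1; first by move/eqP; rewrite eq_sym oner_eq0.
  by move=> j; case: H; exists j.
pose e i := nth j0 (enum J) i.
have sumE (V : nmodType) (F : J -> V) : \sum_(i < #|J|) F (e i) = \sum_j F j.
  rewrite -(big_mkord xpredT (fun i => F (e i))) cardE.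
  by rewrite -(big_nth j0 xpredT F) big_enum.
pose s i : {measure set X -> \bar R} := mscale (NngNum (w0 (e i))) (m (e i)).
pose q : {measure set X -> \bar R} := msum s #|J|.
have qE S : (q S = \sum_j (w j)%:E * m j S)%E.
  by rewrite -(sumE _ (fun j => (w j)%:E * m j S)%E).
have q1 : q setT = 1%E.
  rewrite qE; under eq_bigr do rewrite probability_setT mule1.
  by rewrite sumEFin w1.
have [p pE] := probability_of_measure q1.
exists p => [S|h mh h0]; first by rewrite pE qE.
transitivity (\int[q]_x h x)%E; first by apply: eq_measure_integral => S _ _; rewrite -pE.
rewrite /q ge0_integral_measure_sum//.
rewrite -(sumE _ (fun j => (w j)%:E * \int[m j]_x h x)%E).
by apply: eq_bigr => i _; rewrite /s ge0_integral_mscale.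
Qed.

Section couplings.
Variables (R : realType) (n : nat).
Implicit Types m : probability 'cV[R]_n R.

Lemma measurable_enormB d (X : measurableType d) (f g : X -> 'cV[R]_n) (D : set X) :
  measurable D -> measurable_fun D f -> measurable_fun D g ->
  measurable_fun D (fun x => enorm (f x - g x)).
Proof.
move=> mD mf mg; apply: (@measurableT_comp _ _ _ _ _ _ (@enorm R n)); first exact: measurable_enorm.
apply: measurable_fun_mx => // i j.
rewrite (_ : (fun t => _) = (fun t => f t i j) \- (fun t => g t i j)); last first.
  by apply/funext => t; rewrite !mxE.
by apply: measurable_funB; exact: measurable_coord.
Qed.

(** The joint law of [f] and [g] is a coupling of the two images. *)
Lemma d1_pushforward d (X : measurableType d) (P : probability X R) (f g : X -> 'cV[R]_n) m m' :
  measurable_fun setT f -> measurable_fun setT g ->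
  (forall S, measurable S -> m S = P (f @^-1` S)) ->
  (forall S, measurable S -> m' S = P (g @^-1` S)) ->
  (d1 m m' <= \int[P]_x (enorm (f x - g x))%:E)%E.
Proof.
move=> mf mg mE mE'.
have mfg : measurable_fun setT (fun x => (f x, g x)) by exact: measurable_fun_pair.
have [p pE pI] := pushforward_probability P mfg.
rewrite -(pI (fun z => (enorm (z.1 - z.2))%:E)).
- apply: ereal_inf_lbound; exists p => // S mS.
  rewrite mE// mE'// !pE; [|exact: measurableX|exact: measurableX].
  by split; congr (P _); apply/seteqP; split => x /=; [case|split|case|split].
- by apply/measurable_EFinP; apply: measurable_enormB.
- by move=> z; rewrite lee_fin enorm_ge0.
Qed.

(** Coupling [q]: the common mass stays on the diagonal, and the surplus [a] is sent to the deficit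
    [b] by a normalised product. The mass moved is at most the l1 distance of the weights, over a
    distance at most [2 * M]. *)
Lemma d1_discrete (J : finType) (y : J -> 'cV[R]_n) (w w' : J -> R) (M : R) m m' :
  (forall j, 0 <= w j) -> (forall j, 0 <= w' j) -> \sum_j w j = 1 -> \sum_j w' j = 1 ->
  (forall j, enorm (y j) <= M) ->
  (forall S, measurable S -> m S = \sum_j (w j)%:E * \d_(y j) S)%E ->
  (forall S, measurable S -> m' S = \sum_j (w' j)%:E * \d_(y j) S)%E ->
  (d1 m m' <= (2 * M * \sum_j `|w j - w' j|)%:E)%E.
Proof.
move=> w0 w'0 w1 w'1 yM mE mE'.
pose a j := Num.max (w j - w' j) 0; pose b j := Num.max (w' j - w j) 0.
have a0 j : 0 <= a j by rewrite le_max lexx orbT.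
have b0 j : 0 <= b j by rewrite le_max lexx orbT.
have ab j : w j - w' j = a j - b j.
  by rewrite /a /b; case: (leP (w j - w' j) 0); case: (leP (w' j - w j) 0); lra.
pose D := \sum_j a j.
have Db : D = \sum_j b j.
  apply/eqP; rewrite -subr_eq0 -sumrB.
  by under eq_bigr do rewrite -ab; rewrite sumrB w1 w'1 subrr.
pose q (p : J * J) := Num.min (w p.1) (w' p.1) * (p.1 == p.2)%:R + a p.1 * b p.2 / D.
have D0 : 0 <= D by exact: sumr_ge0.
have q0 p : 0 <= q p.
  by rewrite addr_ge0 ?mulr_ge0 ?ler0n ?invr_ge0// le_min w0 w'0.
(* When [D = 0] every [a j] vanishes, so the convention for division by 0 does no harm. *)
have aD j : a j * D / D = a j.
  have [D0'|Dn] := eqVneq D 0; last by rewrite mulfK.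
  have /eqP := D0'; rewrite psumr_eq0// => /allP/(_ j); rewrite mem_index_enum => /(_ isT)/eqP->.
  by rewrite !mul0r.
have bD j : D * b j / D = b j.
  have [D0'|Dn] := eqVneq D 0; last by rewrite mulrAC mulfV// mul1r.
  have /eqP : \sum_j b j = 0 by rewrite -Db.
  rewrite psumr_eq0// => /allP/(_ j); rewrite mem_index_enum => /(_ isT)/eqP->.
  by rewrite mulr0 mul0r.
have wa j : Num.min (w j) (w' j) + a j = w j.
  by rewrite /a; case: (leP (w j) (w' j)); case: (leP (w j - w' j) 0); lra.
have wb j : Num.min (w j) (w' j) + b j = w' j.
  by rewrite /b; case: (leP (w j) (w' j)); case: (leP (w' j - w j) 0); lra.
have sum1 i : \sum_j q (i, j) = w i.
  rewrite big_split /= (bigD1 i)//= eqxx mulr1 big1 ?addr0; last first.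
    by move=> j ji; rewrite eq_sym (negbTE ji) mulr0.
  by rewrite -mulr_suml -mulr_sumr -Db aD wa.
have sum2 j : \sum_i q (i, j) = w' j.
  rewrite big_split /= (bigD1 j)//= eqxx mulr1 big1 ?addr0; last first.
    by move=> i ij; rewrite (negbTE ij) mulr0.
  by rewrite -mulr_suml -mulr_suml -/D bD wb.
have q1 : \sum_p q p = 1.
  by rewrite -(pair_bigA _ (fun i j => q (i, j))) /=; under eq_bigr do rewrite sum1.
have [p pE pI] := @convex_combination _ ('cV[R]_n * 'cV[R]_n)%type R _ q
  (fun p => \d_(y p.1, y p.2)) q0 q1.
apply: (@le_trans _ _ (\int[p]_z (enorm (z.1 - z.2))%:E)%E).
  apply: ereal_inf_lbound; exists p => // S mS; rewrite !pE mE// mE'//; split.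
    rewrite -(pair_bigA _ (fun i j => (q (i, j))%:E * \d_(y i, y j) (S `*` setT)))%E /=.
    apply: eq_bigr => i _; rewrite -sum1 -sumEFin ge0_sume_distrl; last by move=> j _; rewrite lee_fin.
    apply: eq_bigr => j _; congr (_ * _)%E; rewrite !diracE; congr ((nat_of_bool _)%:R%:E).
    by apply/idP/idP => /set_mem /=; [case => *; exact: mem_set|move=> ?; exact: mem_set].
  rewrite -(pair_bigA _ (fun i j => (q (i, j))%:E * \d_(y i, y j) (setT `*` S)))%E /= exchange_big /=.
  apply: eq_bigr => j _; rewrite -sum2 -sumEFin ge0_sume_distrl; last by move=> i _; rewrite lee_fin.
  apply: eq_bigr => i _; congr (_ * _)%E; rewrite !diracE; congr ((nat_of_bool _)%:R%:E).
  by apply/idP/idP => /set_mem /=; [case => *; exact: mem_set|move=> ?; exact: mem_set].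
rewrite pI; last 2 first.
- by apply/measurable_EFinP; apply: measurable_enormB.
- by move=> z; rewrite lee_fin enorm_ge0.
have me : measurable_fun setT (fun z : 'cV[R]_n * 'cV[R]_n => (enorm (z.1 - z.2))%:E).
  by apply/measurable_EFinP; apply: measurable_enormB.
under eq_bigr do rewrite integral_dirac// diracT mul1e -EFinM.
rewrite sumEFin lee_fin.
have M0 (j : J) : 0 <= M by exact: le_trans (enorm_ge0 _) (yM j).
apply: (@le_trans _ _ (\sum_(p : J * J) 2 * M * (a p.1 * b p.2 / D))).
  apply: ler_sum => -[i j] _ /=; rewrite /q /=.
  have [->|ij] := eqVneq i j.
    by rewrite subrr enorm0 mulr0 !mulr_ge0 ?invr_ge0 ?(M0 j).
  rewrite mulr0 add0r mulrC ler_wpM2r ?mulr_ge0 ?invr_ge0//.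
  by apply: (le_trans (enormB _ _)); rewrite (mulrDl 1 1) !mul1r lerD.
rewrite -mulr_sumr -(pair_bigA _ (fun i j => a i * b j / D)) /=.
under eq_bigr do rewrite -mulr_suml -mulr_sumr -Db aD.
have [j0|noJ] := pickP (fun _ : J => true); last first.
  by rewrite !big_pred0 ?mulr0// => j; have := noJ j.
rewrite ler_wpM2l ?mulr_ge0 ?(M0 j0)//; apply: ler_sum => j _.
by rewrite /a ge_max ler_norm normr_ge0.
Qed.

End couplings.

Lemma measure_partition d (X : measurableType d) (R : realType) (P : {measure set X -> \bar R})
    (J : finType) (f : X -> J) (E : set X) : measurable E ->
  (forall j, measurable [set x | f x = j]) ->
  (P E = \sum_j P (E `&` [set x | f x = j]))%E.
Proof.
move=> mE mf.
have H (s : seq J) : uniq s -> measurable (E `&` [set x | f x \in s]) /\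
    (P (E `&` [set x | f x \in s]) = \sum_(j <- s) P (E `&` [set x | f x = j]))%E.
  elim: s => [_|j s IH /= /andP[js /IH[mI PI]]].
    rewrite big_nil (_ : _ `&` _ = set0) ?measure0//.
    by apply/seteqP; split => x // [].
  have -> : E `&` [set x | f x \in j :: s] =
      (E `&` [set x | f x = j]) `|` (E `&` [set x | f x \in s]).
    apply/seteqP; split => x /=; rewrite inE.
      by move=> [Ex /orP[/eqP|]]; [left|right].
    by move=> [[Ex ->]|[Ex ->]]; rewrite ?eqxx ?orbT.
  have mj : measurable (E `&` [set x | f x = j]) by exact: measurableI.
  split; first exact: measurableU.
  rewrite big_cons -PI; apply: measureU => //.
  by apply/seteqP; split => x //= [[_ ->] [_]]; rewrite (negbTE js).
have [_ {1}<-] := H (index_enum J) (index_enum_uniq J).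
by congr (P _); apply/seteqP; split => x /=; [move=> Ex; rewrite mem_index_enum|case].
Qed.

Lemma integral_cst_probability d (X : measurableType d) (R : realType) (P : probability X R) (c : \bar R) :
  (\int[P]_x c = c)%E.
Proof.
transitivity (c * P setT)%E; last by rewrite probability_setT mule1.
exact: (integral_cst P measurableT c).
Qed.

(** * Moments and tails of the initial law *)

Section moments.
Variables (R : realType) (n : nat) (m0 : probability 'cV[R]_n R).

Lemma measurable_enorm_powR p : measurable_fun setT (fun x : 'cV[R]_n => enorm x `^ p).
Proof.
apply: (@measurableT_comp _ _ _ _ _ _ (fun z : R => z `^ p)); first exact: measurable_powR.
exact: measurable_enorm.
Qed.

(** The weight [1 + enorm x] is the one in the linear growth bounds for curves of bounded energy. *)
Definition tail (k : nat) (x : 'cV[R]_n) : R := if k%:R < enorm x then 1 + enorm x else 0.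

Lemma measurable_tail k : measurable_fun setT (tail k).
Proof.
apply: measurable_fun_ifT; last exact: measurable_cst.
  by apply: measurable_fun_ltr; [exact: measurable_cst|exact: measurable_enorm].
by apply: measurable_funD; [exact: measurable_cst|exact: measurable_enorm].
Qed.

Lemma Pspace_mono alpha : 1 <= alpha -> Pspace alpha m0 -> Pspace 1 m0.
Proof.
move=> a1; rewrite /Pspace /moment /= => H.
apply: (@le_lt_trans _ _ (\int[m0]_x (1 + (enorm x `^ alpha)%:E))%E).
  apply: le_integral_nonneg => // x _; first by rewrite lee_fin powR_ge0.
  rewrite -EFinD lee_fin powRr1 ?enorm_ge0//.
  have [x1|x1] := leP (enorm x) 1; first by rewrite (le_trans x1)// lerDl powR_ge0.
  apply: (@le_trans _ _ (enorm x `^ alpha)); last by rewrite lerDr.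
  by rewrite -{1}(powRr1 (enorm_ge0 x)) ler_powR// ltW.
rewrite ge0_integralD//; last 2 first.
- by move=> x _; rewrite lee_fin powR_ge0.
- apply/measurable_EFinP; exact: measurable_enorm_powR.
by rewrite integral_cst_probability lte_add_pinfty// ltry.
Qed.

Hypothesis P1 : Pspace 1 m0.

Lemma integrable_1enorm : m0.-integrable setT (EFin \o (fun x => 1 + enorm x)).
Proof.
apply/integrableP; split.
  by apply/measurable_EFinP; apply: measurable_funD; [exact: measurable_cst|exact: measurable_enorm].
apply: (@le_lt_trans _ _ (\int[m0]_x (1 + (enorm x `^ 1)%:E))%E).
  apply: le_integral_nonneg => // x _; rewrite /= ?abse_ge0// -EFinD lee_fin powRr1 ?enorm_ge0//.
  by rewrite ger0_norm// addr_ge0 ?enorm_ge0.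
rewrite ge0_integralD//; last 2 first.
- by move=> x _; rewrite lee_fin powR_ge0.
- apply/measurable_EFinP; exact: measurable_enorm_powR.
by rewrite integral_cst_probability lte_add_pinfty// ltry.
Qed.

Lemma tail_small e : 0 < e -> exists k, (\int[m0]_x (tail k x)%:E <= e%:E)%E.
Proof.
move=> e0.
have [] := @dominated_convergence _ _ _ m0 setT measurableT (fun k x => (tail k x)%:E)
  (cst 0%E) (EFin \o (fun x => 1 + enorm x)).
- by move=> k; apply/measurable_EFinP; exact: measurable_tail.
- exact: measurable_cst.
- apply: aeW => x _; apply: cvg_near_cst.
  exists (Num.truncn (enorm x)).+1 => // k /= xk; rewrite /tail ifF//.
  apply/negbTE; rewrite -leNgt; apply: (le_trans (ltW (truncnS_gt _))).
  by rewrite ler_nat.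
- exact: integrable_1enorm.
- apply: aeW => x k _ /=; rewrite lee_fin /tail.
  by case: ifP => _; rewrite ?normr0 ?ger0_norm ?addr_ge0 ?enorm_ge0.
move=> _ _; rewrite integral0 => /fine_cvgP[fin /cvgrPdist_le/(_ e e0) H].
have [k _ /(_ k (leqnn k))[]] : \forall k \near \oo,
   (\int[m0]_x (tail k x)%:E)%E \is a fin_num /\
   `|fine 0%E - fine (\int[m0]_x (tail k x)%:E)%E| <= e.
  by near=> k; split; near: k.
move=> fk; rewrite sub0r normrN => H'; exists k.
by rewrite -(fineK fk) lee_fin; apply: le_trans H'; exact: ler_norm.
Unshelve. all: by end_near.
Qed.

End moments.

Lemma double_lt_triple (R : realFieldType) (r : R) : 0 < r -> r + r < 3 * r.
Proof. by lra. Qed.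

Section represented_flows.
Variables (R : realType) (d k : nat) (T : R) (A : 'M[R]_d) (B : 'M[R]_(d, k)).
Hypothesis T0 : 0 < T.
Local Notation Gam := (Gamma T A B).
Variables (m0 : probability 'cV[R]_d R) (c : R).
Hypothesis P1 : Pspace 1 m0.
Hypothesis c_ge0 : 0 <= c.

(** A random curve [Y] with initial law [m0], bounded energy and time marginals [m]. It covers both
    a measure on curves ([Y = id]) and the limit object, whose probability space is the product of
    starting points and the unit interval. *)
Definition represents ds (X : measurableType ds) (P : probability X R) (Y : X -> Gam)
    (m : R -> probability 'cV[R]_d R) : Prop :=
  [/\ measurable_fun setT Y,
      forall S, measurable S -> P [set w | S (Y w 0)] = m0 S,
      {ae P, forall w, energy_class c (Y w)} &
      forall t S, measurable S -> m t S = P [set w | S (Y w t)]].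

Lemma measurable_eval ds (X : measurableType ds) (Y : X -> Gam) t :
  measurable_fun setT Y -> measurable_fun setT (fun w => Y w t).
Proof. by move=> mY; exact: (measurableT_comp (@measurable_evaluation R d k T A B t) mY). Qed.

Lemma integral_initial ds (X : measurableType ds) (P : probability X R) Y m (h : 'cV[R]_d -> R)
    (F : X -> R) :
  represents P Y m -> measurable_fun setT h -> (forall x, 0 <= h x) -> (forall w, 0 <= F w) ->
  {ae P, forall w, F w <= h (Y w 0)} -> (\int[P]_w (F w)%:E <= \int[m0]_x (h x)%:E)%E.
Proof.
move=> [mY P0 _ _] mh h0 F0 Fh.
have [q qE qI] := pushforward_probability P (measurable_eval 0 mY).
have -> : (\int[m0]_x (h x)%:E = \int[P]_w (h (Y w 0))%:E)%E.
  rewrite -(qI (fun x => (h x)%:E)).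
  - by apply: eq_measure_integral => S mS _; exact: etrans (esym (P0 S mS)) (esym (qE S mS)).
  - exact/measurable_EFinP.
  - by move=> x; rewrite lee_fin.
apply: le_integral_ae => //; [by move=> w _; rewrite lee_fin|by move=> w _; rewrite lee_fin|].
by have AF := ae_filter_ringOfSetsType P; apply: filterS Fh => w H _; rewrite lee_fin.
Qed.

Lemma integral_affine_initial (a : R) : 0 <= a ->
  exists2 M, 0 <= M & (\int[m0]_x (a * (1 + enorm x))%:E <= M%:E)%E.
Proof.
move=> a0; have i1 := integrable_1enorm P1.
pose M := \int[m0]_x (1 + enorm x).
have M0 : 0 <= M by apply: fine_ge0; apply: integral_ge0 => x _; rewrite lee_fin addr_ge0 ?enorm_ge0.
exists (a * M); first exact: mulr_ge0.
under eq_integral do rewrite EFinM.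
rewrite integralZl// EFinM /M /Rintegral fineK//; exact: integrable_fin_num.
Qed.

(** The marginals at times [s] and [t] are coupled by the curve itself; growth and modulus are
    linear in the starting point, so the finite first moment of [m0] controls both. *)
Lemma represents_flow ds (X : measurableType ds) (P : probability X R) Y m :
  represents P Y m -> flow T m.
Proof.
move=> rep; have [mY P0 Pc Pm] := rep.
have AF := ae_filter_ringOfSetsType P.
have [C C0 HC] := solution_energy_bound A B (ltW T0) c_ge0.
have [D D0 HD] := solution_modulus A B (ltW T0) c_ge0.
have mlin a : measurable_fun setT (fun x : 'cV[R]_d => a * (1 + enorm x)).
  apply: measurable_funM; first exact: measurable_cst.
  by apply: measurable_funD; [exact: measurable_cst|exact: measurable_enorm].
have lin0 a (x : 'cV[R]_d) : 0 <= a -> 0 <= a * (1 + enorm x).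
  by move=> a0; rewrite mulr_ge0// addr_ge0 ?enorm_ge0.
split=> [t tT|e e0].
  have [M M0 HM] := integral_affine_initial C0.
  apply: (@le_lt_trans _ _ M%:E); last exact: ltry.
  apply: le_trans HM.
  have [q qE qI] := pushforward_probability P (measurable_eval t mY).
  rewrite /moment (_ : (\int[m t]_x _ = \int[P]_w (enorm (Y w t) `^ 1)%:E)%E); last first.
    rewrite -(qI (fun x => (enorm x `^ 1)%:E)).
    - by apply: eq_measure_integral => S mS _; exact: etrans (Pm t S mS) (esym (qE S mS)).
    - by apply/measurable_EFinP; exact: measurable_enorm_powR.
    - by move=> x; rewrite lee_fin powR_ge0.
  apply: (integral_initial rep) => //.
  - by move=> x; exact: lin0.
  - by move=> w; rewrite powR_ge0.
  apply: filterS Pc => w [u [mu_ ue su]]; rewrite powRr1 ?enorm_ge0//.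
  exact: (HC _ _ _ (Lp_control2P mu_ ue) ue su t tT).
have [M M0 HM] := integral_affine_initial D0.
pose r := Num.min 1 (e / (M + 1) / 3).
have M1 : 0 < M + 1 by rewrite ltr_wpDl.
have r0 : 0 < r by rewrite lt_min ltr01 !divr_gt0.
have r1 : 0 < r <= 1 by rewrite r0 ge_min lexx.
have Mr : M * (r + r) < e.
  apply: (@lt_le_trans _ _ ((M + 1) * (3 * r))).
    apply: (@le_lt_trans _ _ ((M + 1) * (r + r))).
      by rewrite ler_wpM2r ?addr_ge0 ?ltW// ltrDl.
    by rewrite ltr_pM2l//; exact: double_lt_triple.
  rewrite mulrC -ler_pdivlMr// mulrC -ler_pdivlMr//.
  by rewrite ge_min lexx orbT.
exists (r * r); first by rewrite mulr_gt0.
move=> s t; wlog st : s t / s <= t.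
  move=> W; have [st|/ltW ts] := leP s t; first exact: W.
  move=> sT tT; rewrite distrC => /(W _ _ ts tT sT); apply: le_lt_trans.
  have mYs := measurable_eval s mY; have mYt := measurable_eval t mY.
  (* Symmetry of [d1], needed for the reduction to [s <= t]: swapping the factors turns couplings
     into couplings of the same cost. *)
  rewrite /d1; apply: le_ereal_inf => _ [p pc <-].
  have mswap : measurable_fun setT (fun z : 'cV[R]_d * 'cV[R]_d => (z.2, z.1)).
    exact: measurable_fun_pair.
  have [q qE qI] := pushforward_probability p mswap.
  exists q.
    move=> S mS; rewrite !qE; [|exact: measurableX|exact: measurableX].
    have [p1 p2] := pc S mS; split.
      by rewrite -p2; congr (p _); apply/seteqP; split => z /= [].
    by rewrite -p1; congr (p _); apply/seteqP; split => z /= [].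
  rewrite (qI (fun z => (enorm (z.1 - z.2))%:E)).
  - by apply: eq_integral => z _ /=; rewrite enormBC.
  - by apply/measurable_EFinP; apply: measurable_enormB.
  - by move=> z; rewrite lee_fin enorm_ge0.
move=> /andP[s0 sT] /andP[t0 tT]; rewrite distrC ger0_norm ?subr_ge0// => ts.
apply: (@le_lt_trans _ _ (\int[P]_w (enorm (Y w s - Y w t))%:E)%E).
  apply: d1_pushforward; [exact: measurable_eval|exact: measurable_eval| |].
    by move=> S mS; rewrite Pm.
  by move=> S mS; rewrite Pm.
have rr0 : 0 <= r + r by rewrite addr_ge0 ?ltW.
apply: (@le_lt_trans _ _ (\int[m0]_x ((r + r) * (D * (1 + enorm x)))%:E)%E).
  apply: (integral_initial rep).
  - by apply: measurable_funM; [exact: measurable_cst|exact: mlin].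
  - by move=> x; rewrite mulr_ge0// lin0.
  - by move=> w; rewrite enorm_ge0.
  apply: filterS Pc => w [u [mu_ ue su]]; rewrite enormBC.
  apply: (le_trans (HD _ _ _ (Lp_control2P mu_ ue) ue su s t r s0 st tT r1)).
  rewrite mulrC ler_wpM2r ?lin0// lerD2r ler_pdivrMr//; exact: ltW.
under eq_integral do rewrite EFinM.
rewrite ge0_integralZl_EFin//; last 2 first.
- by move=> x _; rewrite lee_fin lin0.
- by apply/measurable_EFinP; exact: mlin.
apply: (@le_lt_trans _ _ ((r + r)%:E * M%:E)%E); first by apply: lee_wpmul2l; rewrite ?lee_fin.
by rewrite -EFinM lte_fin mulrC.
Qed.

End represented_flows.

(** * Costs depend on finitely many cell masses *)

Lemma measurable_countably_valued d (X : measurableType d) (J : countType) (f : X -> J) :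
  (forall j, measurable [set x | f x = j]) -> forall S : set J, measurable [set x | S (f x)].
Proof.
move=> mf S; pose Z i := if unpickle i is Some j then
  (if `[< S j >] then [set x | f x = j] else set0) else set0.
rewrite (_ : [set _ | _] = \bigcup_i Z i).
  apply: bigcup_measurable => i _; rewrite /Z; case: unpickle => [j|]; last exact: measurable0.
  by case: ifP => _; [exact: mf|exact: measurable0].
apply/seteqP; split=> [x /= Sx|x [i _]].
  by exists (pickle (f x)) => //; rewrite /Z pickleK; case: asboolP.
by rewrite /Z; case: unpickle => [j|//]; case: asboolP => [Sj /= ->|//].
Qed.

Lemma partition_probability d (X : measurableType d) (R : realType) (P : probability X R)
    (J : finType) (f : X -> J) : (forall j, measurable [set x | f x = j]) ->
  \sum_j fine (P [set x | f x = j]) = 1.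
Proof.
move=> mf; have H := etrans (esym (measure_partition P measurableT mf)) (@probability_setT _ _ _ P).
apply: EFin_inj; rewrite -[RHS]H -sumEFin; apply: eq_bigr => j _.
by rewrite setTI fineK// fin_num_measure.
Qed.

Section coded_flows.
Variables (R : realType) (d k : nat) (T : R) (A : 'M[R]_d) (B : 'M[R]_(d, k)).
Hypothesis T0 : 0 < T.
Local Notation Gam := (Gamma T A B).
Variables (m0 : probability 'cV[R]_d R) (c : R).
Hypothesis P1 : Pspace 1 m0.
Hypothesis c_ge0 : 0 <= c.

(** The code is that of a curve [h] near [Y w], with the same start, and not of [Y w] itself: a
    limit of curves taken in cells need not lie in these cells. *)
Definition coded e n ds (X : measurableType ds) (P : probability X R) (Y : X -> Gam)
    (f : X -> n.-tuple bool) : Prop :=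
  (forall b, measurable [set w | f w = b]) /\
  {ae P, forall w, exists h : Gam,
    [/\ energy_class c h, h 0 = Y w 0, cell (f w) h & udist_le T e (Y w) h]}.

(** [Y w] is replaced by a fixed representative of its coded cell. For starts within [K] this costs
    [2 * e], one for the coding and one for the cell; larger starts cost at most [e] by the choice
    of the tail. *)
Lemma discretize e : 0 < e -> exists M n0, 0 <= M /\ forall n, (n0 <= n)%N ->
  exists y : n.-tuple bool -> Gam,
  (forall b t, 0 <= t <= T -> enorm (y b t) <= M) /\
  forall ds (X : measurableType ds) (P : probability X R) (Y : X -> Gam) m f,
  represents m0 c P Y m -> coded e P Y f ->
  forall t (md : probability 'cV[R]_d R), 0 <= t <= T ->
  (forall S, measurable S -> md S = \sum_b P [set w | f w = b] * \d_(y b t) S)%E ->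
  (d1 (m t) md <= (3 * e)%:E)%E.
Proof.
move=> e0.
have [C C0 HC] := solution_energy_bound A B (ltW T0) c_ge0.
have C1 : 0 < 2 * C + 1 by rewrite ltr_wpDl// mulr_ge0.
have [K HK] := tail_small P1 (divr_gt0 e0 C1).
have [n0 Hn0] := energy_class_prefix A B T0 K%:R c_ge0 e0.
exists (C * (1 + K%:R)), n0; split; first by rewrite mulr_ge0// addr_ge0.
move=> n nn.
pose Q b := [set h : Gam | [/\ energy_class c h, enorm (h 0) <= K%:R & cell b h]].
(* Cells without a suitable curve get the zero curve, which obeys the same bound; among starts
   within [K] they are almost surely not met. *)
pose y (b : n.-tuple bool) : Gam := xget point (Q b).
have bnd (h : Gam) t : energy_class c h -> 0 <= t <= T -> enorm (h t) <= C * (1 + enorm (h 0)).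
  by move=> [u [mu_ ue su]] tT; exact: (HC _ _ _ (Lp_control2P mu_ ue) ue su t tT).
have yM b t : 0 <= t <= T -> enorm (y b t) <= C * (1 + K%:R).
  move=> tT; rewrite /y; case: xgetP => [h _ [hc hK _]|_].
    by apply: (le_trans (bnd h t hc tT)); rewrite ler_wpM2l// lerD2l.
  have -> : (point : Gam) t = 0 by [].
  by rewrite enorm0 mulr_ge0// addr_ge0.
exists y; split => // ds X P Y m f rep [mf fY] t md tT mdE.
have [mY P0 Pc Pm] := rep.
have AF := ae_filter_ringOfSetsType P.
have myf : measurable_fun setT (fun w => y (f w) t).
  by move=> _ S mS; rewrite setTI; exact: (measurable_countably_valued mf [set b | S (y b t)]).
apply: (@le_trans _ _ (\int[P]_w (enorm (Y w t - y (f w) t))%:E)%E).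
  apply: d1_pushforward => //; first exact: measurable_eval.
    by move=> S mS; rewrite Pm.
  move=> S mS; rewrite mdE//.
  have mE : measurable [set w | S (y (f w) t)] by rewrite -[X in measurable X]setTI; exact: myf.
  rewrite (measure_partition P mE mf); apply: eq_bigr => b _; rewrite diracE.
  have [yS|yS] := boolP (y b t \in S).
    rewrite mule1; congr (P _); apply/seteqP; split=> w /=; last by case.
    by move=> fb; rewrite fb; split => //; exact: set_mem yS.
  rewrite mule0 (_ : _ `&` _ = set0) ?measure0//.
  by apply/seteqP; split=> w //= [+ fb]; rewrite fb => /mem_set; rewrite (negbTE yS).
pose h0 (x : 'cV[R]_d) := 2 * e + 2 * C * tail K x.
have tail0 (x : 'cV[R]_d) : 0 <= tail K x.
  by rewrite /tail; case: ifP => // _; rewrite addr_ge0 ?enorm_ge0.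
have mt := @measurable_tail R d K.
have e20 : 0 <= 2 * e by rewrite mulr_ge0// ltW.
have C20 : 0 <= 2 * C by rewrite mulr_ge0.
apply: (@le_trans _ _ (\int[m0]_x (h0 x)%:E)%E).
  apply: (integral_initial rep).
  - apply: measurable_funD; first exact: measurable_cst.
    by apply: measurable_funM => //; exact: measurable_cst.
  - by move=> x; rewrite addr_ge0// mulr_ge0.
  - by move=> w; rewrite enorm_ge0.
  apply: filterS2 Pc fY => w wc [h [hc h0E hf Yh]].
  rewrite /h0 /tail; case: ltP => [YK|YK].
    apply: (le_trans (enormB _ _)); apply: (@le_trans _ _ (2 * C * (1 + enorm (Y w 0)))).
      rewrite -mulrA (mulrDl 1 1) !mul1r; apply: lerD; first exact: bnd.
      by apply: (le_trans (yM _ _ tT)); rewrite ler_wpM2l// lerD2l ltW.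
    by rewrite lerDr.
  rewrite mulr0 addr0.
  have [yc yK yb] : Q (f w) (y (f w)).
    rewrite /y; case: xgetP => [//|/(_ h) H]; exfalso; apply: H.
    by split => //; rewrite h0E.
  have hy : udist_le T e h (y (f w)).
    by apply: (Hn0 (f w)) => //; [rewrite size_tuple|rewrite h0E].
  apply: (le_trans (enorm_dist3 _ (h t) _)); rewrite (mulrDl 1 1) !mul1r.
  by apply: lerD; [exact: Yh|exact: hy].
rewrite (eq_integral (fun x => ((2 * e)%:E + (2 * C)%:E * (tail K x)%:E)%E)); last first.
  by move=> x _; rewrite /h0 EFinD (EFinM (2 * C)).
rewrite ge0_integralD//; last 2 first.
- by move=> x _; apply: mule_ge0; rewrite lee_fin.
- by apply: measurable_funeM; exact/measurable_EFinP.
rewrite integral_cst_probability ge0_integralZl_EFin//; last 2 first.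
- by move=> x _; rewrite lee_fin.
- exact/measurable_EFinP.
apply: (@le_trans _ _ ((2 * e)%:E + (2 * C)%:E * (e / (2 * C + 1))%:E)%E).
  by apply: leeD2l; apply: lee_wpmul2l; rewrite ?lee_fin.
rewrite -EFinM -EFinD lee_fin (_ : 3 * e = 2 * e + e); last by ring.
rewrite lerD2l.
rewrite mulrCA ger_pMr// ler_pdivrMr// mul1r lerDl//.
Qed.

Variables (L : 'cV[R]_d -> 'cV[R]_k -> probability 'cV[R]_d R -> R)
  (G : 'cV[R]_d -> probability 'cV[R]_d R -> R).
Variables (c0 c1 c2 c3 lam : R).
Hypothesis Lt : tame L c0 c1 c2 c3 lam.
Hypothesis GC : forall eps : R, 0 < eps -> exists2 delta : R, 0 < delta &
  forall x y m m', Pspace 1 m -> Pspace 1 m' -> enorm (x - y) < delta ->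
    (d1 m m' < delta%:E)%E -> `|G x m - G y m'| < eps.

(** Both marginals are compared with discrete measures on the same representatives, whose distance
    is governed by the cell masses. The costs are compared along these three steps, each
    contributing [e / 3]. *)
Lemma coded_flows_close e : 0 < e -> exists r n0, 0 < r /\ forall n, (n0 <= n)%N ->
  exists2 dl, 0 < dl &
  forall ds (X : measurableType ds) (P : probability X R) (Y : X -> Gam) m f
    ds' (X' : measurableType ds') (P' : probability X' R) (Y' : X' -> Gam) m' f',
  represents m0 c P Y m -> coded r P Y (f : X -> n.-tuple bool) ->
  represents m0 c P' Y' m' -> coded r P' Y' (f' : X' -> n.-tuple bool) ->
  \sum_b `|fine (P [set w | f w = b]) - fine (P' [set w | f' w = b])| <= dl ->
  forall t, 0 <= t <= T ->
    (forall x u, `|L x u (m t) - L x u (m' t)| <= e) /\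
    (forall x, `|G x (m t) - G x (m' t)| <= e).
Proof.
move=> e0; have l0 := tame_lam Lt.
have e3 : 0 < e / 3 by rewrite divr_gt0.
have l1 : 0 < lam + 1 by rewrite ltr_wpDl.
have [g g0 Hg] := GC e3.
(* The first bound serves the Lipschitz dependence of [L]; the second stays strictly below the
   modulus [g] of [G]. *)
pose s := Num.min (e / 3 / (lam + 1)) (g / 2).
have s0 : 0 < s by rewrite lt_min !divr_gt0.
have sg : s < g.
  by apply: (@le_lt_trans _ _ (g / 2)); [rewrite ge_min lexx orbT|rewrite ltr_pdivrMr// ltr_pMr// ltr1n].
have ls : lam * s <= e / 3.
  apply: (@le_trans _ _ (lam * (e / 3 / (lam + 1)))).
    by rewrite ler_wpM2l// ge_min lexx.
  by rewrite mulrCA ger_pMr// ler_pdivrMr// mul1r lerDl.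
have s3 : 0 < s / 3 by rewrite divr_gt0.
have [M [n0 [M0 H]]] := discretize s3.
exists (s / 3), n0; split => // n nn; have [y [yM Hy]] := H n nn.
have M1 : 0 < 2 * M + 1 by rewrite ltr_wpDl// mulr_ge0.
exists (s / (2 * M + 1)); first by rewrite divr_gt0.
move=> ds X P Y m f ds' X' P' Y' m' f' rep cod rep' cod' close t tT.
have w0 (b : n.-tuple bool) : 0 <= fine (P [set w | f w = b]) by rewrite fine_ge0.
have w'0 (b : n.-tuple bool) : 0 <= fine (P' [set w | f' w = b]) by rewrite fine_ge0.
have finP b : (P [set w | f w = b] = (fine (P [set w | f w = b]))%:E)%E.
  by rewrite fineK// fin_num_measure//; exact: cod.1.
have finP' b : (P' [set w | f' w = b] = (fine (P' [set w | f' w = b]))%:E)%E.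
  by rewrite fineK// fin_num_measure//; exact: cod'.1.
have w1 := partition_probability P cod.1; have w'1 := partition_probability P' cod'.1.
have [md mdE mdI] := convex_combination (fun b => \d_(y b t)) w0 w1.
have [md' md'E md'I] := convex_combination (fun b => \d_(y b t)) w'0 w'1.
have D1 : (d1 (m t) md <= s%:E)%E.
  apply: le_trans (Hy _ _ _ _ _ _ rep cod t md tT _) _.
    by move=> S mS; rewrite mdE; apply: eq_bigr => b _; rewrite finP.
  by rewrite lee_fin mulrC divfK.
have D2 : (d1 (m' t) md' <= s%:E)%E.
  apply: le_trans (Hy _ _ _ _ _ _ rep' cod' t md' tT _) _.
    by move=> S mS; rewrite md'E; apply: eq_bigr => b _; rewrite finP'.
  by rewrite lee_fin mulrC divfK.
have D3 : (d1 md md' <= s%:E)%E.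
  apply: (le_trans (d1_discrete w0 w'0 w1 w'1 (fun b => yM b t tT) (fun S _ => mdE S) (fun S _ => md'E S))).
  rewrite lee_fin; apply: (@le_trans _ _ (2 * M * (s / (2 * M + 1)))).
    by rewrite ler_wpM2l// mulr_ge0.
  by rewrite mulrCA ger_pMr// ler_pdivrMr// mul1r lerDl.
have Pm : Pspace 1 (m t) by have [+ _] := represents_flow T0 P1 c_ge0 rep; apply.
have Pm' : Pspace 1 (m' t) by have [+ _] := represents_flow T0 P1 c_ge0 rep'; apply.
have Pd (q : probability 'cV[R]_d R) (w : n.-tuple bool -> R) : (forall h, measurable_fun setT h ->
    (forall x, 0 <= h x)%E -> (\int[q]_x h x = \sum_b (w b)%:E * \int[\d_(y b t)]_x h x)%E) -> Pspace 1 q.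
  have me : measurable_fun setT (fun x : 'cV[R]_d => (enorm x `^ 1)%:E).
    by apply/measurable_EFinP; exact: measurable_enorm_powR.
  move=> qI; rewrite /Pspace /= /moment qI.
  - rewrite (eq_bigr (fun b => (w b * enorm (y b t) `^ 1)%:E)); first by rewrite sumEFin ltry.
    by move=> b _; rewrite integral_dirac// diracT mul1e EFinM.
  - by apply/measurable_EFinP; exact: measurable_enorm_powR.
  - by move=> x; rewrite lee_fin powR_ge0.
have Pmd := Pd _ _ mdI; have Pmd' := Pd _ _ md'I.
have chain (a b b' a' z : R) : `|a - b| <= z -> `|b - b'| <= z -> `|a' - b'| <= z -> `|a - a'| <= z + z + z.
  move=> ab bb ab'; apply: (le_trans (ler_distD b' _ _)); rewrite (distrC b') lerD//.
  by apply: (le_trans (ler_distD b _ _)); rewrite lerD.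
have ee : e / 3 + e / 3 + e / 3 = e by field.
split=> [x u|x]; rewrite -ee.
  apply: (@chain _ (L x u md) (L x u md')).
  - by apply: le_trans ls; exact: (tame_close Lt).
  - by apply: le_trans ls; exact: (tame_close Lt).
  - by apply: le_trans ls; exact: (tame_close Lt).
have xx : enorm (x - x) < g by rewrite subrr enorm0.
have sgE : (s%:E < g%:E)%E by rewrite lte_fin.
apply: (@chain _ (G x md) (G x md')); apply/ltW/Hg => //; exact: le_lt_trans sgE.
Qed.

End coded_flows.

(** * Speeds *)

Section speed.
Variables (R : realType) (d k : nat) (T : R) (A : 'M[R]_d) (B : 'M[R]_(d, k)).
Hypothesis T0 : 0 < T.
Local Notation mu := (@lebesgue_measure R).
Local Notation I := (`[0, T]%classic : set R).
Local Notation Gam := (Gamma T A B).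

Lemma ae_neq (x : R) : {ae mu, forall t, t != x}.
Proof.
exists [set x]; split; [exact: measurable_set1|exact: lebesgue_measure_set1|].
by move=> t /= /negP; rewrite negbK => /eqP.
Qed.

Lemma energy_derive1 x u (g : R -> 'cV[R]_d) : vintegrable T u -> solution T A B x u g ->
  energy T (derive1 g) = energy T (rhs A B g u).
Proof.
move=> vu su; have AF := ae_filter_ringOfSetsType mu.
have E : {ae mu, forall t, I t -> derive1 g t = rhs A B g u t}.
  have H0 := ae_neq 0; have HT := ae_neq T.
  apply: filterS3 (solution_derive1 T0 vu su) H0 HT => t D t0 tT.
  rewrite /= in_itv /= => /andP[lo hi].
  have [] // := D _; first by rewrite !lt_neqAle eq_sym t0 lo tT.
  by move=> _ dE; rewrite derive1E.
apply/eqP; rewrite eq_le; apply/andP; split; apply: le_integral_ae => //.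
- by move=> t _; rewrite lee_fin sqr_ge0.
- by move=> t _; rewrite lee_fin sqr_ge0.
- by apply: filterS E => t H /H ->.
- by move=> t _; rewrite lee_fin sqr_ge0.
- by move=> t _; rewrite lee_fin sqr_ge0.
- by apply: filterS E => t H /H ->.
Qed.

Lemma energy_ge0 n (u : R -> 'cV[R]_n) : (0 <= energy T u)%E.
Proof. by apply: integral_ge0 => t _; rewrite lee_fin sqr_ge0. Qed.

Lemma speed_normE (g : Gam) : speed_norm g = (energy T (derive1 g) `^ 2^-1)%E.
Proof. by []. Qed.

Lemma speed_pow_ge (g : Gam) (alpha s : R) : 1 < alpha -> 0 <= s ->
  (energy T (derive1 g) <= (s ^+ 2)%:E)%E <-> (speed_norm g `^ alpha <= (s `^ alpha)%:E)%E.
Proof.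
move=> a1 s0; rewrite speed_normE; have := energy_ge0 (derive1 g).
have a0 : 0 < alpha by exact: lt_trans a1.
case: (energy T (derive1 g)) => [e| |] //; last first.
  by rewrite !poweRyr ?gt_eqF ?invr_gt0// !leye_eq.
rewrite /= !lee_fin => e0; rewrite powR12_sqrt//; split => H.
  apply: ge0_ler_powR; rewrite ?nnegrE ?sqrtr_ge0 ?(ltW a0)//.
  by rewrite -[leRHS]ger0_norm// -sqrtr_sqr ler_wsqrtr.
rewrite -[leLHS]sqr_sqrtr// ler_pXn2r ?nnegrE ?sqrtr_ge0//.
rewrite leNgt; apply/negP => lt; move: H; rewrite leNgt => /negP; apply.
by apply: gt0_ltr_powR; rewrite ?nnegrE ?sqrtr_ge0.
Qed.

Lemma displacement_le (alpha : R) : 1 < alpha -> exists2 K, 0 < K & forall (g : Gam) t, 0 <= t <= T ->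
  ((Num.max ((enorm (g t) - enorm (g 0)) / K - 2) 0)%:E <= speed_norm g `^ alpha)%E.
Proof.
move=> a1; pose K := d%:R * (T + 1) + 1.
have T1 : 0 <= T + 1 by rewrite addr_ge0// ltW.
have K0 : 0 < K by rewrite ltr_wpDl// mulr_ge0.
exists K => // g t tT.
have [u vu su] := Gamma_solution T0 g.
have [gc _] := su.
have vr := vintegrable_rhs A B gc vu.
have a0 : 0 < alpha by exact: lt_trans a1.
have := energy_ge0 (derive1 g).
case E : (energy T (derive1 g)) => [e| |] // e0; last first.
  by rewrite speed_normE E !poweRyr ?gt_eqF ?invr_gt0// leey.
rewrite lee_fin in e0.
have rE : (energy T (rhs A B g u) <= e%:E)%E by rewrite -(energy_derive1 vu su) E.
have rc := Lp_control2P vr.1 rE.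
have /andP[t0 tT'] := tT.
pose s := Num.sqrt e.
have s0 : 0 <= s by exact: sqrtr_ge0.
have ss : s ^+ 2 = e by rewrite sqr_sqrtr.
have es : 0 < (1 + s)^-1 by rewrite invr_gt0 ltr_pwDl.
have s1 : 0 < 1 + s by rewrite ltr_pwDl.
have H1 := integral_enorm_le rc rE (lexx 0) t0 tT' es.
have H2 : enorm (g t - g 0) <= d%:R * \int[mu]_(r in `[0, t]) enorm (rhs A B g u r).
  by rewrite (solution_increment vu su (lexx 0) t0 tT'); exact: (enorm_vint (lexx 0) tT' vr).
have H3 : enorm (g t) - enorm (g 0) <= K * (1 + s).
  rewrite lerBlDr; apply: (@le_trans _ _ (enorm (g t - g 0) + enorm (g 0))).
    by apply: le_trans (enormD _ _); rewrite subrK.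
  rewrite lerD2r; apply: (le_trans H2).
  apply: (@le_trans _ _ (d%:R * ((T + 1) * (1 + s)))); last first.
    by rewrite mulrA; apply: ler_wpM2r; [exact: ltW|rewrite lerDl].
  rewrite ler_wpM2l//; apply: (le_trans H1); rewrite subr0 invrK mulrDl mul1r; apply: lerD.
    by apply: ler_wpM2r => //; exact: ltW.
  rewrite mulrC ler_pdivrMr// -ss -expr2 ler_pXn2r ?nnegrE ?(ltW s1)//.
  by rewrite lerDr.
have sa : s <= 1 + s `^ alpha.
  have [s1'|s1'] := leP s 1; first by rewrite (le_trans s1')// lerDl powR_ge0.
  apply: (@le_trans _ _ (s `^ alpha)); last by rewrite lerDr.
  by rewrite -{1}(powRr1 s0) ler_powR// ltW.
have -> : (speed_norm g `^ alpha = (s `^ alpha)%:E)%E.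
  by rewrite speed_normE E /= powR12_sqrt.
rewrite lee_fin ge_max powR_ge0 andbT lerBlDr ler_pdivrMr//.
apply: (le_trans H3); rewrite mulrC; apply: ler_wpM2r; first exact: ltW.
by apply: (le_trans (lerD (lexx 1) sa)); rewrite addrA addrC.
Qed.

Variables (alpha : R) (m0 : probability 'cV[R]_d R) (r : R).
Hypothesis a1 : 1 < alpha.
Hypothesis Pm0 : Pspace alpha m0.

(** For a general [eta] no energy bound on the controls is available, so the first moment at time
    [t] is drawn from the speed constraint through [displacement_le]. *)
Lemma PGamma_Pspace1 eta : PGamma T A B alpha m0 r eta ->
  forall t, 0 <= t <= T -> Pspace 1 (time_marginal t eta).
Proof.
move=> [eS e0] t tT; have P1 := Pspace_mono (ltW a1) Pm0.
have [K K0 HK] := displacement_le a1.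
pose h (g : Gam) := Num.max ((enorm (g t) - enorm (g 0)) / K - 2) 0.
have me s : measurable_fun setT (fun g : Gam => enorm (g s)).
  exact: (measurableT_comp (@measurable_enorm R d) (@measurable_evaluation R d k T A B s)).
have mh : measurable_fun setT h.
  apply: measurable_maxr; last exact: measurable_cst.
  apply: measurable_funB; last exact: measurable_cst.
  apply: measurable_funM; last exact: measurable_cst.
  by apply: measurable_funB.
have h0 g : 0 <= h g by rewrite le_max lexx orbT.
have hr : (\int[eta]_g (h g)%:E <= r%:E)%E.
  by apply: le_trans eS; apply: le_integral_nonneg => // g _; [rewrite lee_fin|exact: HK].
have m1 : (\int[eta]_g (enorm ((g : Gam) 0))%:E < +oo)%E.
  apply: le_lt_trans P1; rewrite /moment.
  have [q qE qI] := pushforward_probability eta (@measurable_evaluation R d k T A B 0).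
  rewrite (_ : (\int[m0]_x _ = \int[eta]_g (enorm (evaluation 0 g) `^ 1)%:E)%E); last first.
    rewrite -(qI (fun x => (enorm x `^ 1)%:E)).
    - by apply: eq_measure_integral => S mS _; exact: etrans (esym (e0 S mS)) (esym (qE S mS)).
    - by apply/measurable_EFinP; exact: measurable_enorm_powR.
    - by move=> x; rewrite lee_fin powR_ge0.
  apply: le_integral_nonneg => // g _; first by rewrite lee_fin enorm_ge0.
  by rewrite lee_fin powRr1 ?enorm_ge0.
rewrite /Pspace /= /moment.
rewrite ge0_integral_distribution; last 2 first.
- by apply/measurable_EFinP; exact: measurable_enorm_powR.
- by move=> x; rewrite lee_fin powR_ge0.
apply: (@le_lt_trans _ _ (\int[eta]_g (((enorm ((g : Gam) 0))%:E + (K * 2)%:E) + K%:E * (h g)%:E))%E).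
  apply: le_integral_nonneg => // g _ /=; first by rewrite lee_fin powR_ge0.
  rewrite powRr1 ?enorm_ge0// -EFinM -!EFinD lee_fin -addrA -mulrDr -lerBlDl mulrC -ler_pdivrMr//.
  by rewrite -lerBlDl /h le_max lexx.
rewrite ge0_integralD//; last 4 first.
- by move=> g _; rewrite adde_ge0// lee_fin ?enorm_ge0// mulr_ge0// ltW.
- by apply/measurable_EFinP; apply: measurable_funD => //; exact: measurable_cst.
- by move=> g _; rewrite mule_ge0// lee_fin// ltW.
- by apply: measurable_funeM; exact/measurable_EFinP.
rewrite ge0_integralD//; last 3 first.
- by move=> g _; rewrite lee_fin enorm_ge0.
- by apply/measurable_EFinP.
- by move=> g _; rewrite lee_fin mulr_ge0// ltW.
rewrite integral_cst_probability ge0_integralZl_EFin//; last 3 first.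
- by move=> g _; rewrite lee_fin.
- exact/measurable_EFinP.
- exact: ltW.
apply: lte_add_pinfty; first by apply: lte_add_pinfty => //; exact: ltry.
apply: (@le_lt_trans _ _ (K%:E * r%:E)%E); last by rewrite -EFinM ltry.
by apply: lee_wpmul2l; rewrite ?lee_fin// ltW.
Qed.

End speed.

(** * Approximate equilibria *)

Lemma trunc_close (R : realType) (a b : R) : 0 <= a -> 0 <= b ->
  Num.truncn a = Num.truncn b -> `|a - b| <= 1.
Proof.
move=> /Num.Theory.truncn_itv/andP[al ah] /Num.Theory.truncn_itv/andP[bl bh] E.
rewrite E in al ah; rewrite -natr1 in ah; rewrite -natr1 in bh.
by rewrite ler_norml; lra.
Qed.

Section stages.
Variables (R : realType) (d k : nat) (T : R) (A : 'M[R]_d) (B : 'M[R]_(d, k)).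
Hypothesis T0 : 0 < T.
Local Notation Gam := (Gamma T A B).
Variables (L : 'cV[R]_d -> 'cV[R]_k -> probability 'cV[R]_d R -> R)
  (G : 'cV[R]_d -> probability 'cV[R]_d R -> R).
Variables (c0 c1 c2 c3 lam M : R).
Hypothesis Lt : tame L c0 c1 c2 c3 lam.
Hypothesis GM : forall x m, Pspace 1 m -> `|G x m| <= M.
Variables (alpha : R) (m0 : probability 'cV[R]_d R) (r : R).
Hypothesis a1 : 1 < alpha.
Hypothesis Pm0 : Pspace alpha m0.
Local Notation c := (energy_bound T c0 c2 c3 M).
Local Notation PG := (PGamma T A B alpha m0 r).

Definition concentrated : set (probability Gam R) :=
  [set eta | PG eta /\ eta (~` energy_class c) = 0%E].

Lemma concentrated_represents eta : concentrated eta ->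
  represents m0 c eta id (fun t => time_marginal t eta).
Proof.
move=> [[_ e0] ec]; split.
- exact: measurable_id.
- by move=> S mS; rewrite -(e0 S mS).
- exists (~` energy_class c); split => //; apply: measurableC; exact: measurable_energy_class.
- by [].
Qed.

Definition code_tuple n (g : Gam) : n.-tuple bool := Tuple (introT eqP (size_code n g)).

Lemma code_tupleP n g (b : n.-tuple bool) : code_tuple n g = b <-> cell b g.
Proof.
split=> [<-|/cell_codeP bE]; first exact: cell_code.
by apply: val_inj => /=; rewrite [RHS]bE size_tuple.
Qed.

Lemma concentrated_coded e n eta : 0 <= e -> concentrated eta ->
  coded c e eta id (code_tuple n : Gam -> n.-tuple bool).
Proof.
move=> e0 /concentrated_represents[_ _ ec _]; split.
  move=> b; rewrite (_ : [set _ | _] = cell b); first exact: measurable_cell.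
  by apply/seteqP; split => g /=; rewrite code_tupleP.
have AF := ae_filter_ringOfSetsType eta.
apply: filterS ec => g gc; exists g; split => //; first exact: cell_code.
by move=> t tT; rewrite subrr enorm0.
Qed.

Lemma kernel_null (nux : {measure set Gam -> \bar R}) (Q S : set Gam) :
  measurable Q -> supp nux `<=` S -> Q `&` S `<=` set0 -> nux Q = 0%E.
Proof.
move=> mQ nS QS; apply/eqP; rewrite eq_le measure_ge0 andbT leNgt; apply/negP => /(supp_exists T0 mQ)[g Qg sg].
exact: (QS g (conj Qg (nS g sg))).
Qed.

(** The energy bound for minimizers is uniform, so the values of [E] at all measures of [PG] live on
    one common class of curves. *)
Lemma Emap_concentrated eta nu : PG eta -> Emap T A B L G alpha m0 r eta nu -> concentrated nu.
Proof.
move=> eP [nP [nux [nE _] nS]]; split => //.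
have AF := ae_filter_ringOfSetsType m0.
have mc : measurable (~` energy_class c : set Gam) by apply: measurableC; exact: measurable_energy_class.
apply/eqP; rewrite eq_le measure_ge0 andbT nE//.
rewrite -[leRHS](@integral0 _ _ _ m0 setT); apply: le_integral_ae => //.
apply: filterS nS => x sx _; rewrite (kernel_null mc sx)// => g [gc go].
by apply: gc; case: (Gamma_opt_class T0 Lt GM (PGamma_Pspace1 T0 a1 Pm0 eP) go).
Qed.

Lemma concentrated_convex (J : finType) (w : J -> R) (nu : J -> probability Gam R) :
  (forall j, 0 <= w j) -> \sum_j w j = 1 -> (forall j, concentrated (nu j)) ->
  exists2 eta, concentrated eta & forall S, eta S = (\sum_j (w j)%:E * nu j S)%E.
Proof.
move=> w0 w1 nuc; have [eta eE eI] := convex_combination nu w0 w1; exists eta => //.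
split; [split|].
(* The convex combination is distributed over integrals of simple functions only, the speed itself
   possibly being nonmeasurable. *)
- apply: le_lower_integral => [g|h hs]; first exact: poweR_ge0.
  rewrite eI; last 2 first.
  + exact/measurable_EFinP.
  + by move=> g; rewrite lee_fin.
  apply: (@le_trans _ _ (\sum_j (w j)%:E * r%:E)%E).
    apply: lee_sum => j _; apply: lee_wpmul2l; rewrite ?lee_fin//.
    have [[+ _] _] := nuc j; apply: le_trans.
    by apply: le_integral_nonneg => // g _; rewrite lee_fin.
  rewrite (eq_bigr (fun j => (w j * r)%:E)); last by move=> j _; rewrite EFinM.
  by rewrite sumEFin -mulr_suml w1 mul1r.
- move=> S mS; have -> : time_marginal 0 eta S = (\sum_j (w j)%:E * time_marginal 0 (nu j) S)%E by exact: eE.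
  rewrite (eq_bigr (fun j => (w j)%:E * m0 S)%E); last first.
    by move=> j _; have [[_ H] _] := nuc j; congr (_ * _)%E; exact: H.
  rewrite -ge0_sume_distrl; last by move=> j _; rewrite lee_fin.
  by rewrite sumEFin w1 mul1e.
- by rewrite eE big1// => j _; have [_ ->] := nuc j; rewrite mule0.
Qed.

(* The only information about the approximate equilibrium [eta] that survives
   the passage to the limit: all curves selected by [P] have to be compatible
   with the cells charged by [eta]. *)
Definition selects n (dl : R) (eta : probability Gam R) : Prop :=
  forall P : 'cV[R]_d -> set Gam,
  (forall eta', concentrated eta' ->
     (forall b : n.-tuple bool, `|fine (eta (cell b : set Gam)) - fine (eta' (cell b : set Gam))| <= dl) ->
     forall x, Gamma_opt L G eta' x `<=` P x) ->
  forall b : seq bool, exists Z : set 'cV[R]_d,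
    [/\ measurable Z, [set x | ~ (P x `&` cell b !=set0)] `<=` Z &
        eta ([set g : Gam | Z (g 0)] `&` cell b) = 0%E].

Hypothesis hP : PG !=set0.
Hypothesis hE : forall eta, PG eta -> Emap T A B L G alpha m0 r eta !=set0.

Lemma fine_cell_itv (eta : probability Gam R) b : 0 <= fine (eta (cell b : set Gam)) <= 1.
Proof.
have mb := @measurable_cell R d k T A B b.
rewrite fine_ge0//= -lee_fin fineK ?fin_num_measure//; exact: probability_le1.
Qed.

Lemma measurable_initial (S : set 'cV[R]_d) : measurable S -> measurable [set g : Gam | S (g 0)].
Proof. by move=> mS; rewrite -[X in measurable X]setTI; exact: (@measurable_evaluation R d k T A B 0). Qed.

(** Measures are classified by their rounded level-[n] cell masses; each class gets a representative
    and one value of [E] there. [approximate_kakutani] mixes these values into an [eta] such that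
    every representative in use is [dl]-close to [eta]. Then [P] contains the curves optimal for
    each of them, and a cell missed by [P x] is null for every kernel in the mixture. *)
Lemma stage n dl : 0 < dl -> exists2 eta, concentrated eta & selects n dl eta.
Proof.
move=> dl0.
have [eta0 c_eta0] : exists eta0, concentrated eta0.
  by have [e1 e1P] := hP; have [e2 /(Emap_concentrated e1P)] := hE e1P; exists e2.
pose v (eta : probability Gam R) (b : n.-tuple bool) : R := fine (eta (cell b)).
pose N := Num.truncn (dl / 2)^-1.
pose I : finType := {ffun n.-tuple bool -> 'I_N.+2}.
pose key (eta : probability Gam R) : I := [ffun b => inord (Num.truncn (v eta b * N.+1%:R))].
have v01 eta b : 0 <= v eta b <= 1 by exact: fine_cell_itv.
have keyP eta eta' : key eta = key eta' -> forall b, `|v eta b - v eta' b| <= dl / 2.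
  move=> /ffunP kE b; have := congr1 val (kE b); rewrite !ffunE /=.
  have /andP[p0 p1] := v01 eta b; have /andP[q0 q1] := v01 eta' b.
  have N0 : 0 < N.+1%:R :> R by [].
  have lt_tr (z : R) : 0 <= z -> z <= 1 -> (Num.truncn (z * N.+1%:R) < N.+2)%N.
    move=> z0 z1; rewrite ltnS -(ler_nat R).
    have /Num.Theory.truncn_itv/andP[zl _] := mulr_ge0 z0 (ltW N0).
    by apply: (le_trans zl); rewrite ger_pMl.
  rewrite !inordK ?lt_tr// => E.
  have NE : N.+1%:R^-1 <= dl / 2.
    rewrite -[leRHS]invrK lef_pV2 ?posrE ?invr_gt0 ?divr_gt0//.
    exact: ltW (truncnS_gt _).
  apply: le_trans NE; rewrite -[leRHS]mul1r ler_pdivlMr// -[X in _ * X]ger0_norm ?ler0n// -normrM mulrBl.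
  by apply: trunc_close => //; rewrite mulr_ge0.
(* Classes that contain no concentrated measure get the default [eta0]; the implication says that
   the representative is genuine whenever the class is realised. *)
have /choice[rep repP] : forall i : I, exists eta, concentrated eta /\
    forall eta', concentrated eta' -> key eta' = i -> key eta = i.
  move=> i; have [[e [ec ei]]|H] := pselect (exists eta, concentrated eta /\ key eta = i).
    by exists e.
  by exists eta0; split => // e ec ei; case: H; exists e.
have /choice[nu nuP] : forall i : I, exists nu, Emap T A B L G alpha m0 r (rep i) nu.
  by move=> i; apply: hE; have [[]] := repP i.
have nuc i : concentrated (nu i).
  by apply: (Emap_concentrated _ (nuP i)); have [[]] := repP i.
have fin_cell (eta : probability Gam R) (b : seq bool) : eta (cell b) \is a fin_num.
  by apply: fin_num_measure; exact: measurable_cell.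
have w1 i b : `|v (nu i) b| <= 1.
  by have /andP[v0 v1] := v01 (nu i) b; rewrite ger0_norm.
have sumv (p : I -> R) (eta : probability Gam R) b : (forall S, eta S = \sum_j (p j)%:E * nu j S)%E ->
    \sum_j p j * v (nu j) b = v eta b.
  move=> eE; rewrite /v eE (eq_bigr (fun j => (p j * fine (nu j (cell b)))%:E)) ?sumEFin//.
  by move=> j _; rewrite EFinM fineK.
have net (p : I -> R) : (forall i, 0 <= p i) -> \sum_i p i = 1 ->
    exists i, forall b, `|\sum_j p j * v (nu j) b - v (rep i) b| <= dl / 2.
  move=> p0 p1; have [eta ec eE] := concentrated_convex p0 p1 nuc.
  exists (key eta) => b; rewrite (sumv _ _ _ eE).
  by apply: keyP; have [_ /(_ eta ec erefl)->] := repP (key eta).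
have dl2 : 0 < dl / 2 by rewrite divr_gt0.
have [p [p0 p1 pP]] := approximate_kakutani (key eta0) w1 net dl2.
have [eta ec eE] := concentrated_convex p0 p1 nuc.
exists eta => // P HP b.
have optP i : 0 < p i -> forall x, Gamma_opt L G (rep i) x `<=` P x.
  move=> pi0; apply: HP; first by have [] := repP i.
  by move=> b'; have := pP i pi0 b'; rewrite (sumv _ _ _ eE) -splitr.
have /choice[nux nuxP] : forall i, exists nux : R.-pker 'cV[R]_d ~> Gam,
    disintegration m0 (nu i) nux /\ {ae m0, forall x, supp (nux x) `<=` Gamma_opt L G (rep i) x}.
  by move=> i; have [_ [nux H1 H2]] := nuP i; exists nux.
have AF := ae_filter_ringOfSetsType m0.
have ae1 : {ae m0, forall x, forall i, supp (nux i x) `<=` Gamma_at x /\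
    supp (nux i x) `<=` Gamma_opt L G (rep i) x}.
  apply: (@filter_forall _ I (fun i x => supp (nux i x) `<=` Gamma_at x /\
    supp (nux i x) `<=` Gamma_opt L G (rep i) x)) => i.
  by have [[_ H1] H2] := nuxP i; apply: filterS2 H1 H2.
have [Nn [mN N0 NP]] := ae1.
have mb := @measurable_cell R d k T A B b.
(* Expressed through the kernels to be measurable, unlike the set of points whose [P x] misses the
   cell, which it contains up to the null set [Nn]. *)
pose Z1 := \bigcap_(i in [set i | 0 < p i]) [set x | nux i x (cell b) = 0%E].
have mZ1 : measurable Z1.
  apply: fin_bigcap_measurable => [|i _]; first exact: finite_finset.
  have /= := measurable_kernel (nux i) _ mb.
  move=> /(_ measurableT [set 0%E] (emeasurable_set1 _)); rewrite setTI => H.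
  exact: H.
have notN x : ~ Nn x -> forall i, supp (nux i x) `<=` Gamma_at x /\
    supp (nux i x) `<=` Gamma_opt L G (rep i) x.
  by move=> xN; apply: contrapT => H; apply: xN; exact: NP.
exists (Z1 `|` Nn); split.
- exact: measurableU.
- move=> x /= H; have [xN|xN] := pselect (Nn x); [by right|left] => i /= pi0.
  have [_ so] := notN x xN i.
  apply: (kernel_null mb so) => g [cg og]; apply: H; exists g; split => //; exact: (optP i pi0).
have mZ : measurable [set g : Gam | (Z1 `|` Nn) (g 0)].
  by apply: measurable_initial; exact: measurableU.
pose E : set Gam := [set g : Gam | (Z1 `|` Nn) (g 0)] `&` cell b.
have mE : measurable E by exact: measurableI.
rewrite -/E eE big1// => i _.
have [->|pi] := eqVneq (p i) 0; first by rewrite mul0e.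
have pi0 : 0 < p i by rewrite lt_neqAle eq_sym pi p0.
have [[nE _] _] := nuxP i; rewrite nE//.
suff -> : (\int[m0]_x nux i x E = 0)%E by rewrite mule0.
apply/eqP; rewrite eq_le integral_ge0 ?andbT//.
rewrite -[leRHS](@integral0 _ _ _ m0 setT); apply: le_integral_ae => //.
exists Nn; split => // x /= H; apply: contrapT => xN; apply: H => _.
have [sa so] := notN x xN i.
have [xZ|xZ] := pselect (Z1 x).
  have := xZ i pi0; rewrite /= => <-; apply: le_measure; rewrite ?inE//.
  by move=> g [].
rewrite (kernel_null mE sa)// => g [[Zg _] gx]; have {}gx : g 0 = x := gx.
by move: Zg => /=; rewrite gx => -[].
Qed.

End stages.

(** * Limit densities *)

Section dominated_additive.
Context d (X : measurableType d) (R : realType) (m0 : probability X R).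
Variable a : set X -> R.
Hypotheses (a0 : forall S, 0 <= a S)
  (aU : forall S S', measurable S -> measurable S' -> S `&` S' = set0 -> a (S `|` S') = a S + a S')
  (am0 : forall S, measurable S -> a S <= fine (m0 S)).

Definition additive_ext : set X -> \bar R := fun S => (a S)%:E.

Let a_set0 : additive_ext set0 = 0%E.
Proof.
rewrite /additive_ext; congr EFin; apply/eqP; rewrite eq_le a0 andbT.
by apply: (le_trans (am0 measurable0)); rewrite measure0.
Qed.

Let a_ge0 S : (0 <= additive_ext S)%E. Proof. by rewrite lee_fin. Qed.

(** Finite additivity suffices: the mass left outside the first [n] sets is at most that given by
    [m0] to a decreasing sequence with empty intersection. *)
Let a_sigma : semi_sigma_additive additive_ext.
Proof.
move=> F mF tF mUF; rewrite /additive_ext.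
pose SF n := \big[setU/set0]_(i < n) F i.
have mSF n : measurable (SF n) by exact: bigsetU_measurable.
have aSF n : \sum_(0 <= i < n) a (F i) = a (SF n).
  elim: n => [|n IH]; first by rewrite /SF big_ord0 big_geq//; have := a_set0; case=> ->.
  rewrite big_nat_recr//= IH /SF big_ord_recr /= aU//; first exact: mSF.
  apply/seteqP; split => x //=; rewrite -bigcup_mkord => -[[i /= ni Fi] Fn].
  by have := tF i n Logic.I Logic.I (ex_intro _ x (conj Fi Fn)) => E; rewrite E ltnn in ni.
have SFU n : SF n `<=` \bigcup_i F i.
  by rewrite /SF -bigcup_mkord => x [i _ Fi]; exists i.
under eq_fun do rewrite sumEFin aSF.
apply: cvg_EFin; first exact: nearW.
pose D n := (\bigcup_i F i) `\` SF n.
have mD n : measurable (D n) by exact: measurableD.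
have capD : \bigcap_n D n = set0.
  apply/seteqP; split => x // xD; have [[i _ Fi] _] := xD 0%N Logic.I.
  have [_] := xD i.+1 Logic.I; apply; rewrite /SF -bigcup_mkord; exists i => //=.
have cD : m0 \o D @ \oo --> m0 (\bigcap_n D n).
  apply: nonincreasing_cvg_mu => //.
  - by apply: (le_lt_trans (probability_le1 m0 (mD 0%N))); exact: ltry.
  - by rewrite capD.
  - move=> m n mn; apply/subsetPset => x [Ux nS]; split => // Sx; apply: nS.
    move: Sx; rewrite /SF -!bigcup_mkord => -[i /= im Fi]; exists i => //=; exact: leq_trans mn.
rewrite capD measure0 in cD.
have /fine_cvgP[_ /cvgrPdist_le cD'] := cD.
apply/cvgrPdist_le => e e0; have := cD' e e0; apply: filterS => n.
rewrite /= sub0r normrN => H.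
have -> : a (\bigcup_i F i) = a (SF n) + a (D n).
  rewrite -aU//.
    congr a; apply/seteqP; split=> [x Ux|x [/SFU//|[]//]].
    by have [?|?] := pselect (SF n x); [left|right].
  by apply/seteqP; split => x // [? []].
rewrite addrAC subrr add0r ger0_norm//.
by apply: (le_trans (am0 (mD n))); apply: le_trans H; exact: ler_norm.
Qed.

HB.instance Definition _ := isMeasure.Build _ _ _ additive_ext a_set0 a_ge0 a_sigma.

Let a_fin : fin_num_fun additive_ext. Proof. by []. Qed.

HB.instance Definition _ := Measure_isFinite.Build _ _ _ additive_ext a_fin.

Lemma dominated_density : exists g : X -> R, [/\ measurable_fun setT g, forall x, 0 <= g x &
  forall S, measurable S -> ((a S)%:E = \int[m0]_(x in S) (g x)%:E)%E].
Proof.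
have dom : additive_ext `<< m0.
  apply/null_content_dominatesP => S mS S0; rewrite /additive_ext; congr EFin.
  by apply/eqP; rewrite eq_le a0 andbT; apply: (le_trans (am0 mS)); rewrite S0.
have [f [f0 ff fi fE]] := radon_nikodym_sigma_finite dom.
exists (fine \o f); split.
- apply: measurableT_comp => //; exact: measurable_int fi.
- by move=> x /=; rewrite fine_ge0.
- move=> S mS; have /= := fE S mS; rewrite /additive_ext => ->.
  by apply: eq_integral => x _; rewrite /= fineK.
Qed.

End dominated_additive.

Lemma ae_forall_countable d (X : measurableType d) (R : realType)
    (m : {measure set X -> \bar R}) (J : countType) (Q : J -> X -> Prop) :
  (forall j, {ae m, forall x, Q j x}) -> {ae m, forall x, forall j, Q j x}.
Proof.
move=> H; pose F i := if unpickle i is Some j then ~` [set x | Q j x] else set0.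
have : m.-negligible (\bigcup_i F i).
  apply: negligible_bigcup => i; rewrite /F; case: unpickle => [j|]; last exact: negligible_set0.
  exact: H.
apply: negligibleS => x /= /existsNP[j xj]; exists (pickle j) => //.
by rewrite /F pickleK.
Qed.

(** The limit is the supremum of the levels exceeded on a set of [U]; for any higher level the
    ultrafilter contains the complement. *)
Lemma ultra_bounded_cvg (R : realType) (U : set_system nat) : UltraFilter U ->
  forall (f : nat -> R) (M : R), (forall k, 0 <= f k <= M) ->
  exists2 l : R, 0 <= l & f k @[k --> U] --> l.
Proof.
move=> UU f M fM; have PU : ProperFilter U by exact: ultra_proper.
pose S := [set t | U [set k | t <= f k]].
have S0 : S 0 by rewrite /S /=; apply: filterS filterT => k _ /=; case/andP: (fM k).
have SM : ubound S M.
  move=> t /= /filter_ex[k tk]; apply: le_trans tk _; by case/andP: (fM k).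
have hS : has_sup S by split; [exists 0|exists M].
exists (sup S); first by apply: ub_le_sup; [exact: hS.2|exact: S0].
apply/cvgrPdist_le => e e0.
have [t St ts] := sup_adherent e0 hS.
have H2 : U [set k | f k < sup S + e].
  have [H|] := in_ultra_setVsetC [set k | sup S + e <= f k] UU.
    have : sup S + e <= sup S by apply: ub_le_sup; [exact: hS.2|exact: H].
    by rewrite gerDl leNgt e0.
  by apply: filterS => k /= /negP; rewrite -ltNge.
apply: filterS2 St H2 => k /= tk ks.
by rewrite ler_distl lerBlDr (ltW ks) /= -lerBlDr (ltW (lt_le_trans ts tk)).
Qed.

Section limit_densities.
Context d (X : measurableType d) (R : realType) (m0 : probability X R).
Variables (U : set_system nat) (beta : nat -> set X -> seq bool -> R).
Hypotheses (UU : UltraFilter U)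
  (b0 : forall k S b, 0 <= beta k S b)
  (bnil : forall k S, measurable S -> beta k S [::] = fine (m0 S))
  (bsplit : forall k S b, measurable S ->
     beta k S b = beta k S (true :: b) + beta k S (false :: b))
  (bU : forall k S S' b, measurable S -> measurable S' -> S `&` S' = set0 ->
     beta k (S `|` S') b = beta k S b + beta k S' b).

Let beta_le k S b : measurable S -> beta k S b <= fine (m0 S).
Proof.
move=> mS; elim: b => [|[] b IH]; first by rewrite bnil.
  by apply: le_trans IH; rewrite [leRHS]bsplit// lerDl.
by apply: le_trans IH; rewrite [leRHS]bsplit// lerDr.
Qed.

Lemma limit_densities : exists g : seq bool -> X -> R,
  [/\ forall b, measurable_fun setT (g b), forall b x, 0 <= g b x, forall x, g [::] x = 1,
    forall b x, g b x = g (true :: b) x + g (false :: b) x &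
    forall S b, measurable S -> exists2 l : R, (l%:E = \int[m0]_(x in S) (g b x)%:E)%E &
      beta k S b @[k --> U] --> l].
Proof.
have PU : ProperFilter U by exact: ultra_proper.
have /choice[a aP] : forall Sb : set X * seq bool, exists l : R, 0 <= l /\
    (measurable Sb.1 -> beta k Sb.1 Sb.2 @[k --> U] --> l).
  move=> [S b] /=; have [mS|nS] := pselect (measurable S); last by exists 0.
  have [k|l l0 lc] := @ultra_bounded_cvg _ U UU (fun k => beta k S b) (fine (m0 S)).
    by rewrite b0 beta_le.
  by exists l.
have aS S b : measurable S -> beta k S b @[k --> U] --> a (S, b) by have [_] := aP (S, b).
have a_ge0 b S : 0 <= a (S, b) by have [] := aP (S, b).
have a_split S b : measurable S -> a (S, b) = a (S, true :: b) + a (S, false :: b).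
  move=> mS; apply: (cvg_unique _ (aS S b mS)) => //.
  rewrite (_ : (fun k => _) = (fun k => beta k S (true :: b) + beta k S (false :: b))).
    by apply: cvgD; exact: aS.
  by apply/funext => k; exact: bsplit.
have a_nil S : measurable S -> a (S, [::]) = fine (m0 S).
  move=> mS; apply: (cvg_unique _ (aS S [::] mS)) => //.
  rewrite (_ : (fun k => _) = cst (fine (m0 S))); first exact: cvg_cst.
  by apply/funext => k; exact: bnil.
have a_add b S S' : measurable S -> measurable S' -> S `&` S' = set0 ->
    a (S `|` S', b) = a (S, b) + a (S', b).
  move=> mS mS' SS; apply: (cvg_unique _ (aS _ b (measurableU _ _ mS mS'))) => //.
  rewrite (_ : (fun k => _) = (fun k => beta k S b + beta k S' b)).
    by apply: cvgD; exact: aS.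
  by apply/funext => k; exact: bU.
have a_le b S : measurable S -> a (S, b) <= fine (m0 S).
  move=> mS; elim: b => [|[] b IH]; first by rewrite a_nil.
    by apply: le_trans IH; rewrite [leRHS]a_split// lerDl.
  by apply: le_trans IH; rewrite [leRHS]a_split// lerDr.
have /choice[g gP] := fun b => dominated_density (a_ge0 b) (a_add b) (a_le b).
have mg b : measurable_fun setT (g b) by have [] := gP b.
have g0 b x : 0 <= g b x by have [] := gP b.
have gE b S : measurable S -> ((a (S, b))%:E = \int[m0]_(x in S) (g b x)%:E)%E.
  by have [_ _] := gP b; apply.
have AF := ae_filter_ringOfSetsType m0.
have mgE b : measurable_fun setT (EFin \o g b) by exact/measurable_EFinP.
have gi b : m0.-integrable setT (EFin \o g b).
  apply/integrableP; split => //.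
  apply: (@le_lt_trans _ _ (\int[m0]_x (g b x)%:E)%E); last by rewrite -gE// ltry.
  by apply: le_integral_nonneg => // x _ /=; rewrite ger0_norm.
have ae1 : {ae m0, forall x, g [::] x = 1}.
  have : ae_eq m0 setT (EFin \o g [::]) (EFin \o cst 1).
    apply: integral_ae_eq => //; first by apply/measurable_EFinP; exact: measurable_cst.
    move=> S _ mS; rewrite -gE// a_nil// fineK ?fin_num_measure//.
    rewrite (_ : EFin \o cst 1 = cst 1%E)// (integral_cst m0 mS 1%E) mul1e//.
  by apply: filterS => x /(_ Logic.I)[].
have ae2 : {ae m0, forall x, forall b, g b x = g (true :: b) x + g (false :: b) x}.
  apply: ae_forall_countable => b.
  have : ae_eq m0 setT (EFin \o g b) (EFin \o (g (true :: b) \+ g (false :: b))).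
    apply: integral_ae_eq => //.
      by apply/measurable_EFinP; exact: measurable_funD.
    move=> S _ mS; rewrite -gE// a_split// EFinD !gE// -ge0_integralD//.
    - by move=> x _; rewrite lee_fin.
    - by apply: measurable_funTS; exact: mgE.
    - by move=> x _; rewrite lee_fin.
    - by apply: measurable_funTS; exact: mgE.
  by apply: filterS => x /(_ Logic.I)[].
have [N [mN N0 NP]] : {ae m0, forall x, g [::] x = 1 /\ forall b, g b x = g (true :: b) x + g (false :: b) x}.
  by apply: filterS2 ae1 ae2.
(* On the exceptional null set the densities become those of the point mass at the all-[false] code,
   which satisfies both identities, so these hold everywhere. *)
pose dflt (b : seq bool) : R := if all negb b then 1 else 0.
pose g' b x := if x \in N then dflt b else g b x.
have NP' x : x \notin N -> g [::] x = 1 /\ forall b, g b x = g (true :: b) x + g (false :: b) x.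
  by move=> xN; apply: contrapT => H; move/negP: xN; apply; apply/mem_set; exact: NP.
have dflt0 b : 0 <= dflt b by rewrite /dflt; case: ifP.
have mg' b : measurable_fun setT (g' b).
  apply: measurable_fun_ifT => //.
  apply: (measurable_fun_bool true); rewrite setTI.
  by rewrite (_ : _ @^-1` _ = N)//; apply/seteqP; split=> x /=; [move=> /set_mem|move=> /mem_set].
exists g'; split.
- exact: mg'.
- by move=> b x; rewrite /g'; case: ifP.
- by move=> x; rewrite /g'; case: ifPn => // /NP'[].
- move=> b x; rewrite /g'; case: ifPn => [_|/NP'[_]]; last exact.
  by rewrite /dflt /= add0r.
move=> S b mS; exists (a (S, b)); last exact: aS.
rewrite gE//; apply: ae_eq_integral => //.
- by apply: measurable_funTS; exact: mgE.
- by apply: measurable_funTS; apply/measurable_EFinP; exact: mg'.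
exists N; split => // x /= H; apply: contrapT => xN; apply: H => _.
by rewrite /g' ifF//; apply/negbTE/negP => /set_mem.
Qed.

End limit_densities.

(** * Addresses in the unit interval *)

Section addresses.
Context d (X : measurableType d) (R : realType).
Variable g : seq bool -> X -> R.
Hypotheses (mg : forall b, measurable_fun setT (g b)) (g0 : forall b x, 0 <= g b x)
  (g1 : forall x, g [::] x = 1) (gs : forall b x, g b x = g (true :: b) x + g (false :: b) x).

(* The slot of [b] is [left_end b, left_end b + g b[; it is cut into the slot of
   [true :: b], on the left, and the slot of [false :: b]. *)
Fixpoint left_end (b : seq bool) (x : X) : R :=
  if b is c :: b' then left_end b' x + (if c then 0 else g (true :: b') x) else 0.

Definition in_slot (b : seq bool) (x : X) (z : R) : Prop :=
  left_end b x <= z < left_end b x + g b x.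

Fixpoint address n (x : X) (z : R) : seq bool :=
  if n is n'.+1 then
    let b := address n' x z in (z < left_end b x + g (true :: b) x) :: b
  else [::].

Lemma size_address n x z : size (address n x z) = n.
Proof. by elim: n => //= n ->. Qed.

Lemma slot_cons c b x z : in_slot (c :: b) x z -> in_slot b x z.
Proof.
have gt := g0 (true :: b) x; have gf := g0 (false :: b) x; rewrite /in_slot /= (gs b).
case: c => /andP[]; rewrite ?addr0 => lo hi; apply/andP; split => //.
- by apply: (lt_le_trans hi); rewrite addrA lerDl.
- by apply: le_trans lo; rewrite lerDl.
- by rewrite addrA.
Qed.

Lemma address_slot n x z : 0 <= z < 1 -> in_slot (address n x z) x z.
Proof.
move=> z01; elim: n => [|n]; first by rewrite /in_slot /= g1 add0r.
set b := address n x z; rewrite /in_slot /= -/b => /andP[lo hi].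
have [lt|ge] := ltP z (left_end b x + g (true :: b) x); first by rewrite addr0 lo.
by rewrite ge /= -addrA -gs.
Qed.

Lemma slot_address b x z : in_slot b x z -> b = address (size b) x z.
Proof.
elim: b => //= c b IH bz; rewrite -(IH (slot_cons bz)); congr (_ :: _).
move: bz; rewrite /in_slot /=; case: c; first by rewrite addr0 => /andP[_ ->].
by move=> /andP[lo _]; apply/esym/negbTE; rewrite -leNgt.
Qed.

Lemma slot_unit b x : 0 <= left_end b x /\ left_end b x + g b x <= 1.
Proof.
elim: b => [|c b [lo hi]] /=; first by rewrite g1 add0r.
have gt := g0 (true :: b) x; have gf := g0 (false :: b) x; move: hi; rewrite (gs b).
case: c; rewrite ?addr0 => hi; split => //.
- by apply: le_trans hi; rewrite addrA lerDl.
- by rewrite addr_ge0.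
- by rewrite -addrA.
Qed.

Lemma address_prefix n m x z : (n <= m)%N ->
  exists b, address m x z = b ++ address n x z.
Proof.
move=> /subnK<-; elim: (m - n)%N => [|j [b bE]]; first by exists [::].
by rewrite addSn /= bE; eexists (_ :: b).
Qed.

Lemma measurable_left_end b : measurable_fun setT (left_end b).
Proof.
elim: b => [|[] b IH] /=; first exact: measurable_cst.
  by apply: measurable_funD => //; exact: measurable_cst.
exact: measurable_funD.
Qed.

Lemma measurable_address n b :
  measurable [set xz : X * measurableTypeR R | address n xz.1 xz.2 = b].
Proof.
elim: n b => [|n IH] [|c b] /=.
- by rewrite (_ : [set _ | _] = setT); [exact: measurableT|apply/seteqP; split].
- by rewrite (_ : [set _ | _] = set0); [exact: measurable0|apply/seteqP; split].
- by rewrite (_ : [set _ | _] = set0); [exact: measurable0|apply/seteqP; split].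
have m1 : measurable_fun setT (fun xz : X * measurableTypeR R => left_end b xz.1 + g (true :: b) xz.1).
  apply: measurable_funD.
    by apply: (measurableT_comp (measurable_left_end b)); exact: measurable_fst.
  by apply: (measurableT_comp (mg (true :: b))); exact: measurable_fst.
have m2 : measurable_fun setT (fun xz : X * measurableTypeR R => xz.2) by exact: measurable_snd.
have := measurable_fun_ltr m2 m1; move=> /(_ measurableT [set c]) H.
rewrite (_ : [set _ | _] = [set xz | address n xz.1 xz.2 = b] `&`
    (setT `&` (fun xz : X * measurableTypeR R => xz.2 < left_end b xz.1 + g (true :: b) xz.1) @^-1` [set c])).
  by apply: measurableI => //; exact: H.
by apply/seteqP; split => xz /=; [case=> <- <-|case=> <- [_ <-]].
Qed.

End addresses.

Lemma exists_unit_uniform (R : realType) : exists2 P : probability (measurableTypeR R) R,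
  forall a b, 0 <= a -> a <= b -> b <= 1 -> P `[a, b[%classic = (b - a)%:E &
  P `[0, 1[%classic = 1%E.
Proof.
have m1 : mrestr (@lebesgue_measure R) (measurable_itv `[0, 1[) setT = 1%E.
  by rewrite /mrestr setTI lebesgue_measure_itv/= lte_fin ltr01 oppr0 adde0.
have [P PE] := probability_of_measure m1.
have H a b : 0 <= a -> a <= b -> b <= 1 -> P `[a, b[%classic = (b - a)%:E.
  move=> a0 ab b1.
  transitivity (@lebesgue_measure R (`[a, b[%classic `&` `[0, 1[%classic)); first exact: PE.
  rewrite setIidl; last first.
    move=> z /=; rewrite !in_itv /= => /andP[az zb].
    by rewrite (le_trans a0 az) (lt_le_trans zb b1).
  rewrite lebesgue_measure_itv/= lte_fin; case: ltP => // ba.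
  by rewrite (le_anti (introT andP (conj ab ba))) subrr.
by exists P => //; rewrite H// subr0.
Qed.

Section kernel_of_probabilities.
Context d d' (X : measurableType d) (Z : measurableType d') (R : realType).
Variable k : X -> probability Z R.
Hypothesis mk : forall U, measurable U -> measurable_fun setT (fun x => k x U).

Definition kernel_of of (forall U, measurable U -> measurable_fun setT (fun x => k x U)) :
  X -> {measure set Z -> \bar R} := k.

HB.instance Definition _ := isKernel.Build _ _ X Z R (kernel_of mk) mk.

Let kernel_of1 x : kernel_of mk x setT = 1%E. Proof. exact: probability_setT. Qed.

HB.instance Definition _ := Kernel_isProbability.Build _ _ X Z R (kernel_of mk) kernel_of1.

Lemma exists_kernel : exists K : R.-pker X ~> Z, forall x, K x = k x :> {measure set Z -> \bar R}.
Proof. by exists (kernel_of mk). Qed.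

End kernel_of_probabilities.

(** Building [q] as the image of a product measure yields its disintegration explicitly: [K x] is
    the law of [f (x, y)] for random [y]. *)
Lemma section_kernel d1 d2 d3 (X : measurableType d1) (Y : measurableType d2)
    (Z : measurableType d3) (R : realType) (m0 : probability X R) (P : probability Y R)
    (f : X * Y -> Z) : measurable_fun setT f ->
  exists2 K : R.-pker X ~> Z, forall x U, measurable U -> K x U = P [set y | U (f (x, y))] &
    exists2 Q : probability (X * Y)%type R,
      forall S, measurable S -> Q S = (\int[m0]_x P [set y | S (x, y)])%E &
      exists2 q : probability Z R, forall U, measurable U -> q U = Q (f @^-1` U) &
        forall U, measurable U -> q U = (\int[m0]_x K x U)%E.
Proof.
move=> mf.
have mfx x : measurable_fun setT (fun y => f (x, y)).
  by apply: (measurableT_comp mf); exact: measurable_pair1.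
have /choice[k kP] : forall x, exists q : probability Z R,
    forall U, measurable U -> q U = P [set y | U (f (x, y))].
  by move=> x; have [q qE _] := pushforward_probability P (mfx x); exists q.
have secE U x : xsection (f @^-1` U) x = [set y | U (f (x, y))].
  by apply/seteqP; split => y; rewrite /xsection /= inE.
have mU U : measurable U -> measurable (f @^-1` U).
  by move=> mU; rewrite -[X in measurable X]setTI; exact: mf.
have mk U : measurable U -> measurable_fun setT (fun x => k x U).
  move=> mU'; have := measurable_fun_xsection P (mU U mU').
  rewrite (_ : P \o _ = fun x => k x U)//; apply/funext => x.
  by rewrite /= secE kP.
have [K KE] := exists_kernel mk.
have KP x U : measurable U -> K x U = P [set y | U (f (x, y))] by rewrite KE; exact: kP.
exists K => //.
pose Q0 : {measure set (X * Y)%type -> \bar R} := (m0 \x P)%E.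
have Q1 : Q0 setT = 1%E by exact: probability_setT.
have [Q QE] := probability_of_measure Q1.
have QE' S : measurable S -> Q S = (\int[m0]_x P [set y | S (x, y)])%E.
  move=> mS; rewrite QE /Q0 /= /product_measure1; apply: eq_integral => x _ /=.
  by congr (P _); apply/seteqP; split => y; rewrite /xsection /= inE.
exists Q => //.
have [q qE _] := pushforward_probability Q mf.
exists q => [//|U mU'].
rewrite qE// QE'; last exact: mU.
by apply: eq_integral => x _; rewrite KP.
Qed.

(** * Limit curves *)

Section limit_curve.
Variables (R : realType) (d k : nat) (T : R) (A : 'M[R]_d) (B : 'M[R]_(d, k)).
Hypothesis T0 : 0 < T.
Local Notation Gam := (Gamma T A B).
Variable c : R.
Hypothesis c_ge0 : 0 <= c.

Lemma energy_class_complete (x : 'cV[R]_d) (h : nat -> Gam) :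
  (forall n, energy_class c (h n) /\ h n 0 = x) ->
  (forall n m, (n <= m)%N -> udist_le T (1 / 2 ^+ n) (h n) (h m)) ->
  exists2 f : Gam, energy_class c f /\ f 0 = x & forall n, udist_le T (d%:R * 2 / 2 ^+ n) (h n) f.
Proof.
move=> hc hn.
have /choice[l lP] : forall ti : R * 'I_d, exists l : R,
    0 <= ti.1 <= T -> forall n, `|h n ti.1 ti.2 0 - l| <= 2 * 1 / 2 ^+ n.
  move=> [t i] /=.
  have [tT|tT] := boolP (0 <= t <= T); last by exists 0.
  have [n|l lP] := @geometric_cvg R (fun n => h n t i 0) 1 ler01; last by exists l.
  apply: le_trans (hn n n.+1 (leqnSn n) t tT).
  by rewrite distrC; have := entry_le_enorm (h n t - h n.+1 t) i; rewrite !mxE.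
have [r rE] : exists r : nat -> R, forall n, r n = d%:R * 2 / 2 ^+ n.
  by exists (fun n => d%:R * 2 / 2 ^+ n).
have [f hf] : exists f : R -> 'cV[R]_d, forall n, udist_le T (r n) (h n) f.
  exists (fun t => \col_i l (t, i)) => n t tT; rewrite rE; apply: (le_trans (enorm_le_sum _)).
  rewrite -mulrA -[X in X%:R * _]card_ord -sum1_card natr_sum mulr_suml.
  by apply: ler_sum => i _; rewrite mul1r !mxE; have := lP (t, i) tT n; rewrite mulr1.
have small (e : R) : 0 < e -> exists n : nat, r n < e.
  by move=> e0; have [n ne] := @geometric_small R (d%:R * 2) e e0; exists n; rewrite rE.
have TT : (0:R) <= 0 <= T by rewrite lexx ltW.
have [e e0|g gc gf] := @energy_class_limit _ _ _ _ A B T0 c f.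
  have [n ne] := small e e0; exists (h n); first by case: (hc n).
  by move=> t tT; apply: (le_trans (hf n t tT)); exact: ltW.
exists g; last by move=> n t tT; rewrite -rE gf//; exact: hf.
split => //; rewrite gf//; apply/eqP; rewrite -subr_eq0; apply/eqP.
apply: enorm_eq0; apply/eqP; rewrite eq_le enorm_ge0 andbT; apply/ler_addgt0Pr => e e0.
have [n ne] := small e e0; rewrite add0r enormBC; have [_ <-] := hc n.
by apply: (le_trans (hf n 0 TT)); exact: ltW.
Qed.

Variable g : seq bool -> 'cV[R]_d -> R.
Hypotheses (mg : forall b, measurable_fun setT (g b)) (g0 : forall b x, 0 <= g b x)
  (g1 : forall x, g [::] x = 1) (gs : forall b x, g b x = g (true :: b) x + g (false :: b) x).
Variable E : set 'cV[R]_d.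
Hypothesis mE : measurable E.
Hypothesis EP : forall x b, E x -> 0 < g b x ->
  exists h : Gam, [/\ energy_class c h, h 0 = x & cell b h].

Lemma slot_gt0 b x z : in_slot g b x z -> 0 < g b x.
Proof. by move=> /andP[lo hi]; have := le_lt_trans lo hi; rewrite ltrDl. Qed.

Lemma cell_cat (b b' : seq bool) : cell (b' ++ b) `<=` (cell b : set Gam).
Proof. by elim: b' => //= a b' IH h [+ _]; exact: IH. Qed.

(** Convergence is required of all curves in the address cells, not of one chosen sequence; this
    fixes the limit and frees later arguments from the choice of representatives. *)
Definition limit_curve (x : 'cV[R]_d) (z : R) (h : Gam) : Prop :=
  [/\ energy_class c h, h 0 = x &
  forall e, 0 < e -> exists N, forall n, (N <= n)%N -> forall h' : Gam,
    cell (address g n x z) h' -> udist_le T e h h'].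

Lemma limit_curve_exists x z : E x -> 0 <= z < 1 -> exists h, limit_curve x z h.
Proof.
move=> Ex z01.
have slot n := address_slot g1 gs n x z01.
have /choice[h hP] : forall n, exists h : Gam, [/\ energy_class c h, h 0 = x & cell (address g n x z) h].
  by move=> n; apply: EP => //; exact: slot_gt0 (slot n).
have pre e : 0 < e -> exists N, forall n, (N <= n)%N -> forall h' : Gam,
    cell (address g n x z) h' -> udist_le T e (h n) h'.
  move=> e0; have [N NP] := energy_class_prefix A B T0 (enorm x) c_ge0 e0.
  exists N => n Nn h' h'c; have [hc hx hn] := hP n.
  by apply: (NP (address g n x z)) => //; [rewrite size_address|rewrite hx].
have nest n m h' : (n <= m)%N -> cell (address g m x z) h' -> cell (address g n x z) (h' : Gam).
  by move=> nm; have [b ->] := address_prefix g x z nm; exact: cell_cat.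
have /choice[N NP] : forall j : nat, exists N, forall n, (N <= n)%N -> forall h' : Gam,
    cell (address g n x z) h' -> udist_le T (1 / 2 ^+ j) (h n) h'.
  by move=> j; apply: pre; rewrite divr_gt0 ?exprn_gt0.
(* A monotone choice of depths, so that the selected curves are Cauchy at rate [2^-j]. *)
pose M j := (\sum_(i < j.+1) N i)%N.
have NM j : (N j <= M j)%N by rewrite /M big_ord_recr leq_addl.
have Mm i j : (i <= j)%N -> (M i <= M j)%N.
  move=> /subnK<-; elim: (j - i)%N => // a IH; apply: (leq_trans IH).
  by rewrite addSn /M [X in (_ <= X)%N]big_ord_recr leq_addr.
have [n|n m nm|f [fc fx] hf] := @energy_class_complete x (fun j => h (M j)).
- by have [] := hP (M n).
- apply: (NP n (M n) (NM n)); apply: nest (Mm _ _ nm) _; by have [] := hP (M m).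
exists f; split => // e e0.
have e2 : 0 < e / 2 by rewrite divr_gt0.
have [j1 Hj1] := @geometric_small R (d%:R * 2) _ e2.
have [j2 Hj2] := @geometric_small R 1 _ e2.
pose j := maxn j1 j2.
have mono (C : R) i : 0 <= C -> (i <= j)%N -> C / 2 ^+ j <= C / 2 ^+ i.
  by move=> C0 ij; rewrite ler_wpM2l// lef_pV2 ?posrE ?exprn_gt0// ler_weXn2l ?ler1n.
exists (M j) => n Mn h' h'c.
have H1 : udist_le T (e / 2) f (h (M j)).
  apply: udist_leC; apply: udist_le_weak (hf j).
  by apply: le_trans (ltW Hj1); apply: mono; [rewrite mulr_ge0|exact: leq_maxl].
have H2 : udist_le T (e / 2) (h (M j)) h'.
  have H : udist_le T (1 / 2 ^+ j) (h (M j)) h'.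
    by apply: (NP j (M j) (NM j)); exact: nest Mn h'c.
  apply: udist_le_weak H.
  by apply: le_trans (ltW Hj2); apply: mono => //; exact: leq_maxr.
by rewrite (splitr e); exact: udist_le_trans H1 H2.
Qed.

Definition limit_domain : set ('cV[R]_d * measurableTypeR R) :=
  [set xz | E xz.1 /\ 0 <= xz.2 < 1].

Definition psi (xz : 'cV[R]_d * measurableTypeR R) : Gam :=
  xget point [set h | limit_domain xz /\ limit_curve xz.1 xz.2 h].

Lemma psiP x z : E x -> 0 <= z < 1 -> limit_curve x z (psi (x, z)).
Proof.
move=> Ex z01; rewrite /psi; case: xgetP => [h _ []//|H].
have [h hP] := limit_curve_exists Ex z01.
by exfalso; apply: (H h).
Qed.

Lemma psi_out xz : ~ limit_domain xz -> psi xz = point.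
Proof. by move=> nd; rewrite /psi; case: xgetP => // h _ []. Qed.

Lemma measurable_limit_domain : measurable limit_domain.
Proof.
rewrite (_ : limit_domain = E `*` `[0, 1[%classic); first exact: measurableX.
by apply/seteqP; split => xz /=; rewrite in_itv.
Qed.

(** [psi] is picked by choice, but on the domain it is the limit of representatives of the address
    cells, which take countably many values. Membership in an open [V] becomes a countable
    condition: for some [m], eventually the representative lies in [V] with margin [m.+1%:R^-1]. *)
Lemma measurable_psi : measurable_fun setT psi.
Proof.
pose ad n (xz : 'cV[R]_d * measurableTypeR R) := address g n xz.1 xz.2.
have mad n W : measurable [set xz | W (ad n xz)].
  apply: (measurable_countably_valued (f := ad n)) => b.
  exact: measurable_address.
pose rep b : Gam := xget point (cell b).
apply: (measurability (@open Gam)) => // _ [V oV <-]; rewrite setTI.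
pose Vm (m : nat) := [set h : Gam | forall h' : Gam, udist_le T m.+1%:R^-1 h' h -> V h'].
pose S := \bigcup_m \bigcup_N \bigcap_(n in [set n | (N <= n)%N]) [set xz | Vm m (rep (ad n xz))].
have mS : measurable S.
  apply: bigcup_measurable => m _; apply: bigcup_measurable => N _.
  by apply: bigcap_measurable => [|n _]; [exists N => /=|exact: (mad n (fun b => Vm m (rep b)))].
rewrite (_ : psi @^-1` V = (limit_domain `&` S) `|` (if `[< V point >] then ~` limit_domain else set0)).
  apply: measurableU.
    by apply: measurableI => //; exact: measurable_limit_domain.
  case: asboolP => _; last exact: measurable0.
  by apply: measurableC; exact: measurable_limit_domain.
have inS x z : limit_domain (x, z) -> S (x, z) <-> V (psi (x, z)).
  move=> [/= Ex z01]; have [pc px pl] := psiP Ex z01.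
  have repP e : 0 < e -> exists N, forall n, (N <= n)%N -> udist_le T e (psi (x, z)) (rep (ad n (x, z))).
    move=> /pl[N NP]; exists N => n Nn; apply: NP Nn _ _; rewrite /rep; case: xgetP => //.
    have [h [_ _ hc]] := EP Ex (slot_gt0 (address_slot g1 gs n x z01)).
    by move=> /(_ h).
  split.
    move=> [m _ [N _ H]]; have m0 : 0 < m.+1%:R^-1 :> R by rewrite invr_gt0.
    have [N' HN'] := repP _ m0.
    exact: (H (maxn N N') (leq_maxl _ _)) (HN' _ (leq_maxr _ _)).
  move=> Vp; have [e e0 He] := udist_nbhs (open_nbhs_nbhs (conj oV Vp)).
  have e2 : 0 < e / 2 by rewrite divr_gt0.
  have [N HN] := repP _ e2.
  exists (Num.truncn (e / 2)^-1) => //; exists N => // n /= Nn h' hh.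
  have H1 : udist_le T (e / 2) h' (rep (ad n (x, z))).
    apply: udist_le_weak hh; rewrite -[leRHS]invrK lef_pV2 ?posrE ?invr_gt0//.
    exact: ltW (truncnS_gt _).
  apply: He; rewrite (splitr e); apply: udist_le_trans H1 _.
  by apply: udist_leC; exact: HN.
apply/seteqP; split => -[x z] /=.
  move=> Vp; have [D|D] := pselect (limit_domain (x, z)).
    by left; split => //; apply/inS.
  by right; move: Vp; rewrite psi_out// => Vp; case: asboolP.
move=> [[D /inS]|]; first exact.
by case: asboolP => // Vp D; rewrite psi_out.
Qed.

End limit_curve.

Lemma integral_finite_valued d (X : measurableType d) (R : realType) (P : {measure set X -> \bar R})
    (J : finType) (f : X -> J) (F : J -> R) : (forall j, measurable [set x | f x = j]) ->
  (forall j, 0 <= F j) ->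
  (\int[P]_x (F (f x))%:E = \sum_j (F j)%:E * P [set x | f x = j])%E.
Proof.
move=> mf F0.
rewrite (eq_integral (fun x => \sum_(j <- index_enum J) (F j)%:E * (\1_[set x | f x = j] x)%:E)%E); last first.
  move=> x _; rewrite (bigD1_seq (f x)) ?mem_index_enum ?index_enum_uniq//=.
  rewrite indicE mem_set// mule1 big1 ?adde0// => j jx.
  by rewrite indicE memNset ?mule0// => /= E; move: jx; rewrite E eqxx.
rewrite ge0_integral_sum//.
- apply: eq_bigr => j _; rewrite ge0_integralZl_EFin//; last first.
    by apply/measurable_EFinP; exact: measurable_indic.
  by rewrite integral_indic// setIT.
- by move=> j; apply: measurable_funeM; apply/measurable_EFinP; exact: measurable_indic.
- by move=> j x _; rewrite mule_ge0// lee_fin.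
Qed.

(** * Addresses of a uniform random point have the prescribed masses *)

Section address_mass.
Context d (X : measurableType d) (R : realType) (P : probability (measurableTypeR R) R).
Hypotheses (Pab : forall a b, 0 <= a -> a <= b -> b <= 1 -> P `[a, b[%classic = (b - a)%:E)
  (P01 : P `[0, 1[%classic = 1%E).
Variable g : seq bool -> X -> R.
Hypotheses (mg : forall b, measurable_fun setT (g b)) (g0 : forall b x, 0 <= g b x)
  (g1 : forall x, g [::] x = 1) (gs : forall b x, g b x = g (true :: b) x + g (false :: b) x).

Lemma unit_complement : P (~` `[0, 1[%classic) = 0%E.
Proof.
have m01 : measurable (`[0, 1[%classic : set (measurableTypeR R)) by [].
by rewrite probability_setC// P01 subee.
Qed.

Lemma unit_positive (S : set (measurableTypeR R)) : measurable S -> (0 < P S)%E ->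
  exists z, S z /\ 0 <= z < 1.
Proof.
move=> mS PS; apply: contrapT => H.
have SC : S `<=` ~` `[0, 1[%classic.
  by move=> z Sz; rewrite /= in_itv /= => z01; apply: H; exists z.
have m01 : measurable (`[0, 1[%classic : set (measurableTypeR R)) by [].
have := lt_le_trans PS (le_measure P (mem_set mS) (mem_set (measurableC m01)) SC).
by rewrite [X in (_ < X)%E]unit_complement ltxx.
Qed.

Lemma address_mass n b x : size b = n ->
  P [set z | address g n x z = b] = (g b x)%:E.
Proof.
move=> bn; have [lo hi] := slot_unit g0 g1 gs b x.
have m01 : measurable (`[0, 1[%classic : set (measurableTypeR R)) by [].
have mA : measurable [set z : measurableTypeR R | address g n x z = b].
  have := measurable_address mg n b => H.
  have := measurable_xsection x H; congr measurable.
  by apply/seteqP; split => z; rewrite /xsection /= inE.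
have Z : P ([set z | address g n x z = b] `&` ~` `[0, 1[%classic) = 0%E.
  apply/eqP; rewrite eq_le measure_ge0 andbT -unit_complement.
  by apply: le_measure; rewrite ?inE//; [apply: measurableI => //|]; exact: measurableC.
have E : P [set z | address g n x z = b] = P ([set z | address g n x z = b] `&` `[0, 1[%classic).
  rewrite -[in LHS](setIT [set z | address g n x z = b]) -(setUv (`[0, 1[%classic : set R)) setIUr.
  rewrite (@measureU _ _ _ P _ _ _ (measurableI _ _ mA (measurableC m01))); last 2 first.
  - exact: measurableI.
  - by apply/seteqP; split => z //= [[_ z1] [_]].
  exact: (etrans (congr1 (fun z => (_ + z)%E) Z) (adde0 _)).
rewrite E.
have -> : [set z | address g n x z = b] `&` `[0, 1[%classic =
    `[left_end g b x, left_end g b x + g b x[%classic :> set (measurableTypeR R).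
  apply/seteqP; split=> z /=; rewrite !in_itv /=.
    by move=> [<- z01]; exact: address_slot.
  move=> bz; split; first by rewrite -bn; exact/esym/slot_address.
  by move: bz => /andP[lz zh]; rewrite (le_trans lo lz) (lt_le_trans zh hi).
by rewrite Pab ?lerDl// addrAC subrr add0r.
Qed.

End address_mass.

Section levels.
Variables (R : realType) (d k : nat) (T : R) (A : 'M[R]_d) (B : 'M[R]_(d, k)).
Local Notation Gam := (Gamma T A B).
Hypothesis T0 : 0 < T.

Lemma measurable_initial_cell (S : set 'cV[R]_d) b : measurable S ->
  measurable ([set h : Gam | S (h 0)] `&` cell b).
Proof.
by move=> mS; apply: measurableI; [exact: measurable_initial|exact: measurable_cell].
Qed.

Lemma cell_split (eta : probability Gam R) (S : set 'cV[R]_d) b : measurable S ->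
  fine (eta ([set h : Gam | S (h 0)] `&` cell b)) =
  fine (eta ([set h : Gam | S (h 0)] `&` cell (true :: b))) +
  fine (eta ([set h : Gam | S (h 0)] `&` cell (false :: b))).
Proof.
move=> mS; have mc b' := measurable_initial_cell b' mS.
rewrite -fineD ?fin_num_measure//; congr fine; rewrite -measureU//.
  congr (eta _); apply/seteqP; split=> h /=.
    by move=> [Sh hb]; have [hB|hB] := pselect (bit_set (size b) h); [left|right].
  by move=> [[Sh [hb _]]|[Sh [hb _]]].
by apply/seteqP; split=> h //= [[_ [_ h1]] [_ [_ h2]]].
Qed.

(** A cell [j] levels above the bottom is the disjoint union of [2 ^+ j] bottom cells, and errors
    add up. *)
Lemma level_close (eta eta' : probability Gam R) n dl :
  (forall b : n.-tuple bool, `|fine (eta (cell b)) - fine (eta' (cell b))| <= dl) ->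
  forall j b, (size b + j)%N = n ->
    `|fine (eta (cell b : set Gam)) - fine (eta' (cell b : set Gam))| <= 2 ^+ j * dl.
Proof.
move=> H; elim=> [|j IH] b.
  by rewrite addn0 expr0 mul1r => /eqP bn; exact: (H (Tuple bn)).
rewrite addnS => bn.
have E0 (Q : set Gam) : [set h : Gam | (setT : set 'cV[R]_d) (h 0)] `&` Q = Q.
  by apply/seteqP; split=> h // [].
have split (e : probability Gam R) : fine (e (cell b : set Gam)) =
    fine (e (cell (true :: b) : set Gam)) + fine (e (cell (false :: b) : set Gam)).
  by move: (@cell_split e setT b measurableT); rewrite !E0.
rewrite !split opprD addrACA; apply: (le_trans (ler_normD _ _)).
by rewrite exprS -mulrA (mulrDl 1 1) !mul1r; apply: lerD; apply: IH; rewrite /= addSn.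
Qed.

End levels.

(** * The limit measure *)

Section limit_code.
Variables (R : realType) (d k : nat) (T : R) (A : 'M[R]_d) (B : 'M[R]_(d, k)).
Local Notation Gam := (Gamma T A B).
Variables (m0 : probability 'cV[R]_d R) (eta : nat -> probability Gam R) (U : set_system nat).
Hypotheses (UU : UltraFilter U)
  (emarg : forall j S, measurable S -> eta j [set h : Gam | S (h 0)] = m0 S).
Local Notation beta j S b := (fine (eta j ([set h : Gam | S (h 0)] `&` cell b))).

Lemma code_densities : exists g : seq bool -> 'cV[R]_d -> R,
  [/\ forall b, measurable_fun setT (g b), forall b x, 0 <= g b x, forall x, g [::] x = 1,
      forall b x, g b x = g (true :: b) x + g (false :: b) x &
      forall S b, measurable S ->
        exists2 l : R, (l%:E = \int[m0]_(x in S) (g b x)%:E)%E & beta j S b @[j --> U] --> l].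
Proof.
apply: (@limit_densities _ _ _ m0 U (fun j S b => beta j S b) UU).
- by move=> j S b; apply: fine_ge0; exact: measure_ge0.
- by move=> j S mS /=; rewrite setIT (emarg j mS).
- by move=> j S b mS; exact: cell_split.
- move=> j S S' b mS mS' SS'.
  rewrite -fineD ?fin_num_measure//; [|exact: measurable_initial_cell..].
  congr fine; rewrite -measureU; [|exact: measurable_initial_cell..|].
    by congr (eta j _); rewrite -setIUl.
  apply/seteqP; split=> //= h [[Sh _] [Sh' _]].
  by have : (S `&` S') (h 0%R : 'cV[R]_d) by []; rewrite SS'.
Qed.

Variable g : seq bool -> 'cV[R]_d -> R.
Hypotheses (mg : forall b, measurable_fun setT (g b)) (g0 : forall b x, 0 <= g b x).
Hypothesis gl : forall S b, measurable S ->
  exists2 l : R, (l%:E = \int[m0]_(x in S) (g b x)%:E)%E & beta j S b @[j --> U] --> l.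

(** The exceptional sets vary with [j] without any convergence, so their intersection is used: the
    cell [b] started there is null for [U]-many [j], hence the limit mass, which is the integral of
    [g b] over it, vanishes. *)
Lemma density_null (Z : nat -> set 'cV[R]_d) b : (forall j, measurable (Z j)) ->
  U [set j | eta j ([set h : Gam | Z j (h 0)] `&` cell b) = 0%E] ->
  {ae m0, forall x, (forall j, Z j x) -> g b x = 0}.
Proof.
move=> mZ UZ; pose S := \bigcap_j Z j.
have mS : measurable S by exact: bigcapT_measurable.
have [l lE cl] := gl b mS.
have l0 : l = 0.
  apply: (cvg_unique (@Rhausdorff R) cl); apply: cvg_near_cst.
  apply: filterS UZ => j /= j0.
  have le0 : (eta j ([set h : Gam | S (h 0%R)] `&` cell b) <= 0)%E.
    rewrite -j0; apply: le_measure; rewrite ?inE; [exact: measurable_initial_cell..|].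
    by move=> h [Sh hb]; split => //; exact: Sh.
  by have /eqP -> : eta j ([set h : Gam | S (h 0%R)] `&` cell b) == 0%E
    by rewrite eq_le le0 measure_ge0.
have mgS : measurable_fun S (EFin \o g b).
  by apply/measurable_EFinP; exact: measurable_funS (mg b).
have /(ae_eq_integral_abs m0 mS mgS) H : (\int[m0]_(x in S) `|(EFin \o g b) x| = 0)%E.
  rewrite -[RHS]/(0%R%:E) -l0 lE; apply: eq_integral => x _ /=.
  by rewrite ger0_norm.
have AF := ae_filter_ringOfSetsType m0.
apply: filterS H => x Hx Zx.
have gx : (EFin \o g b) x = cst 0%E x by apply: Hx => j _; exact: Zx.
exact: (@EFin_inj R _ _ gx).
Qed.

Lemma density_selects (P : 'cV[R]_d -> set Gam) :
  U [set j | forall b, exists Z, [/\ measurable Z,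
      [set x | ~ (P x `&` cell b !=set0)] `<=` Z &
      eta j ([set h : Gam | Z (h 0)] `&` cell b) = 0%E]] ->
  {ae m0, forall x, forall b, 0 < g b x -> P x `&` cell b !=set0}.
Proof.
move=> UP; apply: ae_forall_countable => b.
pose good j (Z : set 'cV[R]_d) := [/\ measurable Z,
  [set x | ~ (P x `&` cell b !=set0)] `<=` Z &
  eta j ([set h : Gam | Z (h 0)] `&` cell b) = 0%E].
(* Stages where no good set exists get the whole space, neutral for the intersection. As [P] does
   not depend on the stage, the points whose [P x] misses the cell lie in every [Z j]. *)
have /choice[Z ZP] j : exists Z, (good j Z \/ Z = setT) /\ ((exists Z, good j Z) -> good j Z).
  have [[Z gZ]|N] := pselect (exists Z, good j Z); first by exists Z; split; [left|].
  by exists setT; split; [right|move=> /N].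
have mZ j : measurable (Z j) by have [[[]//|-> //] _] := ZP j.
have AF := ae_filter_ringOfSetsType m0.
apply: filterS (density_null mZ (b := b) _) => [x H gx|].
  apply: contrapT => N; move: gx; rewrite H ?ltxx// => j.
  by have [[[_ +  _]|->//] _] := ZP j; exact.
by apply: filterS UP => j /= /(_ b) /(ZP j).2[].
Qed.

End limit_code.

Section limit_measure.
Variables (R : realType) (d k : nat) (T : R) (A : 'M[R]_d) (B : 'M[R]_(d, k)).
Hypothesis T0 : 0 < T.
Local Notation Gam := (Gamma T A B).
Variables (c : R) (m0 : probability 'cV[R]_d R).
Hypothesis c_ge0 : 0 <= c.
Variable g : seq bool -> 'cV[R]_d -> R.
Hypotheses (mg : forall b, measurable_fun setT (g b)) (g0 : forall b x, 0 <= g b x)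
  (g1 : forall x, g [::] x = 1) (gs : forall b x, g b x = g (true :: b) x + g (false :: b) x).
Variable E : set 'cV[R]_d.
Hypotheses (mE : measurable E) (aeE : {ae m0, forall x, E x}).
Hypothesis EP : forall x b, E x -> 0 < g b x ->
  exists h : Gam, [/\ energy_class c h, h 0 = x & cell b h].
Variable P : probability (measurableTypeR R) R.
Hypotheses (Pab : forall a b, 0 <= a -> a <= b -> b <= 1 -> P `[a, b[%classic = (b - a)%:E)
  (P01 : P `[0, 1[%classic = 1%E).
Local Notation Y := (psi T A B c g E).
Variables (K : R.-pker 'cV[R]_d ~> Gam)
  (Q : probability ('cV[R]_d * measurableTypeR R)%type R) (q : probability Gam R).
Hypotheses (KP : forall x U, measurable U -> K x U = P [set z | U (Y (x, z))])
  (QP : forall S, measurable S -> Q S = (\int[m0]_x P [set z | S (x, z)])%E)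
  (qP : forall U, measurable U -> q U = Q (Y @^-1` U)).

Lemma section_out (S : set ('cV[R]_d * measurableTypeR R)) x : measurable S ->
  (forall z, 0 <= z < 1 -> ~ S (x, z)) -> P [set z | S (x, z)] = 0%E.
Proof.
move=> mS H; apply/eqP; rewrite eq_le measure_ge0 andbT -(unit_complement P01).
apply: le_measure; rewrite ?inE//; last by move=> z Sz /= z01; exact: (H z).
  have := measurable_xsection x mS; congr measurable.
  by apply/seteqP; split => z; rewrite /xsection /= inE.
exact: measurableC.
Qed.

Lemma section_in (S : set ('cV[R]_d * measurableTypeR R)) x : measurable S ->
  (forall z, 0 <= z < 1 -> S (x, z)) -> P [set z | S (x, z)] = 1%E.
Proof.
move=> mS H.
have mx : measurable [set z : measurableTypeR R | S (x, z)].
  have := measurable_xsection x mS; congr measurable.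
  by apply/seteqP; split => z; rewrite /xsection /= inE.
apply/eqP; rewrite eq_le probability_le1//= -P01.
by apply: le_measure; rewrite ?inE// => z /H.
Qed.

Let mY : measurable_fun setT Y := measurable_psi T0 c_ge0 mg g1 gs mE EP.

Lemma ae_limit_domain : {ae Q, forall xz, limit_domain E xz}.
Proof.
have mD := measurable_limit_domain mE.
exists (~` limit_domain E); split => //; first exact: measurableC.
rewrite QP; last exact: measurableC.
apply/eqP; rewrite eq_le integral_ge0 ?andbT; last by move=> x _; exact: measure_ge0.
have -> : 0%E = (\int[m0]_x (cst 0%E x))%E :> \bar R by rewrite integral0.
apply: le_integral_ae => //.
have AF := ae_filter_ringOfSetsType m0.
apply: filterS aeE => x Ex _; rewrite section_out//; first exact: measurableC.
by move=> z z01; apply.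
Qed.

Lemma limit_start S : measurable S -> Q [set xz | S (Y xz 0)] = m0 S.
Proof.
move=> mS.
have mS' : measurable [set xz | S (Y xz 0)].
  have := mY measurableT (measurable_initial (T := T) (A := A) (B := B) mS).
  by rewrite setTI.
rewrite QP//.
have := integral_indic m0 measurableT mS; rewrite setIT => E1; apply: (etrans _ E1).
have AF := ae_filter_ringOfSetsType m0.
have H : {ae m0, forall x, P [set z | S (Y (x, z) 0)] = (\1_S x)%:E}.
  apply: filterS aeE => x Ex.
  have Y0 z : 0 <= z < 1 -> Y (x, z) 0 = x by move=> z01; have [] := psiP T0 c_ge0 g1 gs EP Ex z01.
  rewrite indicE; have [Sx|Sx] := boolP (x \in S).
    by apply: (section_in mS') => z z01 /=; rewrite Y0//; exact: set_mem.
  apply: (section_out mS') => z z01 /=; rewrite Y0// => Sx'.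
  by move/negP: Sx; apply; exact: mem_set.
apply/eqP; rewrite eq_le; apply/andP; split; apply: le_integral_ae => //;
  try (by move=> x _; rewrite lee_fin); by apply: filterS H => x -> _.
Qed.

Lemma limit_represents : represents m0 c Q Y (fun t => time_marginal t q).
Proof.
have AF := ae_filter_ringOfSetsType Q.
split; first exact: mY.
- exact: limit_start.
- apply: filterS ae_limit_domain => -[x z] [Ex z01].
  by have [] := psiP T0 c_ge0 g1 gs EP Ex z01.
- move=> t S mS; have mV : measurable [set h : Gam | S (h t)].
    by have := @measurable_evaluation R d k T A B t measurableT _ mS; rewrite setTI.
  exact: (qP mV).
Qed.

Lemma limit_initial S : measurable S -> time_marginal 0 q S = m0 S.
Proof.
move=> mS; have [_ H1 _ H2] := limit_represents.
exact: etrans (H2 0 S mS) (H1 S mS).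
Qed.

Definition address_tuple n (xz : 'cV[R]_d * measurableTypeR R) : n.-tuple bool :=
  Tuple (introT eqP (size_address g n xz.1 xz.2)).

Lemma address_tupleE n (b : n.-tuple bool) :
  [set xz | address_tuple n xz = b] = [set xz | address g n xz.1 xz.2 = b].
Proof. by apply/seteqP; split=> xz /= => [<-//|H]; exact: val_inj. Qed.

Lemma measurable_address_tuple n (b : n.-tuple bool) :
  measurable [set xz | address_tuple n xz = b].
Proof. by rewrite address_tupleE; exact: measurable_address. Qed.

Lemma address_tuple_mass n (b : n.-tuple bool) :
  Q [set xz | address_tuple n xz = b] = (\int[m0]_x (g b x)%:E)%E.
Proof.
rewrite QP; last exact: measurable_address_tuple.
apply: eq_integral => x _; rewrite -(address_mass Pab P01 mg g0 g1 gs x (size_tuple b)).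
by congr (P _); apply/seteqP; split=> z /= => [<-//|H]; exact: val_inj.
Qed.

(** The required curve [h] is taken in a deeper cell of the same address: deep enough to be close to
    the limit curve, and still inside the level-[n] cell. *)
Lemma limit_coded e n : 0 < e -> coded c e Q Y (address_tuple n).
Proof.
move=> e0; split; first exact: measurable_address_tuple.
have AF := ae_filter_ringOfSetsType Q.
apply: filterS ae_limit_domain => -[x z] [/= Ex z01].
have [_ Y0 /(_ e e0)[N HN]] := psiP T0 c_ge0 g1 gs EP Ex z01.
have [h [hc h0 hb]] := EP Ex (slot_gt0 (address_slot g1 gs (maxn N n) x z01)).
exists h; split => //; first by rewrite Y0.
  have [b E'] := address_prefix g x z (leq_maxr N n).
  by rewrite E' in hb; exact: cell_cat hb.
by apply: (HN _ (leq_maxl N n)).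
Qed.

(** The slots containing [z] have positive length, so [S x] meets every cell along the address of
    [z], and these cells converge to the limit curve. *)
Lemma limit_approx (S : 'cV[R]_d -> set Gam) x z e : E x -> 0 <= z < 1 -> 0 < e ->
  (forall b, 0 < g b x -> S x `&` cell b !=set0) ->
  exists2 h, S x h & udist_le T e (Y (x, z)) h.
Proof.
move=> Ex z01 e0 H; have [_ _ /(_ e e0)[N HN]] := psiP T0 c_ge0 g1 gs EP Ex z01.
have [h [Sh hb]] := H _ (slot_gt0 (address_slot g1 gs N x z01)).
by exists h => //; exact: (HN N (leqnn N)).
Qed.

Lemma supp_approx x h e : 0 < e -> supp (K x) h ->
  exists z, 0 <= z < 1 /\ udist_le T e (Y (x, z)) h.
Proof.
move=> e0 sh.
have := nbhs_udist h e0; rewrite nbhsE => -[V [oV Vh] Vsub].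
have mV : measurable V by exact: sub_sigma_algebra.
have := sh V oV Vh; rewrite KP// => PV.
have mPV : measurable [set z : measurableTypeR R | V (Y (x, z))].
  have := mY measurableT mV; rewrite setTI => /(measurable_xsection x); congr measurable.
  by apply/seteqP; split => z; rewrite /xsection /= inE.
have [z [Vz z01]] := unit_positive P01 mPV PV.
by exists z; split => //; exact: Vsub.
Qed.

End limit_measure.

(** * Stability of almost optimality *)

(** The power of 2 compensates the loss in [level_close] at any coarser fixed level; the factor
    [j.+1] makes the error there tend to 0. *)
Definition level_gap (R : realType) (j : nat) : R := (j.+1%:R * 2 ^+ j)^-1.

Lemma level_gap_gt0 (R : realType) j : 0 < level_gap R j.
Proof. by rewrite invr_gt0 mulr_gt0// exprn_gt0. Qed.

Section stability.
Variables (R : realType) (d k : nat) (T : R) (A : 'M[R]_d) (B : 'M[R]_(d, k)).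
Hypothesis T0 : 0 < T.
Local Notation Gam := (Gamma T A B).
Variables (L : 'cV[R]_d -> 'cV[R]_k -> probability 'cV[R]_d R -> R)
  (G : 'cV[R]_d -> probability 'cV[R]_d R -> R).
Variables (c0 c1 c2 c3 lam M : R).
Hypothesis Lt : tame L c0 c1 c2 c3 lam.
Hypothesis M0 : 0 <= M.
Hypothesis GM : forall x m, Pspace 1 m -> `|G x m| <= M.
Hypothesis GC : forall eps : R, 0 < eps -> exists2 delta : R, 0 < delta &
  forall x y m m', Pspace 1 m -> Pspace 1 m' -> enorm (x - y) < delta ->
    (d1 m m' < delta%:E)%E -> `|G x m - G y m'| < eps.
Variables (alpha : R) (m0 : probability 'cV[R]_d R) (r : R).
Hypothesis P1 : Pspace 1 m0.
Local Notation c := (energy_bound T c0 c2 c3 M).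
Variables (eta : nat -> probability Gam R) (U : set_system nat).
Hypotheses (UU : UltraFilter U) (UN : forall N, U [set j | (N <= j)%N]).
Variables (ds : measure_display) (X : measurableType ds) (Q : probability X R) (Y : X -> Gam)
  (m : R -> probability 'cV[R]_d R) (f : forall n, X -> n.-tuple bool).
Hypotheses (rep : represents m0 c Q Y m) (cod : forall n e, 0 < e -> coded c e Q Y (f n))
  (lim : forall n (b : n.-tuple bool),
    fine (eta j (cell b : set Gam)) @[j --> U] --> fine (Q [set w | f n w = b])).

Definition level_near j (eta' : probability Gam R) : Prop :=
  concentrated c0 c2 c3 M alpha m0 r eta' /\
  forall b : j.-tuple bool,
    `|fine (eta j (cell b : set Gam)) - fine (eta' (cell b : set Gam))| <= level_gap R j.

(** At the fixed level [n], one half of the error is the passage from [eta'] to [eta j], summed over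
    subcells, and the other the convergence of [eta j] along [U]. *)
Lemma level_near_codes n e : 0 < e -> U [set j | forall eta', level_near j eta' ->
  \sum_(b : n.-tuple bool) `|fine (eta' [set h : Gam | code_tuple n h = b]) -
    fine (Q [set w | f n w = b])| <= e].
Proof.
move=> e0; pose N : R := #|{: n.-tuple bool}|%:R + 1.
have N0 : 0 < N by rewrite ltr_wpDl.
pose a := e / N / 2; have a0 : 0 < a by rewrite !divr_gt0.
have H1 : U [set j | forall b : n.-tuple bool,
    `|fine (Q [set w | f n w = b]) - fine (eta j (cell b : set Gam))| < a].
  by apply: filter_forall => b; have /cvgrPdist_lt := @lim n b; exact.
have [J HJ] : exists J : nat, a^-1 < J%:R by exists (Num.truncn a^-1).+1; exact: truncnS_gt.
apply: filterS (filterI (filterI H1 (UN n)) (UN J)) => j [[/= Hj nj] Jj] eta' [_ near].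
apply: (@le_trans _ _ (\sum_(b : n.-tuple bool) (a + a))); last first.
  rewrite sumr_const -[X in X <= _]mulr_natr /a -splitr mulrAC ler_pdivrMr//.
  by rewrite ler_pM2l// lerDl.
apply: ler_sum => b _.
have -> : [set h : Gam | code_tuple n h = b] = cell b.
  by apply/seteqP; split=> h /=; rewrite code_tupleP.
have := level_close near (j := (j - n)%N) (b := b); rewrite size_tuple subnKC// => /(_ erefl) Hc.
have Hg : 2 ^+ (j - n) * level_gap R j <= a.
  apply: (@le_trans _ _ (2 ^+ j * level_gap R j)).
    by rewrite ler_pM2r ?level_gap_gt0// ler_weXn2l ?leq_subr// ler1n.
  rewrite /level_gap invfM mulrCA divff ?mulr1 ?expf_neq0//.
  rewrite -[a]invrK lef_pV2 ?posrE ?invr_gt0//.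
  by apply: ltW; apply: (lt_le_trans HJ); rewrite ler_nat; exact: leqW.
have /ltW Hq := Hj b.
rewrite distrC; apply: (le_trans (ler_distD (fine (eta j (cell b : set Gam))) _ _)).
by apply: lerD => //; exact: le_trans Hc Hg.
Qed.

Lemma level_near_flows e : 0 < e -> U [set j | forall eta', level_near j eta' ->
  forall t, 0 <= t <= T ->
    (forall x u, `|L x u (time_marginal t eta') - L x u (m t)| <= e) /\
    (forall x, `|G x (time_marginal t eta') - G x (m t)| <= e)].
Proof.
move=> e0; have c_ge0 : 0 <= c := energy_bound_ge0 T0 Lt M0.
have [s [n [s0 /(_ n (leqnn n))[dl dl0 H]]]] := coded_flows_close A B T0 P1 c_ge0 Lt GC e0.
apply: filterS (level_near_codes n dl0) => j /= Hj eta' near.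
have conc := near.1.
apply: (H _ _ eta' id (fun t => time_marginal t eta') (code_tuple n) _ _ Q Y m (f n)) => //.
- exact: (concentrated_represents T0 conc).
- exact: (concentrated_coded T0 n (ltW s0) conc).
- exact: cod.
- exact: Hj.
Qed.

Lemma level_near_opt e : 0 < e -> U [set j | forall eta', level_near j eta' ->
  forall x, Gamma_opt L G eta' x `<=` near_opt L G c3 c m x e].
Proof.
move=> e0; have c_ge0 : 0 <= c := energy_bound_ge0 T0 Lt M0.
(* Solves [2 * (e' * T + e') = e], the loss in [near_opt_transfer]. *)
pose e' := e / (T + 1) / 2.
have T1 : 0 < T + 1 by rewrite addr_gt0.
have e'0 : 0 < e' by rewrite !divr_gt0.
have -> : e = 2 * (e' * T + e').
  by rewrite /e'; field; rewrite ?pnatr_eq0 ?gt_eqF.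
apply: filterS (level_near_flows e'0) => j /= Hj eta' near x h hopt.
have fl := represents_flow T0 P1 c_ge0 (concentrated_represents T0 near.1).
apply: (near_opt_transfer T0 Lt fl (represents_flow T0 P1 c_ge0 rep) (ltW e'0)).
- by move=> y w t tT; exact: (Hj eta' near t tT).1.
- by move=> y; apply: (Hj eta' near T _).2; rewrite lexx ltW.
- exact: (minimizer_near_opt T0 Lt GM fl hopt).
Qed.

End stability.

(** * The speed bound in the limit *)

Section speed_bound.
Variables (R : realType) (d k : nat) (T : R) (A : 'M[R]_d) (B : 'M[R]_(d, k)).
Hypothesis T0 : 0 < T.
Local Notation Gam := (Gamma T A B).
Local Notation mu := (@lebesgue_measure R).
Local Notation I := (`[0, T]%classic : set R).
Variables (alpha c : R).
Hypothesis a1 : 1 < alpha.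
Local Notation spd h := (speed_norm (h : Gam) `^ alpha)%E.

Lemma speed_limit (a : R) (h : Gam) (hs : nat -> Gam) : 0 <= a ->
  (forall n, energy_class c (hs n) /\ (spd (hs n) <= a%:E)%E) ->
  (forall e, 0 < e -> exists N, forall n, (N <= n)%N -> udist_le T e h (hs n)) ->
  (spd h <= a%:E)%E.
Proof.
move=> a_ge0 H cv; pose s := a `^ alpha^-1.
have s0 : 0 <= s := powR_ge0 _ _.
have alpha0 : alpha != 0 by rewrite gt_eqF// (lt_trans _ a1).
have sa : s `^ alpha = a by rewrite -powRrM mulVf// powRr1.
have /choice[us usP] n : exists u : R -> 'cV[R]_k, [/\ measurable_fun I u,
    (energy T u <= c%:E)%E, solution T A B (hs n 0) u (hs n) &
    (energy T (rhs A B (hs n) u) <= (s ^+ 2)%:E)%E].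
  have [[u [mu_ eu su]] sp] := H n; exists u; split => //.
  have vu : vintegrable T u.
    by apply: vintegrable_energy; exact: Lp_control2P mu_ eu.
  have := (speed_pow_ge (hs n) a1 s0).2; rewrite sa => /(_ sp).
  by rewrite (energy_derive1 T0 vu su).
have [u [mu_ eu su es]] : exists u, [/\ measurable_fun I u, (energy T u <= c%:E)%E,
    solution T A B (h 0) u h & (energy T (rhs A B h u) <= (s ^+ 2)%:E)%E].
  apply: (speed_lower_semicontinuous (ltW T0) (us := us) (xs := fun n => hs n 0) (gs := hs)).
  - by move=> n; have [? ?] := usP n.
  - by move=> n; have [] := usP n.
  - move=> e e0; have [N HN] := cv e e0; exists N => n Nn.
    have Hn := udist_leC (HN n Nn); split; last exact: Hn.
    by apply: Hn; rewrite lexx ltW.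
  - by move=> n; have [] := usP n.
have vu : vintegrable T u.
  by apply: vintegrable_energy; exact: Lp_control2P mu_ eu.
rewrite -sa; apply: (speed_pow_ge h a1 s0).1.
by rewrite (energy_derive1 T0 vu su).
Qed.

(** A minorant of the speed power that depends only on the code, so its integrals are finite sums of
    cell masses and pass to the limit. Truncation at [n] keeps it finite, also on cells with no
    curve of the class, where the infimum is infinite. *)
Definition cell_speed n (b : seq bool) : \bar R :=
  mine (ereal_inf [set spd h | h in energy_class c `&` cell b]) n%:R%:E.

Lemma cell_speed_ge0 n b : (0 <= cell_speed n b)%E.
Proof.
rewrite /cell_speed le_min lee_fin ler0n andbT.
by apply: le_ereal_inf_tmp => _ [h _ <-]; exact: poweR_ge0.
Qed.

Lemma cell_speedK n b : (fine (cell_speed n b))%:E = cell_speed n b.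
Proof.
apply: fineK; rewrite ge0_fin_numE ?cell_speed_ge0//.
by apply: (@le_lt_trans _ _ n%:R%:E); rewrite ?ltry// /cell_speed ge_min lexx orbT.
Qed.

Lemma cell_speed_le n b h : energy_class c h -> cell b h -> (cell_speed n b <= spd h)%E.
Proof. by move=> hc hb; rewrite /cell_speed ge_min ereal_inf_lbound//; exists h. Qed.

(** If the liminf were smaller, cells arbitrarily far along [bs] would contain curves of the class
    with speed power below some [a < spd h]; they converge to [h], against lower semicontinuity. *)
Lemma cell_speed_lim (bs : nat -> seq bool) (h : Gam) :
  (forall e, 0 < e -> exists N, forall n, (N <= n)%N -> forall h' : Gam,
    cell (bs n) h' -> udist_le T e h h') ->
  (spd h <= limn_einf (fun n => cell_speed n (bs n)))%E.
Proof.
move=> cv; apply: le_limn_einf; [exact: poweR_ge0|by move=> n; exact: cell_speed_ge0|].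
move=> a ah; apply: contrapT => N.
have [a0|a0] := ltP a 0.
  apply: N; exists 0%N => n _; apply: le_trans (cell_speed_ge0 _ _).
  by rewrite lee_fin ltW.
have /choice[ns nsP] i : exists n, (i <= n)%N /\
    exists h' : Gam, [/\ energy_class c h', cell (bs n) h' & (spd h' <= a%:E)%E].
  apply: contrapT => H; apply: N; exists (maxn i (Num.truncn a).+1) => n Nn.
  rewrite leNgt; apply/negP; rewrite /cell_speed gt_min => /orP[/ereal_inf_lt|].
    move=> [_ [h' [h'c h'b] <-] lt_a]; apply: H; exists n; split.
      exact: leq_trans (leq_maxl _ _) Nn.
    by exists h'; split => //; exact: ltW.
  rewrite lte_fin ltNge; apply/negP; rewrite negbK ltW//.
  apply: (lt_le_trans (truncnS_gt a)); rewrite ler_nat.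
  exact: leq_trans (leq_maxr _ _) Nn.
have /choice[hs hsP] i := (nsP i).2.
suff : (spd h <= a%:E)%E by rewrite leNgt ah.
apply: (speed_limit a0 (hs := hs)) => [n|e e0]; first by have [] := hsP n.
have [i Hi] := cv e e0; exists i => n ni.
by have [_ hb _] := hsP n; apply: Hi hb; exact: leq_trans ni (nsP n).1.
Qed.

Variables (r : R) (eta : nat -> probability Gam R) (U : set_system nat).
Hypotheses (UU : UltraFilter U).
Hypothesis eta_speed : forall j, (\int[eta j]_h (spd h) <= r%:E)%E.
Hypothesis eta_class : forall j, eta j (~` energy_class c) = 0%E.
Variables (ds : measure_display) (X : measurableType ds) (Q : probability X R) (Y : X -> Gam)
  (f : forall n, X -> n.-tuple bool) (q : probability Gam R).
Hypotheses (mY : measurable_fun setT Y)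
  (mf : forall n (b : n.-tuple bool), measurable [set w | f n w = b])
  (lim : forall n (b : n.-tuple bool),
    fine (eta j (cell b : set Gam)) @[j --> U] --> fine (Q [set w | f n w = b]))
  (cv : {ae Q, forall w, forall e, 0 < e -> exists N, forall n, (N <= n)%N ->
    forall h' : Gam, cell (f n w) h' -> udist_le T e (Y w) h'})
  (qP : forall S, measurable S -> q S = Q (Y @^-1` S)).

Lemma stage_cell_speed n j :
  \sum_(b : n.-tuple bool) fine (cell_speed n b) * fine (eta j (cell b : set Gam)) <= r.
Proof.
rewrite -lee_fin; apply: le_trans (eta_speed j).
have -> : ((\sum_(b : n.-tuple bool) fine (cell_speed n b) * fine (eta j (cell b : set Gam)))%:E =
    \int[eta j]_h (fine (cell_speed n (code_tuple n h)))%:E)%E.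
  rewrite (integral_finite_valued (eta j) (f := code_tuple n)
    (F := fun b : n.-tuple bool => fine (cell_speed n b))); last 2 first.
  - move=> b; rewrite (_ : [set _ | _] = cell b); first exact: measurable_cell.
    by apply/seteqP; split=> h /=; rewrite code_tupleP.
  - by move=> b; apply: fine_ge0; exact: cell_speed_ge0.
  rewrite -sumEFin; apply: eq_bigr => b _.
  rewrite (_ : [set h | code_tuple n h = b] = cell b); last first.
    by apply/seteqP; split=> h /=; rewrite code_tupleP.
  by rewrite EFinM (fineK (fin_num_measure (eta j) _ (@measurable_cell R d k T A B b))).
apply: le_integral_ae => //.
- by move=> h _; rewrite cell_speedK; exact: cell_speed_ge0.
- by move=> h _; exact: poweR_ge0.
- exists (~` energy_class c); split; [|exact: eta_class|].
    by apply: measurableC; exact: measurable_energy_class.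
  move=> h /= H hc; apply: H => _; rewrite cell_speedK.
  by apply: cell_speed_le => //; exact: cell_code.
Qed.

Lemma limit_cell_speed n : (\int[Q]_w (fine (cell_speed n (f n w)))%:E <= r%:E)%E.
Proof.
rewrite (integral_finite_valued Q (f := f n)
    (F := fun b : n.-tuple bool => fine (cell_speed n b))); last 2 first.
- exact: mf.
- by move=> b; apply: fine_ge0; exact: cell_speed_ge0.
have -> : (\sum_(b : n.-tuple bool) (fine (cell_speed n b))%:E * Q [set w | f n w = b] =
    (\sum_(b : n.-tuple bool) fine (cell_speed n b) * fine (Q [set w | f n w = b]))%:E)%E.
  rewrite -sumEFin; apply: eq_bigr => b _.
  by rewrite EFinM (fineK (fin_num_measure Q _ (mf b))).
rewrite lee_fin.
have C : \sum_(b : n.-tuple bool) fine (cell_speed n b) * fine (eta j (cell b : set Gam)) @[j --> U]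
    --> \sum_(b : n.-tuple bool) fine (cell_speed n b) * fine (Q [set w | f n w = b]).
  by apply: cvg_big => [|b _]; [exact: add_continuous|apply: cvgMr; exact: lim].
apply: (closed_cvg (fun x => x <= r) _ _ _ C); first exact: closed_le.
by apply: nearW => j; exact: stage_cell_speed.
Qed.

(** Two separate limits: at fixed [n] the stages tend to the limit along [U], which is a matter of
    finite sums; Fatou's lemma is then used in [n], under the single measure [Q]. *)
Lemma limit_speed : (\int[q]_h (spd h) <= r%:E)%E.
Proof.
apply: le_lower_integral => [h|phi phiE]; first exact: poweR_ge0.
have [q' qE qI] := pushforward_probability Q mY.
have -> : (\int[q]_h (phi h)%:E = \int[Q]_w (phi (Y w))%:E)%E.
  rewrite -(qI (fun h => (phi h)%:E)).
  - by apply: eq_measure_integral => S mS _; exact: etrans (qP mS) (esym (qE S mS)).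
  - by apply/measurable_EFinP; exact: measurable_funP.
  - by move=> h; rewrite lee_fin.
apply: (fatou_bound (f := fun n w => (fine (cell_speed n (f n w)))%:E)) => //.
- move=> n _ S mS; rewrite setTI.
  exact: (measurable_countably_valued (@mf n)
    [set b : n.-tuple bool | S (fine (cell_speed n b))%:E]).
- by move=> n w _; rewrite cell_speedK; exact: cell_speed_ge0.
- by move=> w _; rewrite lee_fin.
- have AF := ae_filter_ringOfSetsType Q.
  apply: filterS cv => w Hw _; apply: (le_trans (phiE (Y w))).
  have -> : (fun n => (fine (cell_speed n (f n w)))%:E) = (fun n => cell_speed n (f n w)).
    by apply/funext => n; rewrite cell_speedK.
  exact: cell_speed_lim.
- move=> e e0; exists 0%N => n _; apply: (le_trans (limit_cell_speed n)).
  by rewrite lee_fin lerDl ltW.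
Qed.

End speed_bound.

(** * Existence of an equilibrium *)

Section equilibrium.
Variables (R : realType) (d k : nat) (T : R) (A : 'M[R]_d) (B : 'M[R]_(d, k)).
Hypothesis T0 : 0 < T.
Local Notation Gam := (Gamma T A B).
Variables (L : 'cV[R]_d -> 'cV[R]_k -> probability 'cV[R]_d R -> R)
  (G : 'cV[R]_d -> probability 'cV[R]_d R -> R).
Variables (c0 c1 c2 c3 lam M : R).
Hypothesis Lt : tame L c0 c1 c2 c3 lam.
Hypothesis M0 : 0 <= M.
Hypothesis GM : forall x m, Pspace 1 m -> `|G x m| <= M.
Hypothesis GC : forall eps : R, 0 < eps -> exists2 delta : R, 0 < delta &
  forall x y m m', Pspace 1 m -> Pspace 1 m' -> enorm (x - y) < delta ->
    (d1 m m' < delta%:E)%E -> `|G x m - G y m'| < eps.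
Hypothesis GD : forall m, Pspace 1 m -> C1b (G ^~ m).
Variables (alpha : R) (m0 : probability 'cV[R]_d R) (r : R).
Hypothesis a1 : 1 < alpha.
Hypothesis Pm0 : Pspace alpha m0.
Local Notation c := (energy_bound T c0 c2 c3 M).
Local Notation PG := (PGamma T A B alpha m0 r).
Hypotheses (hP : PG !=set0)
  (hE : forall eta, PG eta -> Emap T A B L G alpha m0 r eta !=set0).

Let P1 : Pspace 1 m0 := Pspace_mono (ltW a1) Pm0.
Let c_ge0 : 0 <= c := energy_bound_ge0 T0 Lt M0.

(** The selection property is used twice. With the curves of bounded energy from [x] it makes the
    cells of positive density inhabited, which is what constructs [psi] and [q]. With the curves
    almost optimal for [q], available only afterwards, it makes the supports optimal. *)
Lemma exists_equilibrium : exists q, PG q /\ Emap T A B L G alpha m0 r q q.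
Proof.
have /choice[eta etaP] j : exists eta, concentrated c0 c2 c3 M alpha m0 r eta /\
    selects L G c0 c2 c3 M alpha m0 r j (level_gap R j) (eta : probability Gam R).
  by have [eta] := stage T0 Lt GM a1 Pm0 hP hE j (level_gap_gt0 R j); exists eta.
have [U [UU UN]] := ultraFilterLemma (F := \oo) eventually_filter.
have emarg j S : measurable S -> eta j [set h : Gam | S (h 0)] = m0 S.
  by move=> mS; exact: (etaP j).1.1.2.
have [g [mg g0 g1 gs gl]] := code_densities UU emarg.
(* It is enough that [S x] contains the optimal curves for all measures near [eta j], for [U]-many
   [j] only. *)
have sel (S : 'cV[R]_d -> set Gam) : U [set j | forall eta', level_near c0 c2 c3 M alpha m0 r eta j eta' ->
    forall x, Gamma_opt L G eta' x `<=` S x] ->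
    {ae m0, forall x, forall b, 0 < g b x -> S x `&` cell b !=set0}.
  move=> H; apply: (density_selects UU mg g0 gl); apply: filterS H => j /= Hj.
  by apply: (etaP j).2 => eta' conc near; apply: Hj.
have aeEP : {ae m0, forall x, forall b, 0 < g b x ->
    [set h : Gam | energy_class c h /\ h 0 = x] `&` cell b !=set0}.
  apply: (sel (fun x => [set h : Gam | energy_class c h /\ h 0 = x])).
  apply: filterS filterT => j _ eta' near x h; apply: (Gamma_opt_class T0 Lt GM).
  exact: (PGamma_Pspace1 T0 a1 Pm0 near.1.1).
have [N [mN N0 NP]] := aeEP; pose E := ~` N.
have mE : measurable E by exact: measurableC.
have aeE : {ae m0, forall x, E x} by exists N; split => // x /= Ex; exact: contrapT.
have EP x b : E x -> 0 < g b x -> exists h : Gam, [/\ energy_class c h, h 0 = x & cell b h].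
  move=> Ex gx; have [h [[hc h0] hb]] : [set h : Gam | energy_class c h /\ h 0 = x] `&` cell b !=set0.
    by apply: contrapT => H; apply: Ex; apply: NP => /(_ b gx).
  by exists h.
have [P Pab P01] := exists_unit_uniform R.
have mY := measurable_psi T0 c_ge0 mg g1 gs mE EP.
have [K KP [Q QP [q qP qK]]] := section_kernel m0 P mY.
have rep := limit_represents T0 c_ge0 mg g1 gs mE aeE EP P01 QP qP.
have lim n (b : n.-tuple bool) : fine (eta j (cell b : set Gam)) @[j --> U] -->
    fine (Q [set w | address_tuple g n w = b]).
  have [l lE] := gl _ b measurableT.
  have -> : fine (Q [set w | address_tuple g n w = b]) = l.
    by rewrite (address_tuple_mass mg g0 g1 gs Pab P01 QP) -lE.
  rewrite (_ : (fun j => fine (eta j ([set h : Gam | (setT : set 'cV[R]_d) (h 0)] `&` cell b))) =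
    (fun j => fine (eta j (cell b : set Gam))))//.
  apply/funext => j; congr (fine (eta j _)).
  by apply/seteqP; split=> h // [].
have qPG : PG q.
  split; last exact: (limit_initial T0 c_ge0 mg g1 gs mE aeE EP P01 QP qP).
  apply: (limit_speed T0 a1 UU (fun j => (etaP j).1.1.1) (fun j => (etaP j).1.2)
    (f := address_tuple g) mY _ lim _ qP).
    by move=> n b; exact: measurable_address_tuple.
  have AF := ae_filter_ringOfSetsType Q.
  apply: filterS (ae_limit_domain mE aeE P01 QP) => -[x z] [/= Ex z01] e e0.
  by have [_ _] := psiP T0 c_ge0 g1 gs EP Ex z01; exact.
pose m t := time_marginal t q.
have flm : flow T m := represents_flow T0 P1 c_ge0 rep.
(* Only the tolerances [i.+1%:R^-1] are considered, to have a single null set for all of them. *)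
have aeopt : {ae m0, forall x, forall i b, 0 < g b x ->
    near_opt (T := T) (A := A) (B := B) L G c3 c m x i.+1%:R^-1 `&` cell b !=set0}.
  apply: ae_forall_countable => i; apply: sel.
  apply: (level_near_opt T0 Lt M0 GM GC alpha r P1 UU _ rep _ lim); last by rewrite invr_gt0.
  - by move=> n; apply: UN; exists n.
  - by move=> n e e0; exact: (limit_coded T0 c_ge0 mg g1 gs mE aeE EP P01 QP).
have aesupp : {ae m0, forall x, supp (K x) `<=` Gamma_opt L G q x}.
  have AF := ae_filter_ringOfSetsType m0.
  apply: filterS2 aeE aeopt => x Ex Hx h /= sh.
  apply: (near_opt_minimizer T0 Lt flm).
  apply: (near_opt_closed T0 Lt M0 c_ge0 GM GD flm) => e e0.
  have e2 : 0 < e / 2 by rewrite divr_gt0.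
  (* A curve of the support is within [e / 2] of some [psi (x, z)], itself within [e / 2] of an
     almost optimal curve; [near_opt_closed] turns this into exact optimality. *)
  have [z [z01 zh]] := supp_approx T0 c_ge0 mg g1 gs mE EP P01 KP e2 sh.
  have [i ie] : exists i, (i.+1%:R : R)^-1 <= e.
    exists (Num.truncn e^-1); rewrite -[leRHS]invrK lef_pV2 ?posrE ?invr_gt0//.
    by apply: ltW; exact: truncnS_gt.
  have [h' [u [mu_ eu su H]] hh'] := limit_approx T0 c_ge0 g1 gs EP Ex z01 e2
    (S := fun x => near_opt (T := T) (A := A) (B := B) L G c3 c m x i.+1%:R^-1) (Hx i).
  exists h'.
    exists u; split => // v vc; apply: (le_trans (H v vc)).
    by rewrite leeD2l// lee_fin.
  rewrite (splitr e); exact: udist_le_trans (udist_leC hh') zh.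
exists q; split => //; split => //; exists K => //; split; first exact: qK.
have AF := ae_filter_ringOfSetsType m0.
apply: filterS aesupp => x sx h /sx hopt; rewrite /Gamma_at /=.
by have [] := Gamma_opt_class T0 Lt GM flm.1 hopt.
Qed.

End equilibrium.

Theorem theorem4p5 (R : realType) (d k : nat) (T : R) (hT : 0 < T)
    (A : 'M[R]_d) (B : 'M[R]_(d, k))
    (L : 'cV[R]_d -> 'cV[R]_k -> probability 'cV[R]_d R -> R)
    (G : 'cV[R]_d -> probability 'cV[R]_d R -> R)
    (hL : running_cost_regular L) (hG : terminal_cost_regular G)
    (hLgrowth : running_cost_growth L)
    (alpha : R) (halpha : 1 < alpha)
    (m0 : probability 'cV[R]_d R) (hm0 : Pspace alpha m0)
    (r0 : R) (hr0 : admissible_bound T A B L G alpha m0 r0)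
    (r : R) (hr : r0 <= r) :
  exists eta : probability (Gamma T A B) R,
    PGamma T A B alpha m0 r eta /\ Emap T A B L G alpha m0 r eta eta.
Proof.
have [c0 [c1 [c2 [c3 [lam Lt]]]]] := tameP hL hLgrowth.
have [[M GM] GC GD] := hG; have [_ _ /(_ r hr)[hP hE]] := hr0.
apply: (exists_equilibrium hT Lt (normr_ge0 M) _ GC GD halpha hm0 hP hE).
by move=> x m Pm; apply: (le_trans (GM x m Pm)); exact: ler_norm.
Qed.
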